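(* Let $\widehat\beta,\widehat\pi,\beta,\pi$ be as in the context, let $\kappa,\tau,\gamma,l\in(0,+\infty)$, and let $\varphi^*\in W$ with $\beta^\circ(\varphi^* )\in H$. Then there exists a constant $C_8>0$ with the following property, where $C_8$ is independent of $\rho$ and of the data and solutions below. For every $\rho>0$, for $i=1,2$ let $\vartheta_{0,i}\in V$, $w_{0,i}\in W$, $\varphi_{0,i}\in V$ with $\widehat\beta(\varphi_{0,i})\in L^1(\Omega)$, let $f_i\in L^2(Q)$, and let $(w_i,\varphi_i,\xi_i,\sigma_i)$ be a solution of Problem (B) with $(\vartheta_0,w_0,\varphi_0)=(\vartheta_{0,i},w_{0,i},\varphi_{0,i})$ and $f=f_i$. Then $$\begin{aligned}&\|w_1-w_2\|_{W^{1,\infty}(0,T;H)\cap H^1(0,T;V)}+\|\varphi_1-\varphi_2\|_{L^\infty(0,T;H)\cap L^2(0,T;V)}\\&\quad\le C_8\big(\|\vartheta_{0,1}-\vartheta_{0,2}\|_H+\|w_{0,1}-w_{0,2}\|_V+\|\varphi_{0,1}-\varphi_{0,2}\|_H+\|f_1-f_2\|_{L^2(Q)}\big).\end{aligned}$$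
   Context: $\Omega\subset\mathbb R^N$ is open, bounded and smooth, with boundary $\Gamma$ and outward normal derivative $\partial_n$; $T>0$, $Q=\Omega\times(0,T)$. $H=L^2(\Omega)$, $V=H^1(\Omega)$, $W=\{v\in H^2(\Omega):\partial_n v=0 \text{ on }\Gamma\}$; $H,V$ have their standard norms and $\|u\|_W^2=\|u\|_H^2+\|\Delta u\|_H^2$. The norm on an intersection of spaces is the sum of the norms. $\widehat\beta:\mathbb R\to[0,+\infty]$ is convex, proper, lower semicontinuous with $\widehat\beta(0)=0$; $\widehat\pi:\mathbb R\to\mathbb R$ is $C^1$ with Lipschitz-continuous derivative; $\beta=\partial\widehat\beta$ (subdifferential, a maximal monotone graph) and $\pi=\widehat\pi'$. $\beta^\circ(r)$ denotes the element of $\beta(r)$ of minimum modulus. $\operatorname{Sign}$ is the subdifferential of $\|\cdot\|_H$ on $H$: $\operatorname{Sign}(v)=\{v/\|v\|_H\}$ if $v\ne0$, and $\operatorname{Sign}(0)$ is the closed unit ball of $H$. A solution of Problem (B) (with parameter $\rho>0$ and target $\varphi^*$) is a quadruplet $(w,\varphi,\xi,\sigma)$ with $w\in H^2(0,T;H)\cap W^{1,\infty}(0,T;V)\cap H^1(0,T;W)$, $\varphi\in H^1(0,T;H)\cap L^\infty(0,T;V)\cap L^2(0,T;W)$, $\xi\in L^2(0,T;H)$, $\sigma\in L^\infty(0,T;H)$, such that - $(w_t+l\varphi)_t-\kappa\Delta w_t-\tau\Delta w=f$ a.e. in $Q$, - $\varphi_t-\Delta\varphi+\xi+\pi(\varphi)+\rho\sigma=\gamma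 w_t$ a.e. in $Q$, - $\sigma(t)\in\operatorname{Sign}(\varphi(t)-\varphi^* )$ in $H$ for a.e. $t\in(0,T)$, - $\xi\in\beta(\varphi)$ a.e. in $Q$, - $w_t(0)=\vartheta_0$, $w(0)=w_0$, $\varphi(0)=\varphi_0$ a.e. in $\Omega$. *)

(* Defs.v *)
From HB Require Import structures.
From mathcomp Require Import all_boot all_order all_algebra.
From mathcomp Require Import all_classical all_reals all_analysis.

Set Implicit Arguments.
Unset Strict Implicit.
Unset Printing Implicit Defensive.

Import Order.TTheory GRing.Theory Num.Theory.
Import numFieldNormedType.Exports.

Local Open Scope classical_set_scope.
Local Open Scope ring_scope.

(* R^n is 'rV[R]_n, with the product (= Borel) sigma-algebra, generated by the
   coordinates. *)
Section measurable_rV.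
Context {R : realType} {n : nat}.

Let coord (i : 'I_n) (v : 'rV[R]_n) : R := v ord0 i.

Let rV_set0 : g_sigma_preimage coord set0.
Proof. exact: sigma_algebra0. Qed.

Let rV_setC A : g_sigma_preimage coord A -> g_sigma_preimage coord (~` A).
Proof. exact: sigma_algebraC. Qed.

Let rV_bigcup (F : _^nat) : (forall i, g_sigma_preimage coord (F i)) ->
  g_sigma_preimage coord (\bigcup_i (F i)).
Proof. exact: sigma_algebra_bigcup. Qed.

HB.instance Definition _ := @isMeasurable.Build default_measure_display
  'rV[R]_n (g_sigma_preimage coord) rV_set0 rV_setC rV_bigcup.

End measurable_rV.

Lemma measurable_rV_coord (R : realType) n (i : 'I_n) :
  measurable_fun [set: 'rV[R]_n] (fun v : 'rV[R]_n => v ord0 i).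
Proof.
move=> _ A mA; rewrite setTI; apply: sub_sigma_algebra => /=.
rewrite -bigcup_seq/=; exists i => /=; first by rewrite mem_index_enum.
by exists A => //; rewrite setTI.
Qed.

Lemma measurable_fun_rV d (T : measurableType d) (R : realType) n
    (f : T -> 'rV[R]_n) :
  (forall i, measurable_fun [set: T] (fun x => f x ord0 i)) ->
  measurable_fun [set: T] f.
Proof.
move=> mf; apply: (@measurability _ _ T 'rV[R]_n setT f _ erefl) => _ [B + <-].
rewrite -bigcup_seq => -[i _ [A mA <-]].
by have := mf i measurableT A mA; rewrite !setTI.
Qed.

(* Lebesgue measure on R^n: R^0 is a point of mass 1, and the Lebesgue measure
   on R^(n+1) is the image of the product measure on R * R^n. *)
Section lebesgue_rV.
Context {R : realType}.

Definition consrv n (z : measurableTypeR R * 'rV[R]_n) : 'rV[R]_n.+1 :=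
  \row_i oapp (z.2 ord0) z.1 (unlift ord0 i).

Definition unconsrv n (v : 'rV[R]_n.+1) : measurableTypeR R * 'rV[R]_n :=
  (v ord0 ord0, \row_j v ord0 (lift ord0 j)).

Lemma consrvK n : cancel (@consrv n) (@unconsrv n).
Proof.
case=> a v; rewrite /consrv /unconsrv mxE unlift_none /=; congr pair.
by apply/rowP => j; rewrite !mxE liftK.
Qed.

Lemma measurable_consrv n : measurable_fun setT (@consrv n).
Proof.
apply: measurable_fun_rV => i; rewrite /consrv.
under eq_fun do rewrite mxE.
case: unliftP => [j _|_] /=; last exact: measurable_fst.
by apply: (measurableT_comp (measurable_rV_coord j)); exact: measurable_snd.
Qed.

Lemma measurable_unconsrv n : measurable_fun setT (@unconsrv n).
Proof.
apply/measurable_fun_pairP; split; first exact: measurable_rV_coord.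
apply: measurable_fun_rV => i.
rewrite (_ : (fun _ => _) = (fun v : 'rV[R]_n.+1 => v ord0 (lift ord0 i))).
  exact: measurable_rV_coord.
by apply/funext => v; rewrite /= mxE.
Qed.

Section succ.
Variables (n : nat) (mu : {sigma_finite_measure set 'rV[R]_n -> \bar R}).

Definition leb_succ : set 'rV[R]_n.+1 -> \bar R :=
  pushforward (lebesgue_measure \x mu)%E (@consrv n).

Let leb_succ0 : leb_succ set0 = 0%E.
Proof. by rewrite /leb_succ /pushforward preimage_set0 measure0. Qed.

Let leb_succ_ge0 A : (0 <= leb_succ A)%E.
Proof. by apply: integral_ge0 => x _; exact: measure_ge0. Qed.

Let leb_succ_sigma_additive : semi_sigma_additive leb_succ.
Proof.
move=> F mF tF mUF; rewrite /leb_succ /pushforward preimage_bigcup.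
apply: (@measure_semi_sigma_additive _ _ _ (lebesgue_measure \x mu)%E).
- by move=> k; rewrite -[X in measurable X]setTI; exact: measurable_consrv.
- apply/trivIsetP => /= i j _ _ ij; rewrite -preimage_setI.
  by move/trivIsetP : tF => /(_ _ _ _ _ ij) ->//; rewrite preimage_set0.
- rewrite -preimage_bigcup -[X in measurable X]setTI.
  exact: measurable_consrv.
Qed.

HB.instance Definition _ := isMeasure.Build _ _ _ leb_succ
  leb_succ0 leb_succ_ge0 leb_succ_sigma_additive.

Let leb_succ_sigma_finite : sigma_finite setT leb_succ.
Proof.
have /sigma_finiteP[F [TF ndF Foo]] := sigma_finiteT (@lebesgue_measure R).
have /sigma_finiteP[G [TG ndG Goo]] := sigma_finiteT mu.
exists (fun k => @unconsrv n @^-1` (F k `*` G k)).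
  rewrite -preimage_bigcup (_ : \bigcup_k _ = setT) ?preimage_setT//.
  rewrite -setXTT TF TG predeqE => -[x y]; split.
    by move=> [k _ []/= ? ?]; split; exists k.
  move=> [/= [k _ Fkx] [m _ Gmy]]; exists (maxn k m) => //; split.
  - by move: x Fkx; exact/subsetPset/ndF/leq_maxl.
  - by move: y Gmy; exact/subsetPset/ndG/leq_maxr.
move=> k; have [? ?] := Foo k; have [? ?] := Goo k; split.
  rewrite -[X in measurable X]setTI; apply: measurable_unconsrv => //.
  exact: measurableX.
rewrite /leb_succ /pushforward -comp_preimage.
rewrite (_ : _ \o _ = id); last by rewrite funeqE => z /=; rewrite consrvK.
by rewrite preimage_id product_measure1E// lte_mul_pinfty// ge0_fin_numE.
Qed.

HB.instance Definition _ := Measure_isSigmaFinite.Build _ _ _ leb_succ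
  leb_succ_sigma_finite.

End succ.

Fixpoint leb (n : nat) : {sigma_finite_measure set 'rV[R]_n -> \bar R} :=
  if n is m.+1 then leb_succ (leb m) else \d_(0 : 'rV[R]_0).

End lebesgue_rV.

Section convex_analysis.
Context {R : realType}.
Local Open Scope ereal_scope.

Definition ereal_convex (h : R -> \bar R) : Prop :=
  forall (r s a : R), (0 <= a <= 1)%R ->
    h (a * r + (1 - a) * s)%R <= a%:E * h r + (1 - a)%:E * h s.

Definition ereal_proper (h : R -> \bar R) : Prop :=
  (forall r, -oo < h r) /\ exists r, h r < +oo.

Definition subdiff (h : R -> \bar R) (r : R) : set R :=
  [set xi | h r < +oo /\ forall s, h r + (xi * (s - r))%:E <= h s].

(* [min_section B r b] says that [b] is the element of minimum modulus of the
   set [B r]; in particular [B r] is not empty. *)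
Definition min_section (B : R -> set R) (r b : R) : Prop :=
  B r b /\ forall b', B r b' -> (`|b| <= `|b'|)%R.

End convex_analysis.

Section smooth.
Context {R : realType} {N : nat}.
Local Notation E := 'rV[R]_N.

Definition basis_vec (i : 'I_N) : E := delta_mx ord0 i.

Definition pd (i : 'I_N) (f : E -> R) : E -> R := 'D_(basis_vec i) f.

(* C^oo: all the iterated partial derivatives exist and are continuous. *)
Definition smooth (f : E -> R) : Prop :=
  forall s : seq 'I_N,
    continuous (foldr pd f s) /\
    forall i x, derivable (foldr pd f s) x (basis_vec i).

Definition smooth1 (f : R -> R) : Prop :=
  forall k x, derivable (derive1n k f) x 1.

Definition test_fun (A : set E) (f : E -> R) : Prop :=
  [/\ smooth f, compact (closure [set x | f x != 0]) &
      closure [set x | f x != 0] `<=` A].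

Definition test_fun1 (A : set R) (f : R -> R) : Prop :=
  [/\ smooth1 f, compact (closure [set x | f x != 0]) &
      closure [set x | f x != 0] `<=` A].

Definition euclid_norm (v : 'I_N -> R) : R := Num.sqrt (\sum_i v i ^+ 2).

Definition boundary (Om : set E) : set E := closure Om `\` interior Om.

(* Near the boundary point [x], [Om] is the side [h < 0] of the smooth
   hypersurface [h = 0]. *)
Definition local_defining (Om : set E) (x : E) (h : E -> R) : Prop :=
  [/\ smooth h, exists i, pd i h x != 0 &
      \forall y \near x, Om y <-> h y < 0].

Definition smooth_boundary (Om : set E) : Prop :=
  forall x, boundary Om x -> exists h, local_defining Om x h.

Definition is_outward_normal (Om : set E) (x n : E) : Prop :=
  exists2 h, local_defining Om x h &
    forall i, n ord0 i = pd i h x / euclid_norm (fun j => pd j h x).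

(* A smooth vector field on R^N extending the outward unit normal of Om. *)
Definition normal_extension (Om : set E) (nu : E -> E) : Prop :=
  (forall i, smooth (fun x => nu x ord0 i)) /\
  forall x, boundary Om x -> is_outward_normal Om x (nu x).

End smooth.

(* Elements of H = L^2(Om) are represented by functions E -> R that are
   measurable on Om; they are identified when they agree a.e. on Om, and only
   their values on Om matter. *)
Section sobolev.
Context {R : realType} {N : nat}.
Local Notation E := 'rV[R]_N.
Variable Om : set E.

Definition ae_Om (P : E -> Prop) : Prop :=
  \forall x \ae (leb N), Om x -> P x.

Definition normH (u : E -> R) : \bar R :=
  'N[leb N]_2%:E[(EFin \o u) \_ Om].

Definition inH (u : E -> R) : Prop :=
  measurable_fun Om u /\ (normH u < +oo)%E.

Definition weak_pd (i : 'I_N) (u g : E -> R) : Prop :=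
  forall psi, test_fun Om psi ->
    \int[leb N]_(x in Om) (u x * pd i psi x) =
    - \int[leb N]_(x in Om) (g x * psi x).

(* The weak i-th partial derivative in L^2 (unique a.e.), when it exists. *)
Definition wpd (i : 'I_N) (u : E -> R) : E -> R :=
  xget (fun=> 0) [set g | inH g /\ weak_pd i u g].

Definition inV (u : E -> R) : Prop :=
  inH u /\ forall i, exists g, inH g /\ weak_pd i u g.

Definition normV (u : E -> R) : \bar R :=
  ((normH u ^+ 2 + \sum_(i < N) normH (wpd i u) ^+ 2) `^ (2^-1))%E.

Definition inH2 (u : E -> R) : Prop :=
  inV u /\ forall i, inV (wpd i u).

Definition lap (u : E -> R) : E -> R :=
  fun x => \sum_(i < N) wpd i (wpd i u) x.

(* u in H^1_0(Om), the closure of the test functions in H^1(Om). *)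
Definition zero_trace (u : E -> R) : Prop :=
  inV u /\ exists psi : nat -> E -> R,
    (forall k, test_fun Om (psi k)) /\
    (fun k => normV (fun x => psi k x - u x)) @ \oo --> 0%E.

(* For u in H^2(Om): the trace on the boundary of the normal derivative,
   nu . grad u, vanishes. *)
Definition zero_normal_derivative (u : E -> R) : Prop :=
  exists2 nu, normal_extension Om nu &
    zero_trace (fun x => \sum_(i < N) nu x ord0 i * wpd i u x).

Definition inW (u : E -> R) : Prop := inH2 u /\ zero_normal_derivative u.

Definition normW (u : E -> R) : \bar R :=
  ((normH u ^+ 2 + normH (lap u) ^+ 2) `^ (2^-1))%E.

(* The graph of the subdifferential of the norm of H. *)
Definition Sign (v s : E -> R) : Prop :=
  inH s /\
  (normH v != 0%E -> ae_Om (fun x => s x = v x / fine (normH v))) /\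
  (normH v = 0%E -> (normH s <= 1)%E).

End sobolev.

(* Functions from (0,T) to H are represented by curried functions of (t,x),
   jointly measurable on Q = (0,T) x Om; this identifies L^2(0,T;H) and
   L^2(Q). *)
Section bochner.
Context {R : realType} {N : nat}.
Local Notation E := 'rV[R]_N.
Local Notation lebR := (@lebesgue_measure R).
Variables (Om : set E) (T : R).

Definition ae_time (P : R -> Prop) : Prop :=
  \forall t \ae lebR, `]0, T[%classic t -> P t.

(* By Fubini, for measurable conditions this is "a.e. in Q"; the iterated form
   does not depend on the representative chosen, at each time, for the weak
   derivatives in space. *)
Definition ae_Q (P : R -> E -> Prop) : Prop :=
  ae_time (fun t => ae_Om Om (P t)).

Definition cylinder : set (measurableTypeR R * E) := `]0, T[%classic `*` Om.

Definition measurable_Q (u : R -> E -> R) : Prop :=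
  measurable_fun cylinder (fun z => u z.1 z.2).

Definition normL2Q (f : R -> E -> R) : \bar R :=
  'N[(lebR \x leb N)%E]_2%:E[(fun z => (f z.1 z.2)%:E) \_ cylinder].

Definition inL2Q (f : R -> E -> R) : Prop :=
  measurable_Q f /\ (normL2Q f < +oo)%E.

(* Norm of L^p(0,T;X), where nX is the norm of X. *)
Definition normLp (p : \bar R) (nX : (E -> R) -> \bar R) (u : R -> E -> R) :
    \bar R :=
  'N[lebR]_p[(fun t => nX (u t)) \_ `]0, T[%classic].

Definition inLpH (p : \bar R) (u : R -> E -> R) : Prop :=
  measurable_Q u /\ (normLp p (normH Om) u < +oo)%E.

(* Measurability with values in V (resp. W): u |-> (u, grad u) (resp.
   u |-> (u, lap u)) is an isometry from V (resp. W) to a power of H. *)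
Definition inLpV (p : \bar R) (u : R -> E -> R) : Prop :=
  [/\ measurable_Q u, ae_time (fun t => inV Om (u t)),
      forall i, exists2 g, measurable_Q g &
        ae_Q (fun t x => g t x = wpd Om i (u t) x) &
      (normLp p (normV Om) u < +oo)%E].

Definition inLpW (p : \bar R) (u : R -> E -> R) : Prop :=
  [/\ measurable_Q u, ae_time (fun t => inW Om (u t)),
      exists2 g, measurable_Q g &
        ae_Q (fun t x => g t x = lap Om (u t) x) &
      (normLp p (normW Om) u < +oo)%E].

(* v is the derivative of u in the sense of H-valued distributions on (0,T);
   the H-valued integrals are computed pointwise. *)
Definition weak_dt (u v : R -> E -> R) : Prop :=
  forall eta, test_fun1 `]0, T[%classic eta ->
    ae_Om Om (fun x =>
      \int[lebR]_(t in `]0, T[) (u t x * derive1 eta t) =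
      - \int[lebR]_(t in `]0, T[) (v t x * eta t)).

Definition is_dt (u v : R -> E -> R) : Prop := inLpH 1 v /\ weak_dt u v.

(* The weak time derivative in L^1(0,T;H) (unique a.e.), when it exists. *)
Definition dt (u : R -> E -> R) : R -> E -> R :=
  xget (fun _ => fun=> 0) [set v | is_dt u v].

(* W^{1,p}(0,T;X), where inLX is membership in L^p(0,T;X). *)
Definition inW1 (inLX : (R -> E -> R) -> Prop) (u : R -> E -> R) : Prop :=
  [/\ inLX u, exists v, is_dt u v & inLX (dt u)].

Definition normW1oo (nX : (E -> R) -> \bar R) (u : R -> E -> R) : \bar R :=
  (normLp +oo nX u + normLp +oo nX (dt u))%E.

Definition normH1 (nX : (E -> R) -> \bar R) (u : R -> E -> R) : \bar R :=
  ((normLp 2%:E nX u ^+ 2 + normLp 2%:E nX (dt u) ^+ 2) `^ (2^-1))%E.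

(* u(0) = u0 in H, where u(0) is the value at 0 of the representative of u in
   C([0,T];H). *)
Definition initial_value (u : R -> E -> R) (u0 : E -> R) : Prop :=
  exists c : R -> E -> R,
    [/\ forall t, `[0, T]%classic t -> inH Om (c t),
        ae_Q (fun t x => c t x = u t x),
        forall s, `[0, T]%classic s ->
          (fun t => normH Om (fun x => c t x - c s x))
            @ within `[0, T]%classic (nbhs s) --> 0%E &
        ae_Om Om (fun x => c 0 x = u0 x)].

End bochner.

Section problemB.
Context {R : realType} {N : nat}.
Local Notation E := 'rV[R]_N.

Record solutionB (Om : set E) (T kappa tau gamma l rho : R)
    (betahat : R -> \bar R) (pihat : R -> R) (phistar : E -> R)
    (f : R -> E -> R) (theta0 w0 phi0 : E -> R)
    (w phi xi sigma : R -> E -> R) : Prop := SolutionB {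
  w_H2H : inW1 Om T (inLpH Om T 2%:E) w /\
          inW1 Om T (inLpH Om T 2%:E) (dt Om T w) ;
  w_W1ooV : inW1 Om T (inLpV Om T +oo%E) w ;
  w_H1W : inW1 Om T (inLpW Om T 2%:E) w ;
  phi_H1H : inW1 Om T (inLpH Om T 2%:E) phi ;
  phi_LooV : inLpV Om T +oo%E phi ;
  phi_L2W : inLpW Om T 2%:E phi ;
  xi_L2H : inLpH Om T 2%:E xi ;
  sigma_LooH : inLpH Om T +oo%E sigma ;
  eq_w : ae_Q Om T (fun t x =>
    dt Om T (fun t' x' => dt Om T w t' x' + l * phi t' x') t x
      - kappa * lap Om (dt Om T w t) x - tau * lap Om (w t) x = f t x) ;
  eq_phi : ae_Q Om T (fun t x =>
    dt Om T phi t x - lap Om (phi t) x + xi t x + derive1 pihat (phi t x)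
      + rho * sigma t x = gamma * dt Om T w t x) ;
  sigma_Sign : ae_time T (fun t =>
    Sign Om (fun x => phi t x - phistar x) (sigma t)) ;
  xi_beta : ae_Q Om T (fun t x => subdiff betahat (phi t x) (xi t x)) ;
  wt_0 : initial_value Om T (dt Om T w) theta0 ;
  w_0 : initial_value Om T w w0 ;
  phi_0 : initial_value Om T phi phi0
}.

End problemB.

(* Main.v *)
Require Import Defs.
From mathcomp Require Import all_boot all_order all_algebra.
From mathcomp Require Import all_classical all_reals all_analysis.
From mathcomp Require Import measurable_realfun ess_sup_inf.
From mathcomp Require Import ring lra.

(** The theorem follows from the energy method applied to the difference of the
    two solutions. Let w, phi, f denote differences, and e = w_t + l phi. The first
    equation reads e_t = kappa Lap w_t + tau Lap w + f. It is tested with e, and the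
    second one with 2 kappa l^2 phi. By Green's formula the first test produces
    the dissipation kappa |grad w_t|^2 and cross terms in grad phi and grad w. The
    cross terms in grad phi are absorbed by the dissipation of the second test,
    thanks to the weight. The gradient of w is the one of the initial datum plus
    a primitive of grad w_t, so that its square is controlled by the dissipation
    up to the same time. In the second test the terms in xi and sigma have a sign,
    since beta and Sign are monotone; this is why the constant does not depend on
    rho. The term in pi is Lipschitz, and w_t = e - l phi. Gronwall's inequality
    concludes: energy_bound is this argument for real functions of time,
    energy_curves for curves in L^2, difference_energy for solutions.

    The rest makes these steps legitimate for functions that are only weakly
    differentiable, and not chosen continuous in time.

    In space, what is needed is Green's formula (green) for u in W and v in V.
    The product of two functions with weak derivatives is treated line by line,
    where both are primitives (space_parts, local_parts). The gradient of u is the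
    sum of its normal component, of zero trace, and of a field that is tangential
    up to the distance to the boundary. For the former one approximates by test
    functions (divergence_zero_trace). For the latter one cuts off near the
    boundary: the gradient of the cutoff is nearly normal, hence nearly orthogonal
    to the field (tangential_gradient, tangential_divergence).

    In time, a function with a weak derivative is, at almost every point of space,
    a primitive of it (time_repr), the constant of integration is the initial
    value (time_bar), and the energy identity is the product rule for primitives
    integrated over space (bar_energy). The gradient of a primitive in time is the
    primitive of the gradient (weak_pd_bar), which gives grad w from grad w_t. *)

Set Implicit Arguments.
Unset Strict Implicit.
Unset Printing Implicit Defensive.

Import Order.TTheory GRing.Theory Num.Theory.
Import numFieldNormedType.Exports.

Local Open Scope classical_set_scope.
Local Open Scope ring_scope.

(** * Smooth functions of several variables *)

Section smooth_calculus.
Context {R : realType} {N : nat}.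
Local Notation E := 'rV[R]_N.
Implicit Types (f g : E -> R) (phi : R -> R).

Lemma is_derive_line f (x v : E) (t : R) :
  derivable f (t *: v + x) v ->
  is_derive t 1 (fun s : R => f (s *: v + x)) ('D_v f (t *: v + x)).
Proof.
move=> df.
have E1 : (fun h : R => h^-1 *: (((fun s : R => f (s *: v + x)) \o shift t) (h *: 1) - f (t *: v + x)))
  = (fun h : R => h^-1 *: ((f \o shift (t *: v + x)) (h *: v) - f (t *: v + x))).
  by apply/funext => h /=; rewrite [h *: 1]mulr1 scalerDl addrA.
split; first by rewrite /derivable E1; exact: df.
by rewrite /derive E1.
Qed.

Lemma is_derive_comp1 f phi (x v : E) :
  derivable f x v -> derivable phi (f x) 1 ->
  is_derive x v (phi \o f) (derive1 phi (f x) * 'D_v f x).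
Proof.
move=> df dp.
have df0 : derivable f (0 *: v + x) v by rewrite scale0r add0r.
have h1 := is_derive_line df0.
have d1 : derivable (fun s : R => f (s *: v + x)) 0 1 by exact: ex_derive.
have dp0 : derivable phi ((fun s : R => f (s *: v + x)) 0) 1.
  by rewrite scale0r add0r.
have d2 : derivable (phi \o (fun s : R => f (s *: v + x))) 0 1.
  apply/derivable1_diffP; apply: differentiable_comp; exact/derivable1_diffP.
have E1 : (fun h : R => h^-1 *: ((phi \o f \o shift x) (h *: v) - (phi \o f) x)) =
  (fun h : R => h^-1 *: (((phi \o (fun s : R => f (s *: v + x))) \o shift 0) (h *: 1) -
       (phi \o (fun s : R => f (s *: v + x))) 0)).
  by apply/funext => h /=; rewrite [h *: 1]mulr1 !addr0 scale0r add0r.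
have h2 := derive1_comp d1 dp0.
split; first by rewrite /derivable E1; exact: d2.
rewrite /derive E1 -[LHS]/('D_1 (phi \o (fun s : R => f (s *: v + x))) 0) -derive1E h2.
rewrite [X in _ * X]derive1E (@derive_val _ _ _ _ _ _ _ h1) !scale0r !add0r.
by [].
Qed.

Lemma derive1n_derive1 phi k : derive1n k (derive1 phi) = derive1n k.+1 phi.
Proof. by elim: k => //= k <-. Qed.

Lemma smooth1_derive1 phi : smooth1 phi -> smooth1 (derive1 phi).
Proof. by move=> sphi k x; rewrite derive1n_derive1; exact: sphi. Qed.

Lemma smooth1_continuous phi : smooth1 phi -> continuous phi.
Proof.
by move=> sp x; apply/differentiable_continuous/derivable1_diffP; exact: (sp 0%N).
Qed.

Lemma smooth_pd f i : smooth f -> smooth (pd i f).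
Proof.
move=> sf s; have -> : foldr pd (pd i f) s = foldr pd f (rcons s i).
  by rewrite foldr_rcons.
exact: sf.
Qed.

Lemma smooth_continuous f : smooth f -> continuous f.
Proof. by move=> /(_ [::])[]. Qed.

Lemma smooth_derivable f x i : smooth f -> derivable f x (basis_vec i).
Proof. by move=> /(_ [::])[_ /(_ i x)]. Qed.

Lemma pdD f g i x : derivable f x (basis_vec i) -> derivable g x (basis_vec i) ->
  pd i (fun y => f y + g y) x = pd i f x + pd i g x.
Proof. by move=> df dg; rewrite /pd -deriveD. Qed.

Lemma pdM f g i x : derivable f x (basis_vec i) -> derivable g x (basis_vec i) ->
  pd i (fun y => f y * g y) x = pd i f x * g x + f x * pd i g x.
Proof.
by move=> df dg; rewrite /pd (deriveM df dg) addrC; congr (_ + _); rewrite mulrC.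
Qed.

(** Smooth functions are only described by their iterated partial derivatives,
    so closure under products and compositions is proved for this algebraically
    generated class, which is visibly stable under one partial derivative. *)
Inductive smooth_gen : (E -> R) -> Prop :=
| SGsmooth f of smooth f : smooth_gen f
| SGadd f g of smooth_gen f & smooth_gen g : smooth_gen (fun x => f x + g x)
| SGmul f g of smooth_gen f & smooth_gen g : smooth_gen (fun x => f x * g x)
| SGcomp phi f of smooth1 phi & smooth_gen f : smooth_gen (fun x => phi (f x)).

Lemma smooth_gen_step f : smooth_gen f -> [/\ continuous f,
  forall i x, derivable f x (basis_vec i) & forall i, smooth_gen (pd i f)].
Proof.
elim => {f}.
- move=> f sf; split; first exact: smooth_continuous.
    by move=> i x; exact: smooth_derivable.
  by move=> i; apply: SGsmooth; exact: smooth_pd.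
- move=> f g sf [cf df pf] sg [cg dg pg]; split.
  + by move=> x; apply: (@continuousD _ _ _ f g); [exact: cf|exact: cg].
  + by move=> i x; apply: (@derivableD _ _ _ f g); [exact: df|exact: dg].
  + move=> i; rewrite (_ : pd i _ = fun x => pd i f x + pd i g x); first exact: SGadd.
    by apply/funext => x; rewrite pdD.
- move=> f g sf [cf df pf] sg [cg dg pg]; split.
  + by move=> x; apply: (@continuousM _ _ f g); [exact: cf|exact: cg].
  + by move=> i x; apply: (@derivableM _ _ f g); [exact: df|exact: dg].
  + move=> i; rewrite (_ : pd i _ = fun x => pd i f x * g x + f x * pd i g x).
      by apply: SGadd; exact: SGmul.
    by apply/funext => x; rewrite pdM.
- move=> phi f sp sf [cf df pf]; split.
  + move=> x; apply: continuous_comp; first exact: cf.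
    exact: smooth1_continuous.
  + move=> i x; have H := is_derive_comp1 (df i x) (sp 0%N (f x)).
    exact: (@ex_derive _ _ _ _ _ _ _ H).
  + move=> i; rewrite (_ : pd i _ = fun x => derive1 phi (f x) * pd i f x).
      by apply: SGmul => //; apply: SGcomp => //; exact: smooth1_derive1.
    apply/funext => x; have H := is_derive_comp1 (df i x) (sp 0%N (f x)).
    exact: (@derive_val _ _ _ _ _ _ _ H).
Qed.

Lemma smooth_genW f : smooth_gen f -> smooth f.
Proof.
move=> sf s.
have : smooth_gen (foldr pd f s).
  by elim: s => //= i s /smooth_gen_step[_ _]; exact.
by move=> /smooth_gen_step[].
Qed.

Lemma smoothD f g : smooth f -> smooth g -> smooth (fun x => f x + g x).
Proof. by move=> sf sg; apply: smooth_genW; apply: SGadd; exact: SGsmooth. Qed.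

Lemma smoothM f g : smooth f -> smooth g -> smooth (fun x => f x * g x).
Proof. by move=> sf sg; apply: smooth_genW; apply: SGmul; exact: SGsmooth. Qed.

Lemma smooth_comp1 phi f : smooth1 phi -> smooth f -> smooth (fun x => phi (f x)).
Proof. by move=> sp sf; apply: smooth_genW; apply: SGcomp => //; exact: SGsmooth. Qed.

Lemma pd_comp1 phi f i x : smooth1 phi -> smooth f ->
  pd i (fun y => phi (f y)) x = derive1 phi (f x) * pd i f x.
Proof.
move=> sp sf; have H := is_derive_comp1 (@smooth_derivable _ x i sf) (sp 0%N (f x)).
exact: (@derive_val _ _ _ _ _ _ _ H).
Qed.

Lemma pd_cst (c : R) i : pd i (fun=> c) = (fun=> 0 : R) :> (E -> R).
Proof. by apply/funext => x; rewrite /pd derive_cst. Qed.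

Lemma smooth_cst (c : R) : smooth ((fun=> c) : E -> R).
Proof.
move=> s; have [c' ->] : exists c' : R, foldr pd (fun=> c) s = (fun=> c') :> (E -> R).
  elim: s => [|i s [c' IH]] /=; first by exists c.
  by exists 0; rewrite IH pd_cst.
split; first by move=> ?; exact: cst_continuous.
by move=> i x; exact: derivable_cst.
Qed.

Lemma is_derive_coord k (x v : E) : is_derive x v (fun y : E => y ord0 k) (v ord0 k).
Proof.
have E1 : (fun h : R => h^-1 *: (((fun y : E => y ord0 k) \o shift x) (h *: v) - x ord0 k)) @ 0^' --> v ord0 k.
  apply: (@cvg_trans _ ((fun=> v ord0 k) @ (0 : R)^')); last exact: cvg_cst.
  apply: near_eq_cvg; near=> h; rewrite /= !mxE addrK scalerA mulVf ?scale1r//.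
  by near: h; exact: nbhs_dnbhs_neq.
split; first by apply/cvg_ex; exists (v ord0 k).
exact/cvg_lim.
Unshelve. all: by end_near. Qed.

Lemma smooth_coord k : smooth (fun x : E => x ord0 k).
Proof.
move=> [|i s].
  split; first exact: coord_continuous.
  by move=> i x; have H := is_derive_coord k x (basis_vec i); exact: (@ex_derive _ _ _ _ _ _ _ H).
rewrite -[i :: s]cat0s; case/lastP: s => [|s j].
  rewrite /= (_ : pd i _ = fun=> (basis_vec i : E) ord0 k).
    exact: (smooth_cst _ [::]).
  by apply/funext => x; have H := is_derive_coord k x (basis_vec i); exact: (@derive_val _ _ _ _ _ _ _ H).
rewrite cat0s -rcons_cons foldr_rcons (_ : pd j _ = fun=> (basis_vec j : E) ord0 k).
  exact: smooth_cst.
by apply/funext => x; have H := is_derive_coord k x (basis_vec j); exact: (@derive_val _ _ _ _ _ _ _ H).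
Qed.

Lemma smoothN f : smooth f -> smooth (fun x => - f x).
Proof.
move=> sf; rewrite (_ : (fun x => _) = (fun x => (fun=> -1) x * f x)).
  by apply: smoothM => //; exact: smooth_cst.
by apply/funext => x; rewrite mulN1r.
Qed.

Lemma smoothB f g : smooth f -> smooth g -> smooth (fun x => f x - g x).
Proof. by move=> sf sg; exact: (smoothD sf (smoothN sg)). Qed.

Lemma smooth_sum (I : Type) (r : seq I) (P : pred I) (F : I -> E -> R) :
  (forall i, smooth (F i)) -> smooth (fun x => \sum_(i <- r | P i) F i x).
Proof.
move=> sF; elim: r => [|i r IH].
  by under eq_fun do rewrite big_nil; exact: smooth_cst.
under eq_fun do rewrite big_cons; case: (P i); last exact: IH.
exact: (smoothD (sF i) IH).
Qed.

Lemma smooth_prod (I : Type) (r : seq I) (P : pred I) (F : I -> E -> R) :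
  (forall i, smooth (F i)) -> smooth (fun x => \prod_(i <- r | P i) F i x).
Proof.
move=> sF; elim: r => [|i r IH].
  by under eq_fun do rewrite big_nil; exact: smooth_cst.
under eq_fun do rewrite big_cons; case: (P i); last exact: IH.
exact: (smoothM (sF i) IH).
Qed.

Lemma pd_near0 f i x : (\forall y \near x, f y = 0) -> pd i f x = 0.
Proof.
move=> f0.
rewrite /pd /derive; apply/cvg_lim => //.
apply: (@cvg_trans _ ((fun=> 0 : R) @ (0 : R)^')); last exact: cvg_cst.
apply: near_eq_cvg; near=> h => /=.
rewrite (nbhs_singleton f0) subr0.
suff -> : f (h *: basis_vec i + x) = 0 by rewrite scaler0.
near: h.
have c0 : (fun h : R => h *: (basis_vec i : E) + x) @ (0 : R)^' --> x.
  have -> : x = 0 *: (basis_vec i : E) + x by rewrite scale0r add0r.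
  rewrite {1}scale0r add0r.
  apply: cvgD; last exact: cvg_cst.
  apply: cvgZr_tmp.
  exact: nbhs_dnbhs.
exact: (c0 _ f0).
Unshelve. all: by end_near. Qed.

End smooth_calculus.

(** * Smooth steps and bumps on the line *)

Lemma compact_continuous_bounded (R : realType) (T : topologicalType) (A : set T)
    (f : T -> R) : compact A -> continuous f ->
  exists2 M : R, 0 < M & forall x, A x -> `|f x| <= M.
Proof.
move=> cA cf.
have /compact_bounded/ex_strict_bound_gt0[M M0 HM] : compact (f @` A).
  by apply: continuous_compact => //; exact: continuous_subspaceT.
by exists M => // x Ax; apply/ltW/HM; exists x.
Qed.

Section smooth1_calculus.
Context {R : realType}.
Implicit Types (f g phi : R -> R).
Local Notation mu := (@lebesgue_measure R).

Lemma smooth1_ind_class (P : (R -> R) -> Prop) :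
  (forall f, P f -> (forall x, derivable f x 1) /\ P (derive1 f)) ->
  forall f, P f -> smooth1 f.
Proof.
move=> H f Pf k; have : P (derive1n k f).
  by elim: k => //= k /H[].
by move=> /H[].
Qed.

Lemma derive1D_fun f g : (forall x, derivable f x 1) -> (forall x, derivable g x 1) ->
  derive1 (fun x => f x + g x) = fun x => derive1 f x + derive1 g x.
Proof.
move=> df dg; apply/funext => x; rewrite !derive1E.
exact: (@deriveD _ _ _ f g).
Qed.

Lemma derive1M_fun f g : (forall x, derivable f x 1) -> (forall x, derivable g x 1) ->
  derive1 (fun x => f x * g x) = fun x => derive1 f x * g x + f x * derive1 g x.
Proof.
move=> df dg; apply/funext => x; rewrite !derive1E.
by rewrite (@deriveM _ _ f g _ _ (df x) (dg x)) addrC; congr (_ + _); rewrite mulrC.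
Qed.

(** The one variable analogue of the class above. *)
Inductive smooth1_gen : (R -> R) -> Prop :=
| SG1smooth f of smooth1 f : smooth1_gen f
| SG1add f g of smooth1_gen f & smooth1_gen g : smooth1_gen (fun x => f x + g x)
| SG1mul f g of smooth1_gen f & smooth1_gen g : smooth1_gen (fun x => f x * g x)
| SG1comp phi f of smooth1 phi & smooth1_gen f : smooth1_gen (fun x => phi (f x)).

Lemma smooth1_gen_step f : smooth1_gen f ->
  (forall x, derivable f x 1) /\ smooth1_gen (derive1 f).
Proof.
elim => {f}.
- move=> f sf; split; first exact: (sf 0%N).
  apply: SG1smooth => k x; rewrite (_ : derive1n k (derive1 f) = derive1n k.+1 f).
    exact: (sf k.+1).
  by elim: k {x} => //= k ->.
- move=> f g sf [df pf] sg [dg pg]; split.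
    by move=> x; apply: (@derivableD _ _ _ f g); [exact: df|exact: dg].
  by rewrite derive1D_fun//; exact: (SG1add pf pg).
- move=> f g sf [df pf] sg [dg pg]; split.
    by move=> x; apply: (@derivableM _ _ f g); [exact: df|exact: dg].
  by rewrite derive1M_fun//; exact: (SG1add (SG1mul pf sg) (SG1mul sf pg)).
- move=> phi f sp sf [df pf]; split.
    move=> x; apply/derivable1_diffP; apply: differentiable_comp.
      exact/derivable1_diffP.
    by apply/derivable1_diffP; exact: (sp 0%N).
  rewrite (_ : derive1 _ = fun x => derive1 phi (f x) * derive1 f x).
    apply: SG1mul => //; apply: (SG1comp _ sf) => k x.
    rewrite (_ : derive1n k (derive1 phi) = derive1n k.+1 phi); first exact: (sp k.+1).
    by elim: k {x} => //= k ->.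
  apply/funext => x; rewrite -[LHS]/(derive1 (phi \o f)%FUN x) derive1_comp//.
  exact: (sp 0%N).
Qed.

Lemma smooth1_genW f : smooth1_gen f -> smooth1 f.
Proof. exact: smooth1_ind_class smooth1_gen_step f. Qed.

Lemma smooth1D f g : smooth1 f -> smooth1 g -> smooth1 (fun x => f x + g x).
Proof. by move=> sf sg; apply: smooth1_genW; apply: SG1add; exact: SG1smooth. Qed.

Lemma smooth1M f g : smooth1 f -> smooth1 g -> smooth1 (fun x => f x * g x).
Proof. by move=> sf sg; apply: smooth1_genW; apply: SG1mul; exact: SG1smooth. Qed.

Lemma smooth1_comp phi f : smooth1 phi -> smooth1 f -> smooth1 (fun x => phi (f x)).
Proof. by move=> sp sf; apply: smooth1_genW; apply: SG1comp => //; exact: SG1smooth. Qed.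

Lemma smooth1_cst (c : R) : smooth1 (fun=> c).
Proof.
apply: (@smooth1_ind_class (fun f => exists c, f = fun=> c)); last by exists c.
move=> _ [c' ->]; split=> [x|]; first exact: derivable_cst.
by exists 0; apply/funext => x; rewrite derive1_cst.
Qed.

Lemma smooth1_id : smooth1 (fun x : R => x).
Proof.
move=> [|k] x; first exact: derivable_id.
have -> : derive1n k.+1 (fun x : R => x) = derive1n k (fun=> 1 : R).
  have E1 : derive1 (fun x : R => x) = fun=> 1.
    by apply/funext => y; rewrite derive1E derive_id.
  by elim: k {x} => //= k ->.
exact: smooth1_cst.
Qed.

(** The functions x^-n exp(-1/x) extended by 0 to x <= 0: they span a space
    stable under differentiation. *)
Definition flat n (x : R) : R := if 0 < x then x^-1 ^+ n * expR (- x^-1) else 0.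

(** The exponential dominates every power: this gives the continuity and the
    differentiability of the extension at 0. *)
Lemma flat_le n (x : R) : 0 < x -> flat n x <= n.+1`!%:R * x.
Proof.
move=> x0; rewrite /flat x0; have xi0 : 0 < x^-1 by rewrite invr_gt0.
have f0 : (0 : R) < n.+1`!%:R by rewrite ltr0n fact_gt0.
have h1 : x^-1 ^+ n.+1 / n.+1`!%:R <= expR x^-1.
  by apply: le_trans (expR_ge1Dxn n (ltW xi0)); rewrite lerDr.
rewrite expRN ler_pdivrMr ?expR_gt0//.
move: h1; rewrite ler_pdivrMr// exprSr ler_pdivrMr//.
by rewrite mulrC (mulrC _ n.+1`!%:R) !mulrA (mulrC x).
Qed.

Lemma flat_ge0 n (x : R) : 0 <= flat n x.
Proof.
rewrite /flat; case: ifPn => // x0.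
by rewrite mulr_ge0 ?expR_ge0// exprn_ge0// invr_ge0 ltW.
Qed.

Lemma is_derive_flat n (x : R) :
  is_derive x 1 (flat n) (flat n.+2 x - n%:R * flat n.+1 x).
Proof.
case: (ltgtP 0 x) => [x0|x0|<-].
- pose F := fun y : R => y^-1 ^+ n * expR (- y^-1).
  have xn0 : x != 0 by rewrite gt_eqF.
  have di : is_derive x 1 (fun y : R => y^-1) (- x ^- 2 *: 1).
    exact: is_deriveV.
  have de : is_derive x 1 (fun y : R => expR (- y^-1)) (expR (- x^-1) * (x ^- 2)).
    have dN : is_derive x 1 (fun y : R => - y^-1) (x ^- 2).
      have := is_deriveN di; rewrite scaleNr opprK [_ *: 1]mulr1; exact.
    exact: (is_derive1_comp (f := expR) (g := fun y : R => - y^-1)).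
  have dX : is_derive x 1 (fun y : R => y^-1 ^+ n) (n%:R * x^-1 ^+ n.-1 * (- x ^- 2)).
    have := is_deriveX n di; rewrite exprfctE scalerA [_ *: 1]mulr1; exact.
  have dF : is_derive x 1 F (flat n.+2 x - n%:R * flat n.+1 x).
    apply: (is_derive_eq (is_deriveM dX de)).
    rewrite /flat x0 /GRing.scale/= -exprVn.
    case: n {F dX} => [|n] /=; first by rewrite !expr0 !mul0r mulr0 addr0 subr0 mul1r mulrC.
    rewrite !exprS; ring.
  have nF : \near x, F x = flat n x.
    near=> y; rewrite /flat ifT//; near: y; exact: lt_nbhsr.
  exact: (near_eq_is_derive nF dF).
- have F0 : \near x, (fun=> 0 : R) x = flat n x.
    near=> y; rewrite /flat ifF//; apply/negbTE; rewrite -leNgt ltW//.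
    near: y; exact: lt_nbhsl.
  have -> : flat n.+2 x - n%:R * flat n.+1 x = 0.
    by rewrite /flat ltNge (ltW x0)/= mulr0 subr0.
  apply: (near_eq_is_derive F0); exact: is_derive_cst.
- have -> : flat n.+2 0 - n%:R * flat n.+1 0 = 0 :> R.
    by rewrite /flat ltxx mulr0 subr0.
  have c0 : (fun h : R => h^-1 *: ((flat n \o shift 0) (h *: 1) - flat n 0)) @ 0^' --> (0 : R).
    apply/cvgrPdist_le => e e0; near=> h.
    rewrite /= sub0r normrN [h *: 1]mulr1 addr0 {2}/flat ltxx subr0 -[_ *: _]/(h^-1 * flat n h).
    have [h0|h0] := ltP 0 h; last first.
      by rewrite /flat ltNge h0/= mulr0 normr0 ltW.
    rewrite (_ : h^-1 * flat n h = flat n.+1 h); last first.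
      by rewrite /flat h0 exprS mulrA.
    rewrite ger0_norm ?flat_ge0//; apply: le_trans (flat_le _ h0) _.
    rewrite mulrC -ler_pdivlMr ?ltr0n ?fact_gt0//.
    apply: (le_trans (ler_norm _)).
    near: h; apply: dnbhs0_le; rewrite divr_gt0// ltr0n fact_gt0//.
  split; first by apply/cvg_ex; exists 0.
  exact/cvg_lim.
Unshelve. all: by end_near. Qed.

Inductive flat_span : (R -> R) -> Prop :=
| FSflat n : flat_span (flat n)
| FSadd f g of flat_span f & flat_span g : flat_span (fun x => f x + g x)
| FSscale (c : R) f of flat_span f : flat_span (fun x => c * f x).

Lemma smooth1_flat n : smooth1 (flat n).
Proof.
apply: smooth1_ind_class (FSflat n) => f; elim => {f n}.
- move=> n; split; first by move=> x; exact: (@ex_derive _ _ _ _ _ _ _ (is_derive_flat n x)).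
  rewrite (_ : derive1 (flat n) = fun x => flat n.+2 x + (- n%:R) * flat n.+1 x).
    by apply: FSadd; [exact: FSflat|apply: FSscale; exact: FSflat].
  apply/funext => x; rewrite derive1E mulNr.
  exact: (@derive_val _ _ _ _ _ _ _ (is_derive_flat n x)).
- move=> f g _ [df pf] _ [dg pg]; split.
    by move=> x; exact: (@derivableD _ _ _ f g).
  by rewrite derive1D_fun//; exact: FSadd.
- move=> c f _ [df pf].
  have dc : forall x, derivable (fun x => c * f x) x 1.
    move=> x; exact: (@derivableZ _ _ _ f c).
  split => //.
  rewrite (_ : derive1 _ = fun x => c * derive1 f x); first exact: FSscale.
  by apply/funext => x; rewrite !derive1E (@deriveZ _ _ _ f c).
Qed.

Definition prim (f : R -> R) (x : R) : R := \int[mu]_(t in `]-oo, x]) f t.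

Section prim.
Variables (f : R -> R) (a b : R).
Hypotheses (fc : continuous f) (f0 : forall x, ~~ (a < x < b) -> f x = 0).

Lemma integrable_compact_support : mu.-integrable setT (EFin \o f).
Proof.
have -> : (EFin \o f) = (EFin \o f) \_ `[a, b].
  apply/funext => x; rewrite patchE; case: ifPn => // xab; rewrite /= f0//.
  apply: contraNN xab => /andP[ax xb]; rewrite inE/= in_itv/=.
  by rewrite (ltW ax) (ltW xb).
apply/(integrable_mkcond _ _).1 => //.
apply: continuous_compact_integrable; first exact: segment_compact.
exact: continuous_subspaceT.
Qed.

Lemma derive1_prim : (forall x, derivable (prim f) x 1) /\ derive1 (prim f) = f.
Proof.
have H x : derivable (prim f) x 1 /\ derive1 (prim f) x = f x.
  apply: (@continuous_FTC1 _ f -oo%O x (x + 1)).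
  - by rewrite ltrDl.
  - by apply: integrableS integrable_compact_support.
  - by rewrite ltNyr.
  - exact: fc.
by split=> [x|]; [have [] := H x|apply/funext => x; have [] := H x].
Qed.

Lemma prim_le x : x <= a -> prim f x = 0.
Proof.
move=> xa; rewrite /prim (@eq_Rintegral _ _ _ _ _ (cst 0)); last first.
  move=> y; rewrite inE/= in_itv/= => yx; apply: f0.
  by rewrite ltNge (le_trans yx xa).
by rewrite Rintegral_cst// mul0r.
Qed.

Lemma prim_ge x : b <= x -> prim f x = \int[mu]_t f t.
Proof.
move=> bx; rewrite /prim Rintegral_mkcond; apply: eq_Rintegral => y _.
rewrite patchE; case: ifPn => //; rewrite notin_setE/= in_itv/= => /negP.
rewrite -ltNge => xy; rewrite f0// negb_and orbC -leNgt (le_trans bx)//.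
exact: ltW.
Qed.

Lemma smooth1_prim : smooth1 f -> smooth1 (prim f).
Proof.
move=> sf [|k] x; first exact: derive1_prim.1.
have -> : derive1n k.+1 (prim f) = derive1n k f.
  elim: k {x} => [|k IH]; first exact: derive1_prim.2.
  by rewrite -[LHS]/(derive1 (derive1n k.+1 (prim f))) IH.
exact: sf.
Qed.

End prim.

Definition bump01 (x : R) : R := flat 0 x * flat 0 (1 - x).

Lemma smooth1_bump01 : smooth1 bump01.
Proof.
apply: smooth1M; first exact: smooth1_flat.
apply: (@smooth1_comp (flat 0) (fun x => 1 - x)); first exact: smooth1_flat.
rewrite (_ : (fun x => _) = (fun x => (fun=> 1) x + (fun=> -1) x * x)); last first.
  by apply/funext => x; rewrite mulN1r.
apply: smooth1D; first exact: smooth1_cst.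
by apply: smooth1M; [exact: smooth1_cst|exact: smooth1_id].
Qed.

Lemma bump01_ge0 x : 0 <= bump01 x.
Proof. by rewrite mulr_ge0// flat_ge0. Qed.

Lemma bump01_out x : ~~ (0 < x < 1) -> bump01 x = 0.
Proof.
rewrite negb_and /bump01 /flat => /orP[/negbTE ->|x1]; first by rewrite mul0r.
by rewrite [in X in _ * X]ifF ?mulr0// subr_gt0; exact/negbTE.
Qed.

Lemma smooth1_derivable f x : smooth1 f -> derivable f x 1.
Proof. exact: (fun sf => sf 0%N x). Qed.

Lemma continuous_smooth1 f : smooth1 f -> continuous f.
Proof.
by move=> sf x; apply/differentiable_continuous/derivable1_diffP; exact: smooth1_derivable.
Qed.

Lemma bump01_int : 0 < \int[mu]_t bump01 t.
Proof.
have ib := integrable_compact_support (continuous_smooth1 smooth1_bump01) bump01_out.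
have c0 : 0 < flat 0 (4^-1) * flat 0 (4^-1) :> R.
  by rewrite /flat invr_gt0 ltr0n/= expr0 mul1r mulr_gt0// expR_gt0.
pose c := flat 0 (4^-1) * flat 0 (4^-1) : R.
pose g : R -> R := (cst c) \_ `[(4^-1 : R), 3 / 4]%classic.
have flat_mono x y : x <= y -> flat 0 x <= flat 0 y :> R.
  move=> xy; rewrite /flat; case: ifPn => x0; last by case: ifPn => //; rewrite expr0 mul1r expR_ge0.
  rewrite (lt_le_trans x0 xy) !expr0 !mul1r ler_expR lerN2 lef_pV2// posrE//.
  exact: lt_le_trans xy.
have ig : mu.-integrable setT (EFin \o g).
  rewrite /g -restrict_EFin; apply/(integrable_mkcond _ _).1 => //.
  apply: continuous_compact_integrable; first exact: segment_compact.
  by apply: continuous_subspaceT => ?; exact: cst_continuous.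
apply: (@lt_le_trans _ _ (\int[mu]_t g t)); last first.
  apply: le_Rintegral => // x _; rewrite /g patchE.
  case: ifPn; last by rewrite bump01_ge0.
  rewrite inE/= in_itv/= => /andP[h1 h2]; rewrite /bump01.
  apply: ler_pM; rewrite ?flat_ge0//; first exact: flat_mono.
  by apply: flat_mono; lra.
have -> : \int[mu]_t g t = c * fine (mu `[(4^-1 : R), 3 / 4]%classic).
  by rewrite /g -(Rintegral_mkcond mu `[(4^-1 : R), 3 / 4]%classic (cst c)) Rintegral_cst.
rewrite lebesgue_measure_itv/= lte_fin.
rewrite ifT; last lra.
by rewrite mulr_gt0//=; lra.
Qed.

(** A smooth transition from 0 on x <= 0 to 1 on x >= 1. *)
Definition step (x : R) : R := (\int[mu]_t bump01 t)^-1 * prim bump01 x.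

Lemma smooth1_step : smooth1 step.
Proof.
apply: smooth1M; first exact: smooth1_cst.
apply: (smooth1_prim _ bump01_out); last exact: smooth1_bump01.
exact/continuous_smooth1/smooth1_bump01.
Qed.

Lemma step_le0 x : x <= 0 -> step x = 0.
Proof. by move=> x0; rewrite /step (prim_le bump01_out)// mulr0. Qed.

Lemma step_ge1 x : 1 <= x -> step x = 1.
Proof.
by move=> x1; rewrite /step (prim_ge bump01_out)// mulVf// gt_eqF// bump01_int.
Qed.

Lemma step_ge0 x : 0 <= step x.
Proof.
rewrite /step mulr_ge0 ?invr_ge0 ?(ltW bump01_int)//.
by apply: Rintegral_ge0 => y _; exact: bump01_ge0.
Qed.

Lemma step_le1 x : step x <= 1.
Proof.
have ib := integrable_compact_support (continuous_smooth1 smooth1_bump01) bump01_out.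
rewrite /step ler_pdivrMl ?bump01_int// mulr1 /prim Rintegral_mkcond.
apply: le_Rintegral => //.
  rewrite -restrict_EFin; apply/(integrable_mkcond _ _).1 => //.
  exact: integrableS ib.
by move=> y _; rewrite patchE; case: ifPn => // _; exact: bump01_ge0.
Qed.

Lemma derive1_step_out x : ~~ (0 < x < 1) -> derive1 step x = 0.
Proof.
move=> x01; rewrite derive1E /step.
have [dp ep] := derive1_prim (continuous_smooth1 smooth1_bump01) bump01_out.
rewrite (@deriveZ _ _ _ (prim bump01))// -derive1E ep bump01_out//.
by rewrite scaler0.
Qed.

Lemma derive1_step_bounded : exists2 M : R, 0 < M & forall x, `|derive1 step x| <= M.
Proof.
have c1 : continuous (derive1 step).
  apply: continuous_smooth1 => k x.
  have -> : derive1n k (derive1 step) = derive1n k.+1 step by elim: k {x} => //= k ->.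
  exact: smooth1_step.
have [M M0 HM] := compact_continuous_bounded (@segment_compact R 0 1) c1.
exists M => // x; have [x01|x01] := boolP (0 < x < 1).
  by apply: HM; rewrite /= in_itv/=; case/andP: x01 => /ltW -> /ltW ->.
by rewrite derive1_step_out// normr0 ltW.
Qed.

(** The shift by 1 keeps the support at distance 1/n from the end points, so
    that these are test functions of ]a, b[; they tend to its indicator. *)
Definition itv_bump (a b : R) (n : nat) (t : R) : R :=
  step (n%:R * (t - a) - 1) * step (n%:R * (b - t) - 1).

Lemma smooth1_affine (c d : R) : smooth1 (fun x => c * x + d).
Proof.
apply: (@smooth1D (fun x => c * x) (fun=> d)); last exact: smooth1_cst.
by apply: (@smooth1M (fun=> c)); [exact: smooth1_cst|exact: smooth1_id].
Qed.

Lemma smooth1_itv_bump a b n : smooth1 (itv_bump a b n).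
Proof.
apply: smooth1M.
  apply: (@smooth1_comp step (fun t => n%:R * (t - a) - 1)); first exact: smooth1_step.
  rewrite (_ : (fun t => _) = (fun t => n%:R * t + (- (n%:R * a) - 1))); first exact: smooth1_affine.
  by apply/funext => t; ring.
apply: (@smooth1_comp step (fun t => n%:R * (b - t) - 1)); first exact: smooth1_step.
rewrite (_ : (fun t => _) = (fun t => (- n%:R) * t + ((n%:R * b) - 1))); first exact: smooth1_affine.
by apply/funext => t; ring.
Qed.

Lemma itv_bump_ge0 a b n t : 0 <= itv_bump a b n t.
Proof. by rewrite mulr_ge0// step_ge0. Qed.

Lemma itv_bump_le1 a b n t : itv_bump a b n t <= 1.
Proof. by rewrite mulr_ile1// ?step_ge0// step_le1. Qed.

Lemma itv_bump_supp a b n t : itv_bump a b n t != 0 ->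
  [/\ (0 < n)%N, a + n%:R^-1 <= t & t <= b - n%:R^-1].
Proof.
move=> t0; have [h1|h1] := leP (n%:R * (t - a)) 1.
  by move: t0; rewrite /itv_bump step_le0 ?mul0r ?eqxx// subr_le0.
have [h2|h2] := leP (n%:R * (b - t)) 1.
  by move: t0; rewrite /itv_bump [X in _ * X]step_le0 ?mulr0 ?eqxx// subr_le0.
have n0 : (0 < n)%N.
  by rewrite lt0n; apply/eqP => n0; move: h1; rewrite n0 mul0r ltr10.
have n0' : (0 : R) < n%:R by rewrite ltr0n.
split => //.
- by rewrite -lerBrDl -[_^-1]mul1r ler_pdivrMr// mulrC ltW.
- by rewrite lerBrDr -lerBrDl -[_^-1]mul1r ler_pdivrMr// mulrC ltW.
Qed.

Lemma itv_bump_in a b n t : itv_bump a b n t != 0 -> a < t < b.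
Proof.
move=> /itv_bump_supp[n0 h1 h2]; apply/andP; split.
  by apply: lt_le_trans h1; rewrite ltrDl invr_gt0 ltr0n.
by apply: le_lt_trans h2 _; rewrite gtrDl oppr_lt0 invr_gt0 ltr0n.
Qed.

Lemma itv_bump1 a b n t : 2 <= n%:R * (t - a) -> 2 <= n%:R * (b - t) ->
  itv_bump a b n t = 1.
Proof.
by move=> h1 h2; rewrite /itv_bump !step_ge1 ?mulr1//; lra.
Qed.

Lemma itv_bump_cvg a b t :
  itv_bump a b n t @[n --> \oo] --> (\1_(`]a, b[%classic) t : R).
Proof.
rewrite indicE; have [tab|tab] := boolP (t \in _); last first.
  apply: cvg_near_cst; near=> n; apply/eqP; apply/negP.
  move=> /negP/itv_bump_in; move: tab.
  by rewrite notin_setE/= in_itv/= => /negP/negbTE ->.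
apply: cvg_near_cst; near=> n; move: tab; rewrite inE/= in_itv/= => /andP[h1 h2].
apply: itv_bump1.
  rewrite -ler_pdivrMr ?subr_gt0//; near: n; exact: nbhs_infty_ger.
rewrite -ler_pdivrMr ?subr_gt0//; near: n; exact: nbhs_infty_ger.
Unshelve. all: by end_near. Qed.

Lemma test_fun1_itv_bump a b n (A : set R) : `]a, b[ `<=` A ->
  test_fun1 A (itv_bump a b n).
Proof.
move=> abA.
have sub : closure [set t | itv_bump a b n t != 0] `<=` `[a + n%:R^-1, b - n%:R^-1] /\
   ((0 < n)%N \/ [set t | itv_bump a b n t != 0] = set0).
  split.
    rewrite [X in _ `<=` X](closure_id _).1; last exact: interval_closed.
    apply: closure_subset => t /= /itv_bump_supp[_ h1 h2].
    by rewrite in_itv/= h1 h2.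
  case: n => [|n]; last by left.
  by right; apply/seteqP; split => // t /= /itv_bump_supp[].
split; first exact: smooth1_itv_bump.
  apply: subclosed_compact; [exact: closed_closure| |exact: sub.1].
  exact: segment_compact.
case: sub.2 => [n0|->]; last by rewrite closure0.
apply: subset_trans abA; apply: subset_trans sub.1 _ => t /=.
rewrite !in_itv/= => /andP[h1 h2]; apply/andP; split.
  by apply: lt_le_trans h1; rewrite ltrDl invr_gt0 ltr0n.
by apply: le_lt_trans h2 _; rewrite gtrDl oppr_lt0 invr_gt0 ltr0n.
Qed.

End smooth1_calculus.

(** * Boxes and Borel sets *)

Section boxes.
Context {R : realType} {n : nat}.
Local Notation E := 'rV[R]_n.
Implicit Types (a b x : E) (f : E -> R).

Definition box a b : set E := [set x | forall k, a ord0 k < x ord0 k < b ord0 k].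

Definition box_bump a b (m : nat) x : R :=
  \prod_k itv_bump (a ord0 k) (b ord0 k) m (x ord0 k).

Lemma smooth_box_bump a b m : smooth (box_bump a b m).
Proof.
apply: smooth_prod => k.
exact: (@smooth_comp1 _ _ (itv_bump (a ord0 k) (b ord0 k) m) (fun x : E => x ord0 k)
  (@smooth1_itv_bump _ _ _ _) (@smooth_coord _ _ k)).
Qed.

Lemma box_bump_ge0 a b m x : 0 <= box_bump a b m x.
Proof. by apply: prodr_ge0 => k _; exact: itv_bump_ge0. Qed.

Lemma box_bump_le1 a b m x : box_bump a b m x <= 1.
Proof. by apply: prodr_ile1 => k _; rewrite itv_bump_ge0 itv_bump_le1. Qed.

Lemma box_bump_supp a b m x : box_bump a b m x != 0 ->
  forall k, a ord0 k + m%:R^-1 <= x ord0 k <= b ord0 k - m%:R^-1.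
Proof.
move=> /prodf_neq0 h k; have /itv_bump_supp[_ h1 h2] := h k isT.
by rewrite h1 h2.
Qed.

Lemma box_bump_in a b m x : box_bump a b m x != 0 -> box a b x.
Proof. by move=> /prodf_neq0 h k; exact: itv_bump_in (h k isT). Qed.

Lemma closed_cbox a b : closed [set x : E | forall k, a ord0 k <= x ord0 k <= b ord0 k].
Proof.
rewrite (_ : mkset _ = \bigcap_(k in setT) ((fun x : E => x ord0 k) @^-1` `[a ord0 k, b ord0 k])).
  apply: closed_bigI => k _; apply: closed_comp; last exact: interval_closed.
  by move=> x _; exact: coord_continuous.
apply/seteqP; split => x /= h k; first by move=> _; rewrite /= in_itv/=; exact: h.
by have := h k I; rewrite /= in_itv.
Qed.

Lemma compact_cbox a b : compact [set x : E | forall k, a ord0 k <= x ord0 k <= b ord0 k].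
Proof.
have := @rV_compact R n (fun k => `[a ord0 k, b ord0 k]%classic) (fun k => @segment_compact _ _ _).
exact.
Qed.

Lemma test_fun_box_bump a b m (A : set E) : (0 < n)%N -> box a b `<=` A ->
  test_fun A (box_bump a b m).
Proof.
move=> n0 abA.
have [m0|m0] := posnP m.
  have -> : box_bump a b m = fun=> 0.
    apply/funext => x; apply/eqP/negPn/negP => /prodf_neq0 /(_ (Ordinal n0) isT).
    by move=> /itv_bump_supp[]; rewrite m0.
  have E0 : [set x : E | (fun=> 0 : R) x != 0] = set0.
    by apply/seteqP; split => // x /=; rewrite eqxx.
  rewrite /test_fun E0 closure0; split => //; [exact: smooth_cst|exact: compact0].
have sub : closure [set x | box_bump a b m x != 0] `<=`
    [set x : E | forall k, (a + const_mx m%:R^-1) ord0 k <= x ord0 k <= (b - const_mx m%:R^-1) ord0 k].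
  rewrite [X in _ `<=` X](closure_id _).1; last exact: closed_cbox.
  by apply: closure_subset => x /= /box_bump_supp h k; rewrite !mxE.
split; first exact: smooth_box_bump.
  apply: (subclosed_compact _ (@compact_cbox (a + const_mx m%:R^-1) (b - const_mx m%:R^-1)) sub).
  exact: closed_closure.
apply: subset_trans abA; apply: subset_trans sub _ => x /= h k.
have := h k; rewrite !mxE => /andP[h1 h2].
have mi : (0 : R) < m%:R^-1 by rewrite invr_gt0 ltr0n.
apply/andP; split; first by apply: lt_le_trans h1; rewrite ltrDl.
by apply: le_lt_trans h2 _; rewrite gtrDl oppr_lt0.
Qed.

Lemma box_bump_cvg a b x :
  box_bump a b m x @[m --> \oo] --> (\1_(box a b) x : R).
Proof.
rewrite indicE; have [xab|xab] := boolP (x \in box a b); last first.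
  apply: cvg_near_cst; near=> m; apply/eqP/negPn/negP => /box_bump_in xab'.
  by move: xab; rewrite notin_setE.
rewrite inE in xab; apply: cvg_near_cst.
have : \forall m \near \oo, forall k, itv_bump (a ord0 k) (b ord0 k) m (x ord0 k) = 1.
  apply: filter_forall => k; have /andP[h1 h2] := xab k.
  near=> m; apply: itv_bump1.
    rewrite -ler_pdivrMr ?subr_gt0//; near: m; exact: nbhs_infty_ger.
  rewrite -ler_pdivrMr ?subr_gt0//; near: m; exact: nbhs_infty_ger.
by apply: filterS => m h; rewrite /box_bump big1.
Unshelve. all: by end_near. Qed.

Lemma measurable_box a b : measurable (box a b).
Proof.
rewrite (_ : box a b = \bigcap_(k in [set: 'I_n]) ((fun x : E => x ord0 k) @^-1` `]a ord0 k, b ord0 k[)).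
  apply: fin_bigcap_measurable; first exact: finite_finset.
  move=> k _; rewrite -[X in measurable X]setTI; apply: measurable_rV_coord => //.
apply/seteqP; split => x /= h k; first by move=> _; rewrite /= in_itv/=; exact: h.
by have := h k I; rewrite /= in_itv.
Qed.

Lemma boxI a b a' b' : box a b `&` box a' b' =
  box (\row_k Num.max (a ord0 k) (a' ord0 k)) (\row_k Num.min (b ord0 k) (b' ord0 k)).
Proof.
apply/seteqP; split => x /=.
  by move=> [h h'] k; rewrite !mxE gt_max lt_min; have /andP[-> ->] := h k; have /andP[-> ->] := h' k.
move=> h; split => k; have := h k; rewrite !mxE gt_max lt_min => /andP[/andP[h1 h2] /andP[h3 h4]].
  by rewrite h1.
by rewrite h2.
Qed.

Lemma setI_closed_box : setI_closed [set A : set E | exists a b, A = box a b].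
Proof. by move=> _ _ [a [b ->]] [a' [b' ->]]; rewrite boxI; eexists; eexists. Qed.

Lemma bigcup_box : \bigcup_(m : nat) box (const_mx (- m%:R)) (const_mx m%:R) = [set: E].
Proof.
apply/seteqP; split => // x _.
have : \forall m \near \oo, forall k, `|x ord0 k| < m%:R.
  by apply: filter_forall => k; exact: nbhs_infty_gtr.
move=> /filter_ex[m h]; exists m => // k; rewrite !mxE.
by rewrite -ltr_norml h.
Qed.

Lemma nondecreasing_box (m p : nat) : (m <= p)%N ->
  box (const_mx (- m%:R)) (const_mx m%:R) `<=` box (const_mx (- p%:R)) (const_mx p%:R).
Proof.
move=> mp x h k; have := h k; rewrite !mxE => /andP[h1 h2].
rewrite (le_lt_trans _ h1) ?lerN2 ?ler_nat//=.
by apply: lt_le_trans h2 _; rewrite ler_nat.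
Qed.

Lemma nbhs_ball_box x (e : R) : 0 < e -> ball x e = box (x - const_mx e) (x + const_mx e).
Proof.
move=> e0; apply/seteqP; split => y.
  move=> [_ h] k; have := h ord0 k; rewrite /ball/= !mxE ltr_distlC => /andP[h1 h2].
  by rewrite h1 h2.
move=> h; split => // i k; rewrite ord1; have := h k; rewrite !mxE /ball/= ltr_distlC; exact.
Qed.

(** Rational boxes make countable unions out of open sets. *)
Lemma open_box_rat (A : set E) (x : E) : open A -> A x ->
  exists p q : 'rV[rat]_n, box (map_mx ratr p) (map_mx ratr q) x /\
    [set y : E | forall k, (map_mx ratr p : E) ord0 k <= y ord0 k <= (map_mx ratr q : E) ord0 k] `<=` A.
Proof.
rewrite openE => oA Ax; have /nbhs_ballP[e /= e0 eA] := oA _ Ax.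
have hp k : exists p : rat, x ord0 k - e < ratr p < x ord0 k.
  by have /rat_in_itvoo[p] : x ord0 k - e < x ord0 k; [rewrite gtrDl oppr_lt0|rewrite in_itv/=; exists p].
have hq k : exists p : rat, x ord0 k < ratr p < x ord0 k + e.
  by have /rat_in_itvoo[p] : x ord0 k < x ord0 k + e; [rewrite ltrDl|rewrite in_itv/=; exists p].
have [p hp'] := choice hp; have [q hq'] := choice hq.
exists (\row_k p k), (\row_k q k); split.
  by move=> k; rewrite !mxE; have /andP[_ ->] := hp' k; have /andP[-> _] := hq' k.
move=> y h; apply: eA; rewrite nbhs_ball_box// => k; have := h k; rewrite !mxE => /andP[h1 h2].
have /andP[h3 _] := hp' k; have /andP[_ h4] := hq' k.
by rewrite (lt_le_trans h3 h1) (le_lt_trans h2 h4).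
Qed.

Lemma box_cbox a b : box a b `<=` [set y | forall k, a ord0 k <= y ord0 k <= b ord0 k].
Proof. by move=> y h k; have /andP[h1 h2] := h k; rewrite !ltW. Qed.

Lemma open_measurable_rV (A : set E) : open A -> measurable A.
Proof.
move=> oA.
have -> : A = \bigcup_(pq in [set: 'rV[rat]_n * 'rV[rat]_n])
    if `[< box (map_mx ratr pq.1) (map_mx ratr pq.2) `<=` A >] then
       box (map_mx ratr pq.1 : E) (map_mx ratr pq.2) else set0.
  apply/seteqP; split => [x Ax|x [[p q] _] /=]; last by case: asboolP => // h /h.
  have [p [q [h1 h2]]] := open_box_rat oA Ax.
  exists (p, q) => //=; case: asboolP => // h; exfalso; apply: h.
  by move=> y /box_cbox /h2.
apply: countable_bigcupT_measurable => [|pq]; first exact: countableP.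
by case: asboolP => // _; exact: measurable_box.
Qed.

Lemma continuous_measurable_rV f : continuous f -> measurable_fun setT f.
Proof.
move=> cf; apply: (@measurability _ _ E R setT f _ (measurable_realfun.RGenOpens.measurableE R)) => _ [_ [a [b ->]] <-].
rewrite setTI; apply: open_measurable_rV; apply: open_comp; last exact: interval_open.
by move=> x _; exact: cf.
Qed.

(** Open boxes form a pi-system, which is what the pi-lambda theorem needs. *)
Lemma measurable_rV_boxE : @measurable _ E = <<s [set A : set E | exists a b, A = box a b] >>.
Proof.
apply/seteqP; split; last first.
  apply: smallest_sub; first exact: sigma_algebra_measurable.
  by move=> _ [a [b ->]]; exact: measurable_box.
apply: smallest_sub; first exact: smallest_sigma_algebra.
move=> A; rewrite -bigcup_seq => -[i _ [B mB <-]].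
pose T := g_sigma_algebraType [set A : set E | exists a b, A = box a b].
suff : measurable_fun [set: T] (fun x : T => (x : E) ord0 i) by move=> /(_ measurableT _ mB).
apply: (@measurability _ _ T R setT _ _ (measurable_realfun.RGenOpens.measurableE R)) => _ [_ [a [b ->]] <-].
rewrite setTI.
have -> : (fun x : T => (x : E) ord0 i) @^-1` `]a, b[ =
   \bigcup_(m : nat) (box (\row_k if k == i then a else - m%:R) (\row_k if k == i then b else m%:R)).
  apply/seteqP; split => x /=.
    rewrite in_itv/= => xab; have : [set: E] x by [].
    rewrite -bigcup_box => -[m _ h]; exists m => // k; rewrite !mxE.
    by case: eqP => [->//|_]; have := h k; rewrite !mxE.
  by move=> [m _ h]; have := h i; rewrite !mxE eqxx in_itv.
apply: bigcupT_measurable => m; apply: sub_sigma_algebra.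
by eexists; eexists; reflexivity.
Qed.

End boxes.

(** * Integrable and square integrable functions *)

Lemma cvg_eq0 (R : realType) (u : nat -> R) (l : R) :
  u @ \oo --> l -> (forall n, u n = 0) -> l = 0.
Proof.
move=> ul u0; apply: (cvg_unique _ ul) => //.
by rewrite (_ : u = fun=> 0); [exact: cvg_cst|exact/funext].
Qed.

Lemma ler_norm_indic (R : realType) T (A : set T) (c : R) x : `|c * \1_A x| <= `|c|.
Proof.
by rewrite normrM indicE; case: (_ \in _); rewrite ?normr1 ?normr0 ?mulr1 ?mulr0.
Qed.

(** Stated for a measure variable, so that the filter structure of almost
    everywhere statements is found also for the Lebesgue measure. *)
Section ae.
Context d (X : measurableType d) (R : realType) (mu : {measure set X -> \bar R}).
Implicit Types P Q S : X -> Prop.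

Lemma aeS P Q : (forall x, P x -> Q x) ->
  (\forall x \ae mu, P x) -> \forall x \ae mu, Q x.
Proof. by move=> PQ; apply: filterS. Qed.

Lemma aeS2 P Q S : (forall x, P x -> Q x -> S x) ->
  (\forall x \ae mu, P x) -> (\forall x \ae mu, Q x) -> \forall x \ae mu, S x.
Proof. by move=> PQ; apply: filterS2. Qed.

End ae.

Section real_integration.
Context d (X : measurableType d) (R : realType).
Variable mu : {measure set X -> \bar R}.
Implicit Types f g h : X -> R.

Definition L1 f : Prop := mu.-integrable setT (EFin \o f).

Lemma L1_meas f : L1 f -> measurable_fun setT f.
Proof. by move=> /measurable_int/measurable_EFinP. Qed.

Lemma L1D f g : L1 f -> L1 g -> L1 (fun x => f x + g x).
Proof. by move=> lf lg; exact: (integrableD measurableT lf lg). Qed.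

Lemma L1Z (c : R) f : L1 f -> L1 (fun x => c * f x).
Proof. by move=> lf; exact: (integrableZl measurableT c lf). Qed.

Lemma L1N f : L1 f -> L1 (fun x => - f x).
Proof. by move=> lf; under eq_fun do rewrite -mulN1r; exact: L1Z. Qed.

Lemma L1B f g : L1 f -> L1 g -> L1 (fun x => f x - g x).
Proof. by move=> lf lg; exact: (L1D lf (L1N lg)). Qed.

Lemma L1_le f g : measurable_fun setT f -> (forall x, `|f x| <= g x) -> L1 g -> L1 f.
Proof.
move=> mf fg lg; apply: (le_integrable measurableT _ _ lg).
  exact/measurable_EFinP.
by move=> x _ /=; rewrite lee_fin (le_trans (fg x))// ler_norm.
Qed.

Lemma L1_norm f : L1 f -> L1 (fun x => `|f x|).
Proof. exact: integrable_norm. Qed.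

Lemma L1_ae f g : measurable_fun setT f -> (\forall x \ae mu, f x = g x) -> L1 g -> L1 f.
Proof.
move=> mf fg /integrableP[mg ig]; apply/integrableP; split; first exact/measurable_EFinP.
rewrite (ae_eq_integral (fun x => `|(g x)%:E|%E))//.
- by apply: measurableT_comp => //; exact/measurable_EFinP.
- exact: measurableT_comp.
- by apply: filterS fg => x /= -> _.
Qed.

Lemma L1_0 : L1 (fun=> 0).
Proof. exact: integrable0. Qed.

Lemma L1_sum (I : Type) (r : seq I) (F : I -> X -> R) :
  (forall i, L1 (F i)) -> L1 (fun x => \sum_(i <- r) F i x).
Proof.
move=> lF; elim: r => [|i r IH].
  by under eq_fun do rewrite big_nil; exact: L1_0.
by under eq_fun do rewrite big_cons; exact: L1D.
Qed.

Lemma intE f : L1 f -> (\int[mu]_x f x)%:E = (\int[mu]_x (f x)%:E)%E.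
Proof. by move=> lf; rewrite fineK//; exact: integrable_fin_num. Qed.

Lemma intD f g : L1 f -> L1 g ->
  \int[mu]_x (f x + g x) = \int[mu]_x f x + \int[mu]_x g x.
Proof. by move=> lf lg; rewrite RintegralD. Qed.

Lemma intB f g : L1 f -> L1 g ->
  \int[mu]_x (f x - g x) = \int[mu]_x f x - \int[mu]_x g x.
Proof. by move=> lf lg; rewrite RintegralB. Qed.

Lemma intZ (c : R) f : L1 f -> \int[mu]_x (c * f x) = c * \int[mu]_x f x.
Proof. by move=> lf; rewrite RintegralZl. Qed.

Lemma int0 : \int[mu]_x (0 : R) = 0.
Proof. by rewrite /Rintegral integral0. Qed.

Lemma int_sum (I : Type) (r : seq I) (F : I -> X -> R) : (forall i, L1 (F i)) ->
  \int[mu]_x (\sum_(i <- r) F i x) = \sum_(i <- r) \int[mu]_x F i x.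
Proof.
move=> lF; elim: r => [|i r IH].
  by rewrite big_nil; under eq_Rintegral do rewrite big_nil; exact: int0.
rewrite big_cons -IH -intD//; last exact: L1_sum.
by under eq_Rintegral do rewrite big_cons.
Qed.

Lemma int_ae f g : measurable_fun setT f -> measurable_fun setT g ->
  (\forall x \ae mu, f x = g x) -> \int[mu]_x f x = \int[mu]_x g x.
Proof.
move=> mf mg fg; congr fine; apply: ae_eq_integral => //.
- exact/measurable_EFinP.
- exact/measurable_EFinP.
- by apply: filterS fg => x /= -> _.
Qed.

Lemma int_le f g : L1 f -> L1 g -> (\forall x \ae mu, f x <= g x) ->
  \int[mu]_x f x <= \int[mu]_x g x.
Proof.
move=> lf lg fg; pose h x := Num.max (f x) (g x).
have mh : measurable_fun setT h by apply: measurable_maxr; exact: L1_meas.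
have hg : \forall x \ae mu, h x = g x.
  by apply: filterS fg => x fgx; rewrite /h; exact/max_idPr.
have lh : L1 h by exact: L1_ae hg lg.
rewrite -(int_ae mh (L1_meas lg) hg); apply: le_Rintegral => // x _.
by rewrite /h le_max lexx.
Qed.

Lemma int_ge0 f : (forall x, 0 <= f x) -> 0 <= \int[mu]_x f x.
Proof. by move=> f0; apply: Rintegral_ge0. Qed.

Lemma int_norm f : L1 f -> `|\int[mu]_x f x| <= \int[mu]_x `|f x|.
Proof. exact: le_normr_Rintegral. Qed.

Lemma int_eq0 f : L1 f -> (forall x, 0 <= f x) -> \int[mu]_x f x = 0 ->
  \forall x \ae mu, f x = 0.
Proof.
move=> lf f0 i0.
have : ae_eq mu setT (EFin \o f) (cst 0%E).
  apply/ae_eq_integral_abs => //; first exact: (measurable_int _ lf).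
  rewrite -[RHS]/(0%:E) -i0 intE//; apply: eq_integral => x _ /=.
  by rewrite ger0_norm.
by apply: filterS => x /(_ I) [].
Qed.

Lemma int_dominated_ae (fn : nat -> X -> R) f g : (forall n, measurable_fun setT (fn n)) ->
  measurable_fun setT f -> (\forall x \ae mu, fn n x @[n --> \oo] --> f x) ->
  (\forall x \ae mu, forall n, `|fn n x| <= g x) -> L1 g ->
  \int[mu]_x fn n x @[n --> \oo] --> \int[mu]_x f x.
Proof.
move=> mfn mf cf fg lg.
have mfn' n : measurable_fun setT ((EFin \o fn n) : X -> \bar R) by exact/measurable_EFinP.
have mf' : measurable_fun setT ((EFin \o f) : X -> \bar R) by exact/measurable_EFinP.
have cf' : {ae mu, forall x, setT x -> (EFin \o fn n) x @[n --> \oo] --> (EFin \o f) x}.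
  by apply: filterS cf => x cx _; apply: cvg_EFin => //; exact: nearW.
have fg' : {ae mu, forall x n, setT x -> (`|(EFin \o fn n) x| <= (EFin \o g) x)%E}.
  by apply: filterS fg => x fgx n _ /=; rewrite lee_fin.
have [l1 _] := dominated_convergence measurableT mfn' mf' cf' lg fg'.
move=> c; apply: fine_cvg; rewrite fineK; last exact: integrable_fin_num.
exact: c.
Qed.

Lemma int_dominated (fn : nat -> X -> R) f g : (forall n, measurable_fun setT (fn n)) ->
  measurable_fun setT f -> (\forall x \ae mu, fn n x @[n --> \oo] --> f x) ->
  (forall n x, `|fn n x| <= g x) -> L1 g ->
  \int[mu]_x fn n x @[n --> \oo] --> \int[mu]_x f x.
Proof.
by move=> mfn mf cf fg; apply: int_dominated_ae => //; apply: aeW => x n; exact: fg.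
Qed.

(** The pi-lambda theorem, for the sets on which the integral vanishes. *)
Lemma int_pisys_eq0 (G : set (set X)) f : measurable = <<s G>> -> setI_closed G ->
  L1 f -> \int[mu]_x f x = 0 ->
  (forall A, G A -> \int[mu]_x (f x * \1_A x) = 0) -> \forall x \ae mu, f x = 0.
Proof.
move=> mG GI lf f0 fG.
pose H := [set A : set X | measurable A /\ (\int[mu]_(x in A) (f x)%:E = 0)%E].
have fA (A : set X) : measurable A ->
   (\int[mu]_(x in A) (f x)%:E = \int[mu]_x (f x * \1_A x)%:E)%E.
  move=> mA; rewrite integral_mkcond; apply: eq_integral => x _.
  by rewrite patchE indicE; case: ifPn => _; rewrite ?mulr1// mulr0.
have lfA A : measurable A -> L1 (fun x => f x * \1_A x).
  move=> mA; apply: (L1_le _ _ (L1_norm lf)).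
    by apply: measurable_funM; [exact: L1_meas|exact: measurable_indic].
  by move=> x; exact: ler_norm_indic.
have dH : dynkin H.
  split.
  - by split => //; rewrite -intE// f0.
  - move=> A [mA A0]; split; first exact: measurableC.
    have := @integral_setU _ _ _ mu A (~` A) (EFin \o f) mA (measurableC mA).
    rewrite setUv => /(_ (measurable_int _ lf)).
    rewrite disj_set2E setICr eqxx => /(_ isT).
    by rewrite /= A0 add0e -intE// f0 => <-.
  - move=> F tF HF; split; first by apply: bigcupT_measurable => k; have [] := HF k.
    rewrite integral_bigcup//.
    + by rewrite eseries0// => i _ _; have [_ ->] := HF i.
    + by move=> k; have [] := HF k.
    + apply: integrableS lf => //; by apply: bigcupT_measurable => k; have [] := HF k.
have HE A : measurable A -> (\int[mu]_(x in A) (f x)%:E = 0)%E.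
  move=> mA; suff [] : H A by [].
  have : <<d G>> A by rewrite setI_closed_g_dynkin_g_sigma_algebra// -mG.
  apply; split => // B GB; have mB : measurable B by rewrite mG; exact: sub_sigma_algebra.
  by split => //; rewrite fA// -intE ?fG//; exact: lfA.
have : ae_eq mu setT (EFin \o f) (cst 0%E).
  apply: integral_ae_eq => // E _ mE; rewrite HE// integral0//.
by apply: filterS => x /(_ I) [].
Qed.

Definition L2 f : Prop := measurable_fun setT f /\ L1 (fun x => f x ^+ 2).

Lemma L2M f g : L2 f -> L2 g -> L1 (fun x => f x * g x).
Proof.
move=> [mf lf] [mg lg]; apply: (L1_le _ _ (L1D lf lg)); first exact: measurable_funM.
move=> x; rewrite normrM.
have := sqr_ge0 (`|f x| - `|g x|); have := sqr_ge0 (f x); have := sqr_ge0 (g x).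
rewrite -!(real_normK (num_real (f x))) -!(real_normK (num_real (g x))); nra.
Qed.

Lemma L2D f g : L2 f -> L2 g -> L2 (fun x => f x + g x).
Proof.
move=> [mf lf] [mg lg]; split; first exact: measurable_funD.
apply: (L1_le _ _ (L1Z 2 (L1D lf lg))).
  by apply: measurable_funX; exact: measurable_funD.
by move=> x; rewrite ger0_norm ?sqr_ge0//; have := sqr_ge0 (f x - g x); nra.
Qed.

Lemma L2Z (c : R) f : L2 f -> L2 (fun x => c * f x).
Proof.
move=> [mf lf]; split; first exact: measurable_funM.
by under eq_fun do rewrite exprMn; exact: L1Z.
Qed.

Lemma L2N f : L2 f -> L2 (fun x => - f x).
Proof. by move=> lf; under eq_fun do rewrite -mulN1r; exact: L2Z. Qed.

Lemma L2B f g : L2 f -> L2 g -> L2 (fun x => f x - g x).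
Proof. by move=> lf lg; exact: (L2D lf (L2N lg)). Qed.

Lemma L2_0 : L2 (fun=> 0).
Proof. by split => //; under eq_fun do rewrite expr0n/=; exact: L1_0. Qed.

Lemma L2_sum (I : Type) (r : seq I) (F : I -> X -> R) :
  (forall i, L2 (F i)) -> L2 (fun x => \sum_(i <- r) F i x).
Proof.
move=> lF; elim: r => [|i r IH].
  by under eq_fun do rewrite big_nil; exact: L2_0.
by under eq_fun do rewrite big_cons; exact: L2D.
Qed.

Lemma L2_bounded (c : R) f g : measurable_fun setT g -> (forall x, `|g x| <= c) -> L2 f ->
  L2 (fun x => g x * f x).
Proof.
move=> mg gc [mf lf]; split; first exact: measurable_funM.
apply: (L1_le _ _ (L1Z (c ^+ 2) lf)).
  by apply: measurable_funX; exact: measurable_funM.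
move=> x; rewrite ger0_norm ?sqr_ge0// exprMn ler_wpM2r ?sqr_ge0//.
by rewrite -(real_normK (num_real (g x))) lerXn2r ?nnegrE// (le_trans _ (gc x)).
Qed.

Lemma L2_ae f g : measurable_fun setT f -> (\forall x \ae mu, f x = g x) -> L2 g -> L2 f.
Proof.
move=> mf fg [mg lg]; split => //; apply: L1_ae lg; first exact: measurable_funX.
by apply: filterS fg => x ->.
Qed.

End real_integration.

Section ext.
Context d (X : measurableType d) (R : realType).
Implicit Types (D : set X) (u : X -> R).

Definition ext D u : X -> R := fun x => u x * \1_D x.

Lemma extE D u : u \_ D = ext D u.
Proof.
by apply/funext => x; rewrite patchE /ext indicE; case: ifPn => _; rewrite ?mulr1 ?mulr0.
Qed.

Lemma ext_in D u x : D x -> ext D u x = u x.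
Proof. by move=> Dx; rewrite /ext indicE mem_set// mulr1. Qed.

Lemma ext_out D u x : ~ D x -> ext D u x = 0.
Proof. by move=> Dx; rewrite /ext indicE memNset// mulr0. Qed.

Lemma int_ext (mu : {measure set X -> \bar R}) D u :
  \int[mu]_(x in D) u x = \int[mu]_x ext D u x.
Proof. by rewrite Rintegral_mkcond extE. Qed.

Lemma measurable_ext D u : measurable D -> measurable_fun D u -> measurable_fun setT (ext D u).
Proof.
by move=> mD mu; rewrite -extE; apply/(measurable_restrictT _ _).1.
Qed.

End ext.

Section fundamental_lemma.
Context {R : realType}.

Lemma measurable_box_bump n (a b : 'rV[R]_n) m : measurable_fun setT (box_bump a b m).
Proof. by apply: continuous_measurable_rV; apply: smooth_continuous; exact: smooth_box_bump. Qed.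

Lemma box_fundamental n (f : 'rV[R]_n -> R) : L1 (leb n) f ->
  (forall a b m, \int[leb n]_x (f x * box_bump a b m x) = 0) ->
  \forall x \ae leb n, f x = 0.
Proof.
move=> lf H.
have box0 a b : \int[leb n]_x (f x * \1_(box a b) x) = 0.
  have h : \int[leb n]_x (f x * box_bump a b m x) @[m --> \oo] --> \int[leb n]_x (f x * \1_(box a b) x).
    apply: (@int_dominated _ _ _ _ _ _ (fun x => `|f x|)).
    - by move=> m; apply: measurable_funM; [exact: L1_meas lf|exact: measurable_box_bump].
    - apply: measurable_funM; [exact: L1_meas lf|apply: measurable_indic; exact: measurable_box].
    - by apply: aeW => x; apply: cvgM; [exact: cvg_cst|exact: box_bump_cvg].
    - move=> m x; rewrite normrM ler_piMr// ger0_norm ?box_bump_ge0//.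
      exact: box_bump_le1.
    - exact: L1_norm.
  by apply: (cvg_eq0 h) => m; exact: H.
apply: (int_pisys_eq0 measurable_rV_boxE setI_closed_box lf); last first.
  by move=> _ [a [b ->]].
have h : \int[leb n]_x (f x * \1_(box (const_mx (- m%:R)) (const_mx m%:R)) x) @[m --> \oo]
    --> \int[leb n]_x f x.
  apply: (@int_dominated _ _ _ _ _ _ (fun x => `|f x|)).
  - move=> m; apply: measurable_funM; [exact: L1_meas lf|apply: measurable_indic; exact: measurable_box].
  - exact: L1_meas lf.
  - apply: aeW => x; have : [set: 'rV[R]_n] x by [].
    rewrite -bigcup_box => -[m _ xm]; apply: cvg_near_cst; near=> p.
    rewrite indicE mem_set ?mulr1//; apply: nondecreasing_box xm.
    by near: p; exact: nbhs_infty_ge.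
  - by move=> m x; exact: ler_norm_indic.
  - exact: L1_norm.
by apply: (cvg_eq0 h) => m; exact: box0.
Unshelve. all: by end_near. Qed.

Lemma test_funM n (A : set 'rV[R]_n) (f g : 'rV[R]_n -> R) : test_fun A f -> smooth g ->
  test_fun A (fun x => f x * g x).
Proof.
move=> [sf cf fA] sg.
have sub : closure [set x | f x * g x != 0] `<=` closure [set x | f x != 0].
  by apply: closure_subset => x /=; apply: contraNN => /eqP ->; rewrite mul0r.
split; first exact: smoothM.
  exact: (subclosed_compact (@closed_closure _ _) cf sub).
exact: subset_trans fA.
Qed.

(** On every rational box inside the open set, the function times a bump of the
    box is still orthogonal to all bumps, hence the function vanishes almost
    everywhere there; countably many such boxes cover the open set. *)
Lemma test_fun_fundamental N (Om : set 'rV[R]_N) (f : 'rV[R]_N -> R) : (0 < N)%N ->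
  open Om -> L1 (leb N) (ext Om f) ->
  (forall psi, test_fun Om psi -> \int[leb N]_(x in Om) (f x * psi x) = 0) ->
  ae_Om Om (fun x => f x = 0).
Proof.
move=> N0 oOm lf H.
pose B (pq : 'rV[rat]_N * 'rV[rat]_N) := box (map_mx ratr pq.1 : 'rV[R]_N) (map_mx ratr pq.2).
have B0 pq : B pq `<=` Om -> \forall x \ae leb N, ext Om f x * \1_(B pq) x = 0.
  move=> BOm; have mB : measurable (B pq) by exact: measurable_box.
  have lfB : L1 (leb N) (fun x => ext Om f x * \1_(B pq) x).
    apply: (L1_le _ _ (L1_norm lf)).
      by apply: measurable_funM; [exact: L1_meas lf|exact: measurable_indic].
    by move=> x; exact: ler_norm_indic.
  apply: box_fundamental => // a b m.
  pose g k x := ext Om f x * (box_bump (map_mx ratr pq.1) (map_mx ratr pq.2) k x * box_bump a b m x).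
  have h : \int[leb N]_x g k x @[k --> \oo] --> \int[leb N]_x (ext Om f x * \1_(B pq) x * box_bump a b m x).
    apply: (@int_dominated _ _ _ _ _ _ (fun x => `|ext Om f x|)).
    - move=> k; apply: measurable_funM; first exact: L1_meas lf.
      by apply: measurable_funM; exact: measurable_box_bump.
    - apply: measurable_funM; first exact: L1_meas lfB.
      exact: measurable_box_bump.
    - apply: aeW => x; rewrite /g -mulrA; apply: cvgM; first exact: cvg_cst.
      by apply: cvgM; [exact: box_bump_cvg|exact: cvg_cst].
    - move=> k x; rewrite normrM ler_piMr// ger0_norm ?mulr_ge0 ?box_bump_ge0//.
      by rewrite mulr_ile1 ?box_bump_ge0 ?box_bump_le1.
    - exact: L1_norm.
  have g0 k : \int[leb N]_x g k x = 0.
    have tf := test_funM (test_fun_box_bump k N0 BOm) (@smooth_box_bump _ _ a b m).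
    have := H _ tf; rewrite int_ext => <-; apply: eq_Rintegral => x _.
    by rewrite /g /ext; ring.
  exact: (cvg_eq0 h g0).
pose G k x := if unpickle k is Some pq then B pq `<=` Om -> ext Om f x * \1_(B pq) x = 0 else True.
have : \forall x \ae leb N, forall k, G k x.
  apply: ae_foralln => k; rewrite /G; case: unpickle => [pq|]; last exact: aeW.
  have [/B0|nB] := pselect (B pq `<=` Om); first by apply: filterS.
  by apply: aeW => x /nB.
apply: filterS => x Gx Omx.
have [p [q [h1 h2]]] := open_box_rat oOm Omx.
have := Gx (pickle (p, q)); rewrite /G pickleK => /(_ _).
rewrite ext_in// indicE mem_set// mulr1; apply => y /box_cbox; exact: h2.
Qed.

End fundamental_lemma.

(** * Fubini's theorem for real functions *)

Section real_fubini.
Context d1 d2 (T1 : measurableType d1) (T2 : measurableType d2) (R : realType).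
Variable m1 : {sigma_finite_measure set T1 -> \bar R}.
Variable m2 : {sigma_finite_measure set T2 -> \bar R}.
Implicit Types F : T1 -> T2 -> R.
Local Notation mm := (m1 \x m2)%E.
Local Notation unc F := (fun z => F z.1 z.2).

Lemma measurable_curry1 F (y : T1) : measurable_fun setT (unc F) -> measurable_fun setT (F y).
Proof. by move=> mF; exact: (measurableT_comp mF (measurable_pair1 y)). Qed.

Lemma measurable_curry2 F (x : T2) : measurable_fun setT (unc F) ->
  measurable_fun setT (fun y => F y x).
Proof. by move=> mF; exact: (measurableT_comp mF (measurable_pair2 x)). Qed.

Lemma measurable_int_param F : measurable_fun setT (unc F) ->
  measurable_fun setT (fun y => \int[m2]_x F y x).
Proof.
move=> mF; apply: measurableT_comp; first exact: (fine_measurable measurableT).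
have mE : measurable_fun setT (EFin \o (unc F)) by exact/measurable_EFinP.
rewrite (_ : (fun y => _) = (fun y => \int[m2]_x ((EFin \o (unc F))^\+ (y, x)) - \int[m2]_x ((EFin \o (unc F))^\- (y, x)))%E); last first.
  apply/funext => y; rewrite [LHS]integralE.
  by congr (_ - _)%E; apply: eq_integral => x _; rewrite ?funeposE ?funenegE.
apply: emeasurable_funB.
  by apply: (measurable_fun_fubini_tonelli_F (m2 := m2)) => //; exact: measurable_funepos.
by apply: (measurable_fun_fubini_tonelli_F (m2 := m2)) => //; exact: measurable_funeneg.
Qed.

Lemma fub_ae1 F : L1 mm (unc F) -> \forall y \ae m1, L1 m2 (F y).
Proof. exact: ae_integrable1. Qed.

Lemma fub_ae2 F : L1 mm (unc F) -> \forall x \ae m2, L1 m1 (fun y => F y x).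
Proof. exact: ae_integrable2. Qed.

Lemma fub_L1_1 F : L1 mm (unc F) -> L1 m1 (fun y => \int[m2]_x F y x).
Proof.
move=> lF; have := integrable_fubini_F lF; apply: le_integrable => //.
  by apply/measurable_EFinP; apply: measurable_int_param; exact: L1_meas lF.
move=> y _ /=; rewrite /Rintegral /fubini_F /=.
by case: (\int[m2]_ _ _)%E => [r| |]//=; rewrite normr0 leey.
Qed.

Lemma fub1 F : L1 mm (unc F) -> \int[mm]_z F z.1 z.2 = \int[m1]_y \int[m2]_x F y x.
Proof.
move=> lF; rewrite {1}/Rintegral -(integral12_prod_meas1 lF); congr fine.
apply: ae_eq_integral => //.
- exact: (measurable_int _ (integrable_fubini_F lF)).
- by have /measurable_int := fub_L1_1 lF.
- by apply: filterS (fub_ae1 lF) => y ly _; rewrite intE.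
Qed.

Lemma fub_ae (P : T1 -> T2 -> Prop) : (\forall z \ae mm, P z.1 z.2) ->
  \forall y \ae m1, \forall x \ae m2, P y x.
Proof.
move=> [N [mN N0 PN]].
have : \forall y \ae m1, m2 (xsection N y) = 0%E.
  have : ae_eq m1 setT (fun y => m2 (xsection N y)) (cst 0%E).
    apply/ae_eq_integral_abs => //; first exact: measurable_fun_xsection.
    rewrite -[RHS]N0; apply: eq_integral => y _.
    by rewrite gee0_abs.
  by apply: filterS => y; exact.
apply: filterS => y Ny; exists (xsection N y); split => //; first exact: measurable_xsection.
move=> x /= nP; rewrite /xsection/= inE; exact: PN.
Qed.

Lemma fub_L1I F : measurable_fun setT (unc F) -> (\forall y \ae m1, L1 m2 (F y)) ->
  L1 m1 (fun y => \int[m2]_x `|F y x|) -> L1 mm (unc F).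
Proof.
move=> mF ae1 l1; apply/(integrable12ltyP _ _ _).2; first exact/measurable_EFinP.
have := integrable_lty measurableT l1; rewrite (ae_eq_integral (fun y => \int[m2]_x `|(F y x)%:E|)%E)//.
- by have /measurable_int := l1.
- apply: (@measurable_fun_fubini_tonelli_F _ _ _ _ _ m2 (fun z => `|(F z.1 z.2)%:E|%E)) => //.
  by apply: measurableT_comp => //; exact/measurable_EFinP.
- by apply: filterS ae1 => y ly _; rewrite /= intE //; exact: L1_norm.
Qed.

End real_fubini.

Section real_fubini_sym.
Context d1 d2 (T1 : measurableType d1) (T2 : measurableType d2) (R : realType).
Variable m1 : {sigma_finite_measure set T1 -> \bar R}.
Variable m2 : {sigma_finite_measure set T2 -> \bar R}.
Implicit Types F : T1 -> T2 -> R.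
Local Notation mm := (m1 \x m2)%E.
Local Notation unc F := (fun z => F z.1 z.2).

Lemma measurable_int_param2 F : measurable_fun setT (unc F) ->
  measurable_fun setT (fun x => \int[m1]_y F y x).
Proof.
move=> mF.
have := @measurable_int_param _ _ T2 T1 R m1 (fun x y => F y x).
by apply; exact: (measurableT_comp mF (@measurable_swap _ _ _ _)).
Qed.

Lemma L1_swap F : L1 mm (unc F) -> L1 (m2 \x m1)%E (unc (fun x y => F y x)).
Proof.
move=> lF; have mF := L1_meas lF.
apply/(integrable12ltyP _ _ _).2.
  apply/measurable_EFinP; exact: (measurableT_comp mF (@measurable_swap _ _ _ _)).
have := (@integrable21ltyP _ _ _ _ _ m1 m2 (EFin \o unc F) (measurable_int _ lF)).1 lF.
by [].
Qed.

Lemma fub_L1_2 F : L1 mm (unc F) -> L1 m2 (fun x => \int[m1]_y F y x).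
Proof. by move=> /L1_swap /fub_L1_1. Qed.

Lemma fub2 F : L1 mm (unc F) -> \int[mm]_z F z.1 z.2 = \int[m2]_x \int[m1]_y F y x.
Proof.
move=> lF; rewrite {1}/Rintegral -(integral21_prod_meas1 lF); congr fine.
apply: ae_eq_integral => //.
- exact: (measurable_int _ (integrable_fubini_F (L1_swap lF))).
- by have /measurable_int := fub_L1_2 lF.
- by apply: filterS (fub_ae2 lF) => y ly _; rewrite intE.
Qed.

Lemma L1_prod (f : T1 -> R) (g : T2 -> R) : L1 m1 f -> L1 m2 g ->
  L1 mm (fun z => f z.1 * g z.2).
Proof.
move=> lf lg; apply: (@fub_L1I _ _ _ _ _ m1 m2 (fun y x => f y * g x)).
- apply: measurable_funM.
    by apply: measurableT_comp measurable_fst; exact: L1_meas lf.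
  by apply: measurableT_comp measurable_snd; exact: L1_meas lg.
- by apply: aeW => y; exact: L1Z.
- under eq_fun do under eq_Rintegral do rewrite normrM.
  under eq_fun do rewrite (intZ _ (L1_norm lg)) mulrC.
  by apply: L1Z; exact: L1_norm.
Qed.

End real_fubini_sym.

(** * Primitives of integrable functions *)

Lemma indic_bool (R : realType) T (A : set T) (x : T) (b : bool) :
  (A x <-> b) -> \1_A x = b%:R :> R.
Proof.
move=> Ab; rewrite indicE; congr (_%:R); congr nat_of_bool.
by apply/idP/idP; rewrite inE => /Ab.
Qed.

Lemma indic_itv (R : realType) (i : interval R) (x : R) : \1_[set` i] x = (x \in i)%:R :> R.
Proof. exact: indic_bool. Qed.

Lemma L1_eq d (X : measurableType d) (R : realType) (m : {measure set X -> \bar R}) (f g : X -> R) :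
  (forall x, f x = g x) -> L1 m g -> L1 m f.
Proof. by move=> fg; rewrite (_ : f = g)//; exact/funext. Qed.

Section primitives.
Context {R : realType}.
Local Notation mu := (@lebesgue_measure R).
Implicit Types p q f : R -> R.

Lemma primE p t : prim p t = \int[mu]_s (p s * \1_(`]-oo, t]%classic) s).
Proof. by rewrite /prim int_ext. Qed.

Lemma L1_indic d (X : measurableType d) (m : {measure set X -> \bar R}) (A : set X) (f : X -> R) :
  measurable A -> L1 m f -> L1 m (fun x => f x * \1_A x).
Proof.
move=> mA lf; apply: (L1_le _ _ (L1_norm lf)); last by move=> x; exact: ler_norm_indic.
by apply: measurable_funM; [exact: L1_meas lf|exact: measurable_indic].
Qed.

Lemma measurable_le_graph : measurable [set z : measurableTypeR R * measurableTypeR R | z.2 <= z.1].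
Proof.
rewrite (_ : mkset _ = (fun z : measurableTypeR R * measurableTypeR R => (z.1 - z.2 : R)) @^-1` `[0, +oo[).
  rewrite -[X in measurable X]setTI; apply: measurable_funB => //.
by apply/seteqP; split => z /=; rewrite in_itv/= andbT subr_ge0.
Qed.

Lemma prim_le_norm p t : L1 mu p -> `|prim p t| <= \int[mu]_s `|p s|.
Proof.
move=> lp; rewrite primE; apply: le_trans (int_norm _) _; first exact: L1_indic.
apply: int_le; [exact/L1_norm/L1_indic|exact: L1_norm|].
by apply: aeW => x; exact: ler_norm_indic.
Qed.

(** Integration by parts for two absolutely continuous functions, by Fubini
    on the two triangles of the square. *)
Lemma prim_parts p q : L1 mu p -> L1 mu q ->
  \int[mu]_s (p s * prim q s) + \int[mu]_s (q s * prim p s) =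
  (\int[mu]_s p s) * (\int[mu]_s q s).
Proof.
move=> lp lq.
pose D := [set z : measurableTypeR R * measurableTypeR R | z.2 <= z.1].
have lpq := L1_prod lp lq.
have mD := measurable_le_graph.
have lA : L1 (mu \x mu)%E (fun z => p z.1 * q z.2 * \1_D z) by exact: L1_indic.
have lB : L1 (mu \x mu)%E (fun z => p z.1 * q z.2 * \1_(~` D) z).
  by apply: L1_indic => //; exact: measurableC.
have E1 : \int[mu]_s (p s * prim q s) = \int[(mu \x mu)%E]_z (p z.1 * q z.2 * \1_D z).
  rewrite (@fub1 _ _ _ _ _ mu mu (fun s r => p s * q r * \1_D (s, r))); last first.
    by apply: (L1_eq _ lA) => -[].
  apply: eq_Rintegral => s _; rewrite primE -intZ; last exact: L1_indic.
  apply: eq_Rintegral => r _; rewrite mulrA; congr (_ * _).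
have E2 : \int[mu]_s (q s * prim p s) = \int[(mu \x mu)%E]_z (p z.1 * q z.2 * \1_(~` D) z).
  rewrite (@fub2 _ _ _ _ _ mu mu (fun s r => p s * q r * \1_(~` D) (s, r))); last first.
    by apply: (L1_eq _ lB) => -[].
  apply: eq_Rintegral => r _.
  have -> : prim p r = \int[mu]_(s in `]-oo, r[) p s.
    rewrite /prim -Rintegral_itv_bndo_bndc//.
    by apply: integrableS lp.
  rewrite int_ext -intZ; last by exact: L1_indic.
  apply: eq_Rintegral => s _; rewrite mulrCA mulrA; congr (_ * _).
  rewrite indic_itv in_itv/= (@indic_bool _ _ (~` D) (s, r) (s < r))//= ltNge.
  by split => [/negP|/negP].
rewrite E1 E2 -intD//.
have := @fub1 _ _ _ _ _ mu mu (fun s r => p s * q r) lpq.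
under [X in _ = X -> _]eq_Rintegral do rewrite (intZ _ lq) mulrC.
rewrite (intZ _ lp) mulrC => <-.
apply: eq_Rintegral => z _; rewrite -mulrDr !indicE in_setC.
by case: (z \in D); rewrite ?addr0 ?add0r mulr1.
Qed.

Lemma prim_indic p t s : prim (fun r => p r * \1_(`]-oo, t]%classic) r) s = prim p (Num.min s t).
Proof.
rewrite !primE; apply: eq_Rintegral => r _; rewrite -mulrA; congr (_ * _).
rewrite !indic_itv !in_itv/= le_min; case: (r <= s); case: (r <= t); by rewrite /= ?mulr1 ?mulr0.
Qed.

Lemma prim_prod p q t : L1 mu p -> L1 mu q ->
  prim p t * prim q t =
  \int[mu]_(s in `]-oo, t]) (p s * prim q s) + \int[mu]_(s in `]-oo, t]) (q s * prim p s).
Proof.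
move=> lp lq; pose A := (`]-oo, t]%classic : set (measurableTypeR R)).
have mA : measurable A by exact: measurable_itv.
have := prim_parts (L1_indic mA lp) (L1_indic mA lq).
move=> h; transitivity (\int[mu]_s (p s * \1_A s) * \int[mu]_s (q s * \1_A s)).
  by rewrite !primE.
rewrite -h !(@int_ext _ _ _ mu A); congr (_ + _); apply: eq_Rintegral => s _;
  rewrite prim_indic /ext /A indic_itv in_itv/=.
- by case: leP => st; rewrite ?mulr0 ?mul0r ?mulr1.
- by case: leP => st; rewrite ?mulr0 ?mul0r ?mulr1.
Qed.

Lemma setI_closed_itvoo : setI_closed [set A : set R | exists a b, A = `]a, b[%classic].
Proof.
move=> _ _ [a [b ->]] [c [e ->]]; exists (Num.max a c), (Num.min b e).
apply/seteqP; split => x /=; rewrite !in_itv/= gt_max lt_min.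
  by move=> [/andP[-> ->] /andP[-> ->]].
by move=> /andP[/andP[-> ->] /andP[-> ->]].
Qed.

Lemma itv_fundamental f : L1 mu f ->
  (forall a b, \int[mu]_t (f t * \1_(`]a, b[%classic) t) = 0) -> \forall t \ae mu, f t = 0.
Proof.
move=> lf H; apply: (@int_pisys_eq0 _ (measurableTypeR R) R mu [set A : set R | exists a b, A = `]a, b[%classic]) => //.
- exact: measurable_realfun.RGenOpens.measurableE.
- exact: setI_closed_itvoo.
- have h : \int[mu]_x (f x * \1_(`](- m%:R), m%:R[%classic) x) @[m --> \oo]
    --> \int[mu]_x f x.
    apply: (@int_dominated _ (measurableTypeR R) R mu
      (fun m x => f x * \1_(`](- m%:R), m%:R[%classic : set (measurableTypeR R)) x) f (fun x => `|f x|)).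
    - by move=> m; apply: measurable_funM; [exact: L1_meas lf|exact: measurable_indic].
    - exact: L1_meas lf.
    - apply: aeW => x; apply: cvg_near_cst; near=> p.
      rewrite indic_itv in_itv/= -ltr_norml.
      suff -> : `|x| < p%:R by rewrite mulr1.
      by near: p; exact: nbhs_infty_gtr.
    - by move=> m x; exact: ler_norm_indic.
    - exact: L1_norm.
  by apply: (cvg_eq0 h) => m; exact: H.
- by move=> _ [a [b ->]].
Unshelve. all: by end_near. Qed.

Lemma int_itv_bump_gt0 (a b : R) : a < b -> exists m, 0 < \int[mu]_t itv_bump a b m t.
Proof.
move=> ab.
have lb m : L1 mu (itv_bump a b m).
  apply: (@integrable_compact_support _ _ a b); first exact/continuous_smooth1/smooth1_itv_bump.
  by move=> t; apply: contraNeq => /itv_bump_in.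
have h : \int[mu]_t itv_bump a b m t @[m --> \oo] --> \int[mu]_t (\1_(`]a, b[%classic : set (measurableTypeR R)) t : R).
  apply: (@int_dominated _ (measurableTypeR R) R mu (fun m t => itv_bump a b m t) _
    (\1_(`[a, b]%classic : set (measurableTypeR R)))).
  - by move=> m; exact: L1_meas (lb m).
  - exact: measurable_indic.
  - by apply: aeW => t; exact: itv_bump_cvg.
  - move=> m t; rewrite ger0_norm ?itv_bump_ge0// indic_itv in_itv/=.
    have [->|/itv_bump_in/andP[h1 h2]] := eqVneq (itv_bump a b m t) 0; first by rewrite ler0n.
    by rewrite (ltW h1) (ltW h2) itv_bump_le1.
  - apply: integrable_indic_itv.
have pos : 0 < \int[mu]_t (\1_(`]a, b[%classic : set (measurableTypeR R)) t : R).
  rewrite /Rintegral.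
  have -> : (\int[mu]_t (\1_(`]a, b[%classic : set (measurableTypeR R)) t : R)%:E)%E = mu `]a, b[%classic.
    by rewrite integral_indic// setIT.
  rewrite lebesgue_measure_itv/= lte_fin ab/=.
  by rewrite subr_gt0.
have /filter_ex[m hm] : \forall m \near \oo, 0 < \int[mu]_t itv_bump a b m t by exact: cvgr_gt h _ pos.
by exists m.
Qed.

End primitives.

Lemma natrM_bool (R : realType) (a b : bool) : (a && b)%:R = a%:R * b%:R :> R.
Proof. by case: a; rewrite ?mul1r ?mul0r. Qed.

Section rectangles.
Context d (X : measurableType d) (R : realType).
Variable m2 : {sigma_finite_measure set X -> \bar R}.
Local Notation mu := (@lebesgue_measure R).
Local Notation mm := (mu \x m2)%E.
Local Notation unc F := (fun z : measurableTypeR R * X => F z.1 z.2).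

Lemma setI_closed_rect : setI_closed
  [set A `*` B | A in @measurable _ (measurableTypeR R) & B in @measurable _ X].
Proof.
move=> _ _ [A mA [B mB <-]] [A' mA' [B' mB' <-]].
exists (A `&` A'); first exact: measurableI.
exists (B `&` B'); first exact: measurableI.
by rewrite setXI.
Qed.

(** The indicators of rectangles suffice, by the pi-lambda theorem, and in time
    the indicator of an interval is a limit of bumps. *)
Lemma time_fundamental (g : R -> X -> R) (a b : R) : L1 mm (unc g) ->
  (forall t x, ~~ (a < t < b) -> g t x = 0) ->
  (forall c e m, a <= c -> e <= b ->
    \forall x \ae m2, \int[mu]_t (g t x * itv_bump c e m t) = 0) ->
  \forall z \ae mm, g z.1 z.2 = 0.
Proof.
move=> lg g0 H.
have H1 c e : a <= c -> e <= b ->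
    \forall x \ae m2, \int[mu]_t (g t x * \1_(`]c, e[%classic : set (measurableTypeR R)) t) = 0.
  move=> ac eb; apply: filterS2 (fub_ae2 lg) (ae_foralln (fun m => H c e m ac eb)) => x lx hx.
  have h : \int[mu]_t (g t x * itv_bump c e m t) @[m --> \oo] -->
      \int[mu]_t (g t x * \1_(`]c, e[%classic : set (measurableTypeR R)) t).
    apply: (@int_dominated _ (measurableTypeR R) R mu (fun m t => g t x * itv_bump c e m t) _ (fun t => `|g t x|)).
    - move=> m; apply: measurable_funM; first exact: L1_meas lx.
      apply: continuous_measurable_fun; exact/continuous_smooth1/smooth1_itv_bump.
    - by apply: measurable_funM; [exact: L1_meas lx|exact: measurable_indic].
    - by apply: aeW => t; apply: cvgM; [exact: cvg_cst|exact: itv_bump_cvg].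
    - by move=> m t; rewrite normrM ler_piMr// ger0_norm ?itv_bump_ge0 ?itv_bump_le1.
    - exact: L1_norm.
  by apply: (cvg_eq0 h) => m; exact: hx.
have H2 c e : \forall x \ae m2, \int[mu]_t (g t x * \1_(`]c, e[%classic : set (measurableTypeR R)) t) = 0.
  have := H1 (Num.max a c) (Num.min b e); rewrite le_max lexx ge_min lexx => /(_ isT isT).
  apply: filterS => x <-; apply: eq_Rintegral => t _; rewrite !indic_itv !in_itv/= gt_max lt_min.
  have [/andP[-> ->]//|/(g0 _ x) ->] := boolP (a < t < b).
  by rewrite !mul0r.
have rectE (A : set (measurableTypeR R)) (B : set X) : measurable A -> measurable B ->
    [/\ L1 mm (fun z : measurableTypeR R * X => g z.1 z.2 * \1_(A `*` B) z),
      \int[mm]_z (g z.1 z.2 * \1_(A `*` B) z) = \int[mu]_t (\1_A t * \int[m2]_x (g t x * \1_B x)) &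
      \int[mm]_z (g z.1 z.2 * \1_(A `*` B) z) = \int[m2]_x (\1_B x * \int[mu]_t (g t x * \1_A t))].
  move=> mA mB.
  have E0 z : g z.1 z.2 * \1_(A `*` B) z = g z.1 z.2 * \1_A z.1 * \1_B z.2.
    by rewrite -mulrA; congr (_ * _); rewrite !indicE in_setX natrM_bool.
  have l1 : L1 mm (fun z : measurableTypeR R * X => g z.1 z.2 * \1_(A `*` B) z).
    by apply: L1_indic => //; exact: measurableX.
  have l2 : L1 mm (fun z : measurableTypeR R * X => g z.1 z.2 * \1_A z.1 * \1_B z.2).
    by apply: (L1_eq _ l1) => z; rewrite E0.
  split => //; under eq_Rintegral do rewrite E0.
    rewrite (@fub1 _ _ _ _ _ mu m2 (fun t x => g t x * \1_A t * \1_B x))//.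
    apply: int_ae.
    - apply: (@measurable_int_param _ _ _ _ _ m2 (fun t x => g t x * \1_A t * \1_B x)).
      exact: (L1_meas l2).
    - apply: measurable_funM; first exact: measurable_indic.
      apply: (@measurable_int_param _ _ _ _ _ m2 (fun t x => g t x * \1_B x)).
      apply: measurable_funM; first exact: L1_meas lg.
      by apply: measurableT_comp measurable_snd; exact: measurable_indic.
    - apply: filterS (fub_ae1 lg) => t lt; rewrite -intZ; last exact: L1_indic.
      by apply: eq_Rintegral => x _; ring.
  rewrite (@fub2 _ _ _ _ _ mu m2 (fun t x => g t x * \1_A t * \1_B x))//.
  apply: int_ae.
  - apply: (@measurable_int_param2 _ _ _ _ _ mu (fun t x => g t x * \1_A t * \1_B x)).
    exact: (L1_meas l2).
  - apply: measurable_funM; first exact: measurable_indic.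
    apply: (@measurable_int_param2 _ _ _ _ _ mu (fun t x => g t x * \1_A t)).
    apply: measurable_funM; first exact: L1_meas lg.
    by apply: measurableT_comp measurable_fst; exact: measurable_indic.
  - apply: filterS (fub_ae2 lg) => x lx; rewrite -intZ; last exact: L1_indic.
    by apply: eq_Rintegral => t _; ring.
have rect (A : set (measurableTypeR R)) (B : set X) : measurable A -> measurable B ->
    \int[mm]_z (g z.1 z.2 * \1_(A `*` B) z) = 0.
  move=> mA mB.
  have h0 : \forall t \ae mu, \int[m2]_x (g t x * \1_B x) = 0.
    apply: itv_fundamental => [|c e].
      apply: (@fub_L1_1 _ _ (measurableTypeR R) X R mu m2 (fun t x => g t x * \1_B x)).
      have [l1 _ _] := rectE setT B measurableT mB.
      by apply: (L1_eq _ l1) => z; rewrite !indicE in_setX in_setT.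
    have [_ h1 h2] := rectE (`]c, e[%classic : set (measurableTypeR R)) B (measurable_itv _) mB.
    under eq_Rintegral do rewrite mulrC.
    rewrite -h1 h2 -[RHS](@int0 _ X R m2); apply: int_ae => //.
    - apply: measurable_funM; first exact: measurable_indic.
      apply: (@measurable_int_param2 _ _ _ _ _ mu (fun t x => g t x * \1_(`]c, e[%classic : set (measurableTypeR R)) t)).
      apply: measurable_funM; first exact: L1_meas lg.
      by apply: measurableT_comp measurable_fst; exact: measurable_indic.
    - by apply: filterS (H2 c e) => x ->; rewrite mulr0.
  have [_ -> _] := rectE A B mA mB.
  rewrite -[RHS](@int0 _ (measurableTypeR R) R mu); apply: int_ae => //.
  - apply: measurable_funM; first exact: measurable_indic.
    apply: (@measurable_int_param _ _ _ _ _ m2 (fun t x => g t x * \1_B x)).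
    apply: measurable_funM; first exact: L1_meas lg.
    by apply: measurableT_comp measurable_snd; exact: measurable_indic.
  - by apply: aeS h0 => t ->; rewrite mulr0.
apply: (int_pisys_eq0 (measurable_prod_measurableType _ _) setI_closed_rect lg).
  rewrite -[RHS](rect setT setT)//; apply: eq_Rintegral => z _.
  by rewrite setXTT indicT/= mulr1.
by move=> _ [A mA [B mB <-]]; exact: rect.
Qed.

End rectangles.

(** * Weak derivatives in time *)

Lemma L1_le_ae d (X : measurableType d) (R : realType) (m : {measure set X -> \bar R})
    (f g : X -> R) : measurable_fun setT f -> L1 m g ->
  (\forall x \ae m, `|f x| <= g x) -> L1 m f.
Proof.
move=> mf lg fg; pose A := [set x | `|f x| <= g x].
have mA : measurable A.
  rewrite (_ : A = (fun x => g x - `|f x|) @^-1` `[0, +oo[).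
    rewrite -[X in measurable X]setTI; apply: measurable_funB => //; first exact: L1_meas lg.
    exact: measurableT_comp.
  by apply/seteqP; split => x /=; rewrite /A/= in_itv/= andbT subr_ge0.
have l1 : L1 m (fun x => f x * \1_A x).
  apply: (L1_le _ _ (L1_norm lg)).
    by apply: measurable_funM => //; exact: measurable_indic.
  move=> x; rewrite indicE; have [|_] := boolP (x \in A).
    by rewrite inE mulr1 => /le_trans; apply; exact: ler_norm.
  by rewrite mulr0 normr0.
apply: L1_ae l1 => //; apply: aeS fg => x fgx.
by rewrite indicE mem_set// mulr1.
Qed.

Section measurable_projections.
Context d1 d2 d3 (T1 : measurableType d1) (T2 : measurableType d2) (T3 : measurableType d3).

Lemma measurable_fun_fst (f : T1 -> T3) : measurable_fun setT f ->
  measurable_fun setT (fun z : T1 * T2 => f z.1).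
Proof. by move=> mf; exact: (measurableT_comp mf measurable_fst). Qed.

Lemma measurable_fun_snd (f : T2 -> T3) : measurable_fun setT f ->
  measurable_fun setT (fun z : T1 * T2 => f z.2).
Proof. by move=> mf; exact: (measurableT_comp mf measurable_snd). Qed.

End measurable_projections.

Section time_smooth.
Context {R : realType}.
Local Notation mu := (@lebesgue_measure R).

Definition supported_in (c e : R) (f : R -> R) := forall t, ~~ (c < t < e) -> f t = 0.

Lemma supported_itv_bump (c e a b : R) m : a <= c -> e <= b ->
  exists2 r, 0 < r & forall r', 0 < r' <= r -> supported_in (a + r') (b - r') (itv_bump c e m).
Proof.
move=> ac eb; have [->|m0] := posnP m.
  exists 1 => // r' _ t _; apply/eqP; apply: contraT => /itv_bump_supp[].
  by rewrite ltnn.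
have mi : (0 : R) < m%:R^-1 by rewrite invr_gt0 ltr0n.
exists (m%:R^-1 / 2); first by rewrite divr_gt0.
move=> r' /andP[r0 r1] t; apply: contraNeq => /itv_bump_supp[_ h1 h2].
by apply/andP; split; lra.
Qed.

Lemma test_fun1_prim (a b c e : R) f : a < c -> e < b -> smooth1 f ->
  supported_in c e f -> \int[mu]_t f t = 0 -> test_fun1 `]a, b[%classic (prim f).
Proof.
move=> ac eb sf f0 i0; have cf := continuous_smooth1 sf.
have sub : closure [set t | prim f t != 0] `<=` `[c, e].
  rewrite [X in _ `<=` X](closure_id _).1; last exact: interval_closed.
  apply: closure_subset => t /= pt; rewrite in_itv/=; apply/andP; split.
    rewrite leNgt; apply: contra pt => tc; rewrite (prim_le f0)//; exact: ltW.
  rewrite leNgt; apply: contra pt => et; rewrite (prim_ge f0) ?i0//; exact: ltW.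
split; first exact: (smooth1_prim cf f0 sf).
  by apply: subclosed_compact sub; [exact: closed_closure|exact: segment_compact].
apply: subset_trans sub _ => t /=; rewrite !in_itv/= => /andP[h1 h2].
by rewrite (lt_le_trans ac h1) (le_lt_trans h2 eb).
Qed.

Lemma measurable_smooth1 (f : R -> R) : smooth1 f -> measurable_fun [set: measurableTypeR R] f.
Proof. by move=> sf; apply: continuous_measurable_fun; exact: continuous_smooth1. Qed.

Lemma supported_smooth1_bounded (c e : R) f : smooth1 f -> supported_in c e f ->
  exists2 M : R, 0 < M & forall t, `|f t| <= M.
Proof.
move=> sf f0.
have [M M0 HM] := compact_continuous_bounded (@segment_compact R c e) (continuous_smooth1 sf).
exists M => // t; have [/andP[h1 h2]|/f0 ->] := boolP (c < t < e); last by rewrite normr0 ltW.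
by apply: HM; rewrite /= in_itv/= (ltW h1) (ltW h2).
Qed.

Lemma L1_M_bounded d (X : measurableType d) (m : {measure set X -> \bar R}) (M : R) (f g : X -> R) :
  measurable_fun setT g -> (forall x, `|g x| <= M) -> L1 m f -> L1 m (fun x => f x * g x).
Proof.
move=> mg gM lf; apply: (L1_le _ _ (L1Z M (L1_norm lf))).
  by apply: measurable_funM => //; exact: L1_meas lf.
by move=> x; rewrite normrM mulrC ler_wpM2r.
Qed.

End time_smooth.

Section time_representation.
Context d (X : measurableType d) (R : realType).
Variable m2 : {sigma_finite_measure set X -> \bar R}.
Local Notation mu := (@lebesgue_measure R).
Local Notation mm := (mu \x m2)%E.
Local Notation unc F := (fun z : measurableTypeR R * X => F z.1 z.2).
Implicit Types u v : R -> X -> R.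

Lemma measurable_prim v : measurable_fun setT (unc v) ->
  measurable_fun setT (fun z : measurableTypeR R * X => prim (v^~ z.2) z.1).
Proof.
move=> mv; pose D := [set z : measurableTypeR R * measurableTypeR R | z.2 <= z.1].
have := @measurable_int_param _ _ (measurableTypeR R * X)%type (measurableTypeR R) R mu
  (fun z s => v s z.2 * \1_D (z.1, s)).
rewrite (_ : (fun y => _) = (fun z => prim (v^~ z.2) z.1)); last first.
  by apply/funext => z; rewrite primE.
apply; apply: measurable_funM.
  have mp : measurable_fun setT (fun w : measurableTypeR R * X * measurableTypeR R => (w.2, w.1.2)).
    apply/measurable_fun_pairP; split; first exact: measurable_snd.
    by apply: measurable_fun_fst; exact: measurable_snd.
  exact: (measurableT_comp mv mp).
have mp : measurable_fun setT (fun w : measurableTypeR R * X * measurableTypeR R => (w.1.1, w.2)).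
  apply/measurable_fun_pairP; split; last exact: measurable_snd.
  by apply: measurable_fun_fst; exact: measurable_fst.
have mD : measurable_fun setT (\1_D : measurableTypeR R * measurableTypeR R -> R).
  by apply: measurable_indic; exact: measurable_le_graph.
exact: (measurableT_comp mD mp).
Qed.

Lemma L1_prim v (a b : R) : L1 mm (unc v) ->
  L1 mm (fun z : measurableTypeR R * X => prim (v^~ z.2) z.1 * \1_(`]a, b[%classic : set (measurableTypeR R)) z.1).
Proof.
move=> lv; pose A := (`]a, b[%classic : set (measurableTypeR R)).
have mV : measurable_fun setT (unc (fun t x => prim (v^~ x) t * \1_A t)).
  apply: measurable_funM; first exact: measurable_prim (L1_meas lv).
  by apply: measurable_fun_fst; apply: measurable_indic; exact: measurable_itv.
have lA : L1 mu (\1_A : R -> R) by exact: integrable_indic_itv.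
apply: (@L1_swap _ _ _ _ _ m2 mu (fun x t => prim (v^~ x) t * \1_A t)).
apply: (@fub_L1I _ _ _ _ _ m2 mu (fun x t => prim (v^~ x) t * \1_A t)).
- exact: (measurableT_comp mV (@measurable_swap _ _ _ _)).
- apply: aeS (fub_ae2 lv) => x lx.
  apply: (L1_le _ _ (L1Z (\int[mu]_s `|v s x|) lA)).
    exact: (@measurable_curry2 _ _ (measurableTypeR R) X R (fun t x => prim (v^~ x) t * \1_A t) x mV).
  move=> t; rewrite normrM; apply: ler_pM => //; first exact: prim_le_norm.
  by rewrite ger0_norm// indicE ler0n.
- apply: (L1_le_ae _ (L1Z (\int[mu]_t \1_A t) (@fub_L1_2 _ _ _ _ _ mu m2 (fun t x => `|v t x|) (L1_norm lv)))).
    apply: (@measurable_int_param2 _ _ _ _ _ mu (fun t x => `|prim (v^~ x) t * \1_A t|)).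
    exact: measurableT_comp.
  apply: aeS (fub_ae2 lv) => x lx.
  have lVx : L1 mu (fun t => prim (v^~ x) t * \1_A t).
    apply: (L1_le _ _ (L1Z (\int[mu]_s `|v s x|) lA)).
      exact: (@measurable_curry2 _ _ (measurableTypeR R) X R (fun t x => prim (v^~ x) t * \1_A t) x mV).
    move=> t; rewrite normrM; apply: ler_pM => //; first exact: prim_le_norm.
    by rewrite ger0_norm// indicE ler0n.
  rewrite ger0_norm; last exact: int_ge0.
  rewrite mulrC -intZ//; apply: int_le; [exact: L1_norm|exact: L1Z|].
  apply: aeW => t; rewrite normrM; apply: ler_pM => //; first exact: prim_le_norm.
  by rewrite ger0_norm// indicE ler0n.
Qed.

(** Du Bois-Reymond's lemma with a parameter: a function of time whose weak
    derivative is integrable is almost everywhere a primitive of it. *)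
Lemma time_repr u v (a b : R) : a < b -> L1 mm (unc u) -> L1 mm (unc v) ->
  (forall x, supported_in a b (u^~ x)) -> (forall x, supported_in a b (v^~ x)) ->
  (forall eta, test_fun1 `]a, b[%classic eta ->
    \forall x \ae m2, \int[mu]_t (u t x * derive1 eta t) = - \int[mu]_t (v t x * eta t)) ->
  exists2 c : X -> R, L1 m2 c &
    \forall z \ae mm, a < z.1 < b -> u z.1 z.2 = c z.2 + prim (v^~ z.2) z.1.
Proof.
move=> ab lu lv u0 v0 H.
pose A := (`]a, b[%classic : set (measurableTypeR R)).
pose W t x := u t x - prim (v^~ x) t * \1_A t.
have lW : L1 mm (unc W) by exact: L1B lu (L1_prim a b lv).
have [m0 k0] := int_itv_bump_gt0 ab.
set z0 := itv_bump a b m0 in k0; set k := (X in 0 < X) in k0.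
have sz0 : smooth1 z0 by exact: smooth1_itv_bump.
have bz c e m t : `|itv_bump c e m t| <= 1 by rewrite ger0_norm ?itv_bump_ge0// itv_bump_le1.
have mz c e m : measurable_fun [set: measurableTypeR R] (itv_bump c e m).
  by apply: measurable_smooth1; exact: smooth1_itv_bump.
have lz c e m : L1 mu (itv_bump c e m).
  apply: (@integrable_compact_support _ _ c e); first exact/continuous_smooth1/smooth1_itv_bump.
  by move=> t; apply: contraNeq => /itv_bump_in.
pose mn x := k^-1 * \int[mu]_t (W t x * z0 t).
have lmn : L1 m2 mn.
  apply: L1Z; apply: (@fub_L1_2 _ _ (measurableTypeR R) X R mu m2 (fun t x => W t x * z0 t)).
  apply: (L1_M_bounded (M := 1)) => //; last by move=> z; exact: bz.
  by apply: measurable_fun_fst; exact: mz.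
exists mn => //.
have lA : L1 mu (\1_A : R -> R) by exact: integrable_indic_itv.
pose g t x := W t x - \1_A t * mn x.
have lg : L1 mm (unc g) by exact: (L1B lW (L1_prod lA lmn)).
suff : \forall z \ae mm, g z.1 z.2 = 0.
  apply: aeS => z gz zab; move/eqP: gz; rewrite /g /W /A indic_itv in_itv/= zab mulr1 mul1r.
  by rewrite subr_eq0 subr_eq => /eqP.
apply: (@time_fundamental _ _ _ _ g a b) => //.
  move=> t x tab; rewrite /g /W /A indic_itv in_itv/= (negbTE tab) mulr0 mul0r !subr0.
  exact: u0.
move=> c e m ac eb.
set zt := itv_bump c e m; set I := \int[mu]_t zt t.
pose th t := zt t - (I / k) * z0 t.
have sth : smooth1 th.
  rewrite (_ : th = fun t => zt t + (fun=> - (I / k)) t * z0 t); last first.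
    by apply/funext => t; rewrite /th mulNr.
  apply: smooth1D; first exact: smooth1_itv_bump.
  by apply: smooth1M => //; exact: smooth1_cst.
have lth : L1 mu th by apply: L1B; [exact: lz|apply: L1Z; exact: lz].
have ith : \int[mu]_t th t = 0.
  rewrite intB//; [|exact: lz|by apply: L1Z; exact: lz].
  by rewrite intZ; [|exact: lz]; rewrite -/I -/k divfK ?subrr// gt_eqF.
have [r1 r10 hr1] := supported_itv_bump m ac eb.
have [r2 r20 hr2] := supported_itv_bump m0 (lexx a) (lexx b).
pose r := Num.min r1 r2.
have r0 : 0 < r by rewrite lt_min r10 r20.
have thr : supported_in (a + r) (b - r) th.
  move=> t tr; rewrite /th /zt /z0 (hr1 r) ?(hr2 r) ?mulr0 ?subrr//.
    by rewrite r0 /r ge_min lexx orbT.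
  by rewrite r0 /r ge_min lexx.
have test : test_fun1 `]a, b[%classic (prim th).
  apply: (test_fun1_prim _ _ sth thr ith); first by rewrite ltrDl.
  by rewrite gtrDl oppr_lt0.
have [dp ep] := derive1_prim (continuous_smooth1 sth) thr.
apply: aeS2 (aeS2 (fun x p q => conj p q) (fub_ae2 lu) (fub_ae2 lv)) (H _ test) => x [lux lvx].
rewrite ep => Hx.
have [M M0 HM] := supported_smooth1_bounded sth thr.
have mth := measurable_smooth1 sth.
have lut : L1 mu (fun t => u t x * th t) by exact: (L1_M_bounded mth HM lux).
have mWx : L1 mu (fun t => prim (v^~ x) t * \1_A t).
  apply: (L1_le _ _ (L1Z (\int[mu]_s `|v s x|) lA)).
    apply: measurable_funM; last by apply: measurable_indic; exact: measurable_itv.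
    exact: (@measurable_curry2 _ _ (measurableTypeR R) X R (fun t x => prim (v^~ x) t) x (measurable_prim (L1_meas lv))).
  move=> t; rewrite normrM; apply: ler_pM => //; first exact: prim_le_norm.
  by rewrite ger0_norm// indicE ler0n.
have lVt : L1 mu (fun t => prim (v^~ x) t * \1_A t * th t) by exact: (L1_M_bounded mth HM mWx).
have Wth : \int[mu]_t (W t x * th t) = 0.
  under eq_Rintegral do rewrite /W mulrBl.
  rewrite intB// Hx.
  have := prim_parts lvx lth; rewrite ith mulr0.
  have -> : \int[mu]_s (th s * prim (v^~ x) s) = \int[mu]_t (prim (v^~ x) t * \1_A t * th t).
    apply: eq_Rintegral => t _; rewrite mulrC /A indic_itv in_itv/=.
    have [_|tab] := boolP (a < t < b); first by rewrite mulr1.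
    rewrite thr ?mulr0//; apply: contra tab => /andP[h1 h2]; apply/andP; split; lra.
  by move=> /eqP; rewrite addr_eq0 => /eqP ->; rewrite opprK subrr.
have lWx : L1 mu (W^~ x) by exact: L1B lux mWx.
have lWz c' e' m' : L1 mu (fun t => W t x * itv_bump c' e' m' t).
  by apply: (L1_M_bounded (mz c' e' m') _ lWx) => t; exact: bz.
have Wz : \int[mu]_t (W t x * zt t) = I * mn x.
  have E t : W t x * th t = W t x * zt t - (I / k) * (W t x * z0 t) by rewrite /th; ring.
  move: Wth; under eq_Rintegral do rewrite E.
  rewrite intB; [|exact: lWz|by apply: L1Z; exact: lWz].
  rewrite intZ; last exact: lWz.
  by move=> /eqP; rewrite subr_eq0 => /eqP ->; rewrite /mn mulrA.
under eq_Rintegral do rewrite /g mulrBl.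
have lAz : L1 mu (fun t => \1_A t * mn x * zt t).
  apply: (L1_eq (g := fun t => mn x * (\1_A t * zt t))); first by move=> t; ring.
  by apply: L1Z; apply: (L1_M_bounded (mz c e m) _ lA) => t; exact: bz.
rewrite intB//; last exact: lWz.
rewrite Wz (_ : \int[mu]_t (\1_A t * mn x * zt t) = mn x * I) ?[mn x * I]mulrC ?subrr//.
rewrite mulrC /I -intZ; last exact: lz.
apply: eq_Rintegral => t _; rewrite /A indic_itv in_itv/=.
have [_|tab] := boolP (a < t < b); first by rewrite mul1r.
have -> : zt t = 0; last by rewrite !mulr0.
apply/eqP; apply: contraNT tab => /itv_bump_in/andP[h1 h2].
by rewrite (le_lt_trans ac h1) (lt_le_trans h2 eb).
Qed.

Lemma time_unique v (a b : R) : L1 mm (unc v) -> (forall x, supported_in a b (v^~ x)) ->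
  (forall eta, test_fun1 `]a, b[%classic eta ->
    \forall x \ae m2, \int[mu]_t (v t x * eta t) = 0) ->
  \forall z \ae mm, v z.1 z.2 = 0.
Proof.
move=> lv v0 H; apply: (@time_fundamental _ _ _ _ v a b) => //.
  by move=> t x tab; exact: v0.
move=> c e m ac eb; apply: H; apply: test_fun1_itv_bump => t /=.
by rewrite !in_itv/= => /andP[h1 h2]; rewrite (le_lt_trans ac h1) (lt_le_trans h2 eb).
Qed.

End time_representation.

(** * Lebesgue measure along one coordinate *)

Section coordinate_fubini.
Context {R : realType}.
Local Notation mu := (@lebesgue_measure R).

Definition insrv n (i : 'I_n.+1) (z : measurableTypeR R * 'rV[R]_n) : 'rV[R]_n.+1 :=
  \row_k oapp (z.2 ord0) z.1 (unlift i k).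

Definition delrv n (i : 'I_n.+1) (x : 'rV[R]_n.+1) : 'rV[R]_n := \row_k x ord0 (lift i k).

Lemma insrv_i n (i : 'I_n.+1) z : insrv i z ord0 i = z.1.
Proof. by rewrite mxE unlift_none. Qed.

Lemma insrv_lift n (i : 'I_n.+1) z k : insrv i z ord0 (lift i k) = z.2 ord0 k.
Proof. by rewrite mxE liftK. Qed.

Lemma delrv_insrv n (i : 'I_n.+1) z : delrv i (insrv i z) = z.2.
Proof. by apply/rowP => k; rewrite mxE insrv_lift. Qed.

Lemma measurable_insrv n (i : 'I_n.+1) : measurable_fun setT (@insrv n i).
Proof.
apply: measurable_fun_rV => k; rewrite /insrv.
under eq_fun do rewrite mxE.
case: unliftP => [j _|_] /=; last exact: measurable_fst.
by apply: (measurableT_comp (measurable_rV_coord j)); exact: measurable_snd.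
Qed.

Lemma insrv_lift0 n (j : 'I_n.+1) (a b : R) (w : 'rV[R]_n) :
  insrv (lift ord0 j) (a, consrv (b, w)) = consrv (b, insrv j (a, w)).
Proof.
apply/rowP => k; case: (unliftP (lift ord0 j) k) => [k'|] ->; last first.
  by rewrite insrv_i mxE liftK /= insrv_i.
rewrite insrv_lift /=.
have -> : @consrv R n (b, w) ord0 k' = oapp (w ord0) b (unlift ord0 k') by rewrite mxE.
rewrite mxE; case: (unliftP ord0 k') => [k''|] -> /=; last first.
  have -> : lift (lift ord0 j) ord0 = ord0 :> 'I_n.+2 by apply/val_inj.
  by rewrite unlift_none.
have -> : lift (lift ord0 j) (lift ord0 k'') = lift ord0 (lift j k'') :> 'I_n.+2.
  by apply/val_inj; rewrite /= /bump/= !add1n ltnS addnS.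
by rewrite liftK /= insrv_lift.
Qed.

Local Open Scope ereal_scope.

Lemma leb_consrv n (f : 'rV[R]_n.+1 -> \bar R) : measurable_fun setT f -> (forall x, 0 <= f x) ->
  \int[leb n.+1]_x f x = \int[mu]_a \int[leb n]_v f (consrv (a, v)).
Proof.
move=> mf f0.
transitivity (\int[(mu \x leb n)]_z f (consrv z)).
  rewrite (@eq_measure_integral _ _ _ _ (pushforward (mu \x leb n) (@consrv R n)))//.
    exact: measurable_consrv.
  by move=> mc; rewrite ge0_integral_pushforward// preimage_setT.
rewrite (fubini_tonelli1 (m1 := mu) (m2 := leb n) (f \o @consrv R n))//; last by move=> z; exact: f0.
by apply: measurableT_comp => //; exact: measurable_consrv.
Qed.

(** The Lebesgue measure is defined by splitting off the first coordinate;
    by induction on the dimension any coordinate may be split off instead. *)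
Lemma leb_insrv n (i : 'I_n.+1) (f : 'rV[R]_n.+1 -> \bar R) : measurable_fun setT f ->
  (forall x, 0 <= f x) ->
  \int[leb n.+1]_x f x = \int[mu]_a \int[leb n]_v f (insrv i (a, v)).
Proof.
elim: n i f => [|n IH] i f mf f0.
  case: (unliftP ord0 i) => [[j jlt]|] ->; first by exfalso; rewrite ltn0 in jlt.
  exact: leb_consrv.
case: (unliftP ord0 i) => [j|] ->; last exact: leb_consrv.
rewrite (leb_consrv mf f0).
have mc (b : R) : measurable_fun setT (fun v => f (consrv (b, v))).
  exact: (measurableT_comp mf (measurableT_comp (@measurable_consrv R n.+1) (measurable_pair1 b))).
transitivity (\int[mu]_b \int[mu]_a \int[leb n]_w f (consrv (b, insrv j (a, w)))).
  by apply: eq_integral => b _; rewrite (IH j).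
have mF : measurable_fun setT (fun z : (measurableTypeR R * measurableTypeR R) * 'rV[R]_n =>
    f (consrv (z.1.1, insrv j (z.1.2, z.2)))).
  have m1 : measurable_fun setT (fun z : (measurableTypeR R * measurableTypeR R) * 'rV[R]_n => (z.1.2, z.2)).
    apply/measurable_fun_pairP; split; last exact: measurable_snd.
    by apply: measurable_fun_fst; exact: measurable_snd.
  have m2 : measurable_fun setT (fun z : (measurableTypeR R * measurableTypeR R) * 'rV[R]_n =>
      (z.1.1, insrv j (z.1.2, z.2))).
    apply/measurable_fun_pairP; split; last exact: (measurableT_comp (measurable_insrv j) m1).
    by apply: measurable_fun_fst; exact: measurable_fst.
  exact: (measurableT_comp mf (measurableT_comp (@measurable_consrv R n.+1) m2)).
have := fubini_tonelli (m1 := mu) (m2 := mu)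
  (fun z : measurableTypeR R * measurableTypeR R => \int[leb n]_w f (consrv (z.1, insrv j (z.2, w)))).
move=> /= ->.
- apply: eq_integral => a _.
  have mi : measurable_fun setT (fun v => f (insrv (lift ord0 j) (a, v))).
    exact: (measurableT_comp mf (measurableT_comp (measurable_insrv _) (measurable_pair1 a))).
  rewrite (leb_consrv mi (fun v => f0 _)).
  by apply: eq_integral => b _; apply: eq_integral => w _; rewrite insrv_lift0.
- exact: (measurable_fun_fubini_tonelli_F (m2 := leb n)
    (fun z : (measurableTypeR R * measurableTypeR R) * 'rV[R]_n => f (consrv (z.1.1, insrv j (z.1.2, z.2))))).
- by move=> z; exact: integral_ge0.
Qed.

Local Close Scope ereal_scope.

Lemma measurable_comp_insrv n (i : 'I_n.+1) (f : 'rV[R]_n.+1 -> R) : measurable_fun setT f ->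
  measurable_fun setT (f \o insrv i).
Proof. by move=> mf; apply: (measurableT_comp mf); exact: measurable_insrv. Qed.

Lemma leb_insrv_prod n (i : 'I_n.+1) (f : 'rV[R]_n.+1 -> \bar R) : measurable_fun setT f ->
  (forall x, 0 <= f x)%E ->
  (\int[leb n.+1]_x f x = \int[(mu \x leb n)]_z f (insrv i z))%E.
Proof.
move=> mf f0; rewrite (leb_insrv i)// (fubini_tonelli1 (m1 := mu) (m2 := leb n) (f \o insrv i))//; last by move=> z; exact: f0.
by apply: measurableT_comp => //; exact: measurable_insrv.
Qed.

Lemma L1_insrv n (i : 'I_n.+1) (f : 'rV[R]_n.+1 -> R) : L1 (leb n.+1) f ->
  L1 (mu \x leb n)%E (f \o insrv i).
Proof.
move=> lf; have mf := L1_meas lf; have /integrableP[_ fi] := lf.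
apply/integrableP; split.
  by apply/measurable_EFinP; exact: measurable_comp_insrv.
move: fi; rewrite (leb_insrv_prod i)//.
by apply: measurableT_comp => //; exact/measurable_EFinP.
Qed.

Lemma int_insrv n (i : 'I_n.+1) (f : 'rV[R]_n.+1 -> R) : measurable_fun setT f ->
  \int[leb n.+1]_x f x = \int[(mu \x leb n)%E]_z f (insrv i z).
Proof.
move=> mf; have mE : measurable_fun setT (EFin \o f) by exact/measurable_EFinP.
congr fine; rewrite integralE [RHS]integralE; congr (_ - _)%E.
  have -> := @leb_insrv_prod n i (EFin \o f)^\+%E (measurable_funepos mE) (funepos_ge0 _).
  by apply: eq_integral => z _; rewrite !funeposE.
have -> := @leb_insrv_prod n i (EFin \o f)^\-%E (measurable_funeneg mE) (funeneg_ge0 _).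
by apply: eq_integral => z _; rewrite !funenegE.
Qed.

End coordinate_fubini.

(** * Integration by parts on the whole space *)

Lemma pd_invariant {R : realType} {N : nat} (i : 'I_N) (f : 'rV[R]_N -> R) :
  (forall h x, f (h *: basis_vec i + x) = f x) -> pd i f = fun=> 0.
Proof.
move=> fi; apply/funext => x; rewrite /pd /derive; apply/cvg_lim => //.
rewrite (_ : (fun h => _) = fun=> 0); first exact: cvg_cst.
by apply/funext => h /=; rewrite fi subrr scaler0.
Qed.

Lemma L1_M_bounded_supp d (X : measurableType d) (R : realType)
    (m : {measure set X -> \bar R}) (M : R) (f g : X -> R) :
  measurable_fun setT g -> (forall x, f x != 0 -> `|g x| <= M) -> L1 m f ->
  L1 m (fun x => f x * g x).
Proof.
move=> mg gM lf; apply: (L1_le _ _ (L1Z M (L1_norm lf))).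
  by apply: measurable_funM => //; exact: L1_meas lf.
move=> x; rewrite normrM mulrC; have [->|f0] := eqVneq (f x) 0.
  by rewrite normr0 !mulr0.
by rewrite ler_wpM2r// gM.
Qed.

Lemma L2_M_bounded_supp d (X : measurableType d) (R : realType)
    (m : {measure set X -> \bar R}) (M : R) (f g : X -> R) : 0 <= M ->
  measurable_fun setT g -> (forall x, f x != 0 -> `|g x| <= M) -> L2 m f ->
  L2 m (fun x => f x * g x).
Proof.
move=> M0 mg gM [mf lf]; split; first exact: measurable_funM.
apply: (L1_eq (g := fun x => f x ^+ 2 * g x ^+ 2)); first by move=> x; rewrite exprMn.
apply: (L1_M_bounded_supp (M := M ^+ 2)) => //; first exact: measurable_funX.
move=> x; rewrite sqrf_eq0 => /gM gx; rewrite normrX lerXn2r// nnegrE//.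
Qed.

Lemma fub_ae_swap d1 d2 (T1 : measurableType d1) (T2 : measurableType d2) (R : realType)
    (m1 : {sigma_finite_measure set T1 -> \bar R}) (m2 : {sigma_finite_measure set T2 -> \bar R})
    (P : T1 -> T2 -> Prop) : (\forall z \ae (m1 \x m2)%E, P z.1 z.2) ->
  \forall x \ae m2, \forall y \ae m1, P y x.
Proof.
move=> [K [mK K0 PK]].
have lN : L1 (m1 \x m2)%E (fun z => (fun y x => \1_K (y, x)) z.1 z.2 : R).
  apply: (L1_eq (g := \1_K)); first by case.
  apply: (L1_ae _ _ (L1_0 _)); first exact: measurable_indic.
  exists K; split => // z /=; apply: contra_notP => nK.
  by rewrite indicE memNset.
have i0 : \int[(m1 \x m2)%E]_z ((fun y x => \1_K (y, x)) z.1 z.2 : R) = 0.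
  rewrite (_ : (fun z => _) = \1_K); last by apply/funext => -[].
  by rewrite /Rintegral integral_indic// setIT [X in fine X]K0.
have l2 := @fub_L1_2 _ _ _ _ _ m1 m2 (fun y x => \1_K (y, x)) lN.
have e2 := @fub2 _ _ _ _ _ m1 m2 (fun y x => \1_K (y, x)) lN.
have h : \forall x \ae m2, \int[m1]_y (\1_K (y, x) : R) = 0.
  apply: (int_eq0 l2) => [x|]; last by rewrite -e2.
  by apply: int_ge0 => y; rewrite indicE ler0n.
apply: aeS2 h (@fub_ae2 _ _ _ _ _ m1 m2 (fun y x => \1_K (y, x)) lN) => x hx lx.
have hy : \forall y \ae m1, \1_K (y, x) = 0 :> R.
  by apply: (int_eq0 lx) => [y|//]; rewrite indicE ler0n.
apply: aeS hy => y Ky; apply: contrapT => nP; move: Ky.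
rewrite indicE mem_set; last exact: PK.
by move=> /eqP; rewrite oner_eq0.
Qed.

Lemma ae_exists_itv {R : realType} (P : R -> Prop) (a b : R) : a < b ->
  (\forall t \ae (@lebesgue_measure R), P t) -> exists2 t, a < t < b & P t.
Proof.
move=> ab [K [mK K0 PK]]; apply: contrapT => nex.
have sub : `]a, b[%classic `<=` K.
  move=> t /=; rewrite in_itv/= => tab; apply: PK => /= Pt; apply: nex; by exists t.
have : (@lebesgue_measure R `]a, b[%classic <= @lebesgue_measure R K)%E.
  by apply: le_measure => //; rewrite inE//; exact: measurable_itv.
by rewrite [X in (_ <= X)%E]K0 lebesgue_measure_itv/= lte_fin ab lee_fin leNgt subr_gt0 ab.
Qed.

Definition cube_supported {R : realType} {N : nat} (A : R) (u : 'rV[R]_N -> R) :=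
  forall x, u x != 0 -> forall k, `|x ord0 k| <= A.

Section lines.
Context {R : realType} {n : nat}.
Variables (i : 'I_n.+1) (A0 A : R).
Hypotheses (A0pos : 0 < A0) (A0A : A0 < A).
Local Notation E := 'rV[R]_n.+1.
Local Notation mu := (@lebesgue_measure R).
Local Notation mm := (mu \x leb n)%E.

Local Notation cube_supported := (cube_supported A0).

Lemma continuous_cube_bounded (f : E -> R) : continuous f ->
  exists2 M : R, 0 < M & forall x : E, (forall k, `|x ord0 k| <= A0) -> `|f x| <= M.
Proof.
move=> cf.
have [M M0 HM] := compact_continuous_bounded
   (@compact_cbox R n.+1 (const_mx (- A0)) (const_mx A0)) cf.
exists M => // x xA; apply: HM => k; rewrite !mxE.
by have := xA k; rewrite ler_norml.
Qed.

Lemma L1_cube_cont (u f : E -> R) : cube_supported u -> L1 (leb n.+1) u -> continuous f ->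
  L1 (leb n.+1) (fun x => u x * f x).
Proof.
move=> su lu cf; have [M M0 HM] := continuous_cube_bounded cf.
apply: (L1_M_bounded_supp (M := M)) => //; first exact: continuous_measurable_rV.
by move=> x /su; exact: HM.
Qed.

(** For compactly supported functions, to which this is applied, all smooth
    functions may serve as test functions. *)
Definition weak_pd_space (u g : E -> R) := forall psi : E -> R, smooth psi ->
  \int[leb n.+1]_x (u x * pd i psi x) = - \int[leb n.+1]_x (g x * psi x).

Local Notation line u := (fun t v => u (insrv i (t, v))).

Lemma supported_line u v : cube_supported u -> supported_in (- A) A (fun t => u (insrv i (t, v))).
Proof.
move=> su t tA; apply/eqP; apply: contraNT tA => /su/(_ i); rewrite insrv_i/= => tA.
by rewrite -ltr_norml (le_lt_trans tA).
Qed.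

Lemma L1_line u : L1 (leb n.+1) u -> L1 mm (fun z => line u z.1 z.2).
Proof. by move=> lu; apply: (L1_eq _ (L1_insrv i lu)) => -[]. Qed.

Let oppA : - A < - A0. Proof. by rewrite ltrN2. Qed.

Let below_cube (t : R) : - A < t -> t < - A0 -> A0 < `|t| /\ - A < t < A.
Proof.
move=> h1 h2; split; last by rewrite h1/=; apply: lt_trans h2 _; move: A0pos A0A; lra.
by rewrite -normrN; apply: lt_le_trans (ler_norm _); rewrite ltrNr.
Qed.

Let above_cube (t : R) : A0 < t -> t < A -> A0 < `|t| /\ - A < t < A.
Proof.
move=> h1 h2; split; first exact: lt_le_trans h1 (ler_norm _).
by rewrite h2 andbT; move: A0pos A0A; lra.
Qed.

(** Testing with the product of a function of the i-th coordinate and of a bump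
    in the others reduces the claim to du Bois-Reymond's lemma with the other
    coordinates as parameters. *)
Lemma line_repr u g : cube_supported u -> cube_supported g -> L1 (leb n.+1) u -> L1 (leb n.+1) g ->
  weak_pd_space u g ->
  (\forall v \ae leb n, \forall t \ae mu, - A < t < A -> u (insrv i (t, v)) = prim (fun s => g (insrv i (s, v))) t) /\
  (\forall v \ae leb n, \int[mu]_t g (insrv i (t, v)) = 0).
Proof.
move=> su sg lu lg ug.
have AA : - A < A by rewrite gtrN// (lt_trans A0pos).
have lU := L1_line lu; have lG := L1_line lg.
have [] := @time_repr _ _ R (leb n) (line u) (line g) (- A) A AA lU lG.
- by move=> v; exact: supported_line.
- by move=> v; exact: supported_line.
- move=> eta [seta _ suppeta].
  have seta' : smooth1 (derive1 eta).
    move=> k x; have -> : derive1n k (derive1 eta) = derive1n k.+1 eta by elim: k {x} => //= k ->.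
    exact: seta.
  have bound (f : R -> R) : smooth1 f -> exists2 M : R, 0 < M & forall t, - A < t < A -> `|f t| <= M.
    move=> sf; have [M M0 HM] := compact_continuous_bounded (@segment_compact R (- A) A) (continuous_smooth1 sf).
    by exists M => // t /andP[h1 h2]; apply: HM; rewrite /= in_itv/= !ltW.
  have lUf (w : E -> R) (f : R -> R) : cube_supported w -> L1 (leb n.+1) w -> smooth1 f ->
      L1 mm (fun z => line w z.1 z.2 * f z.1).
    move=> sw lw sf; have [M M0 HM] := bound f sf.
    apply: (L1_M_bounded_supp (M := M)).
    - by apply: measurable_fun_fst; exact: measurable_smooth1.
    - move=> z; have [tA _|tA] := boolP (- A < z.1 < A); first exact: HM.
      by rewrite (supported_line _ sw tA) eqxx.
    - exact: L1_line.
  pose F v := \int[mu]_t (u (insrv i (t, v)) * derive1 eta t) + \int[mu]_t (g (insrv i (t, v)) * eta t).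
  have l1 := @fub_L1_2 _ _ (measurableTypeR R) _ R mu (leb n) (fun t v => line u t v * derive1 eta t) (lUf u _ su lu seta').
  have l2 := @fub_L1_2 _ _ (measurableTypeR R) _ R mu (leb n) (fun t v => line g t v * eta t) (lUf g _ sg lg seta).
  have lF : L1 (leb n) F by exact: L1D.
  suff : \forall v \ae leb n, F v = 0.
    by apply: filterS => v /eqP; rewrite addr_eq0 => /eqP.
  apply: box_fundamental => // a b m.
  pose psi (x : E) := eta (x ord0 i) * box_bump a b m (delrv i x).
  have sz : smooth (fun x : E => box_bump a b m (delrv i x)).
    rewrite /box_bump; apply: (@smooth_prod _ _ _ _ _ (fun k (x : E) => itv_bump (a ord0 k) (b ord0 k) m (delrv i x ord0 k))) => k.
    rewrite (_ : (fun x => _) = (fun x : E => itv_bump (a ord0 k) (b ord0 k) m (x ord0 (lift i k)))).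
      exact: (smooth_comp1 (@smooth1_itv_bump _ _ _ _) (@smooth_coord _ _ _)).
    by apply/funext => x; rewrite mxE.
  have se : smooth (fun x : E => eta (x ord0 i)).
    exact: (smooth_comp1 seta (@smooth_coord _ _ _)).
  have spsi : smooth psi by exact: smoothM.
  have pdpsi x : pd i psi x = derive1 eta (x ord0 i) * box_bump a b m (delrv i x).
    rewrite pdM; [|exact: smooth_derivable|exact: smooth_derivable].
    rewrite [X in _ + _ * X x]pd_invariant ?mulr0 ?addr0.
      rewrite (@pd_comp1 _ _ eta (fun y : E => y ord0 i) i x seta (@smooth_coord _ _ _)).
      have -> : pd i (fun y : E => y ord0 i) x = 1.
        rewrite /pd (@derive_val _ _ _ _ _ _ _ (is_derive_coord i x (basis_vec i))).
        by rewrite /basis_vec mxE !eqxx.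
      by rewrite mulr1.
    move=> h y; congr (box_bump a b m _); apply/rowP => k.
    by rewrite !mxE eqxx/= [_ == i]eq_sym (negbTE (neq_lift _ _)) mulr0 add0r.
  have mb : measurable_fun setT (fun z : measurableTypeR R * 'rV[R]_n => box_bump a b m z.2).
    by apply: measurable_fun_snd; exact: measurable_box_bump.
  have bb z : `|box_bump a b m z| <= 1 by rewrite ger0_norm ?box_bump_ge0 ?box_bump_le1.
  have conv (w : E -> R) (f : R -> R) : cube_supported w -> L1 (leb n.+1) w -> smooth1 f ->
      let G v := \int[mu]_t (w (insrv i (t, v)) * f t) in
      L1 (leb n) (fun v => G v * box_bump a b m v) /\
      \int[mm]_z (w (insrv i z) * (f z.1 * box_bump a b m z.2)) =
      \int[leb n]_v (G v * box_bump a b m v).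
    move=> sw lw sf G.
    have lwf := lUf w f sw lw sf.
    have lG' : L1 (leb n) G by exact: (@fub_L1_2 _ _ (measurableTypeR R) _ R mu (leb n) (fun t v => line w t v * f t) lwf).
    have lGb : L1 (leb n) (fun v => G v * box_bump a b m v).
      by apply: (L1_M_bounded (@measurable_box_bump _ _ _ _ _) bb lG').
    have lwb : L1 mm (fun z => line w z.1 z.2 * f z.1 * box_bump a b m z.2).
      by apply: (L1_M_bounded mb (fun z => bb z.2)).
    split => //.
    transitivity (\int[mm]_z ((fun t v => line w t v * f t * box_bump a b m v) z.1 z.2)).
      by apply: eq_Rintegral => -[t v] _ /=; rewrite mulrA.
    have -> := @fub2 _ _ _ _ _ mu (leb n) (fun t v => line w t v * f t * box_bump a b m v) lwb.
    apply: int_ae.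
    - exact: L1_meas (@fub_L1_2 _ _ (measurableTypeR R) _ R mu (leb n) (fun t v => line w t v * f t * box_bump a b m v) lwb).
    - exact: L1_meas lGb.
    - apply: aeS (@fub_ae2 _ _ (measurableTypeR R) _ R mu (leb n) (fun t v => line w t v * f t) lwf) => v lv.
      rewrite /G mulrC -intZ//; apply: eq_Rintegral => t _; exact: mulrC.
  have [lb1 c1] := conv u _ su lu seta'.
  have [lb2 c2] := conv g _ sg lg seta.
  have := ug _ spsi.
  rewrite !(int_insrv i); last 2 first.
  - by apply: L1_meas; apply: L1_cube_cont => //; exact: smooth_continuous.
  - apply: L1_meas; apply: L1_cube_cont => //; apply: smooth_continuous; exact: smooth_pd.
  have -> : \int[mm]_z (u (insrv i z) * pd i psi (insrv i z)) =
    \int[mm]_z (u (insrv i z) * (derive1 eta z.1 * box_bump a b m z.2)).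
    by apply: eq_Rintegral => z _; rewrite pdpsi insrv_i delrv_insrv.
  have -> : \int[mm]_z (g (insrv i z) * psi (insrv i z)) =
    \int[mm]_z (g (insrv i z) * (eta z.1 * box_bump a b m z.2)).
    by apply: eq_Rintegral => z _; rewrite /psi insrv_i delrv_insrv.
  rewrite c1 c2 => /eqP; rewrite -addr_eq0 -intD// => /eqP <-.
  by apply: eq_Rintegral => v _; rewrite /F mulrDl.
- move=> c lc H.
  have Hs := @fub_ae_swap _ _ (measurableTypeR R) _ R mu (leb n) (fun t v => - A < t < A ->
     u (insrv i (t, v)) = c v + prim (fun s => g (insrv i (s, v))) t) H.
  have g0 t v : A0 < `|t| -> g (insrv i (t, v)) = 0.
    move=> tA; apply/eqP; apply: contraTT tA => /sg/(_ i); rewrite insrv_i/=.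
    by rewrite leNgt.
  have u0 t v : A0 < `|t| -> u (insrv i (t, v)) = 0.
    move=> tA; apply/eqP; apply: contraTT tA => /su/(_ i); rewrite insrv_i/=.
    by rewrite leNgt.
  have key : \forall v \ae leb n, c v = 0 /\ \int[mu]_t g (insrv i (t, v)) = 0.
    apply: aeS Hs => v Hv.
    have c0 : c v = 0.
      have [t /andP[h1 h2]] := ae_exists_itv oppA Hv.
      have [tA0 tA] := below_cube h1 h2.
      move=> /(_ tA).
      rewrite u0// (_ : prim _ t = 0) ?addr0//.
      rewrite /prim (@eq_Rintegral _ _ _ _ _ (cst 0)) ?Rintegral_cst ?mul0r//.
      move=> s; rewrite inE/= in_itv/= => st; apply: g0.
      by rewrite -normrN; apply: lt_le_trans (ler_norm (- s)); rewrite ltrNr (le_lt_trans st).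
    split => //.
    have [t /andP[h1 h2]] := ae_exists_itv A0A Hv.
    have [tA0 tA] := above_cube h1 h2.
    move=> /(_ tA).
    rewrite u0// c0 add0r => ->.
    rewrite primE; apply: eq_Rintegral => s _; rewrite indic_itv in_itv/=.
    have [_|ts] := leP s t; first by rewrite mulr1.
    by rewrite g0 ?mul0r// (lt_trans h1)// (lt_le_trans ts)// ler_norm.
  split; last by apply: aeS key => v [].
  apply: aeS2 Hs key => v Hv [cv _]; apply: aeS Hv => t Ht tA.
  by rewrite Ht// cv add0r.
Qed.

(** Two compactly supported functions of L^2 can be integrated by parts along
    a coordinate: on almost every line both are primitives of their weak
    derivatives, which have integral zero. *)
Lemma space_parts u g u2 g2 : cube_supported u -> cube_supported g ->
  cube_supported u2 -> cube_supported g2 ->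
  L1 (leb n.+1) u -> L1 (leb n.+1) g -> L1 (leb n.+1) u2 -> L1 (leb n.+1) g2 ->
  L2 (leb n.+1) u -> L2 (leb n.+1) g -> L2 (leb n.+1) u2 -> L2 (leb n.+1) g2 ->
  weak_pd_space u g -> weak_pd_space u2 g2 ->
  \int[leb n.+1]_x (g x * u2 x + g2 x * u x) = 0.
Proof.
move=> su sg su2 sg2 lu lg lu2 lg2 l2u l2g l2u2 l2g2 ug ug2.
have l1 := L1D (L2M l2g l2u2) (L2M l2g2 l2u).
rewrite (int_insrv i); last exact: L1_meas l1.
have lL := L1_line l1.
transitivity (\int[mm]_z ((fun t v => line g t v * line u2 t v + line g2 t v * line u t v) z.1 z.2)).
  by apply: eq_Rintegral => -[].
have -> := @fub2 _ _ _ _ _ mu (leb n) (fun t v => line g t v * line u2 t v + line g2 t v * line u t v) lL.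
rewrite -[RHS](@int0 _ _ R (leb n)); apply: int_ae => //.
  exact: L1_meas (@fub_L1_2 _ _ (measurableTypeR R) _ R mu (leb n) (fun t v => line g t v * line u2 t v + line g2 t v * line u t v) lL).
have [r1 z1] := line_repr su sg lu lg ug.
have [r2 z2] := line_repr su2 sg2 lu2 lg2 ug2.
apply: aeS2 (aeS2 (fun v p q => conj p q) (aeS2 (fun v p q => conj p q) r1 z1) (aeS2 (fun v p q => conj p q) r2 z2))
  (aeS2 (fun v p q => conj p q) (fub_ae2 (L1_line lg)) (fub_ae2 (L1_line lg2))).
move=> v [[e1 i1] [e2 i2]] [lg1v lg2v].
have := prim_parts lg1v lg2v; rewrite i1 mul0r.
have mprim (f : E -> R) : L1 (leb n.+1) f -> measurable_fun [set: measurableTypeR R] (fun t => prim (fun s => f (insrv i (s, v))) t).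
  move=> lf; exact: (@measurable_curry2 _ _ (measurableTypeR R) _ R (fun t w => prim (fun s => f (insrv i (s, w))) t) v (measurable_prim (L1_meas (L1_line lf)))).
have ml (f : E -> R) : L1 (leb n.+1) f -> measurable_fun [set: measurableTypeR R] (fun t => f (insrv i (t, v))).
  by move=> lf; exact: (@measurable_curry2 _ _ (measurableTypeR R) _ R (line f) v (L1_meas (L1_line lf))).
have lp (f h : E -> R) : L1 (leb n.+1) f -> L1 (leb n.+1) h -> L1 mu (fun t => f (insrv i (t, v))) ->
   L1 mu (fun t => h (insrv i (t, v))) -> L1 mu (fun s => f (insrv i (s, v)) * prim (fun s => h (insrv i (s, v))) s).
  move=> lf lh lfv lhv; apply: (L1_M_bounded (mprim h lh) _ lfv) => t; exact: prim_le_norm.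
rewrite -intD; [|exact: lp|exact: lp] => <-.
apply: int_ae.
- by apply: measurable_funD; apply: measurable_funM; exact: ml.
- by apply: measurable_funD; apply: measurable_funM; [exact: ml|exact: mprim|exact: ml|exact: mprim].
- apply: aeS2 e1 e2 => t h1 h2.
  have [tA|tA] := boolP (- A < t < A); first by rewrite h1// h2.
  by rewrite (supported_line v sg tA) (supported_line v sg2 tA) !mul0r.
Qed.

End lines.

(** * The product rule for weak derivatives *)

Lemma box_finite {R : realType} n (a b : 'rV[R]_n) : (leb n (box a b) < +oo)%E.
Proof.
elim: n a b => [|n IH] a b.
  by rewrite /= /dirac indicE; case: (_ \in _); rewrite ltry.
have -> : leb n.+1 (box a b) = (lebesgue_measure `]a ord0 ord0, b ord0 ord0[%classic *
   leb n (box (\row_j a ord0 (lift ord0 j)) (\row_j b ord0 (lift ord0 j))))%E.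
  rewrite -product_measure1E//; last exact: measurable_box.
  congr (product_measure1 _ _ _); apply/seteqP; split => -[t v] /=.
    move=> H; split; first by have := H ord0; rewrite /= mxE unlift_none in_itv.
    by move=> k; have := H (lift ord0 k); rewrite !mxE liftK.
  rewrite in_itv => -[H0 H] k; rewrite mxE.
  by case: unliftP => [j ->|->] //=; have := H j; rewrite !mxE.
rewrite lte_mul_pinfty//.
- by rewrite lebesgue_measure_itv/=; case: ifP => // _; rewrite -EFinB.
Qed.

Section domain.
Context {R : realType} {N : nat}.
Variable Om : set 'rV[R]_N.
Hypotheses (hN : (0 < N)%N) (Om_open : open Om) (Om_bounded : bounded_set Om).
Local Notation E := 'rV[R]_N.
Local Notation lb := (leb N).

Lemma bounded_in_cube : exists2 A : R, 0 < A & forall x, Om x -> forall k, `|x ord0 k| <= A.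
Proof.
have [M [Mr HM]] := Om_bounded; exists (Num.max M 0 + 1).
  by rewrite ltr_wpDl// le_max lexx orbT.
have MM : M < Num.max M 0 + 1 by rewrite ltr_pwDr// le_max lexx.
move=> x /(HM _ MM) /= xM k; apply: le_trans xM.
by rewrite [leRHS]/Num.Def.normr/= mx_normrE; apply/bigmax_geP; right => /=; exists (ord0, k).
Qed.

Lemma measurable_Om : measurable Om.
Proof. exact: open_measurable_rV. Qed.

Lemma extMl (u f : E -> R) x : ext Om (fun y => f y * u y) x = f x * ext Om u x.
Proof. by rewrite /ext mulrA. Qed.

Lemma extMr (u f : E -> R) x : ext Om (fun y => u y * f y) x = ext Om u x * f x.
Proof. by rewrite /ext mulrAC. Qed.

Lemma extDx (u f : E -> R) x : ext Om (fun y => u y + f y) x = ext Om u x + ext Om f x.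
Proof. by rewrite /ext mulrDl. Qed.

Lemma L1_indic_box (a b : E) : L1 lb (\1_(box a b)).
Proof.
apply/integrableP; split; first by apply/measurable_EFinP; apply: measurable_indic; exact: measurable_box.
under eq_integral => x _ do rewrite /= ger0_norm ?indicE//.
rewrite (_ : (\int[lb]_x _)%E = lb (box a b)); first exact: box_finite.
by rewrite -(setIT (box a b)) -integral_indic ?setIT//; exact: measurable_box.
Qed.

Lemma L1_indic_cube (A : R) (f : E -> R) : L1 lb f \/ L2 lb f -> cube_supported A f -> L1 lb f.
Proof.
move=> [//|[mf lf]] sf.
pose B := box (const_mx (- (A + 1)) : E) (const_mx (A + 1)).
apply: (L1_le mf _ (L1D (L1_indic_box (const_mx (- (A + 1))) (const_mx (A + 1))) lf)) => x.
have [fx|fx] := eqVneq (f x) 0.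
  by rewrite fx normr0 addr_ge0// ?sqr_ge0// indicE.
rewrite indicE mem_set/=; last first.
  move=> k; rewrite !mxE -ltr_norml; apply: le_lt_trans (sf _ fx k) _.
  by rewrite ltrDl.
rewrite -[f x ^+ 2]real_normK ?num_real//.
have := sqr_ge0 (`|f x| - 1); have := normr_ge0 (f x); nra.
Qed.

Lemma test_supp (chi : E -> R) : test_fun Om chi -> forall x, ~ Om x -> chi x = 0.
Proof.
move=> [_ _ sO] x xO; apply: contrapT => /eqP cx; apply: xO; apply: sO.
exact: subset_closure.
Qed.

Lemma test_pd (chi : E -> R) i : test_fun Om chi -> test_fun Om (pd i chi).
Proof.
move=> [sc cc sO].
have sub : [set x | pd i chi x != 0] `<=` closure [set x | chi x != 0].
  move=> x /=; apply: contra_neqP => nx; apply: pd_near0.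
  have : nbhs x (~` closure [set x | chi x != 0]).
    by apply: open_nbhs_nbhs; split; first exact/closed_openC/closed_closure.
  apply: filterS => y ny; apply/eqP; apply: contra_notT ny => ny.
  exact: subset_closure.
have csub : closure [set x | pd i chi x != 0] `<=` closure [set x | chi x != 0].
  rewrite [X in _ `<=` X](closure_id _).1; [exact: closure_subset|exact: closed_closure].
split; [exact: smooth_pd| |exact: subset_trans sO].
by apply: subclosed_compact cc csub; exact: closed_closure.
Qed.

Lemma test_bounded (chi : E -> R) : test_fun Om chi ->
  exists2 M : R, 0 < M & forall x, `|chi x| <= M.
Proof.
move=> [sc cc sO].
have [M M0 HM] := compact_continuous_bounded cc (smooth_continuous sc).
exists M => // x; have [->|cx] := eqVneq (chi x) 0; first by rewrite normr0 ltW.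
by apply: HM; exact: subset_closure.
Qed.

Lemma smooth_bounded_Om (f : E -> R) : smooth f ->
  exists2 M : R, 0 < M & forall x, Om x -> `|f x| <= M.
Proof.
move=> sf; have [A A0 HA] := bounded_in_cube.
have [M M0 HM] := compact_continuous_bounded
   (@compact_cbox R N (const_mx (- A)) (const_mx A)) (smooth_continuous sf).
by exists M => // x /HA xA; apply: HM => k; rewrite !mxE -ler_norml.
Qed.

Lemma measurable_smooth (f : E -> R) : smooth f -> measurable_fun setT f.
Proof. by move=> sf; apply: continuous_measurable_rV; exact: smooth_continuous. Qed.

Lemma L2_test (chi u : E -> R) : test_fun Om chi -> L2 lb u -> L2 lb (fun x => chi x * u x).
Proof.
move=> tc; have [M M0 HM] := test_bounded tc; apply: L2_bounded HM.
by case: tc => sc _ _; exact: measurable_smooth.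
Qed.

Lemma L2_smooth (f u : E -> R) : smooth f -> L2 lb (ext Om u) ->
  L2 lb (ext Om (fun x => f x * u x)).
Proof.
move=> sf lu; have [M M0 HM] := smooth_bounded_Om sf.
rewrite (_ : ext _ _ = fun x => ext Om u x * f x); last first.
  by apply/funext => x; rewrite extMl mulrC.
apply: (L2_M_bounded_supp (ltW M0)) => //; first exact: measurable_smooth.
move=> x ux; apply: HM; apply: contra_neqP ux; exact: ext_out.
Qed.

End domain.

Section product_rule.
Context {R : realType} {N : nat}.
Variable Om : set 'rV[R]_N.
Hypotheses (hN : (0 < N)%N) (Om_open : open Om) (Om_bounded : bounded_set Om).
Local Notation E := 'rV[R]_N.
Local Notation lb := (leb N).

(** After multiplication by test functions both factors extend by zero to the
    whole space; the product rule then follows from the integration by parts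
    along lines, without approximation by smooth functions. *)
Lemma local_parts i (u u' v v' chi1 chi2 : E -> R) :
  L2 lb (ext Om u) -> L2 lb (ext Om u') -> L2 lb (ext Om v) -> L2 lb (ext Om v') ->
  weak_pd Om i u u' -> weak_pd Om i v v' -> test_fun Om chi1 -> test_fun Om chi2 ->
  \int[lb]_x (pd i (fun y => chi1 y * chi2 y) x * (ext Om u x * ext Om v x) +
     chi1 x * chi2 x * (ext Om u' x * ext Om v x + ext Om u x * ext Om v' x)) = 0.
Proof.
case: N i u u' v v' chi1 chi2 Om hN Om_open Om_bounded => [//|n] i u u' v v' chi1 chi2 D _ oD bD.
move=> lu lu' lv lv' wu wv t1 t2.
have [A0 A00 HA] := bounded_in_cube bD.
pose U (w chi : 'rV[R]_n.+1 -> R) := fun x => chi x * ext D w x.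
pose G (w w' chi : 'rV[R]_n.+1 -> R) := fun x => chi x * ext D w' x + pd i chi x * ext D w x.
have supp (w chi : 'rV[R]_n.+1 -> R) : cube_supported A0 (U w chi).
  move=> x; rewrite /U => h; apply: HA; apply: contra_neqP h => h; by rewrite ext_out// mulr0.
have suppG (w w' chi : 'rV[R]_n.+1 -> R) : cube_supported A0 (G w w' chi).
  move=> x; rewrite /G => h; apply: HA; apply: contra_neqP h => h.
  by rewrite !ext_out// !mulr0 addr0.
have l2U w chi : test_fun D chi -> L2 (leb n.+1) (ext D w) -> L2 (leb n.+1) (U w chi).
  by move=> tc lw; exact: L2_test tc lw.
have l2G w w' chi : test_fun D chi -> L2 (leb n.+1) (ext D w) -> L2 (leb n.+1) (ext D w') ->
    L2 (leb n.+1) (G w w' chi).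
  move=> tc lw lw'; apply: L2D; first exact: L2_test tc lw'.
  exact: L2_test (test_pd i tc) lw.
have weakG w w' chi : test_fun D chi -> L2 (leb n.+1) (ext D w) -> L2 (leb n.+1) (ext D w') ->
    weak_pd D i w w' -> weak_pd_space i (U w chi) (G w w' chi).
  move=> tc lw lw' ww psi sp.
  have tcp := test_funM tc sp.
  have l1 (f h : 'rV[R]_n.+1 -> R) : cube_supported A0 f -> L2 (leb n.+1) f -> smooth h ->
      L1 (leb n.+1) (fun x => f x * h x).
    move=> cf lf sh; apply: (L1_cube_cont cf) => //.
      by apply: (L1_indic_cube _ cf); right.
    exact: smooth_continuous.
  have := ww _ tcp; rewrite int_ext [X in - X]int_ext.
  have sc : smooth chi by case: tc.
  have -> : \int[leb n.+1]_x ext D (fun x => w x * pd i (fun y => chi y * psi y) x) x =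
     \int[leb n.+1]_x (U w chi x * pd i psi x) + \int[leb n.+1]_x (pd i chi x * ext D w x * psi x).
    rewrite -intD; last 2 first.
    - by apply: (l1 _ _ (supp w chi)); [exact: l2U|exact: smooth_pd].
    - apply: (l1 _ _ (supp w (pd i chi))) => //; apply: l2U => //; exact: test_pd.
    apply: eq_Rintegral => x _; rewrite extMr pdM; [|exact: smooth_derivable|exact: smooth_derivable].
    rewrite /U; ring.
  have -> : \int[leb n.+1]_x ext D (fun x => w' x * (chi x * psi x)) x =
     \int[leb n.+1]_x (chi x * ext D w' x * psi x).
    by apply: eq_Rintegral => x _; rewrite extMr; ring.
  move=> /eqP; rewrite -subr_eq0 => /eqP h.
  have -> : \int[leb n.+1]_x (G w w' chi x * psi x) =
     \int[leb n.+1]_x (chi x * ext D w' x * psi x) + \int[leb n.+1]_x (pd i chi x * ext D w x * psi x).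
    rewrite -intD; last 2 first.
    - by apply: (l1 _ _ (supp w' chi)) => //; exact: l2U.
    - apply: (l1 _ _ (supp w (pd i chi))) => //; apply: l2U => //; exact: test_pd.
    by apply: eq_Rintegral => x _; rewrite /G mulrDl.
  by move: h; lra.
have l1 f : cube_supported A0 f -> L2 (leb n.+1) f -> L1 (leb n.+1) f.
  by move=> sf lf; apply: (L1_indic_cube _ sf); right.
have A0A : A0 < A0 + 1 by rewrite ltrDl.
have := @space_parts R n i A0 (A0 + 1) A00 A0A (U u chi1) (G u u' chi1) (U v chi2) (G v v' chi2)
  (supp _ _) (suppG _ _ _) (supp _ _) (suppG _ _ _)
  (l1 _ (supp _ _) (l2U _ _ t1 lu)) (l1 _ (suppG _ _ _) (l2G _ _ _ t1 lu lu'))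
  (l1 _ (supp _ _) (l2U _ _ t2 lv)) (l1 _ (suppG _ _ _) (l2G _ _ _ t2 lv lv'))
  (l2U _ _ t1 lu) (l2G _ _ _ t1 lu lu') (l2U _ _ t2 lv) (l2G _ _ _ t2 lv lv')
  (weakG _ _ _ t1 lu lu' wu) (weakG _ _ _ t2 lv lv' wv).
move=> <-; apply: eq_Rintegral => x _.
rewrite pdM; [|by case: t1 => ? _ _; exact: smooth_derivable|by case: t2 => ? _ _; exact: smooth_derivable].
rewrite /G /U; ring.
Qed.

End product_rule.

(** * Defining functions and normals of a smooth domain *)

Section geometry.
Context {R : realType} {N : nat}.
Local Notation E := 'rV[R]_N.
Implicit Types (f h : E -> R) (x y d : E).

Lemma half_lt (m : R) : 0 < m -> m / 2 < m.
Proof. by move=> m0; lra. Qed.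

Lemma nbhs_coord (x : E) (P : E -> Prop) : (\forall y \near x, P y) <->
  exists2 r : R, 0 < r & forall y : E, (forall k, `|y ord0 k - x ord0 k| < r) -> P y.
Proof.
split.
  move=> /nbhs_ballP[r /= r0 H]; exists r => // y yx; apply: H.
  rewrite nbhs_ball_box// => k; rewrite !mxE.
  by have := yx k; rewrite ltr_norml; lra.
move=> [r r0 H]; apply/nbhs_ballP; exists r => // y.
rewrite nbhs_ball_box// => yx; apply: H => k.
have := yx k; rewrite !mxE ltr_norml; lra.
Qed.

Lemma line_mvt f k x (c : R) : smooth f -> exists t : R, (0 <= t <= c) || (c <= t <= 0) /\
  f (c *: basis_vec k + x) - f x = c * pd k f (t *: basis_vec k + x).
Proof.
move=> sf; pose g (t : R) := f (t *: basis_vec k + x).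
have dg (t : R) : is_derive t 1 g (pd k f (t *: basis_vec k + x)).
  by apply: is_derive_line; exact: smooth_derivable.
have cg : continuous g.
  by move=> t; apply: differentiable_continuous; apply/derivable1_diffP; apply: ex_derive.
have g0 : g 0 = f x by rewrite /g scale0r add0r.
have [c0|c0] := leP 0 c.
  have [|t + e] := @MVT_segment R g (fun t => pd k f (t *: basis_vec k + x)) 0 c c0 (fun t _ => dg t).
    exact: continuous_subspaceT.
  rewrite in_itv/= => tc; exists t; rewrite tc; split => //.
  by rewrite -g0 -/(g c) e subr0 mulrC.
have [|t + e] := @MVT_segment R g (fun t => pd k f (t *: basis_vec k + x)) c 0 (ltW c0) (fun t _ => dg t).
  exact: continuous_subspaceT.
rewrite in_itv/= => tc; exists t; rewrite tc orbT; split => //.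
by rewrite -g0 -/(g c) -opprB e sub0r; ring.
Qed.

(** Moving one coordinate at a time expresses an increment through partial
    derivatives at points of the box spanned by the two end points. *)
Lemma mean_value f x y : smooth f -> exists2 z : 'I_N -> E,
  forall k j, `|z k ord0 j - x ord0 j| <= `|y ord0 j - x ord0 j| &
  f y - f x = \sum_k (y ord0 k - x ord0 k) * pd k f (z k).
Proof.
move=> sf; pose p (m : nat) : E := \row_j if (j < m)%N then y ord0 j else x ord0 j.
have pS (k : 'I_N) : p k.+1 = (y ord0 k - x ord0 k) *: basis_vec k + p k.
  apply/rowP => j; rewrite !mxE eqxx/= ltnS leq_eqVlt.
  have [->|jk] := eqVneq j k; first by rewrite eqxx ltnn mulr1 subrK.
  by rewrite [(j == k :> nat)](_ : _ = false) ?mulr0 ?add0r//; exact/negbTE.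
have step_ (k : 'I_N) : exists z : E, (forall j, `|z ord0 j - x ord0 j| <= `|y ord0 j - x ord0 j|) /\
    f (p k.+1) - f (p k) = (y ord0 k - x ord0 k) * pd k f z.
  have [t [tc e]] := line_mvt k (p k) (y ord0 k - x ord0 k) sf.
  exists (t *: basis_vec k + p k); split; last by rewrite pS.
  move=> j; rewrite !mxE eqxx/=; have [->|jk] := eqVneq j k.
    rewrite ltnn mulr1 addrK; case/orP: tc => /andP[t0 t1].
      by rewrite !ger0_norm// (le_trans t0).
    by rewrite !ler0_norm ?lerN2// (le_trans t0).
  by rewrite mulr0 add0r; case: ifP => // _; rewrite subrr normr0.
pose z k := xget x [set z : E | (forall j, `|z ord0 j - x ord0 j| <= `|y ord0 j - x ord0 j|) /\
    f (p (k : 'I_N).+1) - f (p k) = (y ord0 k - x ord0 k) * pd k f z].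
have zP k : (forall j, `|z k ord0 j - x ord0 j| <= `|y ord0 j - x ord0 j|) /\
    f (p (k : 'I_N).+1) - f (p k) = (y ord0 k - x ord0 k) * pd k f (z k).
  by rewrite /z; case: xgetP => [_ -> //|/(_ _) nz]; have [w] := step_ k; move/nz.
exists z; first by move=> k; have [] := zP k.
have -> : f y - f x = \sum_(0 <= k < N) (f (p k.+1) - f (p k)).
  rewrite telescope_sumr//; congr (f _ - f _); apply/rowP => j; rewrite mxE //.
  by rewrite ltn_ord.
by rewrite big_mkord; apply: eq_bigr => k _; have [] := zP k.
Qed.

Lemma pd_near h x (e : R) : smooth h -> 0 < e ->
  \forall y \near x, forall k, `|pd k h y - pd k h x| < e.
Proof.
move=> sh e0.
have H k : \forall y \near x, `|pd k h y - pd k h x| < e.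
  have sc : continuous (pd k h) := smooth_continuous (@smooth_pd _ _ h k sh).
  move: (sc x) => /cvgrPdist_lt/(_ _ e0).
  by apply: filterS => y; rewrite distrC.
exact: (@filter_forall _ _ (fun k y => `|pd k h y - pd k h x| < e) (nbhs x) _ H).
Qed.

Lemma direction_pos h x d : smooth h -> h x = 0 -> 0 < \sum_k d ord0 k * pd k h x ->
  exists2 r : R, 0 < r & forall t : R, 0 < t < r -> 0 < h (t *: d + x).
Proof.
move=> sh hx; set s := \sum_k _ => s0.
pose D := 1 + \sum_k `|d ord0 k|.
have D0 : 0 < D by rewrite ltr_wpDr// sumr_ge0.
have eD : 0 < s / D by rewrite divr_gt0.
have /nbhs_coord[r r0 H] := pd_near x sh eD.
exists (r / D); first by rewrite divr_gt0.
move=> t /andP[t0 tr].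
have [z zx hz] := mean_value x (t *: d + x) sh.
move: hz; rewrite hx subr0 => ->.
have dk k : `|d ord0 k| <= D.
  rewrite /D (bigD1 k)//= addrCA lerDl addr_ge0// sumr_ge0//.
have zr k j : `|z k ord0 j - x ord0 j| < r.
  apply: le_lt_trans (zx k j) _; rewrite !mxE addrK normrM (gtr0_norm t0).
  apply: le_lt_trans (_ : t * D < r); first by rewrite ler_pM2l.
  by rewrite -ltr_pdivlMr.
rewrite (_ : \sum_k _ = t * \sum_k (d ord0 k * pd k h (z k))); last first.
  by rewrite mulr_sumr; apply: eq_bigr => k _; rewrite !mxE addrK mulrA.
rewrite pmulr_rgt0//.
have -> : \sum_k d ord0 k * pd k h (z k) = s + \sum_k d ord0 k * (pd k h (z k) - pd k h x).
  by rewrite -big_split/=; apply: eq_bigr => k _; ring.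
have : `|\sum_k d ord0 k * (pd k h (z k) - pd k h x)| <= (\sum_k `|d ord0 k|) * (s / D).
  apply: le_trans (ler_norm_sum _ _ _) _; rewrite mulr_suml; apply: ler_sum => k _.
  rewrite normrM ler_wpM2l//; apply/ltW/H; exact: zr.
rewrite ler_norml => /andP[h1 _].
have h2 : (\sum_k `|d ord0 k|) * (s / D) < s.
  have -> : \sum_k `|d ord0 k| = D - 1 by rewrite /D addrAC subrr add0r.
  by rewrite mulrBl mul1r mulrCA divff ?gt_eqF// mulr1 ltrBlDr ltrDl.
by move: h1 h2; lra.
Qed.

Lemma unit_vectors_eq (p q : 'I_N -> R) : \sum_k p k ^+ 2 = 1 -> \sum_k q k ^+ 2 = 1 ->
  (forall d : 'I_N -> R, \sum_k d k * p k < 0 -> \sum_k d k * q k <= 0) -> p =1 q.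
Proof.
move=> p1 q1 H; pose c := \sum_k p k * q k.
have lin (al be : R) (v : 'I_N -> R) : \sum_k (al * p k + be * q k) * v k =
    al * (\sum_k p k * v k) + be * (\sum_k q k * v k).
  by rewrite !mulr_sumr -big_split/=; apply: eq_bigr => k _; ring.
have pp : \sum_k p k * p k = 1 by rewrite -p1; apply: eq_bigr => k _; rewrite expr2.
have qq : \sum_k q k * q k = 1 by rewrite -q1; apply: eq_bigr => k _; rewrite expr2.
have qp : \sum_k q k * p k = c by apply: eq_bigr => k _; exact: mulrC.
have sq (s : R) : \sum_k (p k + s * q k) ^+ 2 = 1 + 2 * s * c + s ^+ 2.
  transitivity (\sum_k ((p k ^+ 2 + 2 * s * (p k * q k)) + s ^+ 2 * q k ^+ 2)).
    by apply: eq_bigr => k _; ring.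
  by rewrite !big_split/= -!mulr_sumr p1 q1 mulr1.
have sq0 s : 0 <= 1 + 2 * s * c + s ^+ 2.
  by rewrite -sq sumr_ge0// => k _; exact: sqr_ge0.
have c1 : c <= 1 by have := sq0 (-1); lra.
have cN1 : - 1 <= c by have := sq0 1; lra.
have {c1}c1 : c = 1.
  apply/eqP; rewrite eq_le c1/= leNgt; apply/negP => c1'.
  have := H (fun k => - ((1 + c) / 2) * p k + 1 * q k).
  by rewrite !lin pp qq qp -/c => /(_ _); nra.
have := sq (-1); rewrite c1 (_ : 1 + _ + _ = 0); last by ring.
move=> /eqP; rewrite psumr_eq0; last by move=> k _; exact: sqr_ge0.
move=> /allP pq k; have /pq : k \in index_enum 'I_N by rewrite mem_index_enum.
by rewrite /= sqrf_eq0 mulN1r subr_eq0 => /eqP.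
Qed.

Lemma normalize_unit (a : 'I_N -> R) i : a i != 0 ->
  0 < euclid_norm a /\ \sum_k (a k / euclid_norm a) ^+ 2 = 1.
Proof.
move=> ai; have S0 : 0 < \sum_k a k ^+ 2.
  rewrite (bigD1 i)//= ltr_wpDr ?sumr_ge0// => [k _|]; first exact: sqr_ge0.
  by rewrite exprn_even_gt0.
split; first by rewrite /euclid_norm sqrtr_gt0.
under eq_bigr do rewrite exprMn.
rewrite -mulr_suml exprVn /euclid_norm sqr_sqrtr ?ltW// divff//.
by rewrite gt_eqF.
Qed.

(** Two functions that are negative on the same side of a boundary point have
    positively proportional gradients there: a direction decreasing the one
    cannot increase the other. *)
Lemma normal_unique h h' x i i' : smooth h -> smooth h' -> h x = 0 -> h' x = 0 ->
  pd i h x != 0 -> pd i' h' x != 0 -> (\forall y \near x, h y < 0 <-> h' y < 0) ->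
  forall k, pd k h x / euclid_norm (fun j => pd j h x) =
            pd k h' x / euclid_norm (fun j => pd j h' x).
Proof.
move=> sh sh' hx hx' hi hi' nr.
have [n0 u1] := normalize_unit (a := fun j => pd j h x) hi.
have [n0' u1'] := normalize_unit (a := fun j => pd j h' x) hi'.
apply: (unit_vectors_eq u1 u1') => d.
under eq_bigr do rewrite mulrA; rewrite -mulr_suml => dh.
under eq_bigr do rewrite mulrA; rewrite -mulr_suml pmulr_lle0 ?invr_gt0//.
rewrite leNgt; apply/negP => dh'.
move: dh; rewrite pmulr_llt0 ?invr_gt0// => dh.
pose D : E := \row_k d k.
have [||r r0 H] := @direction_pos (fun y => - h y) x D (smoothN sh).
- by rewrite hx oppr0.
- rewrite (_ : \sum_k _ = - \sum_k d k * pd k h x) ?oppr_gt0//.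
  rewrite -sumrN; apply: eq_bigr => k _; rewrite mxE -mulrN; congr (_ * _).
  have -> : (fun y => - h y) = (fun y => (-1) * h y) by apply/funext => y; rewrite mulN1r.
  rewrite pdM; [|exact/smooth_derivable/smooth_cst|exact: smooth_derivable].
  by rewrite pd_cst mul0r add0r mulN1r.
have [|r' r0' H'] := @direction_pos h' x D sh' hx'.
  by rewrite (_ : \sum_k _ = \sum_k d k * pd k h' x)//; apply: eq_bigr => k _; rewrite mxE.
have /nbhs_coord[r2 r20 H2] := nr.
pose S := 1 + \sum_k `|d k|.
have S0 : 0 < S by rewrite ltr_wpDr// sumr_ge0.
pose t := Num.min (Num.min r r') (r2 / S) / 2.
have m0 : 0 < Num.min (Num.min r r') (r2 / S) by rewrite !lt_min r0 r0' divr_gt0.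
have t0 : 0 < t by rewrite divr_gt0.
have tm : t < Num.min (Num.min r r') (r2 / S) by exact: half_lt.
move: tm; rewrite !lt_min => /andP[/andP[tr tr'] tr2].
have := H t; rewrite t0 tr oppr_gt0 => /(_ isT) hn.
have := H' t; rewrite t0 tr' => /(_ isT) hp.
have /H2 : forall k, `|(t *: D + x) ord0 k - x ord0 k| < r2.
  move=> k; rewrite !mxE addrK normrM (gtr0_norm t0).
  apply: le_lt_trans (_ : t * S < r2); last by rewrite -ltr_pdivlMr.
  by rewrite ler_pM2l// /S (bigD1 k)//= addrCA lerDl addr_ge0// sumr_ge0.
by move=> [/(_ hn) hn' _]; rewrite ltNge (ltW hp) in hn'.
Qed.

Lemma pdN h i x : smooth h -> pd i (fun y => - h y) x = - pd i h x.
Proof.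
move=> sh; have -> : (fun y => - h y) = (fun y => (-1) * h y) by apply/funext => y; rewrite mulN1r.
rewrite pdM; [|exact/smooth_derivable/smooth_cst|exact: smooth_derivable].
by rewrite pd_cst mul0r add0r mulN1r.
Qed.

Lemma continuous_near h x (e : R) : smooth h -> 0 < e -> \forall y \near x, `|h y - h x| < e.
Proof.
move=> sh e0; have sc : continuous h by exact: smooth_continuous.
by move: (sc x) => /cvgrPdist_lt/(_ _ e0); apply: filterS => y; rewrite distrC.
Qed.

Lemma boundary_zero (Om : set E) x h : open Om -> boundary Om x -> local_defining Om x h -> h x = 0.
Proof.
move=> oO [cx nx] [sh _ Hx]; have nOx : ~ Om x by move=> Ox; apply: nx; exact: open_nbhs_nbhs.
have h0 : ~ h x < 0 by move=> /(nbhs_singleton Hx).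
apply/eqP; rewrite eq_le [X in _ && X]leNgt; apply/andP; split; last exact/negP.
rewrite leNgt; apply/negP => hx.
have hx2 : 0 < h x / 2 by rewrite divr_gt0.
have [y [Oy [[Hy _] hy]]] := cx _ (filterI Hx (continuous_near x sh hx2)).
by have := Hy Oy; move: hy; rewrite ltr_norml; lra.
Qed.

Lemma zero_boundary (Om : set E) x h i : smooth h -> h x = 0 -> pd i h x != 0 ->
  (\forall y \near x, Om y <-> h y < 0) -> boundary Om x.
Proof.
move=> sh hx hi Hx; split; last first.
  by move=> /nbhs_singleton /(nbhs_singleton Hx); rewrite hx ltxx.
move=> B Bx; have /nbhs_coord[r r0 H] : \forall y \near x, (Om y <-> h y < 0) /\ B y by exact: filterI.
pose D : E := \row_k if k == i then - Num.sg (pd i h x) else 0.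
have [||s s0 Hs] := @direction_pos (fun y => - h y) x D (smoothN sh).
  by rewrite hx oppr0.
  rewrite (bigD1 i)//= big1 ?addr0; last by move=> k /negbTE ki; rewrite mxE ki mul0r.
  by rewrite mxE eqxx pdN// mulrNN -normrEsg normr_gt0.
pose t := Num.min r s / 2.
have m0 : 0 < Num.min r s by rewrite lt_min r0.
have t0 : 0 < t by rewrite divr_gt0.
have tm : t < Num.min r s by exact: half_lt.
move: tm; rewrite lt_min => /andP[tr ts].
exists (t *: D + x).
have [|[_ Oy] By] := H (t *: D + x).
  move=> k; rewrite !mxE addrK; case: ifP => _; last by rewrite mulr0 normr0.
  by rewrite normrM normrN (gtr0_norm t0) normr_sg hi mulr1.
by split => //; apply: Oy; have := Hs t; rewrite t0 ts oppr_gt0 => ->.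
Qed.

(** Along the boundary the gradient of a defining function is normal; hence
    its tangential part is at most a multiple of the distance to the boundary,
    which is comparable to the defining function itself. *)
Lemma tangential_gradient (Om : set E) (nu : E -> E) x h : open Om -> normal_extension Om nu ->
  boundary Om x -> local_defining Om x h ->
  exists2 C : R, 0 < C & \forall y \near x, forall j,
    `|pd j h y - (\sum_k nu y ord0 k * pd k h y) * nu y ord0 j| <= C * `|h y|.
Proof.
move=> oO [snu Hnu] bx ld; have hx := boundary_zero oO bx ld.
have [sh [i hi] Hx] := ld.
pose tau j y := pd j h y - (\sum_k nu y ord0 k * pd k h y) * nu y ord0 j.
have stau j : smooth (tau j).
  apply: (@smoothB _ _ (pd j h) (fun y => (\sum_k nu y ord0 k * pd k h y) * nu y ord0 j)).
    exact: smooth_pd.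
  apply: (@smoothM _ _ (fun y => \sum_k nu y ord0 k * pd k h y) (fun y => nu y ord0 j)); last exact: snu.
  apply: (@smooth_sum _ _ _ _ _ (fun k y => nu y ord0 k * pd k h y)) => k.
  by apply: (@smoothM _ _ (fun y => nu y ord0 k)); [exact: snu|exact: smooth_pd].
pose c := `|pd i h x| / 2.
have c0 : 0 < c by rewrite divr_gt0// normr_gt0.
have l01 : 0 < 1 :> R by [].
have nrtau : \forall y \near x, forall j k, `|pd k (tau j) y - pd k (tau j) x| < 1.
  apply: (@filter_forall _ _ (fun j y => forall k, `|pd k (tau j) y - pd k (tau j) x| < 1) (nbhs x)) => j.
  exact: pd_near (stau j) l01.
have /nbhs_coord[r r0 H] : \forall y \near x, (\forall z \near y, Om z <-> h z < 0) /\
    (forall k, `|pd k h y - pd k h x| < c) /\ (forall j k, `|pd k (tau j) y - pd k (tau j) x| < 1).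
  exact: filterI (nbhs_interior Hx) (filterI (pd_near x sh c0) nrtau).
pose M := 1 + \sum_j `|pd i (tau j) x|.
have M0 : 0 < M by rewrite ltr_wpDr// sumr_ge0.
exists (M / c); first by rewrite divr_gt0.
have rc0 : 0 < c * (r / 2) by rewrite mulr_gt0// divr_gt0.
have r20 : 0 < r / 2 by rewrite divr_gt0.
have nr2 : nbhs x [set y : E | forall k, `|y ord0 k - x ord0 k| < r / 2].
  by apply/nbhs_coord; exists (r / 2).
apply: filterS (filterI (continuous_near x sh rc0) nr2) => y [hy yx] j.
rewrite hx subr0 in hy.
pose t0 := `|h y| / c.
have t00 : 0 <= t0 by rewrite divr_ge0// ltW.
have t0r : t0 < r / 2 by rewrite ltr_pdivrMr// mulrC.
have inball (t : R) : `|t| <= t0 -> forall k, `|(t *: basis_vec i + y) ord0 k - x ord0 k| < r.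
  move=> tt k; rewrite !mxE eqxx/= -addrA; apply: le_lt_trans (ler_normD _ _) _.
  have h1 : `|t * (k == i)%:R| <= t0.
    by case: eqP => _; rewrite ?mulr1// mulr0 normr0.
  by have := yx k; move: h1 t0r; lra.
pose g (t : R) := h (t *: basis_vec i + y).
have dg (t : R) : is_derive t 1 g (pd i h (t *: basis_vec i + y)).
  by apply: is_derive_line; exact: smooth_derivable.
have cg : continuous g.
  by move=> t; apply: differentiable_continuous; apply/derivable1_diffP; apply: ex_derive.
have lower (t : R) : `|t| <= t0 -> (0 < pd i h x -> c <= pd i h (t *: basis_vec i + y)) /\
   (pd i h x < 0 -> pd i h (t *: basis_vec i + y) <= - c).
  move=> /inball/H[_ [/(_ i) + _]]; rewrite /c => hh; split => px; move: hh.
    rewrite (gtr0_norm px) ltr_norml; lra.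
  rewrite (ltr0_norm px) ltr_norml; lra.
have hyc : t0 * c = `|h y| by rewrite /t0 divfK// gt_eqF.
have [t t_in gt0] : exists2 t : R, t \in `[- t0, t0] & g t = 0.
  apply: IVT; [by rewrite -subr_ge0 opprK addr_ge0|exact: continuous_subspaceT|].
  have [a [ta ea]] := line_mvt i y t0 sh; have [b [tb eb]] := line_mvt i y (- t0) sh.
  have an : `|a| <= t0.
    case/orP: ta => /andP[h1 h2]; first by rewrite ger0_norm.
    by rewrite ler0_norm//; lra.
  have bn : `|b| <= t0.
    case/orP: tb => /andP[h1 h2]; first by rewrite ger0_norm//; lra.
    by rewrite ler0_norm//; lra.
  have [la1 la2] := lower _ an; have [lb1 lb2] := lower _ bn.
  move: ea eb; rewrite -/(g t0) -/(g (- t0)) => ea eb.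
  have := ler_norm (h y); have := ler_norm (- h y); rewrite normrN -hyc => n1 n2.
  rewrite ge_min le_max; apply/andP.
  have [px|px|px0] := ltgtP (pd i h x) 0.
  - have {}la2 := la2 px; have {}lb2 := lb2 px.
    by split; apply/orP; [right|left]; nra.
  - have {}la1 := la1 px; have {}lb1 := lb1 px.
    by split; apply/orP; [left|right]; nra.
  - by rewrite px0 eqxx in hi.
have tt0 : `|t| <= t0 by rewrite ler_norml; move: t_in; rewrite in_itv.
set y' := t *: basis_vec i + y.
have hy' : h y' = 0 by exact: gt0.
have iy' : pd i h y' != 0.
  have [l1 l2] := lower _ tt0; have [px|px|px0] := ltgtP (pd i h x) 0.
  - by rewrite lt_eqF// (le_lt_trans (l2 px))// oppr_lt0.
  - by rewrite gt_eqF// (lt_le_trans c0 (l1 px)).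
  - by rewrite px0 eqxx in hi.
have [Hy' _] := H _ (inball _ tt0).
have by' := zero_boundary sh hy' iy' Hy'.
have [h' ld' nuE] := Hnu _ by'.
have hy'0 := boundary_zero oO by' ld'.
have [sh' [i' hi'] Hy2] := ld'.
have nuh k : nu y' ord0 k = pd k h y' / euclid_norm (fun j => pd j h y').
  rewrite nuE; apply/esym/(normal_unique sh sh' hy' hy'0 iy' hi').
  apply: filterS2 Hy' Hy2 => z [a1 a2] [b1 b2]; split => [/a2/b1//|/b2/a1//].
have tau0 : tau j y' = 0.
  have [n0 u1] := normalize_unit (a := fun k => pd k h y') iy'.
  rewrite /tau nuh; set e := euclid_norm _ in n0 u1 *.
  have -> : \sum_k nu y' ord0 k * pd k h y' = e.
    transitivity (e * \sum_k (pd k h y' / e) ^+ 2); last by rewrite u1 mulr1.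
    rewrite mulr_sumr; apply: eq_bigr => k _; rewrite nuh -/e.
    by field; rewrite gt_eqF.
  by rewrite mulrC divfK ?subrr// gt_eqF.
have [s [ts es]] := line_mvt i y t (stau j).
have sn : `|s| <= `|t|.
  case/orP: ts => /andP[h1 h2]; first by rewrite !ger0_norm// (le_trans h1).
  by rewrite !ler0_norm ?lerN2// (le_trans h1).
have [_ [_ /(_ j i) tb]] := H _ (inball _ (le_trans sn tt0)).
have tM : `|pd i (tau j) (s *: basis_vec i + y)| <= M.
  have h1 : `|pd i (tau j) x| <= M - 1.
    by rewrite /M addrAC subrr add0r (bigD1 j)//= lerDl sumr_ge0.
  rewrite -(subrK (pd i (tau j) x) (pd i (tau j) _)).
  by apply: le_trans (ler_normD _ _) _; move: tb h1; lra.
move: es; rewrite -/y' tau0 sub0r => es.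
rewrite -/(tau j y) -normrN es normrM mulrC mulrAC -mulrA.
by rewrite ler_pM// mulrC.
Qed.

End geometry.

(** * The divergence theorem for tangential fields *)

Lemma pd_mul {R : realType} {N : nat} (f g : 'rV[R]_N -> R) i x : smooth f -> smooth g ->
  pd i (fun y => f y * g y) x = pd i f x * g x + f x * pd i g x.
Proof. by move=> sf sg; apply: pdM; exact: (@smooth_derivable _ _ _ _ _ _). Qed.

Lemma pd_add {R : realType} {N : nat} (f g : 'rV[R]_N -> R) i x : smooth f -> smooth g ->
  pd i (fun y => f y + g y) x = pd i f x + pd i g x.
Proof. by move=> sf sg; apply: pdD; exact: (@smooth_derivable _ _ _ _ _ _). Qed.

Section divergence.
Context {R : realType} {N : nat}.
Variable Om : set 'rV[R]_N.
Hypotheses (hN : (0 < N)%N) (Om_open : open Om) (Om_bounded : bounded_set Om).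
Local Notation E := 'rV[R]_N.
Local Notation lb := (leb N).
Variables (G D dv : 'I_N -> E -> R) (v : E -> R).
Hypotheses (lG : forall i, L2 lb (ext Om (G i))) (lD : forall i, L2 lb (ext Om (D i)))
  (ldv : forall i, L2 lb (ext Om (dv i))) (lv : L2 lb (ext Om v))
  (wG : forall i, weak_pd Om i (G i) (D i)) (wv : forall i, weak_pd Om i v (dv i)).

Let A x := \sum_i (ext Om (D i) x * ext Om v x + ext Om (G i) x * ext Om (dv i) x).
Let B i x := ext Om (G i) x * ext Om v x.
Let lam (z : E -> R) x := \sum_i pd i z x * B i x + z x * A x.
Let Lam z := \int[lb]_x lam z x.

Let lA : L1 lb A.
Proof. by apply: L1_sum => i; apply: L1D; exact: L2M. Qed.

Let lB i : L1 lb (B i).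
Proof. exact: L2M. Qed.

Let A_out x : ~ Om x -> A x = 0.
Proof. by move=> xO; rewrite /A big1// => i _; rewrite !(ext_out _ xO) !mul0r addr0. Qed.

Let B_out i x : ~ Om x -> B i x = 0.
Proof. by move=> xO; rewrite /B (ext_out _ xO) mul0r. Qed.

Let L1_sm (f z : E -> R) : L1 lb f -> (forall x, ~ Om x -> f x = 0) -> smooth z ->
  L1 lb (fun x => z x * f x).
Proof.
move=> lf f0 sz; have [M M0 HM] := smooth_bounded_Om Om_bounded sz.
apply: (L1_eq (fun x => mulrC _ _)).
apply: (L1_M_bounded_supp (M := M)) => //; first exact: measurable_smooth.
move=> x fx; apply: HM; apply: contra_neqP fx; exact: f0.
Qed.

Let l1lam z : smooth z -> L1 lb (lam z).
Proof.
move=> sz; apply: L1D; last exact: L1_sm.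
apply: L1_sum => i; apply: L1_sm; [exact: lB|exact: B_out|exact: smooth_pd].
Qed.

Let lamB z1 z2 x : smooth z1 -> smooth z2 -> lam (fun y => z1 y - z2 y) x = lam z1 x - lam z2 x.
Proof.
move=> s1 s2; rewrite /lam mulrBl opprD addrACA; congr (_ + _); rewrite -sumrB; apply: eq_bigr => i _.
by rewrite (pd_add i x s1 (smoothN s2)) (pdN i x s2) mulrBl.
Qed.

Let LamB z1 z2 : smooth z1 -> smooth z2 -> Lam (fun y => z1 y - z2 y) = Lam z1 - Lam z2.
Proof.
move=> s1 s2; rewrite /Lam -intB; [|exact: l1lam|exact: l1lam].
by apply: eq_Rintegral => x _; exact: lamB.
Qed.

Let Lam_test chi1 chi2 : test_fun Om chi1 -> test_fun Om chi2 -> Lam (fun x => chi1 x * chi2 x) = 0.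
Proof.
move=> t1 t2; have s1 : smooth chi1 by case: t1.
have s2 : smooth chi2 by case: t2.
have s12 := @smoothM _ _ chi1 chi2 s1 s2.
rewrite /Lam (_ : lam _ = fun x => \sum_i (pd i (fun y => chi1 y * chi2 y) x * (ext Om (G i) x * ext Om v x) +
     chi1 x * chi2 x * (ext Om (D i) x * ext Om v x + ext Om (G i) x * ext Om (dv i) x))).
  rewrite int_sum; first by apply: big1 => i _; apply: local_parts; rewrite //.
  move=> i; apply: L1D.
    by apply: L1_sm; [exact: lB|exact: B_out|exact: smooth_pd].
  apply: L1_sm s12; first by apply: L1D; exact: L2M.
  by move=> x xO; rewrite !(ext_out _ xO) !mul0r addr0.
by apply/funext => x; rewrite /lam /A mulr_sumr -big_split.
Qed.

Let cutoff (h : E -> R) (n : nat) (y : E) := step (- n.+1%:R * h y - 1).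

Let smooth_cutoff h n : smooth h -> smooth (cutoff h n).
Proof.
move=> sh; apply: (@smooth_comp1 _ _ (fun t => step (- n.+1%:R * t - 1)) h _ sh).
apply: (@smooth1_comp _ step (fun t => - n.+1%:R * t - 1)); first exact: smooth1_step.
exact: smooth1_affine.
Qed.

Let pd_cutoff h n i y : smooth h ->
  pd i (cutoff h n) y = derive1 step (- n.+1%:R * h y - 1) * (- n.+1%:R * pd i h y).
Proof.
move=> sh; have s1 : smooth (fun y => - n.+1%:R * h y).
  by exact: (@smoothM _ _ (fun=> - n.+1%:R) h (@smooth_cst _ _ _) sh).
rewrite /cutoff (@pd_comp1 _ _ step (fun y => - n.+1%:R * h y - 1)); [|exact: smooth1_step|]; last first.
  exact: (@smoothD _ _ (fun y => - n.+1%:R * h y) (fun=> -1) s1 (@smooth_cst _ _ _)).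
congr (_ * _).
rewrite (@pd_add _ _ _ (fun=> -1) i y s1 (@smooth_cst _ _ _)).
rewrite (@pd_mul _ _ (fun=> - n.+1%:R) h i y (@smooth_cst _ _ _) sh).
by rewrite !pd_cst mul0r add0r addr0.
Qed.

Let bumpx (x : E) (r : R) m := box_bump (x - const_mx r) (x + const_mx r) m.

Let in_bumpx x r m y : bumpx x r m y != 0 -> forall k, `|y ord0 k - x ord0 k| < r.
Proof. by move=> /box_bump_in by_ k; have := by_ k; rewrite !mxE ltr_norml; lra. Qed.

Let bumpx1 x r : 0 < r -> exists m, \forall y \near x, bumpx x r m y = 1.
Proof.
move=> r0; exists (Num.truncn (4 / r)).+1; apply/nbhs_coord; exists (r / 2); first by rewrite divr_gt0.
move=> y yx; rewrite /bumpx /box_bump big1// => k _; apply: itv_bump1; rewrite !mxE.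
- have h1 : 4 < (Num.truncn (4 / r)).+1%:R * r by rewrite -ltr_pdivrMr// truncnS_gt.
  have : r / 2 <= y ord0 k - (x ord0 k - r) by have := yx k; rewrite ltr_norml; lra.
  have n0 : 0 < (Num.truncn (4 / r)).+1%:R :> R by rewrite ltr0n.
  by rewrite -(ler_pM2l n0); lra.
- have h1 : 4 < (Num.truncn (4 / r)).+1%:R * r by rewrite -ltr_pdivrMr// truncnS_gt.
  have : r / 2 <= x ord0 k + r - y ord0 k by have := yx k; rewrite ltr_norml; lra.
  have n0 : 0 < (Num.truncn (4 / r)).+1%:R :> R by rewrite ltr0n.
  by rewrite -(ler_pM2l n0); lra.
Qed.

Let local_interior x : Om x -> exists2 b : E -> R, smooth b /\ (\forall y \near x, b y = 1) &
  forall th, smooth th -> Lam (fun y => b y * (b y * th y)) = 0.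
Proof.
move=> Ox; have /nbhs_coord[r r0 H] : \forall y \near x, Om y by exact: open_nbhs_nbhs.
have [m Hm] := bumpx1 x r0.
exists (bumpx x r m); first by split => //; exact: smooth_box_bump.
have tb : test_fun Om (bumpx x r m).
  apply: test_fun_box_bump => // y yb; apply: H => k; have := yb k; rewrite !mxE ltr_norml; lra.
by move=> th sth; exact: (@Lam_test (bumpx x r m) (fun y => bumpx x r m y * th y) tb (test_funM tb sth)).
Qed.

Let test_cutoff (x : E) (r : R) m n (h : E -> R) : smooth h ->
  (forall y : E, (forall k, `|y ord0 k - x ord0 k| <= r) -> Om y <-> h y < 0) ->
  test_fun Om (fun y => bumpx x r m y * cutoff h n y).
Proof.
move=> sh Hr.
have n0 : 0 < n.+1%:R :> R by rewrite ltr0n.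
pose C := [set y : E | forall k, (x - const_mx r : E) ord0 k <= y ord0 k <= (x + const_mx r : E) ord0 k] `&`
   [set y | h y <= - n.+1%:R^-1].
have clC2 : closed [set y | h y <= - n.+1%:R^-1].
  rewrite (_ : [set y | _] = h @^-1` [set t | t <= - n.+1%:R^-1]) //; apply: closed_comp; last exact: closed_le.
  by move=> y _; have sc : continuous h := smooth_continuous sh; exact: sc.
have clC : closed C by apply: closedI => //; exact: closed_cbox.
have cC : compact C.
  by apply: (subclosed_compact clC (@compact_cbox _ _ (x - const_mx r) (x + const_mx r))) => y [].
have CO : C `<=` Om.
  move=> y [yb /= hy]; apply/Hr; last by apply: le_lt_trans hy _; rewrite oppr_lt0 invr_gt0.
  by move=> k; have := yb k; rewrite !mxE ler_norml; lra.
have sC : [set y | bumpx x r m y * cutoff h n y != 0] `<=` C.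
  move=> y /=; rewrite mulf_eq0 negb_or => /andP[b0 c0]; split.
    by move=> k; have := in_bumpx b0 k; rewrite !mxE ltr_norml; lra.
  rewrite /= leNgt; apply: contra_neqN c0 => hy; apply: step_le0.
  rewrite subr_le0 mulNr -mulrN -ler_pdivlMl// mulr1 lerNl; exact: ltW.
have clsC : closure [set y | bumpx x r m y * cutoff h n y != 0] `<=` C.
  rewrite [X in _ `<=` X](closure_id _).1//; exact: closure_subset.
split; last exact: subset_trans CO.
  exact: (@smoothM _ _ (bumpx x r m) _ (@smooth_box_bump _ _ _ _ _) (smooth_cutoff n sh)).
by apply: subclosed_compact cC clsC; exact: closed_closure.
Qed.

(** The function cutoff h n vanishes near the boundary and tends to 1 inside. The
    derivatives of cutoffs contribute n times the normal component of the field
    on the layer where - h is of order 1/n; there the component is at most a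
    multiple of K / n, so that the contribution is dominated by a multiple of K
    times v, on a layer that shrinks to the boundary. *)
Let local_boundary x h (K : E -> R) : local_defining Om x h -> L2 lb (ext Om K) ->
  (\forall y \near x, Om y -> `|\sum_i pd i h y * G i y| <= `|h y| * K y) ->
  exists2 b : E -> R, smooth b /\ (\forall y \near x, b y = 1) &
  forall th, smooth th -> Lam (fun y => b y * (b y * th y)) = 0.
Proof.
move=> [sh _ Hx] lK HK.
have /nbhs_coord[r2 r20 H2] : \forall y \near x, (Om y <-> h y < 0) /\
   (Om y -> `|\sum_i pd i h y * G i y| <= `|h y| * K y) by exact: filterI.
pose r := r2 / 2; have r0 : 0 < r by rewrite divr_gt0.
have H (y : E) : (forall k, `|y ord0 k - x ord0 k| <= r) -> (Om y <-> h y < 0) /\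
   (Om y -> `|\sum_i pd i h y * G i y| <= `|h y| * K y).
  move=> yx; apply: H2 => k; apply: le_lt_trans (yx k) _; exact: half_lt.
have [m Hm] := bumpx1 x r0.
set b := bumpx x r m in Hm.
have sb : smooth b by exact: smooth_box_bump.
exists b; first by split.
move=> th sth.
pose eta y := b y * (b y * th y).
have sbth := @smoothM _ _ b th sb sth.
have seta : smooth eta := @smoothM _ _ b _ sb sbth.
pose z n y := (b y * cutoff h n y) * (b y * cutoff h n y * th y).
have tz n : test_fun Om (fun y => b y * cutoff h n y).
  by apply: test_cutoff => // y yx; have [] := H y yx.
have z0 n : Lam (z n) = 0.
  exact: (@Lam_test _ (fun y => b y * cutoff h n y * th y) (tz n) (test_funM (tz n) sth)).
have sc n : smooth (cutoff h n) := smooth_cutoff n sh.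
have scc n := @smoothM _ _ (cutoff h n) (cutoff h n) (sc n) (sc n).
have zE n : z n = fun y => eta y * (cutoff h n y * cutoff h n y).
  by apply/funext => y; rewrite /z /eta; ring.
have sz n : smooth (z n) by rewrite zE; exact: (@smoothM _ _ _ _ seta (scc n)).
pose Gh y := (\sum_i pd i h y * ext Om (G i) y) * ext Om v y.
have pdz n i y : pd i (z n) y = pd i eta y * (cutoff h n y * cutoff h n y) +
    eta y * (2 * cutoff h n y * (derive1 step (- n.+1%:R * h y - 1) * (- n.+1%:R * pd i h y))).
  rewrite zE (pd_mul i y seta (scc n)) (pd_mul i y (sc n) (sc n)) (pd_cutoff n i y sh).
  ring.
have lamz n y : lam (z n) y = (cutoff h n y * cutoff h n y) * lam eta y -
    eta y * (2 * cutoff h n y * (derive1 step (- n.+1%:R * h y - 1) * n.+1%:R)) * Gh y.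
  rewrite /lam mulrDr addrAC; congr (_ + _); last by rewrite zE; ring.
  rewrite /Gh mulr_suml !mulr_sumr -sumrB; apply: eq_bigr => i _.
  by rewrite pdz /B; ring.
have lam_out n y : b y = 0 -> lam (z n) y = 0 /\ lam eta y = 0.
  move=> b0; have e0 : eta y = 0 by rewrite /eta b0 mul0r.
  have l0 : lam eta y = 0.
    rewrite /lam e0 mul0r addr0 big1// => i _.
    rewrite (pd_mul i y sb sbth).
    by rewrite b0 mul0r !mul0r mulr0 addr0 mul0r.
  by split => //; rewrite lamz l0 e0 mulr0 !mul0r subr0.
have lam_Om z' y : ~ Om y -> lam z' y = 0.
  by move=> yO; rewrite /lam A_out// mulr0 addr0 big1// => i _; rewrite B_out// mulr0.
have [M M0 HM] := smooth_bounded_Om Om_bounded seta.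
have [S S0 HS] := @derive1_step_bounded R.
pose g y := `|lam eta y| + 4 * M * S * `|ext Om K y * ext Om v y|.
have lg : L1 lb g.
  apply: L1D; first by apply: L1_norm; exact: l1lam.
  by apply: L1Z; apply: L1_norm; exact: L2M.
have c01 n y : 0 <= cutoff h n y <= 1 by rewrite step_ge0 step_le1.
have cv : \int[lb]_y lam (z n) y @[n --> \oo] --> \int[lb]_y lam eta y; last first.
  apply: (cvg_eq0 cv) => n; exact: z0.
apply: (int_dominated _ _ _ _ lg).
- by move=> n; exact: (L1_meas (l1lam (sz n))).
- exact: (L1_meas (l1lam seta)).
- apply: aeW => y; have [by0|by0] := eqVneq (b y) 0.
    rewrite (lam_out 0 y by0).2 (_ : (fun n => _) = fun=> 0); first exact: cvg_cst.
    by apply/funext => n; rewrite (lam_out n y by0).1.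
  have [Oy|nOy] := pselect (Om y); last first.
    rewrite lam_Om// (_ : (fun n => _) = fun=> 0); first exact: cvg_cst.
    by apply/funext => n; rewrite lam_Om.
  have hy : h y < 0.
    by apply: (H y _).1.1 => // k; apply/ltW; exact: in_bumpx by0 k.
  apply: cvg_near_cst; exists (Num.truncn (2 / (- h y))) => // n /= nn.
  have n2 : 2 < - n.+1%:R * h y.
    rewrite mulNr -mulrN -ltr_pdivrMr ?oppr_gt0//.
    by apply: lt_le_trans (truncnS_gt _) _; rewrite ler_nat.
  have c1 : cutoff h n y = 1 by apply: step_ge1; lra.
  rewrite lamz c1 derive1_step_out; first by ring.
  by apply/negP => /andP[_]; lra.
- move=> n y; rewrite /g; have [by0|by0] := eqVneq (b y) 0.
    by rewrite (lam_out n y by0).1 normr0 addr_ge0// mulr_ge0// ?mulr_ge0// ltW.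
  have [Oy|nOy] := pselect (Om y); last first.
    by rewrite lam_Om// normr0 addr_ge0// mulr_ge0// ?mulr_ge0// ltW.
  have [Hy1 Hy2] := H y (fun k => ltW (in_bumpx by0 k)).
  have {}Hy2 := Hy2 Oy.
  have /andP[cc0 cc1] := c01 n y.
  rewrite lamz; apply: le_trans (ler_normB _ _) _; apply: lerD.
    rewrite normrM (ger0_norm (mulr_ge0 cc0 cc0)).
    by apply: ler_piMl => //; exact: mulr_ile1.
  set s := - n.+1%:R * h y - 1.
  have [s01|s01] := boolP (0 < s < 1); last first.
    by rewrite derive1_step_out// mul0r !mulr0 mul0r normr0 mulr_ge0// !mulr_ge0// ltW.
  have nh : n.+1%:R * `|h y| <= 2.
    have hy : h y < 0 by exact: Hy1.1.
    by rewrite ltr0_norm//; move: s01; rewrite /s mulrN -mulNr; lra.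
  have nn0 : 0 <= n.+1%:R :> R by [].
  have eM : `|eta y| <= M by exact: HM.
  have dS : `|derive1 step s| <= S by exact: HS.
  rewrite /Gh !ext_in// (_ : \sum_i pd i h y * ext Om (G i) y = \sum_i pd i h y * G i y); last first.
    by apply: eq_bigr => i _; rewrite ext_in.
  move: (\sum_i _) Hy2 (derive1 step s) dS (eta y) eM (cutoff h n y) cc0 cc1 => q0 qK d0 dS e0 eM co cc0 cc1.
  rewrite !normrM (ger0_norm cc0) (ger0_norm nn0) (@ger0_norm _ 2)//.
  move: (ler_norm (K y)) (normr_ge0 q0) (normr_ge0 (v y)) (normr_ge0 d0) (normr_ge0 e0) qK dS eM.
  move: `|q0| `|v y| `|d0| `|e0| `|K y| (normr_ge0 (K y)) => q V d e k k0 Kk q0' V0 d0' e0' qK dS eM.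
  have nq : n.+1%:R * q <= 2 * k.
    apply: le_trans (_ : n.+1%:R * (`|h y| * k) <= _).
      by rewrite ler_wpM2l//; apply: le_trans qK _; rewrite ler_wpM2l.
    by rewrite mulrA ler_wpM2r.
  rewrite (_ : _ * (q * V) = e * ((2 * co) * (d * ((n.+1%:R * q) * V)))); last by ring.
  rewrite (_ : 4 * M * S * _ = M * (2 * (S * ((2 * k) * V)))); last by ring.
  apply: ler_pM => //; first by rewrite !mulr_ge0.
  apply: ler_pM => //; [by rewrite mulr_ge0|by rewrite !mulr_ge0|by lra|].
  apply: ler_pM => //; first by rewrite !mulr_ge0.
  by rewrite ler_wpM2r.
Qed.

(** Integration by parts without boundary term for a tangential field: the
    cutoffs only see the normal component of the field, which is small where
    their gradient is large; a finite cover of the closure by neighbourhoods where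
    this works makes the statement global. *)
Lemma tangential_divergence :
  (forall x, boundary Om x -> exists2 h, local_defining Om x h &
    exists2 K, L2 lb (ext Om K) &
    \forall y \near x, Om y -> `|\sum_i pd i h y * G i y| <= `|h y| * K y) ->
  \int[lb]_x (\sum_i (ext Om (D i) x * ext Om v x + ext Om (G i) x * ext Om (dv i) x)) = 0.
Proof.
move=> tang.
have loc x : exists b : E -> R, closure Om x -> [/\ smooth b, (\forall y \near x, b y = 1) &
    forall th, smooth th -> Lam (fun y => b y * (b y * th y)) = 0].
  have [cx|ncx] := pselect (closure Om x); last by exists (fun=> 0).
  have [Ox|nOx] := pselect (Om x).
    by have [b [sb b1] H] := local_interior Ox; exists b.
  have bx : boundary Om x by split => // /nbhs_singleton.
  have [h ld [K lK HK]] := tang x bx.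
  by have [b [sb b1] H] := local_boundary ld lK HK; exists b.
have [beta Hb] := choice loc.
have [A0 A00 HA] := bounded_in_cube Om_bounded.
have cO : compact (closure Om).
  apply: (subclosed_compact (@closed_closure _ _) (@compact_cbox R N (const_mx (- A0)) (const_mx A0))).
  rewrite [X in _ `<=` X](closure_id _).1; last exact: closed_cbox.
  by apply: closure_subset => y /HA yA k; rewrite !mxE -ler_norml.
move: cO; rewrite compact_cover => /(_ E (closure Om) (fun x => interior [set y | beta x y = 1])).
case.
- by move=> x _; exact: open_interior.
- by move=> x cx; exists x => //; have [_ + _] := Hb x cx.
move=> F FO Fcov.
pose P (s : seq E) (y : E) := \prod_(x <- s) (1 - beta x y * beta x y).
have key (s : seq E) : {subset s <= closure Om} -> smooth (P s) /\
    forall th, smooth th -> Lam (fun y => th y * P s y) = Lam th.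
  elim: s => [|x s IH] sO.
    rewrite /P; split.
      by under eq_fun do rewrite big_nil; exact: smooth_cst.
    by move=> th sth; congr Lam; apply/funext => y; rewrite big_nil mulr1.
  have cx : closure Om x by have := sO x; rewrite inE eqxx => /(_ isT); rewrite inE.
  have [sP HP] := IH (fun y ys => sO y (mem_behead (s := x :: s) ys)).
  have [sb _ HLb] := Hb x cx.
  have s1 : smooth (fun y => 1 - beta x y * beta x y).
    apply: (@smoothB _ _ (fun=> 1) (fun y => beta x y * beta x y)); first exact: smooth_cst.
    exact: (@smoothM _ _ _ _ sb sb).
  have PE : P (x :: s) = fun y => (1 - beta x y * beta x y) * P s y.
    by apply/funext => y; rewrite /P big_cons.
  split; first by rewrite PE; exact: (@smoothM _ _ _ _ s1 sP).
  move=> th sth; rewrite PE.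
  have sth2 : smooth (fun y => beta x y * (beta x y * th y)).
    exact: (@smoothM _ _ (beta x) _ sb (@smoothM _ _ (beta x) th sb sth)).
  have -> : (fun y => th y * ((1 - beta x y * beta x y) * P s y)) =
      (fun y => (th y - beta x y * (beta x y * th y)) * P s y).
    by apply/funext => y; ring.
  rewrite (HP _ (@smoothB _ _ th _ sth sth2)) (LamB sth sth2).
  by rewrite (HLb th sth) subr0.
have [|sP HP] := key (finmap.enum_fset F); first by move=> x xF; have := FO x xF.
have := HP (fun=> 1) (@smooth_cst _ _ 1).
have -> : Lam (fun=> 1) = \int[lb]_x A x.
  by apply: eq_Rintegral => x _; rewrite /lam mul1r big1 ?add0r// => i _; rewrite pd_cst mul0r.
move=> <-; rewrite -[RHS](@int0 _ _ R lb); apply: eq_Rintegral => y _.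
have [Oy|nOy] := pselect (Om y); last first.
  by rewrite /lam A_out// mulr0 addr0 big1// => i _; rewrite B_out// mulr0.
have P0 y' : Om y' -> 1 * P (finmap.enum_fset F) y' = 0.
  move=> Oy'; have [x /= xF /nbhs_singleton /= bx] := Fcov y' (subset_closure Oy').
  by rewrite /P mul1r (big_rem x)//= bx mulr1 subrr mul0r.
rewrite /lam P0// mul0r addr0 big1// => i _.
rewrite pd_near0 ?mul0r//.
have : \forall y' \near y, Om y' by exact: open_nbhs_nbhs.
by apply: filterS => y' /P0.
Qed.

End divergence.

(** * Norms and weak derivatives in L^2 *)

Section L2_norm.
Context d (X : measurableType d) (R : realType).
Variable mu : {measure set X -> \bar R}.
Implicit Types f g : X -> R.

Definition nrm2 f : R := \int[mu]_x (f x ^+ 2).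
Definition nrm f : R := Num.sqrt (nrm2 f).

Lemma nrm2_ge0 f : 0 <= nrm2 f.
Proof. by apply: int_ge0 => x; exact: sqr_ge0. Qed.

Lemma nrm_ge0 f : 0 <= nrm f.
Proof. exact: sqrtr_ge0. Qed.

Lemma nrm_sqr f : nrm f ^+ 2 = nrm2 f.
Proof. by rewrite sqr_sqrtr// nrm2_ge0. Qed.

Lemma nrm2D_sq (s : R) f g : L2 mu f -> L2 mu g ->
  nrm2 (fun x => f x + s * g x) = nrm2 f + 2 * s * (\int[mu]_x (f x * g x)) + s ^+ 2 * nrm2 g.
Proof.
move=> lf lg; have [_ lf2] := lf; have [_ lg2] := lg; have lfg := L2M lf lg.
rewrite /nrm2 -intZ// -intZ// -intD//; last exact: L1Z.
rewrite -intD//; [|by apply: L1D => //; exact: L1Z|exact: L1Z].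
by apply: eq_Rintegral => x _; ring.
Qed.

Lemma cauchy_schwarz f g : L2 mu f -> L2 mu g -> `|\int[mu]_x (f x * g x)| <= nrm f * nrm g.
Proof.
move=> lf lg; set c := \int[mu]_x _.
have H (s : R) : 0 <= nrm2 f + 2 * s * c + s ^+ 2 * nrm2 g by rewrite -nrm2D_sq// nrm2_ge0.
rewrite -[leRHS]ger0_norm ?mulr_ge0 ?nrm_ge0// -ler_sqr ?nnegrE// real_normK ?num_real// ger0_norm ?mulr_ge0 ?nrm_ge0// exprMn !nrm_sqr.
have f0 := nrm2_ge0 f; have g0 := nrm2_ge0 g.
have [g00|gn0] := eqVneq (nrm2 g) 0.
  rewrite g00 mulr0; have [->|c0] := eqVneq c 0; first by rewrite expr0n.
  have := H (- (nrm2 f + 1) / (2 * c)); rewrite g00 mulr0 addr0.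
  rewrite (_ : 2 * _ * c = - (nrm2 f + 1)); first lra.
  by field; rewrite c0.
have := H (- c / nrm2 g).
rewrite (_ : nrm2 f + _ + _ = (nrm2 f * nrm2 g - c ^+ 2) / nrm2 g); last by field.
by rewrite pmulr_lge0 ?invr_gt0 ?subr_ge0// lt_neqAle eq_sym gn0.
Qed.

Lemma nrm2_ae f g : measurable_fun setT f -> measurable_fun setT g ->
  (\forall x \ae mu, f x = g x) -> nrm2 f = nrm2 g.
Proof.
move=> mf mg fg; apply: int_ae; [exact: measurable_funX|exact: measurable_funX|].
by apply: aeS fg => x ->.
Qed.

Lemma L2_abs f : L2 mu f -> L2 mu (fun x => `|f x|).
Proof.
move=> [mf lf]; split; first exact: measurableT_comp.
by apply: (L1_eq (g := fun x => f x ^+ 2)) => // x; rewrite real_normK ?num_real.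
Qed.

Lemma Lnorm2E f : measurable_fun setT f ->
  ('N[mu]_2%:E[EFin \o f] = (\int[mu]_x (f x ^+ 2)%:E) `^ (2^-1))%E.
Proof.
move=> mf; rewrite unlock; congr (_ `^ _)%E; apply: eq_integral => x _ /=.
by rewrite -[2]/(2%:R) powR_mulrn// real_normK ?num_real.
Qed.

Lemma Lnorm2_nrm f : L2 mu f -> ('N[mu]_2%:E[EFin \o f] = (nrm f)%:E)%E.
Proof.
move=> [mf lf]; rewrite Lnorm2E// -intE// poweR_EFin powR12_sqrt//.
exact: nrm2_ge0.
Qed.

Lemma Lnorm2_lty f : measurable_fun setT f -> ('N[mu]_2%:E[EFin \o f] < +oo)%E -> L2 mu f.
Proof.
move=> mf; rewrite Lnorm2E// => /lty_poweRy h; split => //.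
apply/integrableP; split; first by apply/measurable_EFinP; exact: measurable_funX.
under eq_integral => x _ do rewrite /= ger0_norm ?sqr_ge0//.
by apply: h; rewrite invr_neq0.
Qed.

End L2_norm.

Section weak_derivatives.
Context {R : realType} {N : nat}.
Variable Om : set 'rV[R]_N.
Hypotheses (hN : (0 < N)%N) (Om_open : open Om) (Om_bounded : bounded_set Om).
Local Notation E := 'rV[R]_N.
Local Notation lb := (leb N).
Local Notation e := (ext Om).
Implicit Types u v g h : E -> R.

Let mO : measurable Om := measurable_Om Om_open.

Lemma patchE u : (EFin \o u) \_ Om = EFin \o e u.
Proof.
apply/funext => x; rewrite /patch /= /ext indicE; case: (x \in Om); first by rewrite mulr1.
by rewrite mulr0.
Qed.

Lemma inHP u : inH Om u <-> L2 lb (e u).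
Proof.
rewrite /inH /normH patchE; split.
  by move=> [mu_ lu]; apply: Lnorm2_lty => //; exact: measurable_ext.
move=> lu; split; last by rewrite Lnorm2_nrm// ltry.
have [m _] := lu; have := measurable_funS measurableT (@subsetT _ Om) m.
apply: eq_measurable_fun => x; rewrite inE => xO; by rewrite ext_in.
Qed.

Lemma normHE u : L2 lb (e u) -> normH Om u = (nrm lb (e u))%:E.
Proof. by move=> lu; rewrite /normH patchE Lnorm2_nrm. Qed.

Lemma e_add u v : e (fun x => u x + v x) = fun x => e u x + e v x.
Proof. by apply/funext => x; rewrite extDx. Qed.

Lemma e_scale c u : e (fun x => c * u x) = fun x => c * e u x.
Proof. by apply/funext => x; rewrite extMl. Qed.

Lemma e_sub u v : e (fun x => u x - v x) = fun x => e u x - e v x.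
Proof. by apply/funext => x; rewrite /ext mulrBl. Qed.

Lemma e_sum (I : Type) (r : seq I) (F : I -> E -> R) :
  e (fun x => \sum_(i <- r) F i x) = fun x => \sum_(i <- r) e (F i) x.
Proof. by apply/funext => x; rewrite /ext mulr_suml. Qed.

Lemma ae_e u v : ae_Om Om (fun x => u x = v x) <-> (\forall x \ae lb, e u x = e v x).
Proof.
split; apply: aeS => x.
  by move=> H; have [xO|xO] := pselect (Om x); [rewrite !ext_in// H|rewrite !ext_out].
by move=> H xO; rewrite !ext_in in H.
Qed.

Lemma test_L2 psi : test_fun Om psi -> L2 lb psi.
Proof.
move=> tp; have [M M0 HM] := test_bounded tp; have [A A0 HA] := bounded_in_cube Om_bounded.
have sp : smooth psi by case: tp.
have mp := measurable_smooth sp.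
split => //; have cs : cube_supported A (fun x => psi x ^+ 2).
  by move=> x; rewrite sqrf_eq0 => px; apply: HA; apply: contra_neqP px; exact: (test_supp tp).
apply: (@L1_le _ _ _ lb _ (fun x => M ^+ 2 * \1_(box (const_mx (- (A + 1))) (const_mx (A + 1))) x)).
- exact: measurable_funX.
- move=> x; have [->|fx] := eqVneq (psi x ^+ 2) 0.
    by rewrite normr0 mulr_ge0 ?sqr_ge0// indicE.
  rewrite indicE mem_set/= ?mulr1.
    by rewrite normrX lerXn2r// nnegrE// ltW.
  by move=> k; rewrite !mxE -ltr_norml; apply: le_lt_trans (cs _ fx k) _; rewrite ltrDl.
- exact/L1Z/L1_indic_box.
Qed.

Lemma e_test psi : test_fun Om psi -> e psi = psi.
Proof.
move=> tp; apply/funext => x; have [xO|xO] := pselect (Om x); first by rewrite ext_in.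
by rewrite ext_out// (test_supp tp).
Qed.

Lemma L1_e_test u psi : L2 lb (e u) -> test_fun Om psi -> L1 lb (fun x => e u x * psi x).
Proof. by move=> lu tp; apply: L2M => //; exact: test_L2. Qed.

Lemma weak_pdP i u g : weak_pd Om i u g <-> forall psi, test_fun Om psi ->
  \int[lb]_x (e u x * pd i psi x) = - \int[lb]_x (e g x * psi x).
Proof.
have eE (w f : E -> R) : \int[lb]_(x in Om) (w x * f x) = \int[lb]_x (e w x * f x).
  by rewrite int_ext; apply: eq_Rintegral => x _; rewrite extMr.
by split=> H psi tp; have := H psi tp; rewrite !eE.
Qed.

(** Two weak derivatives of the same function have the same integrals against
    test functions. *)
Lemma weak_pd_unique i u u' g g' : L2 lb (e u) -> L2 lb (e u') -> L2 lb (e g) -> L2 lb (e g') ->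
  weak_pd Om i u g -> weak_pd Om i u' g' -> ae_Om Om (fun x => u x = u' x) ->
  ae_Om Om (fun x => g x = g' x).
Proof.
move=> lu lu' lg lg' /weak_pdP wg /weak_pdP wg' /ae_e uu.
have lB : L2 lb (e (fun x => g x - g' x)) by rewrite e_sub; exact: L2B.
have : ae_Om Om (fun x => g x - g' x = 0).
  apply: test_fun_fundamental => //.
    have [A A0 HA] := bounded_in_cube Om_bounded.
    apply: (@L1_indic_cube _ _ A); first by right.
    by move=> x; move=> h; apply: HA; apply: contra_neqP h; exact: ext_out.
  move=> psi tp; rewrite int_ext.
  rewrite (_ : ext _ _ = fun x => e g x * psi x - e g' x * psi x); last first.
    by apply/funext => x; rewrite extMr e_sub mulrBl.
  rewrite intB; [|exact: L1_e_test|exact: L1_e_test].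
  apply/eqP; rewrite subr_eq0 -eqr_opp -wg// -wg'//; apply/eqP.
  have tpd := test_pd i tp.
  apply: int_ae; [exact: L1_meas (L1_e_test lu tpd)|exact: L1_meas (L1_e_test lu' tpd)|].
  by apply: aeS uu => x ->.
by apply: aeS => x H xO; apply/eqP; rewrite -subr_eq0 H.
Qed.

Lemma weak_pdD i u u' g g' : L2 lb (e u) -> L2 lb (e u') -> L2 lb (e g) -> L2 lb (e g') ->
  weak_pd Om i u g -> weak_pd Om i u' g' ->
  weak_pd Om i (fun x => u x + u' x) (fun x => g x + g' x).
Proof.
move=> lu lu' lg lg' /weak_pdP wg /weak_pdP wg'; apply/weak_pdP => psi tp.
rewrite !e_add; under eq_Rintegral do rewrite mulrDl.
under [in RHS]eq_Rintegral do rewrite mulrDl.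
have tpd := test_pd i tp.
by rewrite !intD ?wg ?wg' ?opprD//; exact: L1_e_test.
Qed.

Lemma weak_pdZ i c u g : L2 lb (e u) -> L2 lb (e g) -> weak_pd Om i u g ->
  weak_pd Om i (fun x => c * u x) (fun x => c * g x).
Proof.
move=> lu lg /weak_pdP wg; apply/weak_pdP => psi tp.
rewrite !e_scale; under eq_Rintegral do rewrite -mulrA.
under [in RHS]eq_Rintegral do rewrite -mulrA.
have tpd := test_pd i tp.
by rewrite !intZ ?wg ?mulrN//; exact: L1_e_test.
Qed.

Lemma weak_pdB i u u' g g' : L2 lb (e u) -> L2 lb (e u') -> L2 lb (e g) -> L2 lb (e g') ->
  weak_pd Om i u g -> weak_pd Om i u' g' ->
  weak_pd Om i (fun x => u x - u' x) (fun x => g x - g' x).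
Proof.
move=> lu lu' lg lg' wg wg'.
have lN w : L2 lb (e w) -> L2 lb (e (fun x => -1 * w x)) by rewrite e_scale => lw; exact: L2Z.
have := weak_pdD lu (lN _ lu') lg (lN _ lg') wg (weak_pdZ (-1) lu' lg' wg').
rewrite (_ : (fun x => u x + _) = fun x => u x - u' x); last by apply/funext => x; rewrite mulN1r.
by rewrite (_ : (fun x => g x + _) = fun x => g x - g' x)//; apply/funext => x; rewrite mulN1r.
Qed.

Lemma weak_pd_smooth i f u g : smooth f -> L2 lb (e u) -> L2 lb (e g) -> weak_pd Om i u g ->
  weak_pd Om i (fun x => f x * u x) (fun x => f x * g x + pd i f x * u x).
Proof.
move=> sf lu lg /weak_pdP wg; apply/weak_pdP => psi tp; have sp : smooth psi by case: tp.
have tp' := test_funM tp sf.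
have := wg _ tp'.
have -> : \int[lb]_x (e u x * pd i (fun y => psi y * f y) x) =
   \int[lb]_x (e (fun x => f x * u x) x * pd i psi x) + \int[lb]_x (e u x * (psi x * pd i f x)).
  rewrite -intD; last 2 first.
  - by apply: L1_e_test; [exact: L2_smooth|exact: test_pd].
  - exact: (L1_e_test lu (test_funM tp (@smooth_pd _ _ f i sf))).
  by apply: eq_Rintegral => x _; rewrite (pd_mul i x sp sf) extMl; ring.
have -> : \int[lb]_x (e (fun x => f x * g x + pd i f x * u x) x * psi x) =
   \int[lb]_x (e g x * (psi x * f x)) + \int[lb]_x (e u x * (psi x * pd i f x)).
  rewrite -intD; last 2 first.
  - exact: L1_e_test.
  - exact: (L1_e_test lu (test_funM tp (@smooth_pd _ _ f i sf))).
  by apply: eq_Rintegral => x _; rewrite extDx !extMl; ring.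
lra.
Qed.

Lemma wpdP i u : inV Om u -> L2 lb (e (wpd Om i u)) /\ weak_pd Om i u (wpd Om i u).
Proof.
move=> [_ /(_ i)[g [/inHP lg wg]]]; rewrite /wpd; case: xgetP => [w -> [/inHP ? ?]//|/(_ g)[]].
by split => //; exact/inHP.
Qed.

Lemma inV_L2 u : inV Om u -> L2 lb (e u).
Proof. by case=> /inHP. Qed.

Lemma inVI u (g : 'I_N -> E -> R) : L2 lb (e u) -> (forall i, L2 lb (e (g i))) ->
  (forall i, weak_pd Om i u (g i)) -> inV Om u.
Proof. by move=> lu lg wg; split; [exact/inHP|move=> i; exists (g i); split => //; exact/inHP]. Qed.

Lemma wpdE i u g : inV Om u -> L2 lb (e g) -> weak_pd Om i u g ->
  \forall x \ae lb, e (wpd Om i u) x = e g x.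
Proof.
move=> Vu lg wg; have [lw ww] := wpdP i Vu; have lu := inV_L2 Vu.
by apply/ae_e/(weak_pd_unique lu lu lw lg ww wg); apply: aeW.
Qed.

Lemma inVB u v : inV Om u -> inV Om v -> inV Om (fun x => u x - v x) /\
  forall i, \forall x \ae lb, e (wpd Om i (fun x => u x - v x)) x = e (wpd Om i u) x - e (wpd Om i v) x.
Proof.
move=> Vu Vv; have lu := inV_L2 Vu; have lv := inV_L2 Vv.
have V i : L2 lb (e (fun x => wpd Om i u x - wpd Om i v x)) /\
    weak_pd Om i (fun x => u x - v x) (fun x => wpd Om i u x - wpd Om i v x).
  have [l1 w1] := wpdP i Vu; have [l2 w2] := wpdP i Vv.
  by split; [rewrite e_sub; exact: L2B|exact: weak_pdB].
have Vuv : inV Om (fun x => u x - v x).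
  apply: (@inVI _ (fun i x => wpd Om i u x - wpd Om i v x)).
  - by rewrite e_sub; exact: L2B.
  - by move=> i; have [] := V i.
  - by move=> i; have [] := V i.
split => // i; have [l w] := V i.
by have := wpdE Vuv l w; rewrite e_sub.
Qed.

Lemma normVE u : inV Om u -> normV Om u =
  (Num.sqrt (nrm2 lb (e u) + \sum_i nrm2 lb (e (wpd Om i u))))%:E.
Proof.
have sq w : L2 lb (e w) -> (normH Om w ^+ 2 = (nrm2 lb (e w))%:E)%E.
  by move=> lw; rewrite normHE// expe2 -EFinM -expr2 nrm_sqr.
move=> Vu; rewrite /normV sq; last exact: inV_L2.
rewrite (eq_bigr (fun i => (nrm2 lb (e (wpd Om i u)))%:E)); last first.
  by move=> i _; apply: sq; exact: (wpdP i Vu).1.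
rewrite sumEFin -EFinD poweR_EFin powR12_sqrt//.
by rewrite addr_ge0 ?nrm2_ge0// sumr_ge0// => i _; exact: nrm2_ge0.
Qed.

End weak_derivatives.

(** * Green's formula *)

Lemma int_derivative {R : realType} (F f : R -> R) (a b : R) : a <= b ->
  (forall t : R, is_derive t 1 F (f t)) -> continuous f ->
  (forall t, ~~ (a < t < b) -> F t = 0) -> (forall t, ~~ (a < t < b) -> f t = 0) ->
  \int[@lebesgue_measure R]_t f t = 0.
Proof.
move=> ab dF cf F0 f0; have [dp ep] := derive1_prim cf f0.
have dK (t : R) : is_derive t 1 (F - prim f) 0.
  have h : is_derive t 1 (prim f) (f t).
    by apply: DeriveDef; [exact: dp|rewrite -derive1E ep].
  have := is_deriveB (dF t) h; by rewrite subrr.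
have := @is_derive_0_is_cst _ (F - prim f) a b dK; rewrite -[(F - prim f) a]/(F a - prim f a) -[(F - prim f) b]/(F b - prim f b).
rewrite !F0 ?ltxx ?andbF// (@prim_le _ f a b f0 a (lexx a)) (@prim_ge _ f a b f0 b (lexx b)) !sub0r oppr0 => /eqP.
by rewrite eq_sym oppr_eq0 => /eqP.
Qed.

Lemma int_pd_test {R : realType} N (Om : set 'rV[R]_N) i (psi : 'rV[R]_N -> R) :
  bounded_set Om -> test_fun Om psi -> \int[leb N]_x pd i psi x = 0.
Proof.
case: N Om i psi => [Om []//|n] Om i psi bO tp; have sp : smooth psi by case: tp.
have [A A0 HA] := bounded_in_cube bO.
have tpd := test_pd i tp.
have out (f : 'rV[R]_n.+1 -> R) : test_fun Om f -> cube_supported A f.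
  by move=> tf x fx; apply: HA; apply: contra_neqP fx; exact: (test_supp tf).
have lpd : L1 (leb n.+1) (pd i psi).
  by apply: (L1_indic_cube _ (out _ tpd)); right; exact: (test_L2 bO tpd).
rewrite (int_insrv i); last exact: L1_meas lpd.
have lL : L1 (lebesgue_measure \x leb n)%E (fun z => (fun t v => pd i psi (insrv i (t, v))) z.1 z.2).
  by apply: (L1_eq _ (L1_insrv i lpd)) => -[].
transitivity (\int[(lebesgue_measure \x leb n)%E]_z ((fun t v => pd i psi (insrv i (t, v))) z.1 z.2)).
  by apply: eq_Rintegral => -[].
have -> := @fub2 _ _ (measurableTypeR R) _ R lebesgue_measure (leb n) (fun t v => pd i psi (insrv i (t, v))) lL.
rewrite -[RHS](@int0 _ _ R (leb n)); apply: eq_Rintegral => v _.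
have insE (t : R) : insrv i (t, v) = t *: basis_vec i + insrv i (0, v).
  apply/rowP => k; rewrite !mxE eqxx/=; case: unliftP => [j ->|->] /=.
    by rewrite eq_sym (negbTE (neq_lift _ _)) mulr0 add0r.
  by rewrite eqxx mulr1 addr0.
have far (f : 'rV[R]_n.+1 -> R) : test_fun Om f ->
   forall t : R, ~~ (- (A + 1) < t < A + 1) -> f (insrv i (t, v)) = 0.
  move=> tf t tA; apply/eqP; apply: contraNT tA => /(out _ tf)/(_ i); rewrite insrv_i/= => tA.
  by rewrite -ltr_norml (le_lt_trans tA)// ltrDl.
apply: (@int_derivative _ (fun t : R => psi (insrv i (t, v))) _ (- (A + 1)) (A + 1)).
- lra.
- move=> t; have -> : (fun t : R => psi (insrv i (t, v))) = (fun t => psi (t *: basis_vec i + insrv i (0, v))).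
    by apply/funext => s; rewrite insE.
  rewrite (insE t); exact: (is_derive_line (@smooth_derivable _ _ psi _ i sp)).
- have spd := @smooth_pd _ _ psi i sp.
  move=> t; apply: differentiable_continuous; apply/derivable1_diffP.
  have -> : (fun t : R => pd i psi (insrv i (t, v))) = (fun t => pd i psi (t *: basis_vec i + insrv i (0, v))).
    by apply/funext => s; rewrite insE.
  apply: ex_derive; exact: (is_derive_line (@smooth_derivable _ _ (pd i psi) _ i spd)).
- exact: far.
- exact: far.
Qed.

Section green.
Context {R : realType} {N : nat}.
Variable Om : set 'rV[R]_N.
Hypotheses (hN : (0 < N)%N) (Om_open : open Om) (Om_bounded : bounded_set Om).
Hypothesis Om_smooth : smooth_boundary Om.
Local Notation E := 'rV[R]_N.
Local Notation lb := (leb N).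
Local Notation e := (ext Om).
Implicit Types u v g h : E -> R.

Lemma weak_pd_test i psi : test_fun Om psi -> weak_pd Om i psi (pd i psi).
Proof.
move=> tp; have tpd := test_pd i tp; apply/weak_pdP => eta te.
have sp : smooth psi by case: tp.
have se : smooth eta by case: te.
have teta := test_pd i te.
rewrite !e_test//; apply/eqP; rewrite -addr_eq0 -intD; last 2 first.
- by apply: L2M; apply: (test_L2 Om_bounded).
- by apply: L2M; apply: (test_L2 Om_bounded).
rewrite -[X in _ == X](int_pd_test i Om_bounded (test_funM tp se)); apply/eqP.
by apply: eq_Rintegral => x _; rewrite (pd_mul i x sp se) addrC.
Qed.

Lemma inV_test psi : test_fun Om psi -> inV Om psi.
Proof.
move=> tp; apply: (inVI Om_open (g := fun i => pd i psi)).
- by rewrite e_test//; exact: test_L2 tp.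
- by move=> i; rewrite e_test; [apply: (test_L2 Om_bounded); exact: test_pd|exact: test_pd].
- by move=> i; exact: weak_pd_test.
Qed.

(** The trace of a product with a function of zero trace vanishes: this holds
    for test functions, by which functions of zero trace are approximated, and
    the left-hand side is continuous. *)
Lemma divergence_zero_trace (nu : 'I_N -> E -> R) g v : (forall i, smooth (nu i)) ->
  zero_trace Om g -> inV Om v ->
  \int[lb]_x (\sum_i ((nu i x * e (wpd Om i g) x + pd i (nu i) x * e g x) * e v x +
                      nu i x * e g x * e (wpd Om i v) x)) = 0.
Proof.
move=> snu [Vg [psi [tpsi cpsi]]] Vv.
have lv := inV_L2 Om_open Vv; have lg := inV_L2 Om_open Vg.
have lwv i := (wpdP Om_open i Vv).1.
have lwg i := (wpdP Om_open i Vg).1.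
have ln i w : L2 lb (e w) -> L2 lb (fun x => nu i x * e w x).
  by move=> lw; have := L2_smooth Om_bounded (snu i) lw; congr (L2 lb _); apply/funext => x; rewrite extMl.
have lpn i w : L2 lb (e w) -> L2 lb (fun x => pd i (nu i) x * e w x).
  move=> lw; have := L2_smooth Om_bounded (@smooth_pd _ _ (nu i) i (snu i)) lw.
  by congr (L2 lb _); apply/funext => x; rewrite extMl.
pose Phi (a : E -> R) (b : 'I_N -> E -> R) := \int[lb]_x (\sum_i ((nu i x * b i x + pd i (nu i) x * a x) * e v x +
                      nu i x * a x * e (wpd Om i v) x)).
have PhiE (a : E -> R) (b : 'I_N -> E -> R) : L2 lb a -> (forall i, L2 lb (b i)) -> Phi a b =
   \sum_i (\int[lb]_x (b i x * (nu i x * e v x)) + \int[lb]_x (a x * (pd i (nu i) x * e v x)) +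
     \int[lb]_x (a x * (nu i x * e (wpd Om i v) x))).
  move=> la lbb; have l1 i : L1 lb (fun x => b i x * (nu i x * e v x)) by apply: L2M => //; exact: ln.
  have l2 i : L1 lb (fun x => a x * (pd i (nu i) x * e v x)) by apply: L2M => //; exact: lpn.
  have l3 i : L1 lb (fun x => a x * (nu i x * e (wpd Om i v) x)) by apply: L2M => //; exact: ln.
  rewrite /Phi (_ : (fun x => _) = fun x => \sum_i (b i x * (nu i x * e v x) + a x * (pd i (nu i) x * e v x) +
     a x * (nu i x * e (wpd Om i v) x))); last first.
    by apply/funext => x; apply: eq_bigr => i _; ring.
  rewrite int_sum; last by move=> i; apply: L1D => //; exact: L1D.
  by apply: eq_bigr => i _; rewrite !intD//; exact: L1D.
change (Phi (e g) (fun i => e (wpd Om i g)) = 0).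
have addr6 (a1 a2 a3 b1 b2 b3 : R) :
    a1 + a2 + a3 + (b1 + b2 + b3) = a1 + b1 + (a2 + b2) + (a3 + b3) by ring.
pose ek k := fun x => psi k x - g x.
have Vk k : inV Om (psi k) by exact: inV_test.
have Vek k := inVB hN Om_open Om_bounded (Vk k) Vg.
have lek k := inV_L2 Om_open (Vek k).1.
have lwek k i := (wpdP Om_open i (Vek k).1).1.
have lpk k : L2 lb (psi k) by apply: (test_L2 Om_bounded).
have ldpk k i : L2 lb (pd i (psi k)) by apply: (test_L2 Om_bounded); exact: test_pd.
have test0 k : Phi (psi k) (fun i => pd i (psi k)) = 0.
  have wv i := (wpdP Om_open i Vv).2.
  have sp : smooth (psi k) by case: (tpsi k).
  rewrite PhiE//.
  have -> : \sum_i (\int[lb]_x (pd i (psi k) x * (nu i x * e v x)) +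
     \int[lb]_x (psi k x * (pd i (nu i) x * e v x)) + \int[lb]_x (psi k x * (nu i x * e (wpd Om i v) x))) =
     \sum_i (\int[lb]_x (e v x * pd i (fun y => psi k y * nu i y) x) + \int[lb]_x (e (wpd Om i v) x * (psi k x * nu i x))).
    apply: eq_bigr => i _; congr (_ + _); last by apply: eq_Rintegral => x _; ring.
    rewrite -intD; last 2 first.
    - by apply: L2M => //; exact: ln.
    - by apply: L2M => //; exact: lpn.
    by apply: eq_Rintegral => x _; rewrite (pd_mul i x sp (snu i)); ring.
  apply: big1 => i _; have /weak_pdP -> := wv i; last exact: (test_funM (tpsi k) (snu i)).
  by rewrite addNr.
pose M := \sum_i (nrm lb (fun x => nu i x * e v x) + nrm lb (fun x => pd i (nu i) x * e v x) +
   nrm lb (fun x => nu i x * e (wpd Om i v) x)).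
have bnd k : `|Phi (e g) (fun i => e (wpd Om i g))| <= fine (normV Om (ek k)) * M.
  have -> : Phi (e g) (fun i => e (wpd Om i g)) = - Phi (e (ek k)) (fun i => e (wpd Om i (ek k))).
    apply/eqP; rewrite -addr_eq0 -[X in _ == X](test0 k); apply/eqP.
    rewrite !PhiE//; [|exact: lek|by move=> i; exact: lwek].
    rewrite -big_split; apply: eq_bigr => i _ /=.
    have step (a b c w : E -> R) : L2 lb a -> L2 lb b -> L2 lb c -> L2 lb w ->
        (\forall x \ae lb, c x = a x + b x) ->
        \int[lb]_x (c x * w x) = \int[lb]_x (a x * w x) + \int[lb]_x (b x * w x).
      move=> la lbb lc lw cab; rewrite -intD; [|exact: L2M|exact: L2M].
      apply: int_ae; [exact: L1_meas (L2M lc lw)|exact: L1_meas (L1D (L2M la lw) (L2M lbb lw))|].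
      by apply: aeS cab => x ->; rewrite mulrDl.
    have epsi : \forall x \ae lb, psi k x = e g x + e (ek k) x.
      by apply: aeW => x; rewrite /ek e_sub (e_test (tpsi k)) addrCA subrr addr0.
    have edpsi : \forall x \ae lb, pd i (psi k) x = e (wpd Om i g) x + e (wpd Om i (ek k)) x.
      have := wpdE hN Om_open Om_bounded (Vk k) _ (weak_pd_test i (tpsi k)).
      rewrite e_test; last exact: test_pd.
      move=> /(_ (ldpk k i)); apply: aeS2 ((Vek k).2 i) => x e1 e2.
      by rewrite /ek e1 -e2 addrCA subrr addr0.
    rewrite (step _ _ _ _ (lwg i) (lwek k i) (ldpk k i) (ln i _ lv) edpsi).
    rewrite (step _ _ _ _ lg (lek k) (lpk k) (lpn i _ lv) epsi).
    rewrite (step _ _ _ _ lg (lek k) (lpk k) (ln i _ (lwv i)) epsi).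
    exact: addr6.
  rewrite normrN PhiE; [|exact: lek|by move=> i; exact: lwek].
  apply: le_trans (ler_norm_sum _ _ _) _; rewrite /M mulr_sumr; apply: ler_sum => i _.
  rewrite !mulrDr; apply: le_trans (ler_normD _ _) _; apply: lerD.
    apply: le_trans (ler_normD _ _) _; apply: lerD.
      apply: le_trans (cauchy_schwarz (lwek k i) (ln i _ lv)) _.
      rewrite ler_wpM2r ?nrm_ge0// (normVE Om_open (Vek k).1) /= ler_sqrt.
        rewrite (bigD1 i)//= addrCA lerDl addr_ge0 ?nrm2_ge0// sumr_ge0// => j _; exact: nrm2_ge0.
      by rewrite addr_ge0 ?nrm2_ge0// sumr_ge0// => j _; exact: nrm2_ge0.
    apply: le_trans (cauchy_schwarz (lek k) (lpn i _ lv)) _.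
    rewrite ler_wpM2r ?nrm_ge0// (normVE Om_open (Vek k).1) /= ler_sqrt.
      by rewrite lerDl sumr_ge0// => j _; exact: nrm2_ge0.
    by rewrite addr_ge0 ?nrm2_ge0// sumr_ge0// => j _; exact: nrm2_ge0.
  apply: le_trans (cauchy_schwarz (lek k) (ln i _ (lwv i))) _.
  rewrite ler_wpM2r ?nrm_ge0// (normVE Om_open (Vek k).1) /= ler_sqrt.
    by rewrite lerDl sumr_ge0// => j _; exact: nrm2_ge0.
  by rewrite addr_ge0 ?nrm2_ge0// sumr_ge0// => j _; exact: nrm2_ge0.
have c0 : fine (normV Om (ek k)) * M @[k --> \oo] --> 0.
  rewrite -[X in _ --> X](mul0r M); apply: cvgMl; exact: (fine_cvg cpsi).
apply/eqP; rewrite -normr_le0; rewrite -(cvg_lim _ c0)//.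
apply: limr_ge; first by apply/cvg_ex; exists 0.
by apply: nearW => k; exact: bnd.
Qed.

(** The normal component of the gradient of u has zero trace, and it is handled by
    density; what remains of the gradient is tangential up to a multiple of a
    defining function, and it is handled by the divergence theorem above. *)
Lemma green u v : inW Om u -> inV Om v ->
  \int[lb]_x (e (lap Om u) x * e v x) = - \int[lb]_x (\sum_i e (wpd Om i u) x * e (wpd Om i v) x).
Proof.
move=> [[Vu Vwu] [nu nue ztr]] Vv.
have [snu _] := nue.
pose g x := \sum_i nu x ord0 i * wpd Om i u x.
have Vg : inV Om g by case: ztr.
have lv := inV_L2 Om_open Vv; have lg := inV_L2 Om_open Vg.
have lwv i := (wpdP Om_open i Vv).1; have wv i := (wpdP Om_open i Vv).2.
have lwg i := (wpdP Om_open i Vg).1; have wg i := (wpdP Om_open i Vg).2.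
have lwu i := (wpdP Om_open i Vu).1.
have ld i := (wpdP Om_open i (Vwu i)).1; have wd i := (wpdP Om_open i (Vwu i)).2.
have sm (f w : E -> R) : smooth f -> L2 lb (e w) -> L2 lb (e (fun x => f x * w x)).
  by move=> sf lw; exact: L2_smooth.
pose D' i x := nu x ord0 i * wpd Om i g x + pd i (fun y => nu y ord0 i) x * g x.
have lD' i : L2 lb (e (D' i)).
  by rewrite e_add; apply: L2D; apply: sm => //; exact: (@smooth_pd _ _ (fun y => nu y ord0 i) i (snu i)).
have lng i : L2 lb (e (fun x => nu x ord0 i * g x)) by exact: sm.
have wD' i : weak_pd Om i (fun x => nu x ord0 i * g x) (D' i).
  exact: (weak_pd_smooth Om_bounded (snu i) lg (lwg i) (wg i)).
have Z := divergence_zero_trace (nu := fun i x => nu x ord0 i) snu ztr Vv.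
have T := @tangential_divergence _ _ Om hN Om_open Om_bounded
  (fun i x => wpd Om i u x - nu x ord0 i * g x) (fun i x => wpd Om i (wpd Om i u) x - D' i x)
  (fun i => wpd Om i v) v.
have {}T : \int[lb]_x (\sum_i (e (fun x => wpd Om i (wpd Om i u) x - D' i x) x * e v x +
   e (fun x => wpd Om i u x - nu x ord0 i * g x) x * e (wpd Om i v) x)) = 0.
  apply: T => //.
  - by move=> i; rewrite e_sub; exact: L2B.
  - by move=> i; rewrite e_sub; exact: L2B.
  - by move=> i; exact: (weak_pdB Om_bounded (lwu i) (lng i) (ld i) (lD' i) (wd i) (wD' i)).
  - move=> x bx; have [h ldh] := Om_smooth bx; exists h => //.
    have [C C0 HC] := tangential_gradient Om_open nue bx ldh.
    exists (fun x => \sum_j C * `|wpd Om j u x|).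
      rewrite e_sum; apply: L2_sum => j; rewrite e_scale; apply: L2Z.
      have := L2_abs (lwu j); congr (L2 lb _); apply/funext => y.
      by rewrite /ext normrM [X in _ * X]ger0_norm// indicE.
    apply: filterS HC => y Hy _.
    have -> : \sum_i pd i h y * (wpd Om i u y - nu y ord0 i * g y) =
       \sum_j (pd j h y - (\sum_k nu y ord0 k * pd k h y) * nu y ord0 j) * wpd Om j u y.
      under eq_bigr do rewrite mulrBr; rewrite sumrB.
      under [in RHS]eq_bigr do rewrite mulrBl; rewrite sumrB; congr (_ - _).
      transitivity ((\sum_k nu y ord0 k * pd k h y) * g y).
        by rewrite mulr_suml; apply: eq_bigr => i _; ring.
      by rewrite /g mulr_sumr; apply: eq_bigr => i _; ring.
    apply: le_trans (ler_norm_sum _ _ _) _; rewrite mulr_sumr; apply: ler_sum => j _.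
    by rewrite normrM mulrCA mulrA ler_wpM2r// mulrC [X in _ <= X]mulrC.
have lA : L1 lb (fun x => e (lap Om u) x * e v x).
  by apply: L2M => //; rewrite e_sum; exact: L2_sum.
have lB : L1 lb (fun x => \sum_i e (wpd Om i u) x * e (wpd Om i v) x).
  by apply: L1_sum => i; exact: L2M.
apply/eqP; rewrite -addr_eq0 -intD//; apply/eqP.
rewrite -[RHS](addr0 0) -[X in _ = X + _]T -[X in _ = _ + X]Z -intD; last 2 first.
- apply: L1_sum => i; apply: L1D; apply: L2M => //; rewrite e_sub; exact: L2B.
- apply: L1_sum => i; apply: L1D; apply: L2M => //.
    by have := lD' i; rewrite e_add; congr (L2 lb _); apply/funext => x; rewrite !extMl.
  by have := lng i; congr (L2 lb _); apply/funext => x; rewrite !extMl.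
apply: eq_Rintegral => x _; rewrite -big_split/= e_sum mulr_suml -big_split/=.
by apply: eq_bigr => i _; rewrite !e_sub /D' e_add !extMl; ring.
Qed.

End green.

(** * The energy identity and Gronwall's inequality *)

Section time_primitives.
Context d (X : measurableType d) (R : realType).
Variable m2 : {sigma_finite_measure set X -> \bar R}.
Local Notation mu := (@lebesgue_measure R).
Local Notation mm := (mu \x m2)%E.
Local Notation unc F := (fun z : measurableTypeR R * X => F z.1 z.2).
Implicit Types u v F : R -> X -> R.

Let half (t : R) : set (measurableTypeR R) := `]-oo, t]%classic.

Lemma primD (p q : R -> R) t : L1 mu p -> L1 mu q ->
  prim (fun s => p s + q s) t = prim p t + prim q t.
Proof.
move=> lp lq; rewrite !primE -intD.
- by apply: eq_Rintegral => s _; rewrite mulrDl.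
- by apply: (L1_indic (A := half t)) => //; exact: measurable_itv.
- by apply: (L1_indic (A := half t)) => //; exact: measurable_itv.
Qed.

Lemma primZ (c : R) (p : R -> R) t : L1 mu p -> prim (fun s => c * p s) t = c * prim p t.
Proof.
move=> lp; rewrite !primE -intZ.
  by apply: eq_Rintegral => s _; rewrite mulrA.
by apply: (L1_indic (A := half t)) => //; exact: measurable_itv.
Qed.

Lemma prim_mono (p q : R -> R) t : L1 mu p -> L1 mu q ->
  (\forall s \ae mu, s <= t -> p s <= q s) -> prim p t <= prim q t.
Proof.
move=> lp lq pq; rewrite !primE; apply: int_le.
- by apply: (L1_indic (A := half t)) => //; exact: measurable_itv.
- by apply: (L1_indic (A := half t)) => //; exact: measurable_itv.
- apply: aeS pq => s H; rewrite indic_itv in_itv/=; have [st|_] := leP s t; last by rewrite !mulr0.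
  by rewrite !mulr1 H.
Qed.

Lemma prim_ge0 (p : R -> R) t : (forall s, 0 <= p s) -> 0 <= prim p t.
Proof. by move=> p0; rewrite primE; apply: int_ge0 => s; rewrite mulr_ge0// indicE. Qed.

Lemma prim_le_int (p : R -> R) t : L1 mu p -> (forall s, 0 <= p s) -> prim p t <= \int[mu]_s p s.
Proof.
move=> lp p0; rewrite primE; apply: int_le => //.
  by apply: (L1_indic (A := half t)) => //; exact: measurable_itv.
by apply: aeW => s; rewrite ler_piMr// indicE lern1 leq_b1.
Qed.

Lemma prim_ae (p q : R -> R) t : measurable_fun [set: measurableTypeR R] p ->
  measurable_fun [set: measurableTypeR R] q -> (\forall s \ae mu, p s = q s) -> prim p t = prim q t.
Proof.
move=> mp mq pq; rewrite !primE; apply: int_ae.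
- by apply: measurable_funM => //; apply: measurable_indic; exact: measurable_itv.
- by apply: measurable_funM => //; apply: measurable_indic; exact: measurable_itv.
- by apply: aeS pq => s ->.
Qed.

Lemma L1_half F t : L1 mm (unc F) -> L1 mm (unc (fun s x => F s x * \1_(half t) s)).
Proof.
move=> lF; apply: (@L1_eq _ _ R mm _ (fun z : measurableTypeR R * X => F z.1 z.2 * \1_(half t `*` setT) z)).
  by case=> s x /=; rewrite !indicE in_setX (in_setT x) andbT.
by apply: L1_indic => //; apply: measurableX => //; exact: measurable_itv.
Qed.

Lemma prim_int F t : L1 mm (unc F) ->
  L1 m2 (fun x => prim (F^~ x) t) /\
  \int[m2]_x prim (F^~ x) t = prim (fun s => \int[m2]_x F s x) t.
Proof.
move=> lF; have lH := L1_half t lF.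
have e1 : (fun x => prim (F^~ x) t) = fun x => \int[mu]_s (F s x * \1_(half t) s).
  by apply/funext => x; rewrite primE.
split; first by rewrite e1; exact: (@fub_L1_2 _ _ (measurableTypeR R) X R mu m2 _ lH).
rewrite e1 -(@fub2 _ _ (measurableTypeR R) X R mu m2 (fun s x => F s x * \1_(half t) s) lH).
rewrite (@fub1 _ _ (measurableTypeR R) X R mu m2 (fun s x => F s x * \1_(half t) s) lH) primE.
apply: int_ae.
- exact: L1_meas (@fub_L1_1 _ _ (measurableTypeR R) X R mu m2 _ lH).
- apply: measurable_funM; last by apply: measurable_indic; exact: measurable_itv.
  exact: L1_meas (@fub_L1_1 _ _ (measurableTypeR R) X R mu m2 F lF).
- apply: aeS (@fub_ae1 _ _ (measurableTypeR R) X R mu m2 F lF) => s ls.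
  rewrite [RHS]mulrC -intZ//; apply: eq_Rintegral => x _; exact: mulrC.
Qed.

Variable T : R.
Hypothesis T0 : 0 < T.

Let I : set (measurableTypeR R) := `]0, T[%classic.

Lemma L2_itv : L2 mu (\1_I : measurableTypeR R -> R) /\ nrm2 mu (\1_I : measurableTypeR R -> R) = T.
Proof.
have mI : measurable I by exact: measurable_itv.
have sq (t : R) : (\1_I t : R) ^+ 2 = \1_I t by rewrite indicE; case: (_ \in _); rewrite ?expr1n ?expr0n.
have iT : (\int[mu]_t (\1_I t)%:E = T%:E)%E.
  rewrite integral_indic// setIT [LHS]lebesgue_measure_itv/= lte_fin T0.
  by rewrite -EFinB subr0.
have l1 : L1 mu (\1_I : measurableTypeR R -> R).
  apply/integrableP; split; first by apply/measurable_EFinP; exact: measurable_indic.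
  rewrite (_ : (\int[mu]_x _)%E = T%:E) ?ltry// -iT; apply: eq_integral => x _.
  by rewrite /= ger0_norm// indicE.
split.
  by split; [exact: measurable_indic|exact: (@L1_eq _ _ R mu _ (\1_I : measurableTypeR R -> R) sq)].
rewrite /nrm2 (_ : (fun x => _) = \1_I); last by apply/funext => t; exact: sq.
by rewrite /Rintegral iT.
Qed.

Lemma L2_L1_time (p : R -> R) : supported_in 0 T p -> L2 mu p -> L1 mu p.
Proof.
move=> sp lp; apply: (@L1_eq _ _ R mu _ (fun t : measurableTypeR R => p t * \1_I t)); last exact: L2M lp L2_itv.1.
move=> t; rewrite indic_itv in_itv/=; have [_|tI] := boolP (0 < t < T); first by rewrite mulr1.
by rewrite sp// mul0r.
Qed.

(** Cauchy and Schwarz on (0, T), at a single point of space. *)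
Lemma prim_sqr (p : R -> R) t : supported_in 0 T p -> L2 mu p ->
  prim p t ^+ 2 <= T * prim (fun s => p s ^+ 2) t.
Proof.
move=> sp lp; have lpt : L2 mu (fun s => p s * \1_(half t) s).
  have [mp lp2] := lp; split.
    by apply: measurable_funM => //; apply: measurable_indic; exact: measurable_itv.
  apply: (@L1_eq _ _ R mu _ (fun s : measurableTypeR R => p s ^+ 2 * \1_(half t) s)).
    by move=> s; rewrite exprMn indicE; case: (_ \in _); rewrite ?expr1n ?expr0n.
  by apply: (L1_indic (A := half t)) => //; exact: measurable_itv.
have := cauchy_schwarz lpt L2_itv.1.
have -> : \int[mu]_s (p s * \1_(half t) s * \1_I s) = prim p t.
  rewrite primE; apply: eq_Rintegral => s _; rewrite (indic_itv `]0, T[) in_itv/=.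
  by have [_|sI] := boolP (0 < s < T); rewrite ?mulr1// sp// !mul0r.
move=> h; have := ler_pM (normr_ge0 _) (normr_ge0 _) h h.
rewrite -!expr2 exprMn !nrm_sqr L2_itv.2 real_normK ?num_real// mulrC.
rewrite /nrm2 (_ : \int[mu]_s _ = prim (fun s => p s ^+ 2) t)//.
rewrite primE; apply: eq_Rintegral => s _.
by rewrite exprMn indicE; case: (_ \in _); rewrite ?expr1n ?expr0n.
Qed.

(** The absolutely continuous representative with initial value c and time
    derivative v. *)
Definition bar (c : X -> R) v (t : R) (x : X) : R := c x + prim (v^~ x) t.

Section bar.
Variables (c : X -> R) (v : R -> X -> R).
Hypotheses (lc : L2 m2 c) (sv : forall x, supported_in 0 T (v^~ x))
  (lv1 : L1 mm (unc v)) (lv : L2 mm (unc v)).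

Let lv2 : L1 mm (unc (fun s x => v s x ^+ 2)). Proof. exact: lv.2. Qed.

Let ae_v : \forall x \ae m2, L1 mu (v^~ x) /\ L2 mu (v^~ x).
Proof.
apply: aeS2 (@fub_ae2 _ _ (measurableTypeR R) X R mu m2 v lv1)
  (@fub_ae2 _ _ (measurableTypeR R) X R mu m2 _ lv2) => x l1 l2; split => //.
by split => //; exact: L1_meas l1.
Qed.

Let mprim t : measurable_fun setT (fun x => prim (v^~ x) t).
Proof.
exact: (@measurable_curry1 _ _ (measurableTypeR R) X R (fun t x => prim (v^~ x) t) t (measurable_prim (L1_meas lv1))).
Qed.

Lemma L2_prim t : L2 m2 (fun x => prim (v^~ x) t) /\
  nrm2 m2 (fun x => prim (v^~ x) t) <= T * prim (fun s => nrm2 m2 (v s)) t.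
Proof.
have [l1 e1] := prim_int t lv2.
have ae1 : \forall x \ae m2, prim (v^~ x) t ^+ 2 <= T * prim (fun s => v s x ^+ 2) t.
  by apply: aeS ae_v => x [_ l2]; exact: prim_sqr (sv x) l2.
have l2 : L1 m2 (fun x => prim (v^~ x) t ^+ 2).
  apply: (L1_le_ae _ (L1Z T l1)); first exact: measurable_funX.
  by apply: aeS ae1 => x; rewrite ger0_norm// sqr_ge0.
split; first by split.
apply: le_trans (int_le l2 (L1Z T l1) ae1) _.
by rewrite intZ// e1.
Qed.

Lemma L2_bar t : L2 m2 (bar c v t).
Proof. by apply: L2D => //; exact: (L2_prim t).1. Qed.

Lemma nrm2_bar_le t : nrm2 m2 (bar c v t) <= 2 * nrm2 m2 c + 2 * T * prim (fun s => nrm2 m2 (v s)) t.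
Proof.
have [l2 le2] := L2_prim t; have [_ lc2] := lc; have [_ ll2] := l2.
have lb := L2_bar t; have [_ lb2] := lb.
apply: le_trans (_ : 2 * nrm2 m2 c + 2 * nrm2 m2 (fun x => prim (v^~ x) t) <= _); last first.
  by rewrite lerD2l -mulrA ler_pM2l.
rewrite /nrm2 -!intZ// -intD//; [|exact: L1Z|exact: L1Z].
apply: int_le => //; first by apply: L1D; exact: L1Z.
apply: aeW => x; rewrite /bar -subr_ge0.
rewrite (_ : _ - _ = (c x - prim (v^~ x) t) ^+ 2); last by ring.
exact: sqr_ge0.
Qed.

Lemma measurable_bar : measurable_fun setT (unc (bar c v)).
Proof.
apply: measurable_funD; last exact: measurable_prim (L1_meas lv1).
by apply: measurable_fun_snd; exact: lc.1.
Qed.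

Lemma nrm2_time (w : R -> X -> R) : L2 mm (unc w) -> L1 mu (fun s => nrm2 m2 (w s)).
Proof. by move=> [_ lw]; exact: (@fub_L1_1 _ _ (measurableTypeR R) X R mu m2 (fun s x => w s x ^+ 2) lw). Qed.

Lemma L2_bar_Q : L2 mm (unc (fun s x => bar c v s x * \1_I s)).
Proof.
have mI : measurable_fun setT (\1_I : measurableTypeR R -> R) by apply: measurable_indic; exact: measurable_itv.
have m1 : measurable_fun setT (unc (fun s x => bar c v s x * \1_I s)).
  by apply: measurable_funM; [exact: measurable_bar|exact: measurable_fun_fst].
split => //.
apply: (@fub_L1I _ _ (measurableTypeR R) X R mu m2 (fun s x => (bar c v s x * \1_I s) ^+ 2)).
- exact: measurable_funX.
- apply: aeW => s; have [_ ls] := L2_bar s.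
  apply: (L1_eq (g := fun x => \1_I s ^+ 2 * bar c v s x ^+ 2)) (L1Z _ ls) => x.
  by rewrite exprMn mulrC.
- have lN := nrm2_time lv.
  pose K := 2 * nrm2 m2 c + 2 * T * \int[mu]_s nrm2 m2 (v s).
  have lI1 : L1 mu (\1_I : measurableTypeR R -> R).
    apply: L2_L1_time L2_itv.1 => t tI; by rewrite indic_itv in_itv/= (negbTE tI).
  apply: (@L1_le _ _ _ _ _ (fun s => K * \1_I s)).
  - apply: (@measurable_int_param _ _ (measurableTypeR R) X R m2 (fun s x => `|(bar c v s x * \1_I s) ^+ 2|)).
    by apply: measurableT_comp => //; exact: measurable_funX.
  - move=> s; rewrite ger0_norm; last by apply: int_ge0 => x.
    rewrite (_ : \int[m2]_x _ = \1_I s * nrm2 m2 (bar c v s)); last first.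
      rewrite /nrm2 -intZ; last exact: (L2_bar s).2.
      apply: eq_Rintegral => x _; rewrite ger0_norm ?sqr_ge0// exprMn mulrC.
      by rewrite indicE; case: (_ \in _); rewrite ?expr1n ?expr0n.
    rewrite mulrC ler_wpM2r ?indicE// -?indicE.
    apply: le_trans (nrm2_bar_le s) _; rewrite /K lerD2l.
    rewrite ler_pM2l ?mulr_gt0//; apply: prim_le_int => // s'; exact: nrm2_ge0.
  - exact: L1Z.
Qed.

Lemma L1_bar_pairing : L1 mm (unc (fun s x => v s x * bar c v s x)).
Proof.
apply: (@L1_eq _ _ R mm _ (fun z : measurableTypeR R * X => v z.1 z.2 * (bar c v z.1 z.2 * \1_I z.1))); last exact: L2M lv L2_bar_Q.
case=> s x /=; rewrite indic_itv in_itv/=; have [_|sI] := boolP (0 < s < T); first by rewrite mulr1.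
by rewrite sv// !mul0r.
Qed.

(** The energy identity for an absolutely continuous function of time with
    values in L^2, by integration by parts in time at almost every point. *)
Lemma bar_energy t : nrm2 m2 (bar c v t) =
  nrm2 m2 c + 2 * prim (fun s => \int[m2]_x (v s x * bar c v s x)) t.
Proof.
pose F s x := v s x * bar c v s x.
have lF : L1 mm (unc F) := L1_bar_pairing.
have [l1 e1] := prim_int t lF; rewrite -e1 /nrm2 -(intZ 2 l1) -(intD lc.2 (L1Z 2 l1)).
apply: int_ae.
- by apply: measurable_funX; exact: (L2_bar t).1.
- by apply: measurable_funD; [apply: measurable_funX; exact: lc.1|apply: measurable_funM => //; exact: L1_meas l1].
apply: aeS ae_v => x [lx _].
have mp : measurable_fun [set: measurableTypeR R] (fun s => prim (v^~ x) s).
  exact: (@measurable_curry2 _ _ (measurableTypeR R) X R (fun t x => prim (v^~ x) t) x (measurable_prim (L1_meas lv1))).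
have lvp : L1 mu (fun s => v s x * prim (v^~ x) s).
  by apply: (L1_M_bounded mp _ lx) => s; exact: prim_le_norm.
have -> : F^~ x = fun s => c x * v s x + v s x * prim (v^~ x) s.
  by apply/funext => s; rewrite /F /bar mulrDr mulrC.
rewrite /bar.
rewrite primD//; last exact: L1Z.
rewrite primZ//; have := prim_prod t lx lx; rewrite -/(prim _ _) => pp.
rewrite (_ : (c x + prim (v^~ x) t) ^+ 2 = c x ^+ 2 + 2 * c x * prim (v^~ x) t + prim (v^~ x) t * prim (v^~ x) t); last by ring.
by rewrite pp; ring.
Qed.

End bar.

End time_primitives.

Section gronwall.
Context {R : realType}.
Local Notation mu := (@lebesgue_measure R).

Lemma int_expR (K t : R) : 0 < K -> 0 < t ->
  L1 mu (fun s : measurableTypeR R => expR (K * s) * \1_(`[0, t]%classic) s) /\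
  \int[mu]_s (expR (K * s) * \1_(`[0, t]%classic : set (measurableTypeR R)) s) <= expR (K * t) / K.
Proof.
move=> K0 t0.
have dF (x : R) : is_derive x 1 (fun s : R => expR (K * s)) (K * expR (K * x)).
  have h := @is_derive1_comp R (@expR R) (fun s => K * s) x _ _ (is_derive_expR _) (is_deriveZ _ _).
  rewrite (_ : K * expR _ = expR (K * x) * (K *: 1)); first exact: (h 1 (is_derive_id _ _)).
  by rewrite /GRing.scale/= mulr1 mulrC.
have cE : continuous (fun s : R => expR (K * s)).
  by move=> x; apply: differentiable_continuous; apply/derivable1_diffP; apply: ex_derive.
have cf : continuous (fun s : R => K * expR (K * s)).
  by move=> x; apply: cvgMr; exact: cE.
have ftc := @continuous_FTC2 R (fun s => K * expR (K * s)) (fun s => expR (K * s)) 0 t t0.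
have {}ftc : (\int[mu]_(x in `[0%R, t]) (K * expR (K * x))%:E = (expR (K * t))%:E - (expR (K * 0))%:E)%E.
  apply: ftc; [exact: continuous_subspaceT| |].
    split; [by move=> x _; exact: ex_derive| |].
      by apply: cvg_at_right_filter; exact: cE.
    by apply: cvg_at_left_filter; exact: cE.
  by move=> x _; rewrite derive1E; exact: derive_val.
have mI : measurable (`[0, t]%classic : set (measurableTypeR R)) by exact: measurable_itv.
have mG : measurable_fun setT (fun s : measurableTypeR R => expR (K * s) * \1_(`[0, t]%classic) s).
  apply: measurable_funM; last exact: measurable_indic.
  exact: (continuous_measurable_fun cE).
have i1 : (\int[mu]_s (K * (expR (K * s) * \1_(`[0%R, t]%classic : set (measurableTypeR R)) s))%:E = (expR (K * t) - 1)%:E)%E.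
  rewrite EFinB -[X in _ = (_ - X%:E)%E](expR0 R) -[X in _ = (_ - (expR X)%:E)%E](mulr0 K) -ftc [RHS]integral_mkcond.
  apply: eq_integral => s _; rewrite /patch indicE mulrA; case: (_ \in _); first by rewrite mulr1.
  by rewrite mulr0.
have l1K : L1 mu (fun s : measurableTypeR R => K * (expR (K * s) * \1_(`[0, t]%classic) s)).
  apply/integrableP; split; first by apply/measurable_EFinP; exact: measurable_funM.
  rewrite (_ : (\int[mu]_x _)%E = (expR (K * t) - 1)%:E) ?ltry// -i1; apply: eq_integral => s _.
  rewrite /= ger0_norm//; apply: mulr_ge0; first exact: ltW.
  by apply: mulr_ge0; [exact: expR_ge0|rewrite indicE].
have l1 : L1 mu (fun s : measurableTypeR R => expR (K * s) * \1_(`[0, t]%classic) s).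
  apply: (@L1_eq _ _ R mu _ (fun s : measurableTypeR R => K^-1 * (K * (expR (K * s) * \1_(`[0, t]%classic) s)))).
    by move=> s; rewrite mulKf// gt_eqF.
  exact: L1Z.
split => //; rewrite ler_pdivlMr// mulrC -intZ//.
by rewrite /Rintegral i1 /= gerBl.
Qed.

(** Gronwall's inequality: for the weight expR (2 K t) the integral operator is
    a contraction of ratio 1/2. *)
Lemma gronwall (T K D : R) (Z : R -> R) : 0 < K -> 0 <= D ->
  (forall t, 0 < t < T -> 0 <= Z t) -> (forall t, ~~ (0 < t < T) -> Z t = 0) -> L1 mu Z ->
  (forall t, 0 < t < T -> Z t <= D + K * prim Z t) ->
  forall t, 0 < t < T -> Z t <= 2 * D * expR (2 * K * t).
Proof.
move=> K0 D0 Z0 Zs lZ HZ.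
have Zge0 t : 0 <= Z t.
  by have [tT|tT] := boolP (0 < t < T); [exact: Z0|rewrite Zs].
have K20 : 0 < 2 * K by rewrite mulr_gt0.
pose M := D + K * \int[mu]_s Z s.
have M0 : 0 <= M by apply: addr_ge0 => //; apply: mulr_ge0; [exact: ltW|exact: int_ge0].
have ZM t : 0 < t < T -> Z t <= M.
  move=> /HZ h; apply: le_trans h _; rewrite /M lerD2l ler_pM2l//; exact: prim_le_int.
have e1 t : 0 < t -> 1 <= expR (2 * K * t) by move=> t0; rewrite -[leLHS]expR0 ler_expR; apply: mulr_ge0; exact: ltW.
have key n : forall t, 0 < t < T -> Z t <= (2 * D + M / 2 ^+ n) * expR (2 * K * t).
  elim: n => [|n IH] t tT; have /andP[t0 _] := tT; have et := e1 t t0.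
    by apply: le_trans (ZM t tT) _; rewrite expr0 divr1; nra.
  set A := 2 * D + M / 2 ^+ n in IH.
  have A0 : 0 <= A by rewrite addr_ge0 ?mulr_ge0// divr_ge0// exprn_ge0.
  have [lE iE] := int_expR K20 t0.
  have pZ : prim Z t <= A * (expR (2 * K * t) / (2 * K)).
    apply: le_trans (_ : A * \int[mu]_s (expR (2 * K * s) * \1_(`[0, t]%classic : set (measurableTypeR R)) s) <= _); last first.
      by rewrite ler_wpM2l.
    rewrite primE -intZ//; apply: int_le.
    - by apply: (L1_indic (A := `]-oo, t]%classic : set (measurableTypeR R))) => //; exact: measurable_itv.
    - exact: L1Z.
    - apply: aeW => s; rewrite !indic_itv !in_itv/= mulrA.
      have [sT|sT] := boolP (0 < s < T); last first.
        by rewrite Zs// mul0r mulr_ge0// mulr_ge0// expR_ge0.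
      have /andP[s0 _] := sT; rewrite (ltW s0)/=; case: (s <= t); last by rewrite !mulr0.
      by rewrite !mulr1; exact: IH.
  apply: le_trans (HZ t tT) _; apply: le_trans (_ : D + A * expR (2 * K * t) / 2 <= _).
    rewrite lerD2l; apply: le_trans (_ : K * (A * (expR (2 * K * t) / (2 * K))) <= _).
      by rewrite ler_pM2l.
    rewrite le_eqVlt; apply/orP; left; apply/eqP; field; by rewrite gt_eqF.
  rewrite /A exprS invfM mulrA.
  have : 0 <= M / 2 ^+ n by rewrite divr_ge0// exprn_ge0.
  rewrite (_ : M / 2 / 2 ^+ n = M / 2 ^+ n / 2); last by rewrite mulrAC.
  by move: (M / 2 ^+ n) => m m0; nra.
move=> t tT; have /andP[t0 _] := tT; have e0 : 0 < expR (2 * K * t) by exact: expR_gt0.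
rewrite leNgt; apply/negP => lt.
have d0 : 0 < Z t / expR (2 * K * t) - 2 * D by rewrite subr_gt0 ltr_pdivlMr.
set dl := _ - _ in d0; pose n := (Num.truncn (M / dl)).+1.
have n1 : M / dl < n%:R by exact: truncnS_gt.
have n2 : (n%:R : R) <= 2 ^+ n by rewrite -natrX ler_nat ltnW// ltn_expl.
have p0 : 0 < 2 ^+ n :> R by rewrite exprn_gt0.
have h1 : M / 2 ^+ n < dl.
  rewrite ltr_pdivrMr// mulrC -ltr_pdivrMr//; exact: lt_le_trans n1 n2.
have := key n t tT; rewrite -ler_pdivrMr// => h2.
by move: h2; rewrite -lerBlDl -/dl leNgt h1.
Qed.

End gronwall.

(** * Functions of time with values in H or V *)

Lemma ae_forall d (X : measurableType d) (R : realType) (m : {measure set X -> \bar R})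
    (J : finType) (P : J -> X -> Prop) : (forall j, \forall x \ae m, P j x) ->
  \forall x \ae m, forall j, P j x.
Proof. by move=> H; exact: filter_forall. Qed.

Lemma ge0_le_integral_any d (X : measurableType d) (R : realType)
    (m : {measure set X -> \bar R}) (f g : X -> \bar R) : (forall x, 0 <= f x)%E ->
  (forall x, f x <= g x)%E -> (\int[m]_x f x <= \int[m]_x g x)%E.
Proof.
move=> f0 fg; have g0 x : (0 <= g x)%E by exact: le_trans (f0 x) (fg x).
rewrite !ge0_integralTE//; apply: le_ereal_sup => _ [h hf <-]; exists h => // x.
exact: le_trans (hf x) (fg x).
Qed.

(** The norm of a curve in a Banach space need not be a measurable function of
    time before it is modified on a null set; an upper bound of its integral is
    all that is needed. *)
Lemma integral_le_ae d (X : measurableType d) (R : realType)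
    (m : {measure set X -> \bar R}) (f : X -> \bar R) (g : X -> R) : (forall x, 0 <= f x)%E ->
  (forall x, 0 <= g x) -> L1 m g -> (\forall x \ae m, (f x <= (g x)%:E)%E) ->
  (\int[m]_x f x <= (\int[m]_x g x)%:E)%E.
Proof.
move=> f0 g0 lg [K [mK K0 HK]].
pose h x : \bar R := if x \in K then +oo%E else (g x)%:E.
have mg := L1_meas lg.
have mh : measurable_fun setT h.
  apply: measurable_fun_ifT => //; last exact/measurable_EFinP.
  apply: (measurable_fun_bool true); rewrite setTI (_ : _ @^-1` _ = K)//.
  by apply/seteqP; split => x /= xK; [exact: set_mem|exact: mem_set].
apply: le_trans (_ : \int[m]_x h x <= _)%E.
  apply: ge0_le_integral_any => // x; rewrite /h; case: ifPn => [_|xK]; first exact: leey.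
  by move: xK; rewrite notin_setE => xK; apply: contrapT => nf; apply: xK; exact: HK.
rewrite intE// (ae_eq_integral (EFin \o g))//; first exact/measurable_EFinP.
exists K; split => // x /= /not_implyP[_]; apply: contra_notP => xK.
by rewrite /h memNset.
Qed.

Section time_norms.
Context {R : realType} {N : nat}.
Variables (Om : set 'rV[R]_N) (T : R).
Hypotheses (hN : (0 < N)%N) (Om_open : open Om) (Om_bounded : bounded_set Om) (T0 : 0 < T).
Local Notation E := 'rV[R]_N.
Local Notation lb := (leb N).
Local Notation e := (ext Om).
Local Notation mu := (@lebesgue_measure R).
Local Notation mm := (mu \x lb)%E.
Local Notation unc F := (fun z : measurableTypeR R * E => F z.1 z.2).
Implicit Types (u v : R -> E -> R).

Let I : set (measurableTypeR R) := `]0, T[%classic.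
Let mI : measurable I. Proof. exact: measurable_itv. Qed.

(** Extending by zero turns integrals over the cylinder into integrals over the
    whole product, where Fubini's theorem and primitives need no restriction. *)
Definition q u : R -> E -> R := fun t x => e (u t) x * (\1_(`]0, T[%classic) t).

Lemma q_in u t : 0 < t < T -> q u t = e (u t).
Proof. by move=> tT; apply/funext => x; rewrite /q indic_itv in_itv/= tT mulr1. Qed.

Lemma q_out u t : ~~ (0 < t < T) -> q u t = fun=> 0.
Proof. by move=> tT; apply/funext => x; rewrite /q indic_itv in_itv/= (negbTE tT) mulr0. Qed.

Lemma q_supp u x : supported_in 0 T (q u ^~ x).
Proof. by move=> t tT; rewrite q_out. Qed.

Lemma q_add u v t x : q (fun t x => u t x + v t x) t x = q u t x + q v t x.
Proof. by rewrite /q extDx mulrDl. Qed.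

Lemma q_sub u v t x : q (fun t x => u t x - v t x) t x = q u t x - q v t x.
Proof. by rewrite /q e_sub mulrBl. Qed.

Lemma q_scale c u t x : q (fun t x => c * u t x) t x = c * q u t x.
Proof. by rewrite /q extMl mulrA. Qed.

Lemma cyl_ext u z : ext (cylinder Om T : set (measurableTypeR R * E)) (fun z => u z.1 z.2) z = q u z.1 z.2.
Proof.
case: z => t x; rewrite /q /ext /= -mulrA; congr (_ * _).
by rewrite !indicE /cylinder in_setX -natrM_bool andbC.
Qed.

Lemma measurable_cylinder : measurable (cylinder Om T : set (measurableTypeR R * E)).
Proof. by apply: measurableX => //; exact: measurable_Om. Qed.

Lemma measurable_q u : measurable_Q Om T u -> measurable_fun setT (unc (q u)).
Proof.
move=> mu_; have := measurable_ext measurable_cylinder mu_.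
by rewrite (_ : ext _ _ = unc (q u))//; apply/funext => z; exact: cyl_ext.
Qed.

Lemma measurable_q_slice u t : measurable_Q Om T u -> measurable_fun setT (q u t).
Proof. by move=> /measurable_q mq; exact: (@measurable_curry1 _ _ (measurableTypeR R) E R (q u) t mq). Qed.

Lemma measurable_QD u v : measurable_Q Om T u -> measurable_Q Om T v ->
  measurable_Q Om T (fun t x => u t x + v t x).
Proof. exact: measurable_funD. Qed.

Lemma measurable_QZ c u : measurable_Q Om T u -> measurable_Q Om T (fun t x => c * u t x).
Proof. by move=> mu_; apply: measurable_funM => //; exact: measurable_cst. Qed.

Definition LQ2 u := L2 mm (unc (q u)).
Definition LQ1 u := L1 mm (unc (q u)).

Definition nsq u (t : R) : \bar R := (\int[lb]_x ((q u t x) ^+ 2)%:E)%E.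

Lemma nsq_ge0 u t : (0 <= nsq u t)%E.
Proof. by apply: integral_ge0 => x _; rewrite lee_fin sqr_ge0. Qed.

Lemma measurable_nsq u : measurable_Q Om T u -> measurable_fun [set: measurableTypeR R] (nsq u).
Proof.
move=> /measurable_q mq.
apply: (@measurable_fun_fubini_tonelli_F _ _ (measurableTypeR R) E R lb (fun z => ((q u z.1 z.2) ^+ 2)%:E)).
  by apply/measurable_EFinP; exact: measurable_funX.
by move=> z; rewrite lee_fin sqr_ge0.
Qed.

Lemma nsq_fin u t : measurable_Q Om T u -> (nsq u t < +oo)%E -> L2 lb (q u t) /\ nsq u t = (nrm2 lb (q u t))%:E.
Proof.
move=> mu_ fin; have mq := measurable_q_slice t mu_.
have l1 : L1 lb (fun x => q u t x ^+ 2).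
  apply/integrableP; split; first by apply/measurable_EFinP; exact: measurable_funX.
  by under eq_integral => x _ do rewrite /= ger0_norm ?sqr_ge0//.
by split => //; rewrite /nsq -intE.
Qed.

Lemma normH_slice u t : measurable_Q Om T u ->
  ((fun t => normH Om (u t)) \_ (`]0, T[%classic : set R)) t = (nsq u t `^ (2^-1))%E.
Proof.
move=> mu_; rewrite /patch; have [tT|tT] := boolP (0 < t < T).
  rewrite mem_set ?in_itv//= /normH patchE Lnorm2E; first by rewrite /nsq q_in.
  by rewrite -(q_in u tT); exact: measurable_q_slice.
rewrite memNset ?in_itv//=; last exact/negP.
rewrite /nsq; under eq_integral do rewrite q_out// expr0n/=.
by rewrite integral0 poweR0r// invr_neq0.
Qed.

Lemma inLpH2_LQ2 u : inLpH Om T 2%:E u -> LQ2 u.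
Proof.
move=> [mu_]; rewrite /normLp unlock => /lty_poweRy h.
have mq := measurable_q mu_; split => //.
apply/integrableP; split; first by apply/measurable_EFinP; exact: measurable_funX.
have -> : (\int[mm]_z `|((unc (q u)) z ^+ 2)%:E| = \int[mu]_t nsq u t)%E.
  rewrite (@fubini_tonelli1 _ _ (measurableTypeR R) E R mu lb (fun z => `|((q u z.1 z.2) ^+ 2)%:E|%E)); last by move=> z; exact: abse_ge0.
    apply: eq_integral => t _; rewrite /fubini_F /nsq; apply: eq_integral => x _.
    by rewrite /= ger0_norm ?sqr_ge0.
  by apply: measurableT_comp => //; apply/measurable_EFinP; exact: measurable_funX.
have n2 : (2^-1 : R) != 0 by rewrite invr_neq0.
have {}h := h n2.
apply: le_lt_trans h; rewrite (eq_integral (fun t : measurableTypeR R => nsq u t))// => t _; rewrite normH_slice// gee0_abs ?poweR_ge0//.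
by rewrite -poweRrM mulVf// poweRe1// nsq_ge0.
Qed.

Lemma inL2Q_LQ2 f : inL2Q Om T f -> LQ2 f.
Proof.
move=> [mf]; rewrite /normL2Q.
have -> : (fun z : measurableTypeR R * E => (f z.1 z.2)%:E) \_ (cylinder Om T) = EFin \o unc (q f).
  by apply/funext => z; rewrite -[LHS]/((EFin \o unc f) \_ _ z) /= -cyl_ext /patch /= /ext indicE;
    case: (_ \in _); rewrite ?mulr1 ?mulr0.
by move=> h; apply: Lnorm2_lty => //; exact: measurable_q.
Qed.

Lemma normL2QE f : LQ2 f -> normL2Q Om T f = (nrm mm (unc (q f)))%:E.
Proof.
move=> lf; rewrite /normL2Q -Lnorm2_nrm//; congr (Lnorm _ _ _).
by apply/funext => z; rewrite -[LHS]/((EFin \o unc f) \_ _ z) /= -cyl_ext /patch /= /ext indicE;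
    case: (_ \in _); rewrite ?mulr1 ?mulr0.
Qed.

(** Multiplication by the indicator of a bounded box containing the cylinder
    turns square integrability into integrability. *)
Lemma cylinder_weight : exists2 k : E -> R, L2 lb k & forall u t x, q u t x * k x = q u t x.
Proof.
have [A A0 HA] := bounded_in_cube Om_bounded.
pose B := box (const_mx (- (A + 1)) : E) (const_mx (A + 1)).
have l1 : L1 lb (\1_B) := L1_indic_box (const_mx (- (A + 1))) (const_mx (A + 1)).
exists (\1_B).
  split; first by apply: measurable_indic; exact: measurable_box.
  apply: (L1_eq _ l1) => x; by rewrite indicE; case: (_ \in _); rewrite ?expr1n ?expr0n.
move=> u t x; have [xO|xO] := pselect (Om x); last by rewrite /q ext_out// !mul0r.
rewrite indicE mem_set ?mulr1// => k; rewrite !mxE -ltr_norml.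
by apply: le_lt_trans (HA x xO k) _; rewrite ltrDl.
Qed.

Lemma LQ2_LQ1 u : LQ2 u -> LQ1 u.
Proof.
move=> lu; have [k lk kE] := cylinder_weight.
have [lI _] := L2_itv T0.
have lw : L2 mm (fun z : measurableTypeR R * E => \1_I z.1 * k z.2).
  split.
    apply: measurable_funM; first by apply: measurable_fun_fst; exact: measurable_indic.
    by apply: measurable_fun_snd; exact: lk.1.
  apply: (@L1_eq _ _ R mm _ (fun z : measurableTypeR R * E => \1_I z.1 ^+ 2 * k z.2 ^+ 2)).
    by move=> z; rewrite exprMn.
  exact: (@L1_prod _ _ (measurableTypeR R) E R mu lb _ _ lI.2 lk.2).
apply: (@L1_eq _ _ R mm _ (fun z : measurableTypeR R * E => q u z.1 z.2 * (\1_I z.1 * k z.2))).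
  case=> t x /=; rewrite mulrCA kE; have [tT|tT] := boolP (0 < t < T).
    by rewrite indic_itv in_itv/= tT mul1r.
  by rewrite q_out// mulr0.
exact: L2M.
Qed.

Lemma inLpH1_fin u : inLpH Om T 1 u -> L1 mu (fun t => nrm lb (q u t)) /\
  \forall t \ae mu, L2 lb (q u t).
Proof.
move=> [mu_]; rewrite /normLp Lnorm1 => fin.
have mp : measurable_fun [set: measurableTypeR R] (fun t => (nsq u t `^ (2^-1))%E).
  exact: (measurableT_comp (measurable_poweR _) (measurable_nsq mu_)).
have ig : mu.-integrable setT (fun t : measurableTypeR R => (nsq u t `^ (2^-1))%E).
  apply/integrableP; split => //; move: fin; rewrite (eq_integral (fun t : measurableTypeR R => `|nsq u t `^ 2^-1|%E))//.
  by move=> t _; rewrite normH_slice.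
have n2 : (2^-1 : R) != 0 by rewrite invr_neq0.
have aef : \forall t \ae mu, L2 lb (q u t) /\ (nsq u t `^ 2^-1 = (nrm lb (q u t))%:E)%E.
  apply: aeS (integrable_ae measurableT ig) => t /(_ Logic.I).
  rewrite ge0_fin_numE ?poweR_ge0// => /lty_poweRy h.
  have [l2 e2] := nsq_fin mu_ (h n2).
  by split => //; rewrite e2 poweR_EFin powR12_sqrt// nrm2_ge0.
split; last by apply: aeS aef => t [].
have mn : measurable_fun [set: measurableTypeR R] (fun t => nrm lb (q u t)).
  have mq := measurable_q mu_.
  have := @measurable_int_param _ _ (measurableTypeR R) E R lb (fun t x => q u t x ^+ 2) (measurable_funX 2 mq).
  move=> h; apply: (measurableT_comp _ h); apply: continuous_measurable_fun; exact: sqrt_continuous.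
apply/integrableP; split; first exact/measurable_EFinP.
have /integrableP[_] := ig; apply: le_lt_trans; rewrite le_eqVlt; apply/orP; left; apply/eqP.
apply: ae_eq_integral => //.
- by apply: measurableT_comp => //; exact/measurable_EFinP.
- exact: measurableT_comp.
- by apply: aeS aef => t [_ ->] _.
Qed.

Lemma inLpH1_LQ1 u : inLpH Om T 1 u -> LQ1 u.
Proof.
move=> hu; have [ln ae2] := inLpH1_fin hu; have [k lk kE] := cylinder_weight.
have mq := measurable_q hu.1.
apply: (@fub_L1I _ _ (measurableTypeR R) E R mu lb (q u)) => //.
  by apply: aeS ae2 => t l2; apply: (L1_eq _ (L2M l2 lk)) => x; rewrite kE.
apply: (L1_le_ae _ (L1Z (nrm lb k) ln)).
  by apply: (@measurable_int_param _ _ (measurableTypeR R) E R lb (fun t x => `|q u t x|)); exact: measurableT_comp.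
apply: aeS ae2 => t l2; rewrite ger0_norm ?int_ge0// mulrC.
have := cauchy_schwarz (L2_abs l2) (L2_abs lk).
rewrite (_ : \int[lb]_x (`|q u t x| * `|k x|) = \int[lb]_x `|q u t x|); last first.
  by apply: eq_Rintegral => x _; rewrite -normrM kE.
have nabs (f : E -> R) : nrm lb (fun x => `|f x|) = nrm lb f.
  by congr Num.sqrt; apply: eq_Rintegral => x _; rewrite real_normK ?num_real.
by rewrite !nabs ger0_norm ?int_ge0.
Qed.

Lemma LQ2_inLpH1 u : measurable_Q Om T u -> LQ2 u -> inLpH Om T 1 u.
Proof.
move=> mu_ lu; split => //; rewrite /normLp Lnorm1.
have l1 : L1 mu (fun t : measurableTypeR R => \1_I t + nrm2 lb (q u t)).
  apply: L1D; last exact: (nrm2_time lu).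
  apply: L2_L1_time T0 _ _ (L2_itv T0).1 => t tI; by rewrite indic_itv in_itv/= (negbTE tI).
apply: le_lt_trans (integral_le_ae (g := fun t => \1_I t + nrm2 lb (q u t)) _ _ l1 _) (ltry _) => //.
  by move=> t; rewrite addr_ge0 ?nrm2_ge0// indicE.
apply: aeS (@fub_ae1 _ _ (measurableTypeR R) E R mu lb (fun t x => q u t x ^+ 2) lu.2) => t lt.
rewrite normH_slice// gee0_abs ?poweR_ge0// /nsq -intE// poweR_EFin powR12_sqrt; last exact: nrm2_ge0.
rewrite lee_fin -/(nrm2 _ _); have [tT|tT] := boolP (0 < t < T); last first.
  rewrite q_out// /nrm2; under eq_Rintegral do rewrite expr0n/=.
  by rewrite int0 sqrtr0 addr0 indicE.
rewrite indic_itv in_itv/= tT -/(nrm _ _) -nrm_sqr.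
have := sqr_ge0 (nrm lb (q u t) - 1); have := nrm_ge0 lb (q u t).
have -> : (true%:R : R) = 1 by [].
by move: (nrm lb (q u t)) => a; nra.
Qed.

Lemma lebesgue_setT_gt0 : (0 < mu [set: measurableTypeR R])%E.
Proof.
apply: lt_le_trans (_ : mu I <= _)%E; last by apply: le_measure; rewrite ?inE.
by rewrite lebesgue_measure_itv/= lte_fin T0 -EFinB lte_fin subr0.
Qed.

Lemma normLp_oo_bound (nX : (E -> R) -> \bar R) u : (forall w, 0 <= nX w)%E ->
  (normLp T +oo nX u < +oo)%E ->
  exists2 M : R, 0 <= M & ae_time T (fun t => (nX (u t) <= M%:E)%E).
Proof.
move=> nX0; rewrite /normLp unlock lebesgue_setT_gt0 => fin.
set f := (abse \o _) in fin; have ae_f := ess_sup_ge mu f.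
have [M eM] : exists M : R, (ess_sup mu f <= M%:E)%E.
  move: (ess_sup mu f) fin {ae_f} => [r _|//|_]; first by exists r.
  by exists 0; rewrite leNye.
exists (Num.max M 0); first by rewrite le_max lexx orbT.
apply: aeS ae_f => t ft tI; have : (f t <= (Num.max M 0)%:E)%E.
  by apply: le_trans ft _; apply: le_trans eM _; rewrite lee_fin le_max lexx.
by rewrite /f /= /patch mem_set// gee0_abs.
Qed.

Lemma normLp_oo_le (nX : (E -> R) -> \bar R) u (M : R) : (forall w, 0 <= nX w)%E -> 0 <= M ->
  ae_time T (fun t => (nX (u t) <= M%:E)%E) -> (normLp T +oo nX u <= M%:E)%E.
Proof.
move=> nX0 M0 H; rewrite /normLp unlock lebesgue_setT_gt0; apply/ess_supP.
apply: aeS H => t H; rewrite /= /patch; case: ifPn => tI; last by rewrite abse0 lee_fin.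
by rewrite gee0_abs//; apply: H; rewrite inE in tI.
Qed.

Lemma normLp_2_le (nX : (E -> R) -> \bar R) u (m : R -> R) (A : R) : (forall w, 0 <= nX w)%E ->
  L1 mu m -> (forall t, 0 <= m t) -> ae_time T (fun t => (nX (u t) <= (Num.sqrt (m t))%:E)%E) ->
  \int[mu]_t m t <= A ->
  (normLp T 2%:E nX u <= (Num.sqrt A)%:E)%E.
Proof.
move=> nX0 lm m0 H mA; rewrite /normLp unlock.
have A0 : 0 <= A by apply: le_trans mA; exact: int_ge0.
rewrite -(powR12_sqrt A0) -poweR_EFin; apply: gt0_ler_poweR.
- by rewrite invr_ge0.
- by rewrite in_itv/= leey andbT; apply: integral_ge0 => x _; exact: poweR_ge0.
- by rewrite in_itv/= leey andbT lee_fin.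
apply: le_trans (_ : (\int[mu]_t m t)%:E <= _)%E; last by rewrite lee_fin.
apply: integral_le_ae => //; first by move=> t; exact: poweR_ge0.
apply: aeS H => t H; rewrite /= /patch; case: ifPn => tI; last first.
  by rewrite abse0 poweR0r// lee_fin.
rewrite gee0_abs//; apply: le_trans (_ : (Num.sqrt (m t))%:E `^ 2 <= _)%E.
  apply: gt0_ler_poweR => //; rewrite ?in_itv/= ?leey ?andbT ?lee_fin//.
  by apply: H; rewrite inE in tI.
by rewrite poweR_EFin -[2]/(2%:R) powR_mulrn// sqr_sqrtr.
Qed.

(** The slices are bounded in L^2 and vanish outside a bounded interval. *)
Lemma LQ2_of_bound (F : R -> E -> R) (K : R) : measurable_fun setT (unc F) ->
  (forall x, supported_in 0 T (F ^~ x)) ->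
  (\forall t \ae mu, L2 lb (F t) /\ nrm2 lb (F t) <= K) -> L2 mm (unc F).
Proof.
move=> mF sF H; split => //.
apply: (@fub_L1I _ _ (measurableTypeR R) E R mu lb (fun t x => F t x ^+ 2)).
- exact: measurable_funX.
- by apply: aeS H => t [[]].
- apply: (L1_le_ae (g := fun t : measurableTypeR R => K * \1_I t)).
  + apply: (@measurable_int_param _ _ (measurableTypeR R) E R lb (fun t x => `|F t x ^+ 2|)).
    by apply: measurableT_comp => //; exact: measurable_funX.
  + apply: L1Z; apply: L2_L1_time T0 _ _ (L2_itv T0).1 => t tI.
    by rewrite indic_itv in_itv/= (negbTE tI).
  + apply: aeS H => t [_ FK].
    rewrite (_ : (fun x => `|F t x ^+ 2|) = fun x => F t x ^+ 2); last first.
      by apply/funext => x; rewrite ger0_norm// sqr_ge0.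
    rewrite -/(nrm2 _ _) ger0_norm ?nrm2_ge0//.
    rewrite indic_itv in_itv/=; have [_|tT] := boolP (0 < t < T); first by rewrite mulr1.
    rewrite mulr0 /nrm2; under eq_Rintegral do rewrite sF// expr0n/=.
    by rewrite int0.
Qed.

Lemma normH_ge0 w : (0 <= normH Om w)%E.
Proof. exact: Lnorm_ge0. Qed.

Lemma normV_ge0 w : (0 <= normV Om w)%E.
Proof. exact: poweR_ge0. Qed.

(** The norm of the gradient is at most the norm in V, which is bounded in time;
    joint measurability is part of being a curve in V. *)
Lemma inLpV_grad u : inLpV Om T +oo%E u -> LQ2 u /\ exists g : 'I_N -> R -> E -> R,
  (forall i, measurable_Q Om T (g i) /\ LQ2 (g i)) /\
  \forall t \ae mu, 0 < t < T -> inV Om (u t) /\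
     forall i, \forall x \ae lb, q (g i) t x = e (wpd Om i (u t)) x.
Proof.
move=> [mu_ Vu Hg fin].
have [M M0 HM] := normLp_oo_bound normV_ge0 fin.
have /choice[g Hg'] : forall i, exists g : R -> E -> R, measurable_Q Om T g /\
    ae_Q Om T (fun t x => g t x = wpd Om i (u t) x).
  by move=> i; have [g m a] := Hg i; exists g.
have aeM : \forall t \ae mu, 0 < t < T -> inV Om (u t) /\
   nrm2 lb (e (u t)) + \sum_i nrm2 lb (e (wpd Om i (u t))) <= M ^+ 2.
  apply: aeS2 Vu HM => t V1 V2 tT; have tI : `]0, T[%classic t by rewrite /= in_itv.
  have Vt := V1 tI; have H := V2 tI; split => //; move: V2 => _.
  have s0 : 0 <= nrm2 lb (e (u t)) + \sum_i nrm2 lb (e (wpd Om i (u t))).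
    by rewrite addr_ge0 ?nrm2_ge0// sumr_ge0// => i _; exact: nrm2_ge0.
  move: H; rewrite (normVE Om_open Vt) lee_fin => h.
  by rewrite -(sqr_sqrtr s0) lerXn2r// nnegrE.
have aeg i : \forall t \ae mu, 0 < t < T -> \forall x \ae lb, q (g i) t x = e (wpd Om i (u t)) x.
  apply: aeS (Hg' i).2 => t H tT; have := H; rewrite /= in_itv => /(_ tT)/ae_e.
  by apply: aeS => x; rewrite q_in.
have bnd i : LQ2 (g i).
  apply: (LQ2_of_bound (K := M ^+ 2)); [exact: (measurable_q (Hg' i).1)|exact: q_supp|].
  apply: aeS2 aeM (aeg i) => t H1 H2; have [tT|tT] := boolP (0 < t < T); last first.
    rewrite q_out//; split; first exact: L2_0.
    by rewrite /nrm2; under eq_Rintegral do rewrite expr0n/=; rewrite int0 sqr_ge0.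
  have [Vt le] := H1 tT; have {}H2 := H2 tT; have [lw _] := wpdP Om_open i Vt.
  have mg := measurable_q_slice t (Hg' i).1; split; first exact: L2_ae mg H2 lw.
  rewrite (nrm2_ae mg lw.1 H2); apply: le_trans le.
  by rewrite (bigD1 i)//= addrCA lerDl addr_ge0 ?nrm2_ge0// sumr_ge0// => j _; exact: nrm2_ge0.
split; last first.
  exists g; split; first by move=> i; split => //; exact: (Hg' i).1.
  have aeg' : \forall t \ae mu, forall i, 0 < t < T -> \forall x \ae lb, q (g i) t x = e (wpd Om i (u t)) x.
    exact: (ae_forall aeg).
  by apply: aeS2 aeM aeg' => t H1 H2 tT; split; [have [] := H1 tT|move=> i; exact: H2].
apply: (LQ2_of_bound (K := M ^+ 2)); [exact: measurable_q|exact: q_supp|].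
apply: aeS aeM => t H1; have [tT|tT] := boolP (0 < t < T); last first.
  rewrite q_out//; split; first exact: L2_0.
  by rewrite /nrm2; under eq_Rintegral do rewrite expr0n/=; rewrite int0 sqr_ge0.
have [Vt le] := H1 tT; rewrite q_in//; split; first exact: (inV_L2 Om_open Vt).
by apply: le_trans le; rewrite lerDl sumr_ge0// => j _; exact: nrm2_ge0.
Qed.

End time_norms.

(** * Time derivatives and initial values *)

Section time_derivatives.
Context {R : realType} {N : nat}.
Variables (Om : set 'rV[R]_N) (T : R).
Hypotheses (hN : (0 < N)%N) (Om_open : open Om) (Om_bounded : bounded_set Om) (T0 : 0 < T).
Local Notation E := 'rV[R]_N.
Local Notation lb := (leb N).
Local Notation e := (ext Om).
Local Notation mu := (@lebesgue_measure R).
Local Notation mm := (mu \x lb)%E.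
Local Notation unc F := (fun z : measurableTypeR R * E => F z.1 z.2).
Local Notation q := (q Om T).
Implicit Types (u v U V : R -> E -> R).

Let qs u : forall x, supported_in 0 T (q u ^~ x). Proof. by move=> x; exact: q_supp. Qed.

Definition wdt U V := forall eta, test_fun1 `]0, T[%classic eta ->
  \forall x \ae lb, \int[mu]_t (U t x * derive1 eta t) = - \int[mu]_t (V t x * eta t).

Lemma weak_dtP u v : weak_dt Om T u v <-> wdt (q u) (q v).
Proof.
have qE w (f : R -> R) x : Om x ->
    \int[mu]_(t in `]0, T[) (w t x * f t) = \int[mu]_t (q w t x * f t).
  move=> xO; rewrite int_ext; apply: eq_Rintegral => t _.
  by rewrite /ext /q ext_in// mulrAC.
split=> H eta te; have := H eta te; apply: aeS => x.
  have [xO|xO] := pselect (Om x); first by move=> /(_ xO); rewrite !qE.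
  move=> _; rewrite (_ : (fun t => _) = fun=> 0); last by apply/funext => t; rewrite /q ext_out// !mul0r.
  rewrite int0 (_ : (fun t => _) = fun=> 0) ?int0 ?oppr0//.
  by apply/funext => t; rewrite /q ext_out// !mul0r.
by move=> h xO; rewrite !qE.
Qed.

Lemma smooth1_bounded_time (f : R -> R) : smooth1 f ->
  exists2 M : R, 0 < M & forall t, 0 < t < T -> `|f t| <= M.
Proof.
move=> sf; have [M M0 HM] := compact_continuous_bounded (@segment_compact R 0 T) (continuous_smooth1 sf).
by exists M => // t /andP[h1 h2]; apply: HM; rewrite /= in_itv/= !ltW.
Qed.

Lemma L1_mul_smooth1 (U : R -> E -> R) (f : R -> R) : L1 mm (unc U) -> (forall x, supported_in 0 T (U ^~ x)) ->
  smooth1 f -> L1 mm (unc (fun t x => U t x * f t)).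
Proof.
move=> lU sU sf; have [M M0 HM] := smooth1_bounded_time sf.
apply: (L1_M_bounded_supp (M := M)) => //.
  by apply: measurable_fun_fst; exact: measurable_smooth1.
by move=> z Uz; apply: HM; apply: contraNT Uz => tI; rewrite sU.
Qed.

Lemma wdt_lin (c : R) U1 V1 U2 V2 :
  (forall x, supported_in 0 T (U1 ^~ x)) -> (forall x, supported_in 0 T (V1 ^~ x)) ->
  (forall x, supported_in 0 T (U2 ^~ x)) -> (forall x, supported_in 0 T (V2 ^~ x)) ->
  L1 mm (unc U1) -> L1 mm (unc V1) -> L1 mm (unc U2) -> L1 mm (unc V2) ->
  wdt U1 V1 -> wdt U2 V2 -> wdt (fun t x => U1 t x + c * U2 t x) (fun t x => V1 t x + c * V2 t x).
Proof.
move=> sU1 sV1 sU2 sV2 lU1 lV1 lU2 lV2 w1 w2 eta te; have se : smooth1 eta by case: te.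
have sd := smooth1_derive1 se.
have A1 := @fub_ae2 _ _ (measurableTypeR R) E R mu lb _ (L1_mul_smooth1 lU1 sU1 sd).
have A2 := @fub_ae2 _ _ (measurableTypeR R) E R mu lb _ (L1_mul_smooth1 lU2 sU2 sd).
have B1 := @fub_ae2 _ _ (measurableTypeR R) E R mu lb _ (L1_mul_smooth1 lV1 sV1 se).
have B2 := @fub_ae2 _ _ (measurableTypeR R) E R mu lb _ (L1_mul_smooth1 lV2 sV2 se).
apply: aeS2 (aeS2 (fun x a b => conj a b) (aeS2 (fun x a b => conj a b) A1 A2) (aeS2 (fun x a b => conj a b) B1 B2))
  (aeS2 (fun x a b => conj a b) (w1 eta te) (w2 eta te)) => x [[a1 a2] [b1 b2]] [e1 e2].
rewrite (_ : (fun t => (U1 t x + c * U2 t x) * derive1 eta t) = fun t => U1 t x * derive1 eta t + c * (U2 t x * derive1 eta t)); last first.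
  by apply/funext => t; ring.
rewrite (_ : (fun t => (V1 t x + c * V2 t x) * eta t) = fun t => V1 t x * eta t + c * (V2 t x * eta t)); last first.
  by apply/funext => t; ring.
rewrite (intD a1 (L1Z c a2)) (intZ c a2) (intD b1 (L1Z c b2)) (intZ c b2) e1 e2; ring.
Qed.

Lemma wdt_unique U V V' : (forall x, supported_in 0 T (V ^~ x)) -> (forall x, supported_in 0 T (V' ^~ x)) ->
  L1 mm (unc V) -> L1 mm (unc V') -> wdt U V -> wdt U V' -> \forall z \ae mm, V z.1 z.2 = V' z.1 z.2.
Proof.
move=> sV sV' lV lV' w w'.
have lB : L1 mm (unc (fun t x => V t x - V' t x)) by exact: L1B.
have sB x : supported_in 0 T ((fun t x => V t x - V' t x) ^~ x).
  by move=> t tI /=; rewrite sV// sV'// subrr.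
have := @time_unique _ E R lb (fun t x => V t x - V' t x) 0 T lB sB.
move=> H; apply: aeS (H _) => [z /eqP|eta te]; first by rewrite subr_eq0 => /eqP.
have se : smooth1 eta by case: te.
have B1 := @fub_ae2 _ _ (measurableTypeR R) E R mu lb _ (L1_mul_smooth1 lV sV se).
have B2 := @fub_ae2 _ _ (measurableTypeR R) E R mu lb _ (L1_mul_smooth1 lV' sV' se).
apply: aeS2 (aeS2 (fun x a b => conj a b) B1 B2) (aeS2 (fun x a b => conj a b) (w eta te) (w' eta te)).
move=> x [b1 b2] [e1 e2]; rewrite (_ : (fun t => _) = fun t => V t x * eta t - V' t x * eta t); last first.
  by apply/funext => t; rewrite mulrBl.
by rewrite (intB b1 b2); apply/eqP; rewrite subr_eq0 -eqr_opp -e1 -e2.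
Qed.

Lemma dtP u : (exists v, is_dt Om T u v) -> is_dt Om T u (dt Om T u).
Proof. by move=> ex; exact: (xgetPex (fun _ => fun=> 0) ex). Qed.

(** The operator dt selects some weak derivative; its uniqueness makes the
    selection linear up to null sets. *)
Lemma dt_lin c u1 u2 v1 v2 : measurable_Q Om T v1 -> measurable_Q Om T v2 ->
  LQ1 Om T u1 -> LQ1 Om T u2 -> LQ2 Om T v1 -> LQ2 Om T v2 ->
  is_dt Om T u1 v1 -> is_dt Om T u2 v2 ->
  let u := fun t x => u1 t x + c * u2 t x in
  measurable_Q Om T (dt Om T u) /\ LQ1 Om T (dt Om T u) /\
  \forall z \ae mm, q (dt Om T u) z.1 z.2 = q v1 z.1 z.2 + c * q v2 z.1 z.2.
Proof.
move=> m1 m2 lu1 lu2 lv1 lv2 [_ /weak_dtP w1] [_ /weak_dtP w2] u.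
have lv1' := LQ2_LQ1 Om_bounded T0 lv1; have lv2' := LQ2_LQ1 Om_bounded T0 lv2.
have qE w1' w2' : q (fun t x => w1' t x + c * w2' t x) = fun t x => q w1' t x + c * q w2' t x.
  by apply/funext => t; apply/funext => x; rewrite q_add q_scale.
have wu : wdt (q u) (q (fun t x => v1 t x + c * v2 t x)).
  by rewrite !qE; apply: wdt_lin => //; exact: q_supp.
have mv : measurable_Q Om T (fun t x => v1 t x + c * v2 t x).
  by apply: measurable_QD => //; exact: measurable_QZ.
have lv : LQ2 Om T (fun t x => v1 t x + c * v2 t x).
  by rewrite /LQ2 qE; apply: L2D => //; exact: L2Z.
have [idt wd] : is_dt Om T u (dt Om T u).
  apply: dtP; exists (fun t x => v1 t x + c * v2 t x); split; first exact: LQ2_inLpH1.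
  exact/weak_dtP.
have ld := inLpH1_LQ1 Om_open Om_bounded idt.
split; first by case: idt.
split => //; have := wdt_unique (@qs _) (@qs _) ld (LQ2_LQ1 Om_bounded T0 lv) ((weak_dtP _ _).1 wd) wu.
by rewrite qE.
Qed.

Lemma prim_small (p : R -> R) (t_ : nat -> R) : L1 mu p -> supported_in 0 T p ->
  (forall n, 0 < t_ n < T / n.+1%:R) -> prim p (t_ n) @[n --> \oo] --> 0.
Proof.
move=> lp sp tn; have -> : (fun n => prim p (t_ n)) = fun n => \int[mu]_s (p s * \1_(`]-oo, t_ n]%classic) s).
  by apply/funext => n; rewrite primE.
rewrite -(@int0 _ _ R mu).
have mI (t : R) : measurable (`]-oo, t]%classic : set (measurableTypeR R)) by exact: measurable_itv.
apply: (@int_dominated _ _ R mu (fun n s => p s * \1_(`]-oo, t_ n]%classic) s) (fun=> 0) (fun s => `|p s|)).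
- by move=> n; apply: measurable_funM; [exact: L1_meas lp|exact: measurable_indic].
- exact: measurable_cst.
- apply: aeW => s; have [s0|s0] := leP s 0.
    rewrite sp; last by rewrite ltNge s0.
    by rewrite (_ : (fun n => _) = fun=> 0); [exact: cvg_cst|apply/funext => n; rewrite mul0r].
  apply: cvg_near_cst; exists (Num.truncn (T / s)) => // n /= nn.
  rewrite indic_itv in_itv/= leNgt (_ : t_ n < s) ?mulr0//.
  have /andP[_ h] := tn n; apply: lt_le_trans h _.
  rewrite ler_pdivrMr// mulrC -ler_pdivrMr//; apply/ltW; apply: lt_le_trans (truncnS_gt _) _.
  by rewrite ler_nat ltnS.
- by move=> n s; rewrite normrM ler_piMr// ger0_norm// indicE lern1 leq_b1.
- exact: L1_norm.
Qed.

(** The initial value in the sense of the continuous representative is the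
    constant of integration: along good times tending to 0 the continuous
    representative tends to the first and the primitive tends to 0. *)
Lemma time_bar u v (u0 : E -> R) : LQ1 Om T u -> LQ1 Om T v -> weak_dt Om T u v -> L2 lb (e u0) ->
  initial_value Om T u u0 ->
  \forall t \ae mu, 0 < t < T -> \forall x \ae lb, e (u t) x = bar (e u0) (q v) t x.
Proof.
move=> lu lv /weak_dtP wu lu0 [ct [Hct ctu ctc ct0]].
have [c lc H] := time_repr T0 lu lv (@qs _) (@qs _) wu.
have Hs := @fub_ae _ _ (measurableTypeR R) E R mu lb
  (fun t x => 0 < t < T -> q u t x = c x + prim (q v ^~ x) t) H.
suff ce : \forall x \ae lb, c x = e u0 x.
  apply: aeS Hs => t Ht tT; apply: aeS2 ce Ht => x cx /(_ tT); rewrite q_in// => ->.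
  by rewrite /bar cx.
have [k lk kE] := cylinder_weight T Om_bounded.
have e_k (w : E -> R) x : e w x * k x = e w x.
  have T2 : 0 < T / 2 < T by rewrite divr_gt0//= half_lt.
  by have := kE (fun _ => w) (T / 2) x; rewrite q_in.
have lu01 : L1 lb (e u0).
  by apply: (L1_eq _ (L2M lu0 lk)) => x; rewrite e_k.
have mH n : exists t : R, 0 < t < T / n.+1%:R /\
    (\forall x \ae lb, e (u t) x = c x + prim (q v ^~ x) t) /\
    (\forall x \ae lb, e (ct t) x = e (u t) x).
  have tn : 0 < T / n.+1%:R by rewrite divr_gt0.
  have [t tI [h1 h2]] := ae_exists_itv tn (aeS2 (fun t a b => conj a b) Hs ctu).
  have tT : 0 < t < T.
    have /andP[a b] := tI; rewrite a /=; apply: lt_le_trans b _.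
    rewrite ler_pdivrMr//; apply: ler_peMr; [exact: ltW|by rewrite ler1n].
  exists t; split => //; split.
    by apply: aeS h1 => x /(_ tT); rewrite q_in.
  by apply/ae_e; apply: h2; rewrite /= in_itv.
have [t_ Ht] := choice mH.
have tn n : 0 < t_ n < T / n.+1%:R by have [] := Ht n.
have mp t : measurable_fun setT (fun x => prim (q v ^~ x) t).
  exact: (@measurable_curry1 _ _ (measurableTypeR R) E R (fun t x => prim (q v ^~ x) t) t (measurable_prim (L1_meas lv))).
have P0 : \int[lb]_x `|prim (q v ^~ x) (t_ n)| @[n --> \oo] --> 0.
  rewrite -(@int0 _ _ R lb).
  have aex := @fub_ae2 _ _ (measurableTypeR R) E R mu lb (q v) lv.
  apply: (int_dominated_ae (g := fun x => \int[mu]_s `|q v s x|)).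
  - by move=> n; apply: measurableT_comp => //; exact: mp.
  - exact: measurable_cst.
  - apply: aeS aex => x lx; rewrite -(normr0 R); apply: cvg_norm.
    exact: (prim_small lx (@qs _ _) tn).
  - by apply: aeS aex => x lx n; rewrite normr_id; exact: prim_le_norm.
  - exact: (@fub_L1_2 _ _ (measurableTypeR R) E R mu lb (fun s x => `|q v s x|) (L1_norm lv)).
have lpr n : L1 lb (fun x => `|prim (q v ^~ x) (t_ n)|).
  apply: (L1_le_ae _ (@fub_L1_2 _ _ (measurableTypeR R) E R mu lb (fun s x => `|q v s x|) (L1_norm lv))).
    by apply: measurableT_comp => //; exact: mp.
  apply: aeS (@fub_ae2 _ _ (measurableTypeR R) E R mu lb (q v) lv) => x lx.
  by rewrite normr_id; exact: prim_le_norm.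
have ld : L1 lb (fun x => `|c x - e u0 x|) by apply: L1_norm; exact: L1B.
suff i0 : \int[lb]_x `|c x - e u0 x| = 0.
  have := int_eq0 ld (fun x => normr_ge0 _) i0.
  by apply: aeS => x /normr0_eq0/eqP; rewrite subr_eq0 => /eqP.
apply/eqP; rewrite eq_le int_ge0 ?andbT//; apply/ler_addgt0Pr => eps eps0; rewrite add0r.
have k0 := nrm_ge0 lb k.
pose del := eps / (2 * (nrm lb k + 1)).
have k1 : 0 < 2 * (nrm lb k + 1) by rewrite mulr_gt0// ltr_wpDl.
have del0 : 0 < del by rewrite divr_gt0.
have : \forall t \near within `[0, T]%classic (nbhs 0), (normH Om (fun x => ct t x - ct 0 x)%R < del%:E)%E.
  have s0 : `[0, T]%classic (0 : R) by rewrite /= in_itv/= lexx ltW.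
  apply: (ctc 0 s0 [set y | (y < del%:E)%E]).
  by apply: open_nbhs_nbhs; split; [exact: open_ereal_lt_ereal|rewrite /= lte_fin].
rewrite near_withinE => /nbhs_ballP[r /= r0 Hr].
have [n1 _ Hn1] : \forall n \near \oo, \int[lb]_x `|prim (q v ^~ x) (t_ n)| < eps / 2.
  have := P0 => /cvgrPdist_lt/(_ (eps / 2)); rewrite divr_gt0// => /(_ isT).
  by apply: filterS => n; rewrite sub0r normrN ger0_norm// int_ge0.
pose n := maxn n1 (Num.truncn (T / r)).
have tr : t_ n < r.
  have /andP[_ h] := tn n; apply: lt_trans h _; rewrite ltr_pdivrMr// mulrC -ltr_pdivrMr//.
  by apply: lt_le_trans (truncnS_gt _) _; rewrite ler_nat ltnS leq_maxr.
have tT : 0 < t_ n < T.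
  have /andP[a b] := tn n; rewrite a /=; apply: lt_le_trans b _.
  rewrite ler_pdivrMr//; apply: ler_peMr; [exact: ltW|by rewrite ler1n].
have /andP[t0 t1] := tT.
have tI : `[0, T]%classic (t_ n) by rewrite /= in_itv/= !ltW.
have I0 : `[0, T]%classic (0 : R) by rewrite /= in_itv/= lexx ltW.
have := Hr (t_ n); rewrite /ball/= sub0r normrN gtr0_norm// => /(_ tr tI) hn.
have lct s : `[0, T]%classic s -> L2 lb (e (ct s)) by move=> /Hct/(inHP Om_open).
have lB : L2 lb (e (fun x => ct (t_ n) x - ct 0 x)) by rewrite e_sub; apply: L2B; exact: lct.
rewrite (normHE lB) lte_fin in hn.
have [_ [h1 h2]] := Ht n.
have l1 : L1 lb (fun x => `|e (fun x => ct (t_ n) x - ct 0 x) x| * `|k x|).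
  by apply: L2M; exact: L2_abs.
apply: le_trans (_ : \int[lb]_x (`|e (fun x => ct (t_ n) x - ct 0 x) x| * `|k x| + `|prim (q v ^~ x) (t_ n)|) <= _).
  apply: int_le => //; first exact: L1D.
  apply: aeS2 (aeS2 (fun x a b => conj a b) h1 h2) ((ae_e Om (ct 0) u0).1 ct0) => x [a1 a2] a3.
  rewrite -normrM e_k e_sub a2 a1 a3.
  rewrite (_ : c x - e u0 x = (c x + prim (q v ^~ x) (t_ n) - e u0 x) - prim (q v ^~ x) (t_ n)); last by ring.
  exact: ler_normB.
rewrite intD//.
have cs : \int[lb]_x (`|e (fun x => ct (t_ n) x - ct 0 x) x| * `|k x|) <= eps / 2.
  apply: le_trans (ler_norm _) _; apply: le_trans (cauchy_schwarz (L2_abs lB) (L2_abs lk)) _.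
  have nabs (f : E -> R) : nrm lb (fun x => `|f x|) = nrm lb f.
    by congr Num.sqrt; apply: eq_Rintegral => x _; rewrite real_normK ?num_real.
  rewrite !nabs; apply: le_trans (_ : del * nrm lb k <= _); first by rewrite ler_wpM2r// ltW.
  apply: le_trans (_ : del * (nrm lb k + 1) <= _); first by rewrite ler_pM2l// lerDl.
  rewrite le_eqVlt /del; apply/orP; left; apply/eqP; field; by rewrite gt_eqF// ltr_wpDl.
have := Hn1 n (leq_maxl _ _); move: cs; lra.
Qed.

Lemma prim_int_mul V (psi : E -> R) (M : R) t : L1 mm (unc V) -> measurable_fun setT psi ->
  (forall x, `|psi x| <= M) ->
  \int[lb]_x (prim (V ^~ x) t * psi x) = prim (fun s => \int[lb]_x (V s x * psi x)) t.
Proof.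
move=> lV mpsi bpsi.
have lF : L1 mm (unc (fun s x => V s x * psi x)).
  by apply: (L1_M_bounded (M := M)) => //; exact: measurable_fun_snd.
have [l1 <-] := @prim_int _ _ R lb (fun s x => V s x * psi x) t lF; apply: int_ae.
- apply: measurable_funM => //.
  exact: (@measurable_curry1 _ _ (measurableTypeR R) E R (fun t x => prim (V ^~ x) t) t (measurable_prim (L1_meas lV))).
- exact: L1_meas l1.
- apply: aeS (@fub_ae2 _ _ (measurableTypeR R) E R mu lb V lV) => x lx.
  rewrite mulrC -primZ//; congr prim; apply/funext => s; exact: mulrC.
Qed.

Lemma bar_out (c : E -> R) v t x : ~ Om x -> bar (e c) (q v) t x = 0.
Proof.
move=> xO; rewrite /bar ext_out// add0r primE (_ : (fun s => _) = fun=> 0) ?int0//.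
by apply/funext => s; rewrite /q ext_out// !mul0r.
Qed.

Lemma e_bar (c : E -> R) v t : e (bar (e c) (q v) t) = bar (e c) (q v) t.
Proof.
by apply/funext => x; have [xO|xO] := pselect (Om x); [rewrite ext_in|rewrite ext_out// bar_out].
Qed.

(** Weak derivatives in space commute with primitives in time, by Fubini's
    theorem against a test function of space. *)
Lemma weak_pd_bar i (c : E -> R) v (gc : E -> R) g : LQ2 Om T v -> LQ2 Om T g ->
  L2 lb (e c) -> L2 lb (e gc) -> weak_pd Om i c gc ->
  (\forall t \ae mu, 0 < t < T -> weak_pd Om i (v t) (g t)) ->
  forall t, weak_pd Om i (bar (e c) (q v) t) (bar (e gc) (q g) t).
Proof.
move=> lv lg lc lgc /weak_pdP wc wv t; apply/weak_pdP => psi tp.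
have tpd := test_pd i tp; have sp : smooth psi by case: tp.
have lv1 := LQ2_LQ1 Om_bounded T0 lv; have lg1 := LQ2_LQ1 Om_bounded T0 lg.
have [M M0 HM] := test_bounded tp; have [M' M0' HM'] := test_bounded tpd.
have mpsi := measurable_smooth sp.
have mpd : measurable_fun setT (pd i psi) by apply: measurable_smooth; case: tpd.
have [lp _] := L2_prim T0 (@qs v) lv1 lv t.
have [lpg _] := L2_prim T0 (@qs g) lg1 lg t.
have lpsi := test_L2 Om_bounded tp; have lpd := test_L2 Om_bounded tpd.
rewrite !e_bar /bar; under eq_Rintegral do rewrite mulrDl.
under [in RHS]eq_Rintegral do rewrite mulrDl.
rewrite (intD (L2M lc lpd) (L2M lp lpd)) (intD (L2M lgc lpsi) (L2M lpg lpsi)) wc// opprD; congr (_ + _).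
rewrite (prim_int_mul t lv1 mpd HM') (prim_int_mul t lg1 mpsi HM).
have lF : L1 mm (unc (fun s x => q v s x * pd i psi x)).
  by apply: (L1_M_bounded (M := M')) => //; exact: measurable_fun_snd.
have lG : L1 mm (unc (fun s x => q g s x * psi x)).
  by apply: (L1_M_bounded (M := M)) => //; exact: measurable_fun_snd.
have l1 := @fub_L1_1 _ _ (measurableTypeR R) E R mu lb (fun s x => q v s x * pd i psi x) lF.
have l2 := @fub_L1_1 _ _ (measurableTypeR R) E R mu lb (fun s x => q g s x * psi x) lG.
rewrite -mulN1r -primZ//; apply: prim_ae; [exact: L1_meas l1|exact: L1_meas (L1Z _ l2)|].
apply: aeS wv => s ws; have [sT|sT] := boolP (0 < s < T).
  by rewrite mulN1r q_in// q_in//; have /weak_pdP -> := ws sT.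
rewrite !q_out// mulN1r; under eq_Rintegral do rewrite mul0r.
by under [in RHS]eq_Rintegral do rewrite mul0r; rewrite int0 oppr0.
Qed.

End time_derivatives.

(** * The two equations tested at a fixed time *)

(** The square of the norm of f plus or minus g / (2 s) is nonnegative. *)
Lemma young d (X : measurableType d) (R : realType) (m : {measure set X -> \bar R}) (s : R) (f g : X -> R) :
  0 < s -> L2 m f -> L2 m g -> `|\int[m]_x (f x * g x)| <= s * nrm2 m f + (4 * s)^-1 * nrm2 m g.
Proof.
move=> s0 lf lg; have H c := nrm2D_sq c lf lg.
have p c : 0 <= nrm2 m f + 2 * c * (\int[m]_x (f x * g x)) + c ^+ 2 * nrm2 m g by rewrite -H nrm2_ge0.
have := p (2 * s)^-1; have := p (- (2 * s)^-1).
rewrite (_ : nrm2 m f + _ + _ = s^-1 * (s * nrm2 m f + (4 * s)^-1 * nrm2 m g - \int[m]_x (f x * g x))); last first.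
  by field; rewrite gt_eqF.
rewrite [in X in _ -> X -> _](_ : nrm2 m f + _ + _ = s^-1 * (s * nrm2 m f + (4 * s)^-1 * nrm2 m g + \int[m]_x (f x * g x))); last first.
  by field; rewrite gt_eqF.
rewrite !pmulr_rge0 ?invr_gt0// => h1 h2.
by rewrite ler_norml; apply/andP; split; lra.
Qed.

Section curves.
Context d (X : measurableType d) (R : realType).
Variable m2 : {sigma_finite_measure set X -> \bar R}.
Variable T : R.
Hypothesis T0 : 0 < T.
Local Notation mu := (@lebesgue_measure R).
Local Notation mm := (mu \x m2)%E.
Local Notation unc F := (fun z : measurableTypeR R * X => F z.1 z.2).
Implicit Types U V : R -> X -> R.

(** The form in which H^1(0,T;L^2) enters the energy method: for almost every
    time, U is the primitive of V with initial value c. *)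
Record curve U V (c : X -> R) : Prop := Curve {
  curve_supp : forall x, supported_in 0 T (V ^~ x) ;
  curve_L2u : L2 mm (unc U) ;
  curve_L1 : L1 mm (unc V) ;
  curve_L2 : L2 mm (unc V) ;
  curve_L2c : L2 m2 c ;
  curve_bar : \forall t \ae mu, 0 < t < T -> \forall x \ae m2, U t x = bar c V t x }.

Lemma bar_lin (a : R) V1 V2 c1 c2 : L1 mm (unc V1) -> L1 mm (unc V2) ->
  forall t, \forall x \ae m2, bar (fun x => c1 x + a * c2 x) (fun s x => V1 s x + a * V2 s x) t x =
    bar c1 V1 t x + a * bar c2 V2 t x.
Proof.
move=> l1 l2 t; apply: aeS2 (@fub_ae2 _ _ (measurableTypeR R) X R mu m2 V1 l1)
  (@fub_ae2 _ _ (measurableTypeR R) X R mu m2 V2 l2) => x h1 h2.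
by rewrite /bar primD//; [rewrite primZ//; ring|exact: L1Z].
Qed.

Lemma curve_lin (a : R) U1 V1 c1 U2 V2 c2 : curve U1 V1 c1 -> curve U2 V2 c2 ->
  curve (fun t x => U1 t x + a * U2 t x) (fun t x => V1 t x + a * V2 t x) (fun x => c1 x + a * c2 x).
Proof.
move=> [s1 lu1 l1 q1 k1 b1] [s2 lu2 l2 q2 k2 b2]; split.
- by move=> x t tI /=; rewrite s1// s2// mulr0 addr0.
- by apply: L2D => //; exact: L2Z.
- by apply: L1D => //; exact: L1Z.
- by apply: L2D => //; exact: L2Z.
- by apply: L2D => //; exact: L2Z.
- apply: aeS2 b1 b2 => t h1 h2 tI; have H := @bar_lin a V1 V2 c1 c2 l1 l2 t.
  by apply: aeS2 (aeS2 (fun x a b => conj a b) (h1 tI) (h2 tI)) H => x [-> ->] ->.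
Qed.

Lemma curve_nrm2_le U V c : curve U V c ->
  \forall t \ae mu, 0 < t < T -> nrm2 m2 (U t) <= 2 * nrm2 m2 c + 2 * T * \int[mu]_s nrm2 m2 (V s).
Proof.
move=> [sV lU l1 lV lc bU].
have mU t : measurable_fun setT (U t).
  by exact: (@measurable_curry1 _ _ (measurableTypeR R) X R U t lU.1).
apply: aeS bU => t bt tI; rewrite (nrm2_ae (mU t) (L2_bar T0 lc sV l1 lV t).1 (bt tI)).
apply: le_trans (nrm2_bar_le T0 lc sV l1 lV t) _; rewrite lerD2l ler_pM2l ?mulr_gt0//.
by apply: prim_le_int; [exact: nrm2_time|move=> s; exact: nrm2_ge0].
Qed.

End curves.

Section fixed_time.
Context {R : realType} {N : nat}.
Variable Om : set 'rV[R]_N.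
Hypotheses (hN : (0 < N)%N) (Om_open : open Om) (Om_bounded : bounded_set Om).
Hypothesis Om_smooth : smooth_boundary Om.
Local Notation E := 'rV[R]_N.
Local Notation lb := (leb N).
Local Notation e := (ext Om).
Implicit Types u v p : E -> R.

Lemma inV_lin c u v : inV Om u -> inV Om v -> inV Om (fun x => u x + c * v x) /\
  forall i, \forall x \ae lb, e (wpd Om i (fun x => u x + c * v x)) x = e (wpd Om i u) x + c * e (wpd Om i v) x.
Proof.
move=> Vu Vv; have lu := inV_L2 Om_open Vu; have lv := inV_L2 Om_open Vv.
have lZ w : L2 lb (e w) -> L2 lb (e (fun x => c * w x)) by rewrite e_scale => lw; exact: L2Z.
have V i : L2 lb (e (fun x => wpd Om i u x + c * wpd Om i v x)) /\
    weak_pd Om i (fun x => u x + c * v x) (fun x => wpd Om i u x + c * wpd Om i v x).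
  have [l1 w1] := wpdP Om_open i Vu; have [l2 w2] := wpdP Om_open i Vv.
  split; first by rewrite e_add; apply: L2D => //; exact: lZ.
  exact: (weak_pdD Om_bounded lu (lZ _ lv) l1 (lZ _ l2) w1 (weak_pdZ Om_bounded c lv l2 w2)).
have Vuv : inV Om (fun x => u x + c * v x).
  apply: (inVI Om_open (g := fun i x => wpd Om i u x + c * wpd Om i v x)).
  - by rewrite e_add; apply: L2D => //; exact: lZ.
  - by move=> i; have [] := V i.
  - by move=> i; have [] := V i.
split => // i; have [l w] := V i.
by have := wpdE hN Om_open Om_bounded Vuv l w; rewrite e_add e_scale.
Qed.

Lemma inW_inV u : inW Om u -> inV Om u.
Proof. by case=> -[]. Qed.

Lemma lap_L2 u : inW Om u -> L2 lb (e (lap Om u)).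
Proof.
move=> [[_ V2] _]; rewrite e_sum; apply: L2_sum => i.
exact: (wpdP Om_open i (V2 i)).1.
Qed.

Local Notation dg i u1 u2 := (fun x => e (wpd Om i u1) x - e (wpd Om i u2) x).

(** The gradient of the test function is only used through a representative P,
    because the one chosen by wpd is not additive. *)
Lemma green_diff u1 u2 p (P : 'I_N -> E -> R) : inW Om u1 -> inW Om u2 -> inV Om p ->
  (forall i, L2 lb (P i)) -> (forall i, \forall x \ae lb, e (wpd Om i p) x = P i x) ->
  \int[lb]_x ((e (lap Om u1) x - e (lap Om u2) x) * e p x) =
  - \sum_i \int[lb]_x (dg i u1 u2 x * P i x).
Proof.
move=> W1 W2 Vp lP aeP.
have l1 := lap_L2 W1; have l2 := lap_L2 W2; have lp := inV_L2 Om_open Vp.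
have lw1 i := (wpdP Om_open i (inW_inV W1)).1; have lw2 i := (wpdP Om_open i (inW_inV W2)).1.
have lwp i := (wpdP Om_open i Vp).1.
under eq_Rintegral do rewrite mulrBl.
rewrite (intB (L2M l1 lp) (L2M l2 lp)).
apply: etrans (congr2 (fun a b => a - b) (green hN Om_open Om_bounded Om_smooth W1 Vp)
  (green hN Om_open Om_bounded Om_smooth W2 Vp)) _.
apply: etrans (congr2 (fun a b => - a - - b) (int_sum _ (fun i => L2M (lw1 i) (lwp i)))
  (int_sum _ (fun i => L2M (lw2 i) (lwp i)))) _.
rewrite opprK addrC -sumrB -sumrN; apply: eq_bigr => i _.
have tr (w : E -> R) : L2 lb w -> \int[lb]_x (w x * e (wpd Om i p) x) = \int[lb]_x (w x * P i x).
  move=> lw; apply: int_ae; [exact: L1_meas (L2M lw (lwp i))|exact: L1_meas (L2M lw (lP i))|].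
  by apply: aeS (aeP i) => x ->.
rewrite !tr//; under [in RHS]eq_Rintegral do rewrite mulrBl.
by rewrite (intB (L2M (lw1 i) (lP i)) (L2M (lw2 i) (lP i))) opprB.
Qed.

Lemma pointwise_w (kappa tau : R) (z1 z2 a1 a2 b1 b2 f1 f2 y : E -> R) x :
  (Om x -> z1 x - kappa * a1 x - tau * b1 x = f1 x) -> (Om x -> z2 x - kappa * a2 x - tau * b2 x = f2 x) ->
  (e z1 x - e z2 x) * e y x = (e f1 x - e f2 x) * e y x + kappa * ((e a1 x - e a2 x) * e y x)
    + tau * ((e b1 x - e b2 x) * e y x).
Proof.
move=> h1 h2; have [xO|xO] := pselect (Om x); last by rewrite !ext_out//; ring.
by rewrite !ext_in// -h1// -h2//; ring.
Qed.

Lemma int_comb3 (a b : R) (F G H : E -> R) : L1 lb F -> L1 lb G -> L1 lb H ->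
  \int[lb]_x (F x + a * G x + b * H x) = \int[lb]_x F x + a * \int[lb]_x G x + b * \int[lb]_x H x.
Proof.
move=> lF lG lH.
by rewrite (intD (L1D lF (L1Z a lG)) (L1Z b lH)) (intD lF (L1Z a lG)) !intZ.
Qed.

(** The hyperbolic equation is tested with the function of which it contains the
    time derivative; Green's formula applies because w and w_t are in W. *)
Lemma test_w (kappa tau l : R) (w1 w2 v1 v2 p1 p2 z1 z2 f1 f2 : E -> R) :
  inW Om w1 -> inW Om w2 -> inW Om v1 -> inW Om v2 -> inV Om p1 -> inV Om p2 ->
  L2 lb (e z1) -> L2 lb (e z2) -> L2 lb (e f1) -> L2 lb (e f2) ->
  ae_Om Om (fun x => z1 x - kappa * lap Om v1 x - tau * lap Om w1 x = f1 x) ->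
  ae_Om Om (fun x => z2 x - kappa * lap Om v2 x - tau * lap Om w2 x = f2 x) ->
  \int[lb]_x ((e z1 x - e z2 x) * ((e v1 x - e v2 x) + l * (e p1 x - e p2 x))) =
  \int[lb]_x ((e f1 x - e f2 x) * ((e v1 x - e v2 x) + l * (e p1 x - e p2 x)))
  - kappa * (\sum_i \int[lb]_x (dg i v1 v2 x * (dg i v1 v2 x + l * dg i p1 p2 x)))
  - tau * (\sum_i \int[lb]_x (dg i w1 w2 x * (dg i v1 v2 x + l * dg i p1 p2 x))).
Proof.
move=> Ww1 Ww2 Wv1 Wv2 Vp1 Vp2 lz1 lz2 lf1 lf2 eq1 eq2.
have Vv1 := inW_inV Wv1; have Vv2 := inW_inV Wv2.
have [Va ga] := inVB hN Om_open Om_bounded Vv1 Vv2.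
have [Vb gb] := inVB hN Om_open Om_bounded Vp1 Vp2.
have [Ve ge] := inV_lin l Va Vb.
have leps := inV_L2 Om_open Ve.
set eps := (fun x => v1 x - v2 x + l * (p1 x - p2 x)) in Ve ge leps.
have eE : (fun x => (e v1 x - e v2 x) + l * (e p1 x - e p2 x)) = e eps.
  by rewrite /eps e_add e_scale !e_sub.
pose P i x := dg i v1 v2 x + l * dg i p1 p2 x.
have lP i : L2 lb (P i).
  apply: L2D; first by apply: L2B; [exact: (wpdP Om_open i Vv1).1|exact: (wpdP Om_open i Vv2).1].
  by apply: L2Z; apply: L2B; [exact: (wpdP Om_open i Vp1).1|exact: (wpdP Om_open i Vp2).1].
have aeP i : \forall x \ae lb, e (wpd Om i eps) x = P i x.
  by apply: aeS2 (ge i) (aeS2 (fun x a b => conj a b) (ga i) (gb i)) => x -> [-> ->].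
have g1 := green_diff Wv1 Wv2 Ve lP aeP; have g2 := green_diff Ww1 Ww2 Ve lP aeP.
have lv1 := lap_L2 Wv1; have lv2 := lap_L2 Wv2; have lw1 := lap_L2 Ww1; have lw2 := lap_L2 Ww2.
have lz := L2B lz1 lz2; have lf := L2B lf1 lf2; have llv := L2B lv1 lv2; have llw := L2B lw1 lw2.
transitivity (\int[lb]_x ((e z1 x - e z2 x) * e eps x)).
  by apply: eq_Rintegral => x _; rewrite -eE.
transitivity (\int[lb]_x ((e f1 x - e f2 x) * e eps x + kappa * ((e (lap Om v1) x - e (lap Om v2) x) * e eps x)
   + tau * ((e (lap Om w1) x - e (lap Om w2) x) * e eps x))).
  apply: int_ae.
  - exact: L1_meas (L2M lz leps).
  - exact: (L1_meas (L1D (L1D (L2M lf leps) (L1Z kappa (L2M llv leps))) (L1Z tau (L2M llw leps)))).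
  - apply: aeS2 eq1 eq2 => x h1 h2.
    exact: (pointwise_w (a1 := lap Om v1) (a2 := lap Om v2) (b1 := lap Om w1) (b2 := lap Om w2) eps h1 h2).
apply: etrans (int_comb3 kappa tau (L2M lf leps) (L2M llv leps) (L2M llw leps)) _.
apply: etrans (congr2 (fun a b => _ + kappa * a + tau * b) g1 g2) _.
by rewrite !mulrN -eE.
Qed.

(** The pairing of an element of Sign v with v is the norm of v, and the cross
    terms are bounded by the norms, since elements of Sign have norm at most 1. *)
Lemma sign_monotone (v1 v2 s1 s2 : E -> R) : L2 lb (e v1) -> L2 lb (e v2) ->
  Sign Om v1 s1 -> Sign Om v2 s2 -> L2 lb (e s1) /\ L2 lb (e s2) /\
  0 <= \int[lb]_x ((e s1 x - e s2 x) * (e v1 x - e v2 x)).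
Proof.
have one v s : L2 lb (e v) -> Sign Om v s ->
   [/\ L2 lb (e s), nrm lb (e s) <= 1 & \int[lb]_x (e s x * e v x) = nrm lb (e v)].
  move=> lv [/(inHP Om_open) ls]; rewrite !normHE// => -[h1 h2].
  have [n0|n0] := eqVneq (nrm lb (e v)) 0.
    split => //; first by have := h2 (congr1 EFin n0); rewrite lee_fin.
    have := cauchy_schwarz ls lv; rewrite n0 mulr0 normr_le0 => /eqP //.
  have n0' : 0 < nrm lb (e v) by rewrite lt_neqAle eq_sym n0 nrm_ge0.
  have : \forall x \ae lb, e s x = (nrm lb (e v))^-1 * e v x.
    have := h1 _; rewrite eqe n0 => /(_ isT); apply: aeS => x hx.
    have [xO|xO] := pselect (Om x); last by rewrite !ext_out// mulr0.
    by rewrite !ext_in// hx//= mulrC.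
  move=> sv; have lvv := (lv).2.
  have e1 : nrm2 lb (e s) = 1.
    rewrite (nrm2_ae ls.1 (L2Z (nrm lb (e v))^-1 lv).1 sv) /nrm2.
    under eq_Rintegral do rewrite exprMn.
    rewrite intZ// -/(nrm2 _ _) -nrm_sqr -exprMn mulVf ?gt_eqF// expr1n //.
  split => //; first by rewrite /nrm e1 sqrtr1.
  transitivity (\int[lb]_x ((nrm lb (e v))^-1 * (e v x ^+ 2))).
    apply: int_ae; [exact: L1_meas (L2M ls lv)|exact: L1_meas (L1Z _ lvv)|].
    by apply: aeS sv => x ->; rewrite -mulrA expr2.
  by rewrite intZ// -/(nrm2 _ _) -nrm_sqr expr2 mulKf.
move=> l1 l2 /(one _ _ l1)[ls1 n1 i1] /(one _ _ l2)[ls2 n2 i2]; split => //; split => //.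
have -> : \int[lb]_x ((e s1 x - e s2 x) * (e v1 x - e v2 x)) =
   (\int[lb]_x (e s1 x * e v1 x) - \int[lb]_x (e s1 x * e v2 x)) +
   (\int[lb]_x (e s2 x * e v2 x) - \int[lb]_x (e s2 x * e v1 x)).
  rewrite -(intB (L2M ls1 l1) (L2M ls1 l2)) -(intB (L2M ls2 l2) (L2M ls2 l1)).
  rewrite -(intD (L1B (L2M ls1 l1) (L2M ls1 l2)) (L1B (L2M ls2 l2) (L2M ls2 l1))).
  by apply: eq_Rintegral => x _; ring.
rewrite i1 i2; have a1 := le_trans (ler_norm _) (cauchy_schwarz ls1 l2).
have a2 := le_trans (ler_norm _) (cauchy_schwarz ls2 l1).
have b1 := ler_wpM2r (nrm_ge0 lb (e v2)) n1; have b2 := ler_wpM2r (nrm_ge0 lb (e v1)) n2.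
by move: (le_trans a1 b1) (le_trans a2 b2); lra.
Qed.

Lemma subdiff_monotone (h : R -> \bar R) (r1 r2 x1 x2 : R) : (forall r, 0 <= h r)%E ->
  subdiff h r1 x1 -> subdiff h r2 x2 -> 0 <= (x1 - x2) * (r1 - r2).
Proof.
move=> h0 [f1 m1] [f2 m2].
have := m1 r2; have := m2 r1; have := h0 r1; have := h0 r2.
case: (h r1) f1 => [a1 _|//|//]; case: (h r2) f2 => [a2 _|//|//] _ _.
by rewrite -!EFinD !lee_fin; lra.
Qed.

Lemma pointwise_phi (gamma rho K : R) (h : R -> \bar R) (pi_ : R -> R)
    (p1 p2 pt1 pt2 a1 a2 xi1 xi2 s1 s2 v1 v2 : E -> R) x :
  (forall r, 0 <= h r)%E -> (forall a b, `|pi_ a - pi_ b| <= K * `|a - b|) ->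
  (Om x -> pt1 x - a1 x + xi1 x + pi_ (p1 x) + rho * s1 x = gamma * v1 x) ->
  (Om x -> pt2 x - a2 x + xi2 x + pi_ (p2 x) + rho * s2 x = gamma * v2 x) ->
  (Om x -> subdiff h (p1 x) (xi1 x)) -> (Om x -> subdiff h (p2 x) (xi2 x)) ->
  (e pt1 x - e pt2 x) * (e p1 x - e p2 x) + rho * ((e s1 x - e s2 x) * (e p1 x - e p2 x)) <=
  gamma * ((e v1 x - e v2 x) * (e p1 x - e p2 x)) + (e a1 x - e a2 x) * (e p1 x - e p2 x)
    + K * (e p1 x - e p2 x) ^+ 2.
Proof.
move=> h0 piK e1 e2 b1 b2.
have [xO|xO] := pselect (Om x); last by rewrite !(ext_out _ xO) !subr0 !mulr0 expr0n/= !mulr0 !addr0.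
rewrite !ext_in//; have {}e1 := e1 xO; have {}e2 := e2 xO.
have m1 := subdiff_monotone h0 (b1 xO) (b2 xO).
have m2 : - (K * (p1 x - p2 x) ^+ 2) <= (pi_ (p1 x) - pi_ (p2 x)) * (p1 x - p2 x).
  have := piK (p1 x) (p2 x); set a := pi_ _ - _; set b := p1 x - p2 x => ab.
  have : `|a * b| <= K * b ^+ 2.
    by rewrite normrM -[b ^+ 2]real_normK ?num_real// expr2 mulrA ler_wpM2r.
  by rewrite ler_norml => /andP[].
rewrite -subr_ge0; set G := _ - _.
suff -> : G = (xi1 x - xi2 x) * (p1 x - p2 x) + ((pi_ (p1 x) - pi_ (p2 x)) * (p1 x - p2 x) + K * (p1 x - p2 x) ^+ 2).
  by rewrite addr_ge0// -lerBlDr sub0r.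
have gv : gamma * ((v1 x - v2 x) * (p1 x - p2 x)) = (gamma * v1 x - gamma * v2 x) * (p1 x - p2 x) by ring.
by rewrite /G gv -e1 -e2; ring.
Qed.

(** The parabolic equation tested with the difference of the order parameters:
    the monotone terms have a sign. *)
Lemma test_phi (gamma rho K : R) (h : R -> \bar R) (pi_ : R -> R) (pstar : E -> R)
    (p1 p2 pt1 pt2 xi1 xi2 s1 s2 v1 v2 : E -> R) :
  0 < rho -> (forall r, 0 <= h r)%E -> (forall a b, `|pi_ a - pi_ b| <= K * `|a - b|) ->
  L2 lb (e pstar) -> inW Om p1 -> inW Om p2 ->
  L2 lb (e pt1) -> L2 lb (e pt2) -> L2 lb (e v1) -> L2 lb (e v2) ->
  ae_Om Om (fun x => pt1 x - lap Om p1 x + xi1 x + pi_ (p1 x) + rho * s1 x = gamma * v1 x) ->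
  ae_Om Om (fun x => pt2 x - lap Om p2 x + xi2 x + pi_ (p2 x) + rho * s2 x = gamma * v2 x) ->
  ae_Om Om (fun x => subdiff h (p1 x) (xi1 x)) -> ae_Om Om (fun x => subdiff h (p2 x) (xi2 x)) ->
  Sign Om (fun x => p1 x - pstar x) s1 -> Sign Om (fun x => p2 x - pstar x) s2 ->
  \int[lb]_x ((e pt1 x - e pt2 x) * (e p1 x - e p2 x)) <=
  - \sum_i nrm2 lb (dg i p1 p2) + K * nrm2 lb (fun x => e p1 x - e p2 x)
  + gamma * \int[lb]_x ((e v1 x - e v2 x) * (e p1 x - e p2 x)).
Proof.
move=> rho0 h0 piK lps W1 W2 lt1 lt2 lv1 lv2 eq1 eq2 xb1 xb2 S1 S2.
have V1 := inW_inV W1; have V2 := inW_inV W2.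
have lp1 := inV_L2 Om_open V1; have lp2 := inV_L2 Om_open V2.
have [Vp gp] := inVB hN Om_open Om_bounded V1 V2.
have lP i : L2 lb (dg i p1 p2) by apply: L2B; [exact: (wpdP Om_open i V1).1|exact: (wpdP Om_open i V2).1].
have g := green_diff W1 W2 Vp lP gp.
have lw1 : L2 lb (e (fun x => p1 x - pstar x)) by rewrite e_sub; exact: L2B.
have lw2 : L2 lb (e (fun x => p2 x - pstar x)) by rewrite e_sub; exact: L2B.
have [ls1 [ls2 mon]] := sign_monotone lw1 lw2 S1 S2.
have lp := L2B lp1 lp2; have lt := L2B lt1 lt2; have lv := L2B lv1 lv2; have ls := L2B ls1 ls2.
have ll := L2B (lap_L2 W1) (lap_L2 W2).
have {}mon : 0 <= \int[lb]_x ((e s1 x - e s2 x) * (e p1 x - e p2 x)).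
  by apply: le_trans mon _; rewrite le_eqVlt; apply/orP; left; apply/eqP; apply: eq_Rintegral => x _; rewrite !e_sub; ring.
have {}g : \int[lb]_x ((e (lap Om p1) x - e (lap Om p2) x) * (e p1 x - e p2 x)) = - \sum_i nrm2 lb (dg i p1 p2).
  rewrite e_sub in g; rewrite g; congr (- _); apply: eq_bigr => i _; rewrite /nrm2; apply: eq_Rintegral => x _.
have le : \int[lb]_x ((e pt1 x - e pt2 x) * (e p1 x - e p2 x) + rho * ((e s1 x - e s2 x) * (e p1 x - e p2 x))) <=
  \int[lb]_x (gamma * ((e v1 x - e v2 x) * (e p1 x - e p2 x)) + (e (lap Om p1) x - e (lap Om p2) x) * (e p1 x - e p2 x)
    + K * (e p1 x - e p2 x) ^+ 2).
  apply: int_le.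
  - exact: (L1D (L2M lt lp) (L1Z rho (L2M ls lp))).
  - exact: (L1D (L1D (L1Z gamma (L2M lv lp)) (L2M ll lp)) (L1Z K lp.2)).
  - apply: aeS2 (aeS2 (fun x a b => conj a b) eq1 eq2) (aeS2 (fun x a b => conj a b) xb1 xb2) => x [e1 e2] [b1 b2].
    exact: (pointwise_phi (a1 := lap Om p1) (a2 := lap Om p2) h0 piK e1 e2 b1 b2).
have i1 := intD (L2M lt lp) (L1Z rho (L2M ls lp)).
have i2 := int_comb3 1 K (L1Z gamma (L2M lv lp)) (L2M ll lp) lp.2.
have r0 := mulr_ge0 (ltW rho0) mon.
move: le i1 i2; rewrite intZ; last exact: L2M.
rewrite (intZ gamma (L2M lv lp)) -/(nrm2 _ _) g.
under [X in _ -> _ -> X = _ -> _]eq_Rintegral do rewrite mul1r.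
by move=> le i1 i2; move: le r0; rewrite i1 i2; clear; lra.
Qed.

End fixed_time.

(** * The energy estimate for real functions of time *)

Section energy_gronwall.
Context {R : realType}.
Local Notation mu := (@lebesgue_measure R).
Variables (kappa l m gamma K T : R).
Hypotheses (kappa0 : 0 < kappa) (l0 : 0 < l) (m0 : 0 <= m) (gamma0 : 0 < gamma) (K0 : 0 <= K) (T0 : 0 < T).

Let I : set (measurableTypeR R) := `]0, T[%classic.

Lemma indic_in t : 0 < t < T -> \1_I t = 1 :> R.
Proof. by move=> tI; rewrite indic_itv in_itv/= tI. Qed.

Lemma indic_out t : ~~ (0 < t < T) -> \1_I t = 0 :> R.
Proof. by move=> tI; rewrite indic_itv in_itv/= (negbTE tI). Qed.

Lemma L1_itv : L1 mu (\1_I : measurableTypeR R -> R).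
Proof. by apply: (L2_L1_time T0) (L2_itv T0).1 => t; exact: indic_out. Qed.

Lemma int_itv : \int[mu]_s (\1_I : measurableTypeR R -> R) s = T.
Proof.
rewrite -(L2_itv T0).2; apply: eq_Rintegral => s _.
by rewrite indicE -natrX; case: (_ \in _).
Qed.

Lemma L1_prim_itv (p : R -> R) : L1 mu p -> L1 mu (fun t => prim p t * \1_I t).
Proof.
move=> lp; have mp : measurable_fun [set: measurableTypeR R] (prim p).
  pose v := fun (s : R) (x : measurableTypeR R) => p s.
  have mv : measurable_fun setT (fun z : measurableTypeR R * measurableTypeR R => v z.1 z.2).
    exact: measurable_fun_fst (L1_meas lp).
  exact: (measurableT_comp (measurable_prim mv) (pair2_measurable (0 : measurableTypeR R))).
have := @L1_M_bounded R _ _ mu _ _ _ mp (fun t => prim_le_norm t lp) L1_itv.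
by under eq_fun do rewrite mulrC.
Qed.

Let lam := 2 * kappa * l ^+ 2.
Let C1 := 1 + lam * gamma + 2 * K + gamma.
Let C2 := 6 * m * T / kappa.
Let M := 2 * expR (2 * (C1 + C2) * T).
Let mass (a0 y0 d0 F0 : R) := a0 + lam * y0 + F0 + 6 * m * d0 * T.

Let lam0 : 0 < lam. Proof. by rewrite /lam !mulr_gt0// exprn_gt0. Qed.
Let C20 : 0 <= C2. Proof. by rewrite /C2 !mulr_ge0// ?invr_ge0 ltW. Qed.
Let C10 : 0 < C1. Proof. by rewrite /C1 -!addrA ltr_wpDr// ?addr_ge0 ?mulr_ge0// ltW. Qed.

Section curves.
Variables (a y b c F A B : R -> R) (a0 y0 d0 : R).
Hypotheses (a_ge0 : forall t, 0 <= a t) (y_ge0 : forall t, 0 <= y t) (b_ge0 : forall t, 0 <= b t)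
  (c_ge0 : forall t, 0 <= c t) (F_ge0 : forall t, 0 <= F t).
Hypotheses (a00 : 0 <= a0) (y00 : 0 <= y0) (d00 : 0 <= d0).
Hypotheses (la : L1 mu (fun t => a t * \1_I t)) (ly : L1 mu (fun t => y t * \1_I t))
  (lb : L1 mu b) (lc : L1 mu c) (lF : L1 mu F) (lA : L1 mu A) (lB : L1 mu B).
Hypotheses (sb : supported_in 0 T b) (sc : supported_in 0 T c) (sF : supported_in 0 T F)
  (sA : supported_in 0 T A) (sB : supported_in 0 T B).
Hypotheses (aE : forall t, a t = a0 + 2 * prim A t) (yE : forall t, y t = y0 + 2 * prim B t).
Hypothesis A_le : \forall s \ae mu, 0 < s < T ->
  A s <= 2^-1 * F s + 2^-1 * a s - 2^-1 * kappa * b s + 3 / 2 * kappa * l ^+ 2 * c s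
    + 3 / 2 * m * (2 * d0 + 2 * T * prim b s).
Hypothesis B_le : \forall s \ae mu, 0 < s < T -> B s <= - c s + K * y s + gamma / 2 * (a s + y s).

Let Z t := a t + lam * y t + kappa * prim b t + kappa * l ^+ 2 * prim c t.
Let Zc t := Z t * \1_I t.
Let D := mass a0 y0 d0 (\int[mu]_s F s).

Let Z_ge0 t : 0 <= Z t.
Proof. by rewrite /Z !addr_ge0// mulr_ge0 ?prim_ge0 ?mulr_ge0// ltW// exprn_gt0. Qed.

Let Zc_ge0 t : 0 <= Zc t.
Proof. by rewrite /Zc mulr_ge0// indicE. Qed.

Let D_ge0 : 0 <= D.
Proof. by rewrite /D /mass !addr_ge0 ?int_ge0 ?mulr_ge0// ltW. Qed.

Let L1_Zc : L1 mu Zc.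
Proof.
rewrite (_ : Zc = fun t => a t * \1_I t + lam * (y t * \1_I t) + kappa * (prim b t * \1_I t)
   + kappa * l ^+ 2 * (prim c t * \1_I t)); last by apply/funext => t; rewrite /Zc /Z; ring.
apply: L1D; last by apply: L1Z; exact: L1_prim_itv.
apply: L1D; last by apply: L1Z; exact: L1_prim_itv.
by apply: L1D => //; exact: L1Z.
Qed.

(* The weight 2 kappa l^2 of the second energy makes its dissipation absorb the
   gradient of phi coming from the first one. *)
Let Z_le t : Z t <= D + (C1 + C2) * prim Zc t.
Proof.
have lG1 : L1 mu (fun s => 2 * A s + 2 * lam * B s) by apply: L1D; exact: L1Z.
have lG2 : L1 mu (fun s => kappa * b s + kappa * l ^+ 2 * c s) by apply: L1D; exact: L1Z.
have lH1 : L1 mu (fun s => F s + (6 * m * d0) * \1_I s) by apply: L1D => //; apply: L1Z; exact: L1_itv.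
have lH2 : L1 mu (fun s => (C1 + C2) * Zc s) by exact: L1Z.
have E : Z t = a0 + lam * y0 + prim (fun s => (2 * A s + 2 * lam * B s) + (kappa * b s + kappa * l ^+ 2 * c s)) t.
  rewrite primD// !(primD, primZ)//; try exact: L1Z.
  by rewrite /Z aE yE; ring.
have P : prim (fun s => (2 * A s + 2 * lam * B s) + (kappa * b s + kappa * l ^+ 2 * c s)) t <=
    prim (fun s => (F s + (6 * m * d0) * \1_I s) + (C1 + C2) * Zc s) t.
  apply: prim_mono; [exact: L1D|exact: L1D|].
  apply: aeS2 A_le B_le => s hA hB _.
  have [sI|sI] := boolP (0 < s < T); last first.
    by rewrite sA// sB// sb// sc// sF// /Zc indic_out// !(mulr0, addr0).
  rewrite /Zc indic_in// !mulr1; have := hA sI; have := hB sI.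
  have pb := prim_ge0 s b_ge0; have pc := prim_ge0 s c_ge0.
  have k1 : 6 * m * T * prim b s = C2 * (kappa * prim b s).
    by rewrite /C2 mulrA -[_ / kappa * kappa]mulrA mulVf ?mulr1// gt_eqF.
  have zb : kappa * prim b s <= Z s.
    by rewrite /Z -[leLHS]add0r -addrA lerD ?addr_ge0 ?mulr_ge0 ?lerDl ?mulr_ge0 ?exprn_ge0// ltW.
  have zy : a s + lam * y s <= Z s.
    by rewrite /Z -addrA lerDl addr_ge0 ?mulr_ge0 ?exprn_ge0// ltW.
  have {}zb := ler_wpM2l C20 zb; have {}zy := ler_wpM2l (ltW C10) zy.
  have r1 : 0 <= (2 * K + gamma) * a s by rewrite mulr_ge0// addr_ge0 ?mulr_ge0// ltW.
  have r2 : 0 <= (lam + lam ^+ 2 * gamma) * y s.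
    by rewrite mulr_ge0// addr_ge0 ?mulr_ge0 ?exprn_ge0// ltW.
  move=> /(ler_wpM2l (mulr_ge0 (ler0n R 2) (ltW lam0))) {}hB {}hA.
  have cE : lam * c s = 2 * (kappa * l ^+ 2 * c s) by rewrite /lam; ring.
  move: zy r1 r2 hA hB cE k1 zb; rewrite /C1; move: (lam) (Z s) (C2) => L z k.
  move: (a s) (b s) (c s) (y s) (A s) (B s) (F s) (prim b s) (kappa) (l ^+ 2) => a1 b1 c1 y1 A1 B1 F1 p1 k0 l2.
  lra.
rewrite E; apply: le_trans (lerD (lexx _) P) _.
rewrite primD// (primD _ lF (L1Z _ L1_itv)) !primZ//; last exact: L1_itv.
have f1 := prim_le_int t lF F_ge0.
have f2 : prim (\1_I : R -> R) t <= T.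
  by rewrite -int_itv; apply: prim_le_int; [exact: L1_itv|move=> s; rewrite indicE].
have f3 : 6 * m * d0 * prim (\1_I : R -> R) t <= 6 * m * d0 * T by apply: ler_wpM2l f2; rewrite !mulr_ge0.
by rewrite /D /mass; move: f1 f3; lra.
Qed.

Let Z_bound t : 0 < t < T -> Z t <= M * D.
Proof.
move=> tI; have C0 : 0 < C1 + C2 by rewrite ltr_pwDl.
have := gronwall C0 D_ge0 (fun t _ => Zc_ge0 t) _ L1_Zc _ tI.
rewrite /Zc indic_in// mulr1 => H; apply: le_trans (H _ _) _.
- by move=> s sI; rewrite indic_out// mulr0.
- by move=> s sI; rewrite indic_in// mulr1 Z_le.
- rewrite /M mulrAC ler_wpM2r// ler_pM2l// ler_expR ler_pM2l ?mulr_gt0//.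
  by case/andP: tI => _ /ltW.
Qed.

(* The integrated inequality also holds at t = T, where the primitives of b and c
   are their integrals. *)
Let ZT_bound : Z T <= (1 + (C1 + C2) * T * M) * D.
Proof.
have C0 : 0 < C1 + C2 by rewrite ltr_pwDl.
apply: le_trans (Z_le T) _; have -> : (1 + (C1 + C2) * T * M) * D = D + (C1 + C2) * (T * (M * D)) by ring.
rewrite lerD2l ler_pM2l//.
apply: le_trans (prim_le_int T L1_Zc Zc_ge0) _.
have -> : T * (M * D) = \int[mu]_s ((M * D) * (\1_I : measurableTypeR R -> R) s).
  by rewrite (intZ (M * D) L1_itv) int_itv mulrC.
apply: int_le => //; first by apply: L1Z; exact: L1_itv.
apply: aeW => s; rewrite /Zc; have [sI|sI] := boolP (0 < s < T).
  by rewrite indic_in// !mulr1 Z_bound.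
by rewrite indic_out// !mulr0.
Qed.

Lemma energy_bound_aux : (forall t, 0 < t < T -> a t <= M * D /\ lam * y t <= M * D) /\
  kappa * \int[mu]_s b s <= (1 + (C1 + C2) * T * M) * D /\
  kappa * l ^+ 2 * \int[mu]_s c s <= (1 + (C1 + C2) * T * M) * D.
Proof.
have H t : [/\ a t <= Z t, lam * y t <= Z t, kappa * prim b t <= Z t & kappa * l ^+ 2 * prim c t <= Z t].
  have := a_ge0 t; have : 0 <= lam * y t by rewrite mulr_ge0// ltW.
  have : 0 <= kappa * prim b t by rewrite mulr_ge0// ?prim_ge0// ltW.
  have : 0 <= kappa * l ^+ 2 * prim c t by rewrite !mulr_ge0// ?prim_ge0 ?exprn_ge0// ltW.
  by rewrite /Z; move: (kappa * prim b t) (kappa * l ^+ 2 * _) (lam * y t) (a t) => ? ? ? ?; split; lra.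
have pT p : supported_in 0 T p -> prim p T = \int[mu]_s p s.
  move=> sp; rewrite primE; apply: eq_Rintegral => s _; rewrite indic_itv in_itv/=.
  have [_|sT] := leP s T; first by rewrite mulr1.
  by rewrite mulr0 sp// negb_and -!leNgt (ltW sT) orbT.
split; last by rewrite -!pT//; have [_ _ h1 h2] := H T; split; apply: le_trans ZT_bound.
by move=> t tI; have [h1 h2 _ _] := H t; split; [apply: le_trans h1 _|apply: le_trans h2 _]; exact: Z_bound.
Qed.

Lemma mass_le : D <= (1 + lam + 6 * m * T) * (a0 + y0 + d0 + \int[mu]_s F s).
Proof.
have F0 := @int_ge0 _ _ _ mu F F_ge0.
have h1 : 0 <= lam * a0 + lam * d0 + lam * \int[mu]_s F s by rewrite !addr_ge0 ?mulr_ge0// ltW.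
have h2 : 0 <= m * T * a0 + m * T * y0 + m * T * \int[mu]_s F s by rewrite !addr_ge0 ?mulr_ge0// ltW.
by rewrite /D /mass; move: h1 h2 F0 a00 y00 d00; move: (\int[mu]_s F s) => F0; move: (lam) => L; lra.
Qed.

End curves.

Let k := 1 + lam + 6 * m * T.
Let E := 1 + (C1 + C2) * T * M.
Let Cst := k * (M + M / lam + E / kappa + E / (kappa * l ^+ 2)).

(** The energy method on numbers: a and y are the squared norms of l * phi + w_t
    and of phi, b, c, and 2 * d0 + 2 * T * prim b bound those of the gradients of
    w_t, phi and w, and F is that of the source term. *)
Lemma energy_bound : exists2 C : R, 0 < C &
  forall (a y b c F A B : R -> R) (a0 y0 d0 : R),
  (forall t, 0 <= a t) -> (forall t, 0 <= y t) -> (forall t, 0 <= b t) ->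
  (forall t, 0 <= c t) -> (forall t, 0 <= F t) -> 0 <= a0 -> 0 <= y0 -> 0 <= d0 ->
  L1 mu (fun t => a t * \1_I t) -> L1 mu (fun t => y t * \1_I t) ->
  L1 mu b -> L1 mu c -> L1 mu F -> L1 mu A -> L1 mu B ->
  supported_in 0 T b -> supported_in 0 T c -> supported_in 0 T F ->
  supported_in 0 T A -> supported_in 0 T B ->
  (forall t, a t = a0 + 2 * prim A t) -> (forall t, y t = y0 + 2 * prim B t) ->
  (\forall s \ae mu, 0 < s < T ->
    A s <= 2^-1 * F s + 2^-1 * a s - 2^-1 * kappa * b s + 3 / 2 * kappa * l ^+ 2 * c s
      + 3 / 2 * m * (2 * d0 + 2 * T * prim b s)) ->
  (\forall s \ae mu, 0 < s < T -> B s <= - c s + K * y s + gamma / 2 * (a s + y s)) ->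
  let S := a0 + y0 + d0 + \int[mu]_s F s in
  (forall t, 0 < t < T -> a t <= C * S /\ y t <= C * S) /\
  \int[mu]_s b s <= C * S /\ \int[mu]_s c s <= C * S.
Proof.
have M0 : 0 < M by rewrite /M mulr_gt0// expR_gt0.
have m6 : 0 <= 6 * m * T by rewrite !mulr_ge0// ltW.
have k0 : 0 < k by rewrite /k ltr_wpDr// addr_gt0.
have CC0 : 0 < C1 + C2 by rewrite ltr_pwDl.
have E0 : 0 < E by rewrite /E addr_gt0// mulr_gt0// mulr_gt0.
have kl0 : 0 < kappa * l ^+ 2 by rewrite mulr_gt0// exprn_gt0.
have p1 : 0 < M / lam by rewrite divr_gt0.
have p2 : 0 < E / kappa by rewrite divr_gt0.
have p3 : 0 < E / (kappa * l ^+ 2) by rewrite divr_gt0.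
exists Cst; first by rewrite /Cst mulr_gt0// !addr_gt0.
move=> a y b c F A B a0 y0 d0 pa py pb pc pF pa0 py0 pd0 la ly lb lc lF lA lB sb sc sF sA sB aE yE hA hB S.
have [H1 [H2 H3]] := energy_bound_aux pa py pb pc pF pa0 py0 pd0 la ly lb lc lF lA lB sb sc sF sA sB aE yE hA hB.
have Dle := mass_le pF pa0 py0 pd0.
have S0 : 0 <= S by rewrite /S !addr_ge0// int_ge0.
have bnd (r x G : R) : 0 < r -> 0 < G -> r * x <= G * mass a0 y0 d0 (\int[mu]_s F s) ->
    G / r <= M + M / lam + E / kappa + E / (kappa * l ^+ 2) -> x <= Cst * S.
  move=> r0 G0 h1 h2; have : x <= G / r * (k * S).
    rewrite mulrAC ler_pdivlMr// mulrC; apply: le_trans h1 _.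
    by rewrite ler_pM2l.
  move=> xle; apply: le_trans xle _; have kS : 0 <= k * S by rewrite mulr_ge0// ltW.
  by apply: le_trans (ler_wpM2r kS h2) _; rewrite mulrA [X in X * S <= _]mulrC.
split; last split.
- move=> t /H1[h1 h2]; split.
    by apply: (bnd 1 _ M) => //; [rewrite mul1r|rewrite divr1; lra].
  by apply: (bnd lam _ M) => //; lra.
- by apply: (bnd kappa _ E) => //; lra.
- by apply: (bnd (kappa * l ^+ 2) _ E) => //; lra.
Qed.

End energy_gronwall.

(** * The energy estimate for curves in L^2 *)

Section arithmetic.
Context {R : realType}.

Lemma sum5_le (v w p g f : R) : 0 <= v -> 0 <= w -> 0 <= p -> 0 <= g -> 0 <= f ->
  w <= v + w + p + g + f /\ g <= v + w + p + g + f.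
Proof. by move=> *; split; lra. Qed.

Lemma initial_energy_le (l2 e v w p g f : R) : 0 <= l2 ->
  0 <= v -> 0 <= w -> 0 <= p -> 0 <= g -> 0 <= f -> e <= 2 * v + 2 * l2 * p ->
  e + p + g + f <= (3 + 2 * l2) * (v + w + p + g + f).
Proof.
move=> l0 v0 w0 p0 g0 f0 h.
have := mulr_ge0 l0 v0; have := mulr_ge0 l0 w0; have := mulr_ge0 l0 g0; have := mulr_ge0 l0 f0.
lra.
Qed.

Lemma energy_constants (l T P S : R) : 0 < T -> 0 <= P -> 0 <= S ->
  let G := (2 + 2 * l ^+ 2 + 2 * T + 2 * T * T * (2 + 2 * l ^+ 2)) * P + 2 * S in
  [/\ P <= G, (2 + 2 * l ^+ 2) * P <= G,
      2 * S + 2 * T * (T * ((2 + 2 * l ^+ 2) * P)) <= G & 2 * S + 2 * T * P <= G].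
Proof.
move=> T0 P0 S0 G; have lP : 0 <= l ^+ 2 * P by rewrite mulr_ge0// sqr_ge0.
have TP := mulr_ge0 (ltW T0) P0; have TTP := mulr_ge0 (ltW T0) TP.
have TlP := mulr_ge0 (ltW T0) (mulr_ge0 (ltW T0) lP).
by rewrite /G; split; lra.
Qed.

Lemma half_young (I J a y gam c : R) : 0 < gam -> I + J <= 2^-1 * a + 2^-1 * y -> 0 <= J ->
  c + gam * I <= c + gam / 2 * (a + y).
Proof. by move=> g0 h J0; rewrite lerD2l -mulrA ler_pM2l//; lra. Qed.

End arithmetic.

Section curve_energy.
Context d (X : measurableType d) (R : realType).
Variable m2 : {sigma_finite_measure set X -> \bar R}.
Local Notation mu := (@lebesgue_measure R).
Local Notation mm := (mu \x m2)%E.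
Local Notation unc F := (fun z : measurableTypeR R * X => F z.1 z.2).

(** The right-hand side of the tested hyperbolic equation, by Young's
    inequality; half of the dissipation of w_t survives. *)
Lemma young_w (J : finType) (kappa tau l : R) (F eps : X -> R) (gv gp gw : J -> X -> R) :
  0 < kappa -> 0 < tau -> 0 < l -> L2 m2 F -> L2 m2 eps ->
  (forall i, L2 m2 (gv i)) -> (forall i, L2 m2 (gp i)) -> (forall i, L2 m2 (gw i)) ->
  \int[m2]_x (F x * eps x)
  - kappa * (\sum_i \int[m2]_x (gv i x * (gv i x + l * gp i x)))
  - tau * (\sum_i \int[m2]_x (gw i x * (gv i x + l * gp i x))) <=
  2^-1 * nrm2 m2 F + 2^-1 * nrm2 m2 eps - 2^-1 * kappa * (\sum_i nrm2 m2 (gv i))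
  + 3 / 2 * kappa * l ^+ 2 * (\sum_i nrm2 m2 (gp i)) + 3 / 2 * (tau ^+ 2 / kappa) * (\sum_i nrm2 m2 (gw i)).
Proof.
move=> k0 t0 l0 lF le lv lp lw.
have hF : \int[m2]_x (F x * eps x) <= 2^-1 * nrm2 m2 F + 2^-1 * nrm2 m2 eps.
  have h : 0 < 2^-1 :> R by rewrite invr_gt0.
  apply: le_trans (ler_norm _) (le_trans (young h lF le) _).
  by rewrite (_ : (4 * 2^-1)^-1 = 2^-1)//; field.
have one i : - kappa * (\int[m2]_x (gv i x * (gv i x + l * gp i x)))
    - tau * (\int[m2]_x (gw i x * (gv i x + l * gp i x))) <=
   - 2^-1 * kappa * nrm2 m2 (gv i) + 3 / 2 * kappa * l ^+ 2 * nrm2 m2 (gp i) + 3 / 2 * (tau ^+ 2 / kappa) * nrm2 m2 (gw i).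
  have e1 : \int[m2]_x (gv i x * (gv i x + l * gp i x)) = nrm2 m2 (gv i) + l * \int[m2]_x (gv i x * gp i x).
    rewrite -intZ; last exact: L2M.
    rewrite -(intD (lv i).2 (L1Z l (L2M (lv i) (lp i)))).
    by apply: eq_Rintegral => x _; ring.
  have e2 : \int[m2]_x (gw i x * (gv i x + l * gp i x)) = \int[m2]_x (gv i x * gw i x) + l * \int[m2]_x (gp i x * gw i x).
    rewrite -intZ; last exact: L2M.
    rewrite -(intD (L2M (lv i) (lw i)) (L1Z l (L2M (lp i) (lw i)))).
    by apply: eq_Rintegral => x _; ring.
  have s1 : 0 < (4 * l)^-1 by rewrite invr_gt0 mulr_gt0.
  have s2 : 0 < kappa / (4 * tau) by rewrite divr_gt0 ?mulr_gt0.
  have s3 : 0 < kappa * l / (2 * tau) by rewrite divr_gt0 ?mulr_gt0.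
  have := young s1 (lv i) (lp i); have := young s2 (lv i) (lw i); have := young s3 (lp i) (lw i).
  rewrite !ler_norml => /andP[h3 _] /andP[h2 _] /andP[h1 _]; rewrite e1 e2.
  have {}h1 := ler_wpM2l (ltW (mulr_gt0 k0 l0)) h1.
  have {}h2 := ler_wpM2l (ltW t0) h2.
  have {}h3 := ler_wpM2l (ltW (mulr_gt0 t0 l0)) h3.
  move: h1 h2 h3.
  rewrite (_ : kappa * l * - _ = - (4^-1 * kappa * nrm2 m2 (gv i) + kappa * l ^+ 2 * nrm2 m2 (gp i))); last first.
    by field; rewrite gt_eqF.
  rewrite (_ : tau * - _ = - (4^-1 * kappa * nrm2 m2 (gv i) + (tau ^+ 2 / kappa) * nrm2 m2 (gw i))); last first.
    by field; rewrite !gt_eqF.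
  rewrite (_ : tau * l * - _ = - (2^-1 * kappa * l ^+ 2 * nrm2 m2 (gp i) + 2^-1 * (tau ^+ 2 / kappa) * nrm2 m2 (gw i))); last first.
    by field; rewrite !gt_eqF.
  lra.
have : \sum_i (- kappa * (\int[m2]_x (gv i x * (gv i x + l * gp i x)))
    - tau * (\int[m2]_x (gw i x * (gv i x + l * gp i x)))) <=
   \sum_i (- 2^-1 * kappa * nrm2 m2 (gv i) + 3 / 2 * kappa * l ^+ 2 * nrm2 m2 (gp i) + 3 / 2 * (tau ^+ 2 / kappa) * nrm2 m2 (gw i)).
  by apply: ler_sum => i _; exact: one.
rewrite !big_split/= !sumrN -!mulr_sumr.
by move: hF; lra.
Qed.

Variable T : R.
Hypothesis T0 : 0 < T.
Let I : set (measurableTypeR R) := `]0, T[%classic.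
Local Notation curve := (curve m2 T).

Lemma prim_sum (J : Type) (r : seq J) (p : J -> R -> R) t : (forall j, L1 mu (p j)) ->
  prim (fun s => \sum_(j <- r) p j s) t = \sum_(j <- r) prim (p j) t.
Proof.
move=> lp; elim: r => [|j r IH].
  rewrite big_nil; under eq_fun do rewrite big_nil.
  by rewrite primE; under eq_Rintegral do rewrite mul0r; rewrite int0.
rewrite big_cons -IH -primD//; last exact: L1_sum.
by congr prim; apply/funext => s; rewrite big_cons.
Qed.

Lemma curve_slice U V c : curve U V c -> forall t, L2 m2 (bar c V t).
Proof. by move=> [sV lU l1 lV lc _] t; exact: (L2_bar T0 lc sV l1 lV t). Qed.

Lemma curve_energy U V c : curve U V c ->
  [/\ L1 mu (fun t => nrm2 m2 (bar c V t) * \1_I t),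
      L1 mu (fun s => \int[m2]_x (V s x * bar c V s x)),
      supported_in 0 T (fun s => \int[m2]_x (V s x * bar c V s x)) &
      forall t, nrm2 m2 (bar c V t) = nrm2 m2 c + 2 * prim (fun s => \int[m2]_x (V s x * bar c V s x)) t].
Proof.
move=> [sV lU l1 lV lc _]; split.
- have := nrm2_time (L2_bar_Q T0 lc sV l1 lV); apply: L1_eq => s.
  rewrite /nrm2 /=; have [sI|sI] := boolP (0 < s < T).
    by rewrite indic_in// mulr1; apply: eq_Rintegral => x _; rewrite mulr1.
  by rewrite indic_out// mulr0; under [RHS]eq_Rintegral do rewrite mulr0 expr0n/=; rewrite int0.
- exact: (@fub_L1_1 _ _ (measurableTypeR R) X R mu m2 (fun s x => V s x * bar c V s x) (L1_bar_pairing T0 lc sV l1 lV)).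
- by move=> t tI; under eq_Rintegral do rewrite sV// mul0r; rewrite int0.
- by move=> t; exact: (bar_energy T0 lc sV l1 lV t).
Qed.

Lemma curve_U U V c : curve U V c -> \forall t \ae mu, 0 < t < T -> L2 m2 (U t).
Proof.
move=> hU; apply: aeS (curve_bar hU) => t ht tI.
apply: (L2_ae _ (ht tI) (curve_slice hU t)).
by exact: (@measurable_curry1 _ _ (measurableTypeR R) X R U t (curve_L2u hU).1).
Qed.

Lemma nrm2_lin_le (s : R) (f g : X -> R) : L2 m2 f -> L2 m2 g ->
  nrm2 m2 (fun x => f x + s * g x) <= 2 * nrm2 m2 f + 2 * s ^+ 2 * nrm2 m2 g.
Proof.
move=> lf lg; have := nrm2_ge0 m2 (fun x => f x + (- s) * g x).
by rewrite !(nrm2D_sq _ lf lg) sqrrN; lra.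
Qed.

(** The energies are those of the curves w_t + l phi and phi, whose energy
    identities only involve the pairings that the two equations control. The
    velocity is recovered as a difference, and w and its gradient as primitives. *)
Lemma energy_curves (kappa tau gamma l K : R) : 0 < kappa -> 0 < tau -> 0 < gamma -> 0 < l -> 0 <= K ->
  exists2 C : R, 0 < C &
  forall (J : finType) (Dw Dv Dp Dz Dpt F : R -> X -> R) (Gw Gv Gp : J -> R -> X -> R)
    (cw cv cp : X -> R) (cg : J -> X -> R),
  curve Dw Dv cw -> curve Dv Dz cv -> curve Dp Dpt cp -> (forall i, curve (Gw i) (Gv i) (cg i)) ->
  (forall i, L2 mm (unc (Gp i))) -> (forall i x, supported_in 0 T (Gp i ^~ x)) ->
  L2 mm (unc F) -> (forall x, supported_in 0 T (F ^~ x)) ->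
  (\forall t \ae mu, 0 < t < T -> [/\ L2 m2 (F t), forall i, L2 m2 (Gw i t),
     forall i, L2 m2 (Gv i t), forall i, L2 m2 (Gp i t) & L2 m2 (Dz t) /\ L2 m2 (Dpt t)]) ->
  (\forall t \ae mu, 0 < t < T ->
    \int[m2]_x ((Dz t x + l * Dpt t x) * (Dv t x + l * Dp t x)) =
    \int[m2]_x (F t x * (Dv t x + l * Dp t x))
    - kappa * (\sum_i \int[m2]_x (Gv i t x * (Gv i t x + l * Gp i t x)))
    - tau * (\sum_i \int[m2]_x (Gw i t x * (Gv i t x + l * Gp i t x)))) ->
  (\forall t \ae mu, 0 < t < T ->
    \int[m2]_x (Dpt t x * Dp t x) <=
    - \sum_i nrm2 m2 (Gp i t) + K * nrm2 m2 (Dp t) + gamma * \int[m2]_x (Dv t x * Dp t x)) ->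
  let S := nrm2 m2 cv + nrm2 m2 cw + nrm2 m2 cp + \sum_i nrm2 m2 (cg i) + \int[mu]_t nrm2 m2 (F t) in
  [/\ \forall t \ae mu, 0 < t < T -> [/\ nrm2 m2 (Dv t) <= C * S, nrm2 m2 (Dp t) <= C * S,
        nrm2 m2 (Dw t) <= C * S & \sum_i nrm2 m2 (Gw i t) <= C * S],
      \int[mu]_t (\sum_i nrm2 m2 (Gv i t)) <= C * S &
      \int[mu]_t (\sum_i nrm2 m2 (Gp i t)) <= C * S].
Proof.
move=> k0 t0 g0 l0 K0; have m0 : 0 <= tau ^+ 2 / kappa by rewrite divr_ge0 ?sqr_ge0// ltW.
have [C C0 EB] := energy_bound k0 l0 m0 g0 K0 T0.
pose C3 := C * (3 + 2 * l ^+ 2).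
pose C4 := (2 + 2 * l ^+ 2 + 2 * T + 2 * T * T * (2 + 2 * l ^+ 2)) * C3 + 2.
have l20 : 0 < l ^+ 2 by rewrite exprn_gt0.
have C30 : 0 < C3 by rewrite mulr_gt0// addr_gt0// mulr_gt0.
exists C4; first by rewrite /C4 addr_gt0// mulr_gt0// !addr_gt0// !mulr_gt0// addr_gt0// mulr_gt0.
move=> J Dw Dv Dp Dz Dpt F Gw Gv Gp cw cv cp cg hw hv hp hg lGp sGp lF sF lslice hA hB S.
have hE := curve_lin l hv hp.
have [a1 a2 a3 a4] := curve_energy hE; have [y1 y2 y3 y4] := curve_energy hp.
have sV0 (G : J -> R -> X -> R) : (forall i x, supported_in 0 T (G i ^~ x)) ->
    supported_in 0 T (fun s => \sum_i nrm2 m2 (G i s)).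
  move=> sG t tI; rewrite big1// => i _; rewrite /nrm2.
  by under eq_Rintegral do rewrite sG// expr0n/=; rewrite int0.
have n0 (G : J -> R -> X -> R) t : 0 <= \sum_i nrm2 m2 (G i t) by apply: sumr_ge0 => i _; exact: nrm2_ge0.
have sF' : supported_in 0 T (fun s => nrm2 m2 (F s)).
  by move=> t tI; rewrite /nrm2; under eq_Rintegral do rewrite sF// expr0n/=; rewrite int0.
have d00 : 0 <= \sum_i nrm2 m2 (cg i) by apply: sumr_ge0 => i _; exact: nrm2_ge0.
have lGv i : L1 mu (fun t => nrm2 m2 (Gv i t)) by apply: nrm2_time; exact: (curve_L2 (hg i)).
have lb : L1 mu (fun t => \sum_i nrm2 m2 (Gv i t)) by exact: L1_sum.
have lc : L1 mu (fun t => \sum_i nrm2 m2 (Gp i t)) by apply: L1_sum => i; exact: nrm2_time.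
have gw_le : \forall t \ae mu, 0 < t < T -> \sum_i nrm2 m2 (Gw i t) <=
    2 * (\sum_i nrm2 m2 (cg i)) + 2 * T * prim (fun s => \sum_i nrm2 m2 (Gv i s)) t.
  have := ae_forall (fun i => curve_bar (hg i)).
  apply: aeS2 lslice => t sl hb tI; have [_ sw _ _ _] := sl tI.
  rewrite prim_sum// !mulr_sumr -big_split/=; apply: ler_sum => i _.
  have [sV lU l1 lV lcg _] := hg i.
  rewrite (nrm2_ae (sw i).1 (L2_bar T0 lcg sV l1 lV t).1 (hb i tI)).
  exact: (nrm2_bar_le T0 lcg sV l1 lV t).
pose a t := nrm2 m2 (bar (fun x => cv x + l * cp x) (fun t x => Dz t x + l * Dpt t x) t).
pose y t := nrm2 m2 (bar cp Dpt t).
have slE := curve_slice hE; have slp := curve_slice hp; have slv := curve_slice hv.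
have lVE t : L2 m2 (Dz t) /\ L2 m2 (Dpt t) -> L2 m2 (fun x => Dz t x + l * Dpt t x).
  by move=> [h1 h2]; apply: L2D => //; exact: L2Z.
have state : \forall t \ae mu, 0 < t < T -> [/\ L2 m2 (Dv t), L2 m2 (Dp t),
    L2 m2 (fun x => Dv t x + l * Dp t x), nrm2 m2 (fun x => Dv t x + l * Dp t x) = a t & nrm2 m2 (Dp t) = y t].
  apply: aeS2 (aeS2 (fun x a b => conj a b) (curve_U hv) (curve_U hp))
    (aeS2 (fun x a b => conj a b) (curve_bar hE) (curve_bar hp)) => t [b1 b2] [b3 b4] tI.
  have lv := b1 tI; have lp := b2 tI.
  have le : L2 m2 (fun x => Dv t x + l * Dp t x) by apply: L2D => //; exact: L2Z.
  by split => //; apply: nrm2_ae; [exact: le.1|exact: (slE t).1|exact: b3|exact: lp.1|exact: (slp t).1|exact: b4].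
pose A t := \int[m2]_x ((Dz t x + l * Dpt t x) * bar (fun x => cv x + l * cp x) (fun t x => Dz t x + l * Dpt t x) t x).
pose B t := \int[m2]_x (Dpt t x * bar cp Dpt t x).
have A_le : \forall t \ae mu, 0 < t < T ->
    A t <= 2^-1 * nrm2 m2 (F t) + 2^-1 * a t - 2^-1 * kappa * (\sum_i nrm2 m2 (Gv i t))
     + 3 / 2 * kappa * l ^+ 2 * (\sum_i nrm2 m2 (Gp i t))
     + 3 / 2 * (tau ^+ 2 / kappa) * (2 * (\sum_i nrm2 m2 (cg i)) + 2 * T * prim (fun s => \sum_i nrm2 m2 (Gv i s)) t).
  apply: aeS2 (aeS2 (fun x a b => conj a b) state lslice)
   (aeS2 (fun x a b => conj a b) gw_le (aeS2 (fun x a b => conj a b) hA (curve_bar hE))) => t [b1 b2] [b3 [b4 b5]] tI.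
  have [_ _ le ae _] := b1 tI; have [lFt lw lgv lgp lz] := b2 tI; have {}b3 := b3 tI.
  have -> : A t = \int[m2]_x ((Dz t x + l * Dpt t x) * (Dv t x + l * Dp t x)).
    apply: int_ae; [exact: L1_meas (L2M (lVE t lz) (slE t))|exact: L1_meas (L2M (lVE t lz) le)|].
    by apply: aeS (b5 tI) => x ->.
  rewrite (b4 tI) -ae; apply: le_trans (young_w k0 t0 l0 lFt le lgv lgp lw) _.
  by rewrite lerD2l ler_wpM2l// mulr_ge0.
have B_le : \forall t \ae mu, 0 < t < T ->
    B t <= - (\sum_i nrm2 m2 (Gp i t)) + K * y t + gamma / 2 * (a t + y t).
  apply: aeS2 (aeS2 (fun x a b => conj a b) state lslice)
   (aeS2 (fun x a b => conj a b) hB (curve_bar hp)) => t [b1 b2] [b4 b5] tI.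
  have [lv lp le ae ye] := b1 tI; have [lFt lw lgv lgp lz] := b2 tI.
  have -> : B t = \int[m2]_x (Dpt t x * Dp t x).
    apply: int_ae; [exact: L1_meas (L2M lz.2 (slp t))|exact: L1_meas (L2M lz.2 lp)|].
    by apply: aeS (b5 tI) => x ->.
  apply: le_trans (b4 tI) _; rewrite -ae -ye.
  have h : 0 < 2^-1 :> R by rewrite invr_gt0.
  have := le_trans (ler_norm _) (young h le lp).
  rewrite (_ : (4 * 2^-1)^-1 = 2^-1); last by field.
  rewrite (_ : \int[m2]_x _ = \int[m2]_x (Dv t x * Dp t x) + l * nrm2 m2 (Dp t)); last first.
    rewrite -(intZ l lp.2) -(intD (L2M lv lp) (L1Z l lp.2)).
    by apply: eq_Rintegral => x _; ring.
  have lp0 : 0 <= l * nrm2 m2 (Dp t) by rewrite mulr_ge0 ?nrm2_ge0// ltW.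
  by move=> H; exact: (half_young _ g0 H lp0).
have a_ge0 t : 0 <= a t by exact: nrm2_ge0.
have y_ge0 t : 0 <= y t by exact: nrm2_ge0.
have [H1 [H2 H3]] := EB a y (fun t => \sum_i nrm2 m2 (Gv i t)) (fun t => \sum_i nrm2 m2 (Gp i t))
  (fun t => nrm2 m2 (F t)) A B _ _ _ a_ge0 y_ge0 (n0 Gv) (n0 Gp) (fun t => nrm2_ge0 m2 (F t))
  (nrm2_ge0 m2 _) (nrm2_ge0 m2 _) d00 a1 y1 lb lc (nrm2_time lF) a2 y2
  (sV0 Gv (fun i => curve_supp (hg i))) (sV0 Gp sGp) sF' a3 y3 a4 y4 A_le B_le.
have lcv := curve_L2c hv; have lcp := curve_L2c hp.
have F0 : 0 <= \int[mu]_s nrm2 m2 (F s) by apply: int_ge0 => s; exact: nrm2_ge0.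
have cv0 := nrm2_ge0 m2 cv; have cw0 := nrm2_ge0 m2 cw; have cp0 := nrm2_ge0 m2 cp.
have S0 : 0 <= S by rewrite /S !addr_ge0.
set P := C3 * S.
have P0 : 0 <= P by rewrite /P mulr_ge0// ltW.
have SP : C * (nrm2 m2 (fun x => cv x + l * cp x) + nrm2 m2 cp + \sum_i nrm2 m2 (cg i) + \int[mu]_s nrm2 m2 (F s)) <= P.
  rewrite /P /C3 -[leRHS]mulrA ler_pM2l//; apply: initial_energy_le => //; first exact: ltW.
  exact: nrm2_lin_le.
have vb : \forall t \ae mu, 0 < t < T -> nrm2 m2 (Dv t) <= (2 + 2 * l ^+ 2) * P /\ nrm2 m2 (Dp t) <= P.
  apply: aeS state => t ht tI; have [lv lp le ae ye] := ht tI; have [h1 h2] := H1 t tI.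
  have h3 := le_trans h1 SP; have h4 := le_trans h2 SP; rewrite ye; split => //.
  rewrite (_ : Dv t = fun x => (Dv t x + l * Dp t x) + (- l) * Dp t x); last by apply/funext => x; ring.
  have bd := nrm2_lin_le (- l) le lp; rewrite sqrrN ae ye in bd; apply: le_trans bd _.
  rewrite [leRHS]mulrDl lerD//.
    by rewrite (ler_pM2l (ltr0n R 2)).
  by rewrite ler_pM2l// mulr_gt0.
have intv : \int[mu]_t nrm2 m2 (Dv t) <= T * ((2 + 2 * l ^+ 2) * P).
  have lI := L1_itv T0.
  have -> : T * ((2 + 2 * l ^+ 2) * P) = \int[mu]_s (((2 + 2 * l ^+ 2) * P) * (\1_I : measurableTypeR R -> R) s).
    by rewrite (intZ _ lI) (int_itv T0) mulrC.
  apply: int_le; [apply: nrm2_time; exact: (curve_L2 hw)|exact: L1Z|].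
  apply: aeS vb => t ht; have [tI|tI] := boolP (0 < t < T).
    by rewrite indic_in// mulr1; have [] := ht tI.
  rewrite indic_out// mulr0 /nrm2; under eq_Rintegral do rewrite (curve_supp hw)// expr0n/=.
  by rewrite int0.
have C4S : C4 * S = (2 + 2 * l ^+ 2 + 2 * T + 2 * T * T * (2 + 2 * l ^+ 2)) * P + 2 * S by rewrite /C4 /P; ring.
have [k1 k2 k3 k4] := energy_constants l T0 P0 S0; rewrite -C4S in k1 k2 k3 k4.
have [wS gS] := sum5_le cv0 cw0 cp0 d00 F0; rewrite -/S in wS gS.
have T2 : 0 < 2 * T by rewrite mulr_gt0.
split; last 2 first.
- exact: le_trans (le_trans H2 SP) k1.
- exact: le_trans (le_trans H3 SP) k1.
apply: aeS2 (aeS2 (fun x a b => conj a b) vb gw_le) (curve_nrm2_le T0 hw) => t [b1 b2] b3 tI.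
have [h1 h2] := b1 tI.
have pb := le_trans (le_trans (prim_le_int t lb (n0 Gv)) H2) SP.
split; [exact: le_trans h1 k2|exact: le_trans h2 k1| |].
- apply: le_trans (le_trans (b3 tI) (lerD _ _)) k3; first by rewrite (ler_pM2l (ltr0n R 2)).
  by rewrite ler_pM2l.
- apply: le_trans (le_trans (b2 tI) (lerD _ _)) k4; first by rewrite (ler_pM2l (ltr0n R 2)).
  by rewrite ler_pM2l.
Qed.

End curve_energy.

(** * Solutions as curves *)

Section solution_curves.
Context {R : realType} {N : nat}.
Variables (Om : set 'rV[R]_N) (T : R).
Hypotheses (hN : (0 < N)%N) (Om_open : open Om) (Om_bounded : bounded_set Om) (T0 : 0 < T).
Local Notation E := 'rV[R]_N.
Local Notation lb := (leb N).
Local Notation e := (ext Om).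
Local Notation mu := (@lebesgue_measure R).
Local Notation mm := (mu \x lb)%E.
Local Notation unc F := (fun z : measurableTypeR R * E => F z.1 z.2).
Local Notation q := (q Om T).
Local Notation curve := (curve lb T).
Implicit Types (u v : R -> E -> R).

(** Being a weak derivative only depends on classes modulo null sets. *)
Lemma weak_pd_ae i (u g u' g' : E -> R) : L2 lb (e u) -> L2 lb (e u') -> L2 lb (e g) -> L2 lb (e g') ->
  (\forall x \ae lb, e u x = e u' x) -> (\forall x \ae lb, e g x = e g' x) ->
  weak_pd Om i u' g' -> weak_pd Om i u g.
Proof.
move=> lu lu' lg lg' uu gg /weak_pdP H; apply/weak_pdP => // psi tpsi.
have := H psi tpsi.
have tp := test_L2 Om_bounded (test_pd i tpsi); have tt := test_L2 Om_bounded tpsi.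
rewrite (_ : \int[lb]_x (e u x * pd i psi x) = \int[lb]_x (e u' x * pd i psi x)); last first.
  apply: int_ae; [exact: L1_meas (L2M lu tp)|exact: L1_meas (L2M lu' tp)|].
  by apply: aeS uu => x ->.
rewrite (_ : \int[lb]_x (e g x * psi x) = \int[lb]_x (e g' x * psi x)) //.
apply: int_ae; [exact: L1_meas (L2M lg tt)|exact: L1_meas (L2M lg' tt)|].
by apply: aeS gg => x ->.
Qed.

Lemma normV_ae (u u' : E -> R) : L2 lb (e u) -> inV Om u' -> (\forall x \ae lb, e u x = e u' x) ->
  inV Om u /\ normV Om u = normV Om u'.
Proof.
move=> lu Vu' uu; have lu' := inV_L2 Om_open Vu'.
have W i : weak_pd Om i u (wpd Om i u').
  have [l w] := wpdP Om_open i Vu'.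
  by apply: (weak_pd_ae lu lu' l l uu _ w); apply: aeW.
have Vu : inV Om u by apply: (inVI Om_open lu _ W) => i; exact: (wpdP Om_open i Vu').1.
split; first exact: Vu.
rewrite (normVE Om_open Vu) (normVE Om_open Vu').
have n1 : nrm2 lb (e u) = nrm2 lb (e u') by apply: nrm2_ae => //; [exact: lu.1|exact: lu'.1].
have n2 i : nrm2 lb (e (wpd Om i u)) = nrm2 lb (e (wpd Om i u')).
  have [l w] := wpdP Om_open i Vu'.
  apply: nrm2_ae; [exact: (wpdP Om_open i Vu).1.1|exact: l.1|].
  exact: (wpdE hN Om_open Om_bounded Vu l (W i)).
have n3 : \sum_i nrm2 lb (e (wpd Om i u)) = \sum_i nrm2 lb (e (wpd Om i u')).
  by apply: eq_bigr => i _; exact: n2.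
exact: (congr2 (fun a b => (Num.sqrt (a + b))%:E) n1 n3).
Qed.

Lemma curve_sub U1 V1 c1 U2 V2 c2 : curve U1 V1 c1 -> curve U2 V2 c2 ->
  curve (fun t x => U1 t x - U2 t x) (fun t x => V1 t x - V2 t x) (fun x => c1 x - c2 x).
Proof.
move=> h1 h2; have := curve_lin (-1) h1 h2.
have E (A B : R -> E -> R) : (fun t x => A t x + -1 * B t x) = (fun t x => A t x - B t x).
  by apply/funext => t; apply/funext => x; rewrite mulN1r.
by rewrite !E (_ : (fun x => c1 x + -1 * c2 x) = fun x => c1 x - c2 x)//; apply/funext => x; rewrite mulN1r.
Qed.

Lemma curve_q u v (u0 : E -> R) : LQ2 Om T u -> LQ2 Om T v -> weak_dt Om T u v -> L2 lb (e u0) ->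
  initial_value Om T u u0 -> curve (q u) (q v) (e u0).
Proof.
move=> lu lv wd l0 iv; have lu1 := LQ2_LQ1 Om_bounded T0 lu; have lv1 := LQ2_LQ1 Om_bounded T0 lv.
split => //; first by move=> x; exact: q_supp.
have := time_bar Om_open Om_bounded T0 lu1 lv1 wd l0 iv.
by apply: aeS => t h tI; rewrite q_in//; exact: h.
Qed.

(** The primitive of the gradient of v is the gradient of the primitive of v, and
    weak derivatives are unique. *)
Lemma curve_gradient i u v (u0 : E -> R) gu gv : LQ2 Om T v -> inV Om u0 ->
  curve (q u) (q v) (e u0) -> LQ2 Om T gu -> LQ2 Om T gv ->
  (\forall t \ae mu, 0 < t < T -> inV Om (u t) /\ \forall x \ae lb, q gu t x = e (wpd Om i (u t)) x) ->
  (\forall t \ae mu, 0 < t < T -> inV Om (v t) /\ \forall x \ae lb, q gv t x = e (wpd Om i (v t)) x) ->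
  (\forall t \ae mu, L2 lb (q gv t)) ->
  curve (q gu) (q gv) (e (wpd Om i u0)).
Proof.
move=> lv V0 cu lgu lgv hu hv sl; have l0 := inV_L2 Om_open V0; have [lw0 w0] := wpdP Om_open i V0.
have lv1 := LQ2_LQ1 Om_bounded T0 lv; have lgv1 := LQ2_LQ1 Om_bounded T0 lgv.
split => //; first by move=> x; exact: q_supp.
have W : \forall t \ae mu, 0 < t < T -> weak_pd Om i (v t) (gv t).
  apply: aeS2 hv sl => t h lg tI; have [Vv gg] := h tI; have [l w] := wpdP Om_open i Vv.
  rewrite q_in// in lg gg.
  by apply: (weak_pd_ae (inV_L2 Om_open Vv) (inV_L2 Om_open Vv) lg l _ gg w); apply: aeW.
have B := weak_pd_bar Om_bounded T0 lv lgv l0 lw0 w0 W.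
apply: aeS2 hu (curve_bar cu) => t h b tI; have [Vu gg] := h tI; have {}b := b tI.
have lb1 : L2 lb (e (bar (e u0) (q v) t)).
  by rewrite e_bar; apply: (L2_bar T0) => // x; exact: q_supp.
have lb2 : L2 lb (e (bar (e (wpd Om i u0)) (q gv) t)).
  by rewrite e_bar; apply: (L2_bar T0) => // x; exact: q_supp.
have [l w] := wpdP Om_open i Vu.
have : ae_Om Om (fun x => wpd Om i (u t) x = bar (e (wpd Om i u0)) (q gv) t x).
  apply: (weak_pd_unique hN Om_open Om_bounded (inV_L2 Om_open Vu) lb1 l lb2 w (B t)).
  by apply/ae_e; rewrite e_bar -(q_in Om u tI).
by move/ae_e; rewrite e_bar; apply: aeS2 gg => x -> ->.
Qed.

Lemma LQ2_slice u : LQ2 Om T u -> \forall t \ae mu, L2 lb (q u t).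
Proof.
move=> [m lu]; have := @fub_ae1 _ _ (measurableTypeR R) E R mu lb (fun t x => q u t x ^+ 2) lu.
apply: aeS => t l; split => //.
exact: (@measurable_curry1 _ _ (measurableTypeR R) E R (q u) t m).
Qed.

(** The regularity of a solution, in terms of curves: the weak time derivatives
    are the time derivatives of the curves, and the gradient of w is a curve
    whose time derivative is the gradient of w_t. *)
Record regular (w v z p pt : R -> E -> R) (gw gv gp : 'I_N -> R -> E -> R) (w0 v0 p0 : E -> R) : Prop := Regular {
  reg_w : curve (q w) (q v) (e w0) ;
  reg_v : curve (q v) (q z) (e v0) ;
  reg_p : curve (q p) (q pt) (e p0) ;
  reg_g : forall i, curve (q (gw i)) (q (gv i)) (e (wpd Om i w0)) ;
  reg_gp : forall i, LQ2 Om T (gp i) ;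
  reg_slices : \forall t \ae mu, 0 < t < T ->
    [/\ inW Om (w t), inW Om (v t), inW Om (p t), L2 lb (e (z t)) & L2 lb (e (pt t))] ;
  reg_grad : \forall t \ae mu, 0 < t < T -> forall i,
    [/\ \forall x \ae lb, q (gw i) t x = e (wpd Om i (w t)) x,
        \forall x \ae lb, q (gv i) t x = e (wpd Om i (v t)) x &
        \forall x \ae lb, q (gp i) t x = e (wpd Om i (p t)) x] }.

Lemma regular_intro w v z p pt (w0 v0 p0 : E -> R) : inV Om v0 -> inW Om w0 -> inV Om p0 ->
  inLpH Om T 2%:E w -> inLpH Om T 2%:E v -> inLpH Om T 2%:E z -> inLpH Om T 2%:E p -> inLpH Om T 2%:E pt ->
  weak_dt Om T w v -> weak_dt Om T v z -> weak_dt Om T p pt ->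
  initial_value Om T w w0 -> initial_value Om T v v0 -> initial_value Om T p p0 ->
  inLpV Om T +oo%E w -> inLpV Om T +oo%E v -> inLpV Om T +oo%E p ->
  inLpW Om T 2%:E w -> inLpW Om T 2%:E v -> inLpW Om T 2%:E p ->
  exists gw gv gp, regular w v z p pt gw gv gp w0 v0 p0.
Proof.
move=> Vt Ww Vp wH vH zH pH ptH dw dv dp iw iv ip wV vV pV wW vW pW.
have lw := inLpH2_LQ2 Om_open wH; have lv := inLpH2_LQ2 Om_open vH; have lz := inLpH2_LQ2 Om_open zH.
have lp := inLpH2_LQ2 Om_open pH; have lpt := inLpH2_LQ2 Om_open ptH.
have V0 := inW_inV Ww.
have cw : curve (q w) (q v) (e w0) by exact: curve_q lw lv dw (inV_L2 Om_open V0) iw.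
have cv : curve (q v) (q z) (e v0) by exact: curve_q lv lz dv (inV_L2 Om_open Vt) iv.
have cp : curve (q p) (q pt) (e p0) by exact: curve_q lp lpt dp (inV_L2 Om_open Vp) ip.
have [_ [gw [lgw hw]]] := inLpV_grad Om_open T0 wV.
have [_ [gv [lgv hv]]] := inLpV_grad Om_open T0 vV.
have [_ [gp [lgp hp]]] := inLpV_grad Om_open T0 pV.
exists gw, gv, gp; split.
- exact: cw.
- exact: cv.
- exact: cp.
- move=> i; apply: (curve_gradient lv V0 cw (lgw i).2 (lgv i).2).
  + by apply: aeS hw => t h tI; have [V g] := h tI.
  + by apply: aeS hv => t h tI; have [V g] := h tI.
  + exact: LQ2_slice (lgv i).2.
- by move=> i; exact: (lgp i).2.
- have [_ tW _ _] := wW; have [_ tV _ _] := vW; have [_ tP _ _] := pW.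
  apply: aeS2 (aeS2 (fun x a b => conj a b) tW tV) (aeS2 (fun x a b => conj a b) tP
    (aeS2 (fun x a b => conj a b) (LQ2_slice lz) (LQ2_slice lpt))) => t [h1 h2] [h3 [h4 h5]] tI.
  have tI' : `]0, T[%classic t by rewrite /= in_itv.
  rewrite (q_in Om z tI) in h4; rewrite (q_in Om pt tI) in h5.
  exact: (And5 (h1 tI') (h2 tI') (h3 tI') h4 h5).
- apply: aeS2 hw (aeS2 (fun x a b => conj a b) hv hp) => t h1 [h2 h3] tI i.
  have [_ g1] := h1 tI; have [_ g2] := h2 tI; have [_ g3] := h3 tI; exact: (And3 (g1 i) (g2 i) (g3 i)).
Qed.

Lemma solution_regular kappa tau gamma l rho betahat pihat phistar f theta0 w0 phi0 w phi xi sigma :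
  inV Om theta0 -> inW Om w0 -> inV Om phi0 ->
  solutionB Om T kappa tau gamma l rho betahat pihat phistar f theta0 w0 phi0 w phi xi sigma ->
  exists gw gv gp,
    regular w (dt Om T w) (dt Om T (dt Om T w)) phi (dt Om T phi) gw gv gp w0 theta0 phi0.
Proof.
move=> Vt Ww Vp sol.
have [[wH dw vH] [_ dv zH]] := w_H2H sol; have [wV _ vV] := w_W1ooV sol.
have [wW _ vW] := w_H1W sol; have [pH dp ptH] := phi_H1H sol.
exact: (regular_intro Vt Ww Vp wH vH zH pH ptH (dtP dw).2 (dtP dv).2 (dtP dp).2
  (w_0 sol) (wt_0 sol) (phi_0 sol) wV vV (phi_LooV sol) wW vW (phi_L2W sol)).
Qed.

End solution_curves.

(** * The difference of two solutions *)

Section difference.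
Context {R : realType} {N : nat}.
Variables (Om : set 'rV[R]_N) (T : R).
Hypotheses (hN : (0 < N)%N) (Om_open : open Om) (Om_bounded : bounded_set Om) (T0 : 0 < T).
Hypothesis Om_smooth : smooth_boundary Om.
Local Notation E := 'rV[R]_N.
Local Notation lb := (leb N).
Local Notation e := (ext Om).
Local Notation mu := (@lebesgue_measure R).
Local Notation mm := (mu \x lb)%E.
Local Notation unc F := (fun z : measurableTypeR R * E => F z.1 z.2).
Local Notation q := (q Om T).
Local Notation curve := (curve lb T).
Local Notation regular := (regular Om T).

Lemma int_mul_ae (f f' g g' : E -> R) : L2 lb f -> L2 lb f' -> L2 lb g -> L2 lb g' ->
  (\forall x \ae lb, f x = f' x) -> (\forall x \ae lb, g x = g' x) ->
  \int[lb]_x (f x * g x) = \int[lb]_x (f' x * g' x).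
Proof.
move=> lf lf' lg lg' ff gg; apply: int_ae; [exact: L1_meas (L2M lf lg)|exact: L1_meas (L2M lf' lg')|].
by apply: aeS2 ff gg => x -> ->.
Qed.

(** The energy method needs time derivatives and gradients that are jointly
    measurable in time and space; at almost every time they agree only almost
    everywhere with the ones in the equations. *)
Lemma test_w_repr (kappa tau l : R) (w1 w2 v1 v2 p1 p2 y1 y2 f1 f2 a1 a2 b1 b2 : E -> R)
    (gw1 gw2 gv1 gv2 gp1 gp2 : 'I_N -> E -> R) :
  inW Om w1 -> inW Om w2 -> inW Om v1 -> inW Om v2 -> inW Om p1 -> inW Om p2 ->
  L2 lb (e y1) -> L2 lb (e y2) -> L2 lb (e f1) -> L2 lb (e f2) ->
  ae_Om Om (fun x => y1 x - kappa * lap Om v1 x - tau * lap Om w1 x = f1 x) ->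
  ae_Om Om (fun x => y2 x - kappa * lap Om v2 x - tau * lap Om w2 x = f2 x) ->
  L2 lb a1 -> L2 lb a2 -> L2 lb b1 -> L2 lb b2 ->
  (\forall x \ae lb, e y1 x = a1 x + l * b1 x) -> (\forall x \ae lb, e y2 x = a2 x + l * b2 x) ->
  (forall i, [/\ L2 lb (gw1 i), L2 lb (gv1 i) & L2 lb (gp1 i)]) ->
  (forall i, [/\ L2 lb (gw2 i), L2 lb (gv2 i) & L2 lb (gp2 i)]) ->
  (forall i, [/\ \forall x \ae lb, gw1 i x = e (wpd Om i w1) x,
    \forall x \ae lb, gv1 i x = e (wpd Om i v1) x & \forall x \ae lb, gp1 i x = e (wpd Om i p1) x]) ->
  (forall i, [/\ \forall x \ae lb, gw2 i x = e (wpd Om i w2) x,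
    \forall x \ae lb, gv2 i x = e (wpd Om i v2) x & \forall x \ae lb, gp2 i x = e (wpd Om i p2) x]) ->
  \int[lb]_x (((a1 x - a2 x) + l * (b1 x - b2 x)) * ((e v1 x - e v2 x) + l * (e p1 x - e p2 x))) =
  \int[lb]_x ((e f1 x - e f2 x) * ((e v1 x - e v2 x) + l * (e p1 x - e p2 x)))
  - kappa * (\sum_i \int[lb]_x ((gv1 i x - gv2 i x) * ((gv1 i x - gv2 i x) + l * (gp1 i x - gp2 i x))))
  - tau * (\sum_i \int[lb]_x ((gw1 i x - gw2 i x) * ((gv1 i x - gv2 i x) + l * (gp1 i x - gp2 i x)))).
Proof.
move=> Ww1 Ww2 Wv1 Wv2 Wp1 Wp2 ly1 ly2 lf1 lf2 eq1 eq2 la1 la2 lb1 lb2 yab1 yab2 l1 l2 g1 g2.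
have H := test_w hN Om_open Om_bounded Om_smooth l Ww1 Ww2 Wv1 Wv2 (inW_inV Wp1) (inW_inV Wp2) ly1 ly2 lf1 lf2 eq1 eq2.
have lv1 := inV_L2 Om_open (inW_inV Wv1); have lv2 := inV_L2 Om_open (inW_inV Wv2).
have lp1 := inV_L2 Om_open (inW_inV Wp1); have lp2 := inV_L2 Om_open (inW_inV Wp2).
have leps := L2D (L2B lv1 lv2) (L2Z l (L2B lp1 lp2)).
have lab := L2D (L2B la1 la2) (L2Z l (L2B lb1 lb2)).
have eA : \int[lb]_x (((a1 x - a2 x) + l * (b1 x - b2 x)) * ((e v1 x - e v2 x) + l * (e p1 x - e p2 x))) =
   \int[lb]_x ((e y1 x - e y2 x) * ((e v1 x - e v2 x) + l * (e p1 x - e p2 x))).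
  apply: (int_mul_ae lab (L2B ly1 ly2) leps leps); last by apply: aeW.
  by apply: aeS2 yab1 yab2 => x -> ->; ring.
apply: etrans eA _; apply: etrans H _.
have wp (u : E -> R) i : inW Om u -> L2 lb (e (wpd Om i u)) by move=> W; exact: (wpdP Om_open i (inW_inV W)).1.
have lD (u1 u2 : E -> R) i : inW Om u1 -> inW Om u2 -> L2 lb (fun x => e (wpd Om i u1) x - e (wpd Om i u2) x).
  by move=> h1 h2; exact: L2B (wp _ _ h1) (wp _ _ h2).
have aD (u1 u2 : E -> R) i (h1 h2 : E -> R) : (\forall x \ae lb, h1 x = e (wpd Om i u1) x) ->
   (\forall x \ae lb, h2 x = e (wpd Om i u2) x) ->
   \forall x \ae lb, e (wpd Om i u1) x - e (wpd Om i u2) x = h1 x - h2 x.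
  by move=> h; apply: aeS2 h => x -> ->.
have ag i : \forall x \ae lb, (e (wpd Om i v1) x - e (wpd Om i v2) x) + l * (e (wpd Om i p1) x - e (wpd Om i p2) x) =
    (gv1 i x - gv2 i x) + l * (gp1 i x - gp2 i x).
  have [_ k1 k2] := g1 i; have [_ k3 k4] := g2 i.
  by apply: aeS2 (aD _ _ _ _ _ k1 k3) (aD _ _ _ _ _ k2 k4) => x -> ->.
have lgD i : L2 lb (fun x => (gv1 i x - gv2 i x) + l * (gp1 i x - gp2 i x)).
  by have [_ k1 k2] := l1 i; have [_ k3 k4] := l2 i; exact: L2D (L2B k1 k3) (L2Z l (L2B k2 k4)).
have leD i := L2D (lD _ _ i Wv1 Wv2) (L2Z l (lD _ _ i Wp1 Wp2)).
apply: (congr2 (fun a b => _ - kappa * a - tau * b)); apply: eq_bigr => i _.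
  have [_ k1 k2] := g1 i; have [_ k3 k4] := g2 i; have [_ m1 _] := l1 i; have [_ m3 _] := l2 i.
  exact: (int_mul_ae (lD _ _ i Wv1 Wv2) (L2B m1 m3) (leD i) (lgD i) (aD _ _ _ _ _ k1 k3) (ag i)).
have [k1 _ k2] := g1 i; have [k3 _ k4] := g2 i; have [m1 _ _] := l1 i; have [m3 _ _] := l2 i.
exact: (int_mul_ae (lD _ _ i Ww1 Ww2) (L2B m1 m3) (leD i) (lgD i) (aD _ _ _ _ _ k1 k3) (ag i)).
Qed.

Lemma test_phi_repr (gamma rho K : R) (h : R -> \bar R) (pi_ : R -> R) (pstar : E -> R)
    (p1 p2 pt1 pt2 xi1 xi2 s1 s2 v1 v2 : E -> R) (gp1 gp2 : 'I_N -> E -> R) :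
  0 < rho -> (forall r, 0 <= h r)%E -> (forall a b, `|pi_ a - pi_ b| <= K * `|a - b|) ->
  L2 lb (e pstar) -> inW Om p1 -> inW Om p2 ->
  L2 lb (e pt1) -> L2 lb (e pt2) -> inW Om v1 -> inW Om v2 ->
  ae_Om Om (fun x => pt1 x - lap Om p1 x + xi1 x + pi_ (p1 x) + rho * s1 x = gamma * v1 x) ->
  ae_Om Om (fun x => pt2 x - lap Om p2 x + xi2 x + pi_ (p2 x) + rho * s2 x = gamma * v2 x) ->
  ae_Om Om (fun x => subdiff h (p1 x) (xi1 x)) -> ae_Om Om (fun x => subdiff h (p2 x) (xi2 x)) ->
  Sign Om (fun x => p1 x - pstar x) s1 -> Sign Om (fun x => p2 x - pstar x) s2 ->
  (forall i, L2 lb (gp1 i)) -> (forall i, L2 lb (gp2 i)) ->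
  (forall i, \forall x \ae lb, gp1 i x = e (wpd Om i p1) x) ->
  (forall i, \forall x \ae lb, gp2 i x = e (wpd Om i p2) x) ->
  \int[lb]_x ((e pt1 x - e pt2 x) * (e p1 x - e p2 x)) <=
  - \sum_i nrm2 lb (fun x => gp1 i x - gp2 i x) + K * nrm2 lb (fun x => e p1 x - e p2 x)
  + gamma * \int[lb]_x ((e v1 x - e v2 x) * (e p1 x - e p2 x)).
Proof.
move=> rho0 h0 piK lps W1 W2 lt1 lt2 Wv1 Wv2 eq1 eq2 xb1 xb2 S1 S2 l1 l2 g1 g2.
have lv1 := inV_L2 Om_open (inW_inV Wv1); have lv2 := inV_L2 Om_open (inW_inV Wv2).
apply: le_trans (test_phi hN Om_open Om_bounded Om_smooth rho0 h0 piK lps W1 W2 lt1 lt2 lv1 lv2 eq1 eq2 xb1 xb2 S1 S2) _.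
have wp (u : E -> R) i : inW Om u -> L2 lb (e (wpd Om i u)) by move=> W; exact: (wpdP Om_open i (inW_inV W)).1.
have -> : \sum_i nrm2 lb (fun x => gp1 i x - gp2 i x) = \sum_i nrm2 lb (fun x => e (wpd Om i p1) x - e (wpd Om i p2) x).
  apply: eq_bigr => i _; apply: nrm2_ae; [exact: (L2B (l1 i) (l2 i)).1|exact: (L2B (wp _ i W1) (wp _ i W2)).1|].
  by apply: aeS2 (g1 i) (g2 i) => x -> ->.
exact: lexx.
Qed.

Lemma ae_and (P Q : R -> Prop) : (\forall t \ae mu, P t) -> (\forall t \ae mu, Q t) ->
  \forall t \ae mu, P t /\ Q t.
Proof. exact: aeS2. Qed.

(** The constant is chosen before rho, which enters only through a term with a
    sign. *)
Lemma difference_energy (kappa tau gamma l K : R) : 0 < kappa -> 0 < tau -> 0 < gamma -> 0 < l -> 0 <= K ->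
  exists2 C : R, 0 < C &
  forall (rho : R) (h : R -> \bar R) (pi_ : R -> R) (pstar : E -> R)
    (w1 v1 z1 p1 pt1 y1 f1 xi1 s1 w2 v2 z2 p2 pt2 y2 f2 xi2 s2 : R -> E -> R)
    (gw1 gv1 gp1 gw2 gv2 gp2 : 'I_N -> R -> E -> R) (w01 v01 p01 w02 v02 p02 : E -> R),
  0 < rho -> (forall r, 0 <= h r)%E -> (forall a b, `|pi_ a - pi_ b| <= K * `|a - b|) ->
  L2 lb (e pstar) ->
  regular w1 v1 z1 p1 pt1 gw1 gv1 gp1 w01 v01 p01 -> regular w2 v2 z2 p2 pt2 gw2 gv2 gp2 w02 v02 p02 ->
  LQ2 Om T f1 -> LQ2 Om T f2 ->
  (\forall t \ae mu, 0 < t < T -> L2 lb (e (y1 t)) /\ \forall x \ae lb, e (y1 t) x = q z1 t x + l * q pt1 t x) ->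
  (\forall t \ae mu, 0 < t < T -> L2 lb (e (y2 t)) /\ \forall x \ae lb, e (y2 t) x = q z2 t x + l * q pt2 t x) ->
  ae_Q Om T (fun t x => y1 t x - kappa * lap Om (v1 t) x - tau * lap Om (w1 t) x = f1 t x) ->
  ae_Q Om T (fun t x => y2 t x - kappa * lap Om (v2 t) x - tau * lap Om (w2 t) x = f2 t x) ->
  ae_Q Om T (fun t x => pt1 t x - lap Om (p1 t) x + xi1 t x + pi_ (p1 t x) + rho * s1 t x = gamma * v1 t x) ->
  ae_Q Om T (fun t x => pt2 t x - lap Om (p2 t) x + xi2 t x + pi_ (p2 t x) + rho * s2 t x = gamma * v2 t x) ->
  ae_Q Om T (fun t x => subdiff h (p1 t x) (xi1 t x)) -> ae_Q Om T (fun t x => subdiff h (p2 t x) (xi2 t x)) ->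
  ae_time T (fun t => Sign Om (fun x => p1 t x - pstar x) (s1 t)) ->
  ae_time T (fun t => Sign Om (fun x => p2 t x - pstar x) (s2 t)) ->
  let S := nrm2 lb (fun x => e v01 x - e v02 x) + nrm2 lb (fun x => e w01 x - e w02 x)
    + nrm2 lb (fun x => e p01 x - e p02 x) + \sum_i nrm2 lb (fun x => e (wpd Om i w01) x - e (wpd Om i w02) x)
    + \int[mu]_t nrm2 lb (fun x => q f1 t x - q f2 t x) in
  [/\ \forall t \ae mu, 0 < t < T -> [/\ nrm2 lb (fun x => q v1 t x - q v2 t x) <= C * S,
        nrm2 lb (fun x => q p1 t x - q p2 t x) <= C * S,
        nrm2 lb (fun x => q w1 t x - q w2 t x) <= C * S &
        \sum_i nrm2 lb (fun x => q (gw1 i) t x - q (gw2 i) t x) <= C * S],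
      \int[mu]_t (\sum_i nrm2 lb (fun x => q (gv1 i) t x - q (gv2 i) t x)) <= C * S &
      \int[mu]_t (\sum_i nrm2 lb (fun x => q (gp1 i) t x - q (gp2 i) t x)) <= C * S].
Proof.
move=> k0 t0 g0 l0 K0; have [C C0 H] := energy_curves lb T0 k0 t0 g0 l0 K0; exists C => //.
move=> rho h pi_ pstar w1 v1 z1 p1 pt1 y1 f1 xi1 s1 w2 v2 z2 p2 pt2 y2 f2 xi2 s2.
move=> gw1 gv1 gp1 gw2 gv2 gp2 w01 v01 p01 w02 v02 p02 rho0 h0 piK lps r1 r2 lf1 lf2 hy1 hy2.
move=> ew1 ew2 ep1 ep2 b1 b2 sg1 sg2.
have sl i := ae_and (ae_and (LQ2_slice (curve_L2u (reg_g r1 i))) (LQ2_slice (curve_L2u (reg_g r2 i))))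
  (ae_and (ae_and (LQ2_slice (curve_L2 (reg_g r1 i))) (LQ2_slice (curve_L2 (reg_g r2 i))))
    (ae_and (LQ2_slice (reg_gp r1 i)) (LQ2_slice (reg_gp r2 i)))).
have {}sl := ae_forall sl.
have slf := ae_and (LQ2_slice lf1) (LQ2_slice lf2).
have regs := ae_and (reg_slices r1) (reg_slices r2).
have grads := ae_and (reg_grad r1) (reg_grad r2).
have base := ae_and sl (ae_and slf (ae_and regs grads)).
apply: (H _ _ _ _ _ _ _ _ _ _ _ _ _ _ (curve_sub (reg_w r1) (reg_w r2)) (curve_sub (reg_v r1) (reg_v r2))
  (curve_sub (reg_p r1) (reg_p r2)) (fun i => curve_sub (reg_g r1 i) (reg_g r2 i))).
- by move=> i; exact: (L2B (reg_gp r1 i) (reg_gp r2 i)).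
- by move=> i x t tI /=; rewrite !q_out// subr0.
- exact: (L2B lf1 lf2).
- by move=> x t tI /=; rewrite !q_out// subr0.
- apply: aeS base => t [s [[k1 k2] [[m1 m2] _]]] tI.
  have [_ _ _ n1 n2] := m1 tI; have [_ _ _ n3 n4] := m2 tI.
  split; [exact: L2B|by move=> i; have [[? ?] _] := s i; exact: L2B|
    by move=> i; have [_ [[? ?] _]] := s i; exact: L2B|by move=> i; have [_ [_ [? ?]]] := s i; exact: L2B|].
  split; [rewrite (q_in Om z1 tI) (q_in Om z2 tI)|rewrite (q_in Om pt1 tI) (q_in Om pt2 tI)]; exact: L2B.
- apply: aeS2 base (ae_and (ae_and ew1 ew2) (ae_and hy1 hy2)) => t [s [[k1 k2] [[m1 m2] [g1 g2]]]] [[e1 e2] [y1t y2t]] tI.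
  have tI' : `]0, T[%classic t by rewrite /= in_itv.
  have [Ww1 Wv1 Wp1 n1 n2] := m1 tI; have [Ww2 Wv2 Wp2 n3 n4] := m2 tI.
  have [ly1 ey1] := y1t tI; have [ly2 ey2] := y2t tI.
  have q1 := q_in Om f1 tI; have q2 := q_in Om f2 tI.
  rewrite q1 in k1 *; rewrite q2 in k2 *.
  rewrite (q_in Om v1 tI) (q_in Om v2 tI) (q_in Om p1 tI) (q_in Om p2 tI).
  rewrite -(q_in Om z1 tI) in n1; rewrite -(q_in Om z2 tI) in n3.
  rewrite -(q_in Om pt1 tI) in n2; rewrite -(q_in Om pt2 tI) in n4.
  apply: (test_w_repr Ww1 Ww2 Wv1 Wv2 Wp1 Wp2 ly1 ly2 k1 k2 (e1 tI') (e2 tI') n1 n3 n2 n4 ey1 ey2 _ _ (g1 tI) (g2 tI)).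
    by move=> i; have [[a1 _] [[a2 _] [a3 _]]] := s i; exact: And3 a1 a2 a3.
  by move=> i; have [[_ a1] [[_ a2] [_ a3]]] := s i; exact: And3 a1 a2 a3.
- apply: aeS2 base (ae_and (ae_and ep1 ep2) (ae_and (ae_and b1 b2) (ae_and sg1 sg2))) =>
    t [s [_ [[m1 m2] [g1 g2]]]] [[e1 e2] [[x1 x2] [c1 c2]]] tI.
  have tI' : `]0, T[%classic t by rewrite /= in_itv.
  have [Ww1 Wv1 Wp1 n1 n2] := m1 tI; have [Ww2 Wv2 Wp2 n3 n4] := m2 tI.
  rewrite (q_in Om v1 tI) (q_in Om v2 tI) (q_in Om p1 tI) (q_in Om p2 tI) (q_in Om pt1 tI) (q_in Om pt2 tI).
  apply: (test_phi_repr rho0 h0 piK lps Wp1 Wp2 n2 n4 Wv1 Wv2 (e1 tI') (e2 tI') (x1 tI') (x2 tI') (c1 tI') (c2 tI')).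
  + by move=> i; have [_ [_ [a3 _]]] := s i; exact: a3.
  + by move=> i; have [_ [_ [_ a3]]] := s i; exact: a3.
  + by move=> i; have [_ _ a3] := g1 tI i; exact: a3.
  + by move=> i; have [_ _ a3] := g2 tI i; exact: a3.
Qed.

End difference.

(** * The norms of the difference *)

Lemma H1_norm_le {R : realType} (X Y : \bar R) (a b : R) : 0 <= a -> 0 <= b ->
  (0 <= X)%E -> (0 <= Y)%E -> (X <= (Num.sqrt a)%:E)%E -> (Y <= (Num.sqrt b)%:E)%E ->
  ((X ^+ 2 + Y ^+ 2) `^ (2^-1) <= (Num.sqrt (a + b))%:E)%E.
Proof.
move=> a0 b0 X0 Y0 Xa Yb.
have sq (Z : \bar R) (c : R) : 0 <= c -> (0 <= Z)%E -> (Z <= (Num.sqrt c)%:E)%E -> (Z ^+ 2 <= c%:E)%E.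
  move=> c0 Z0 Zc; rewrite expe2 -(sqr_sqrtr c0) expr2 EFinM.
  by apply: lee_pmul.
rewrite -(powR12_sqrt (addr_ge0 a0 b0)) -poweR_EFin; apply: gt0_ler_poweR.
- by rewrite invr_ge0.
- by rewrite in_itv/= leey andbT adde_ge0// mule_ge0.
- by rewrite in_itv/= leey andbT lee_fin addr_ge0.
- by rewrite EFinD leeD// sq.
Qed.

Lemma sum5_sqrt_le {R : realType} (x1 x2 x3 x4 x5 : \bar R) (a1 a2 a3 a4 a5 B r : R) :
  (x1 <= (Num.sqrt a1)%:E)%E -> (x2 <= (Num.sqrt a2)%:E)%E -> (x3 <= (Num.sqrt a3)%:E)%E ->
  (x4 <= (Num.sqrt a4)%:E)%E -> (x5 <= (Num.sqrt a5)%:E)%E -> 0 <= B -> 0 <= r ->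
  a1 <= B * r ^+ 2 -> a2 <= B * r ^+ 2 -> a3 <= B * r ^+ 2 -> a4 <= B * r ^+ 2 -> a5 <= B * r ^+ 2 ->
  ((x1 + x2) + x3 + (x4 + x5) <= (5 * Num.sqrt B)%:E * r%:E)%E.
Proof.
move=> h1 h2 h3 h4 h5 B0 r0 k1 k2 k3 k4 k5.
have E : Num.sqrt (B * r ^+ 2) = Num.sqrt B * r by rewrite sqrtrM// sqrtr_sqr ger0_norm.
have le x a : (x <= (Num.sqrt a)%:E)%E -> a <= B * r ^+ 2 -> (x <= (Num.sqrt B * r)%:E)%E.
  by move=> h k; apply: le_trans h _; rewrite lee_fin -E ler_wsqrtr.
have := leeD (leeD (leeD (le _ _ h1 k1) (le _ _ h2 k2)) (le _ _ h3 k3)) (leeD (le _ _ h4 k4) (le _ _ h5 k5)).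
move=> h; apply: le_trans h _; rewrite -!EFinD -EFinM lee_fin; lra.
Qed.

Lemma final_constants {R : realType} (T X Y : R) : 0 < T -> 0 <= X -> X <= Y ->
  [/\ X <= (3 * T + 1) * Y, 2 * T * X + (T * X + X) <= (3 * T + 1) * Y & T * X + X <= (3 * T + 1) * Y].
Proof.
move=> T0 X0 XY; have := ler_wpM2l (ltW T0) XY; have := mulr_ge0 (ltW T0) X0; move: X0 XY.
by split; lra.
Qed.

Lemma square_sum_le {R : realType} (a b c d : R) : 0 <= a -> 0 <= b -> 0 <= c -> 0 <= d ->
  a ^+ 2 + b ^+ 2 + c ^+ 2 + d ^+ 2 <= (a + b + c + d) ^+ 2.
Proof.
move=> a0 b0 c0 d0.
have := mulr_ge0 a0 b0; have := mulr_ge0 a0 c0; have := mulr_ge0 a0 d0.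
have := mulr_ge0 b0 c0; have := mulr_ge0 b0 d0; have := mulr_ge0 c0 d0.
lra.
Qed.

Section difference_norms.
Context {R : realType} {N : nat}.
Variables (Om : set 'rV[R]_N) (T : R).
Hypotheses (hN : (0 < N)%N) (Om_open : open Om) (Om_bounded : bounded_set Om) (T0 : 0 < T).
Local Notation E := 'rV[R]_N.
Local Notation lb := (leb N).
Local Notation e := (ext Om).
Local Notation mu := (@lebesgue_measure R).
Local Notation mm := (mu \x lb)%E.
Local Notation q := (q Om T).
Local Notation regular := (regular Om T).

Lemma normH_sub (u1 u2 : E -> R) : L2 lb (e u1) -> L2 lb (e u2) ->
  normH Om (fun x => u1 x - u2 x) = (nrm lb (fun x => e u1 x - e u2 x))%:E.
Proof. by move=> l1 l2; rewrite normHE ?e_sub//; exact: L2B. Qed.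

Lemma normV_sub (u1 u2 : E -> R) (g1 g2 : 'I_N -> E -> R) : inV Om u1 -> inV Om u2 ->
  (forall i, L2 lb (g1 i)) -> (forall i, L2 lb (g2 i)) ->
  (forall i, \forall x \ae lb, g1 i x = e (wpd Om i u1) x) ->
  (forall i, \forall x \ae lb, g2 i x = e (wpd Om i u2) x) ->
  normV Om (fun x => u1 x - u2 x) =
  (Num.sqrt (nrm2 lb (fun x => e u1 x - e u2 x) + \sum_i nrm2 lb (fun x => g1 i x - g2 i x)))%:E.
Proof.
move=> V1 V2 l1 l2 h1 h2; have [V g] := inVB hN Om_open Om_bounded V1 V2.
rewrite (normVE Om_open V) e_sub.
have n i : nrm2 lb (e (wpd Om i (fun x => u1 x - u2 x))) = nrm2 lb (fun x => g1 i x - g2 i x).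
  apply: nrm2_ae; [exact: (wpdP Om_open i V).1.1|exact: (L2B (l1 i) (l2 i)).1|].
  by apply: aeS2 (g i) (aeS2 (fun x a b => conj a b) (h1 i) (h2 i)) => x -> [-> ->].
have n3 : \sum_i nrm2 lb (e (wpd Om i (fun x => u1 x - u2 x))) = \sum_i nrm2 lb (fun x => g1 i x - g2 i x).
  by apply: eq_bigr => i _; exact: n.
by rewrite n3.
Qed.

Lemma time_int_le (m : R -> R) (A : R) : L1 mu m -> supported_in 0 T m ->
  (\forall t \ae mu, 0 < t < T -> m t <= A) -> \int[mu]_t m t <= T * A.
Proof.
move=> lm sm mA; have lI := L1_itv T0.
have -> : T * A = \int[mu]_s (A * (\1_(`]0, T[%classic) : measurableTypeR R -> R) s).
  by rewrite (intZ A lI) (int_itv T0) mulrC.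
apply: int_le => //; first exact: L1Z.
apply: aeS mA => t h; have [tI|tI] := boolP (0 < t < T); first by rewrite indic_in// mulr1 h.
by rewrite indic_out// mulr0 sm.
Qed.

Lemma nrm2_sub_time u1 u2 : LQ2 Om T u1 -> LQ2 Om T u2 ->
  L1 mu (fun t => nrm2 lb (fun x => q u1 t x - q u2 t x)).
Proof. by move=> l1 l2; exact: (nrm2_time (w := fun t x => q u1 t x - q u2 t x) (L2B l1 l2)). Qed.

Lemma nrm2_sub_supp u1 u2 : supported_in 0 T (fun t => nrm2 lb (fun x => q u1 t x - q u2 t x)).
Proof.
move=> t tI; rewrite /nrm2; under eq_Rintegral do rewrite !q_out// subr0 expr0n/=.
by rewrite int0.
Qed.

Lemma normLp2V_sub u1 u2 (u : R -> E -> R) (g1 g2 : 'I_N -> R -> E -> R) (B : R) :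
  LQ2 Om T u1 -> LQ2 Om T u2 -> (forall i, LQ2 Om T (g1 i)) -> (forall i, LQ2 Om T (g2 i)) ->
  (\forall t \ae mu, 0 < t < T -> inV Om (u1 t) /\ forall i, \forall x \ae lb, q (g1 i) t x = e (wpd Om i (u1 t)) x) ->
  (\forall t \ae mu, 0 < t < T -> inV Om (u2 t) /\ forall i, \forall x \ae lb, q (g2 i) t x = e (wpd Om i (u2 t)) x) ->
  (\forall t \ae mu, 0 < t < T -> L2 lb (e (u t)) /\ \forall x \ae lb, e (u t) x = q u1 t x - q u2 t x) ->
  \int[mu]_t nrm2 lb (fun x => q u1 t x - q u2 t x) +
    \int[mu]_t (\sum_i nrm2 lb (fun x => q (g1 i) t x - q (g2 i) t x)) <= B ->
  (normLp T 2%:E (normV Om) u <= (Num.sqrt B)%:E)%E.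
Proof.
move=> l1 l2 lg1 lg2 h1 h2 hu le.
have L1a := nrm2_sub_time l1 l2.
have L1b : L1 mu (fun t => \sum_i nrm2 lb (fun x => q (g1 i) t x - q (g2 i) t x)).
  by apply: L1_sum => i; exact: nrm2_sub_time.
apply: (normLp_2_le (m := fun t => nrm2 lb (fun x => q u1 t x - q u2 t x) +
    \sum_i nrm2 lb (fun x => q (g1 i) t x - q (g2 i) t x))).
- exact: normV_ge0.
- exact: L1D.
- by move=> t; rewrite addr_ge0 ?nrm2_ge0// sumr_ge0// => i _; exact: nrm2_ge0.
- have s1 := ae_forall (fun i => LQ2_slice (lg1 i)); have s2 := ae_forall (fun i => LQ2_slice (lg2 i)).
  apply: aeS2 (ae_and s1 s2) (ae_and hu (ae_and h1 h2)) => t [k1 k2] [hut [h1t h2t]] tI'.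
  have tI : 0 < t < T by move: tI'; rewrite /= in_itv.
  have [V1 a1] := h1t tI; have [V2 a2] := h2t tI; have [lu uu] := hut tI.
  have [V12 _] := inVB hN Om_open Om_bounded V1 V2.
  have {}uu : \forall x \ae lb, e (u t) x = e (fun x => u1 t x - u2 t x) x.
    by rewrite e_sub -(q_in Om u1 tI) -(q_in Om u2 tI).
  rewrite (normV_ae hN Om_open Om_bounded lu V12 uu).2 (normV_sub V1 V2 k1 k2 a1 a2).
  by rewrite (q_in Om u1 tI) (q_in Om u2 tI).
- by rewrite intD.
Qed.

Lemma normLpooH_sub u1 u2 (u : R -> E -> R) (A : R) : 0 <= A ->
  LQ2 Om T u1 -> LQ2 Om T u2 ->
  (\forall t \ae mu, 0 < t < T -> L2 lb (e (u t)) /\ \forall x \ae lb, e (u t) x = q u1 t x - q u2 t x) ->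
  (\forall t \ae mu, 0 < t < T -> nrm2 lb (fun x => q u1 t x - q u2 t x) <= A) ->
  (normLp T +oo%E (normH Om) u <= (Num.sqrt A)%:E)%E.
Proof.
move=> A0 l1 l2 hu hA; apply: normLp_oo_le => //; first exact: normH_ge0.
apply: aeS2 (ae_and hu hA) (ae_and (LQ2_slice l1) (LQ2_slice l2)) => t [hut hAt] [k1 k2] tI'.
have tI : 0 < t < T by move: tI'; rewrite /= in_itv.
have [lu uu] := hut tI; rewrite normHE// lee_fin /nrm ler_wsqrtr//.
by rewrite (nrm2_ae lu.1 (L2B k1 k2).1 uu) hAt.
Qed.

Lemma dt_lin_slice c u1 u2 v1 v2 : inLpH Om T 2%:E u1 -> inLpH Om T 2%:E u2 ->
  inLpH Om T 2%:E v1 -> inLpH Om T 2%:E v2 -> is_dt Om T u1 v1 -> is_dt Om T u2 v2 ->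
  let u := fun t x => u1 t x + c * u2 t x in
  \forall t \ae mu, 0 < t < T -> L2 lb (e (dt Om T u t)) /\
    \forall x \ae lb, e (dt Om T u t) x = q v1 t x + c * q v2 t x.
Proof.
move=> hu1 hu2 hv1 hv2 d1 d2 u.
have l1 := inLpH2_LQ2 Om_open hv1; have l2 := inLpH2_LQ2 Om_open hv2.
have [m [_ yE]] := dt_lin Om_open Om_bounded T0 c hv1.1 hv2.1 (LQ2_LQ1 Om_bounded T0 (inLpH2_LQ2 Om_open hu1))
  (LQ2_LQ1 Om_bounded T0 (inLpH2_LQ2 Om_open hu2)) l1 l2 d1 d2.
move: m yE; rewrite -/u; move: (dt Om T u) => y m yE.
have {}yE := @fub_ae _ _ (measurableTypeR R) E R mu lb (fun t x => q y t x = q v1 t x + c * q v2 t x) yE.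
apply: aeS2 (ae_and (LQ2_slice l1) (LQ2_slice l2)) yE => t [k1 k2] yt tI.
have mt := measurable_q_slice Om_open t m; rewrite (q_in Om y tI) in yt mt.
by split => //; apply: (L2_ae mt yt); apply: L2D => //; exact: L2Z.
Qed.

Lemma dt_sub_slice u1 u2 v1 v2 : inLpH Om T 2%:E u1 -> inLpH Om T 2%:E u2 ->
  inLpH Om T 2%:E v1 -> inLpH Om T 2%:E v2 -> is_dt Om T u1 v1 -> is_dt Om T u2 v2 ->
  let u := fun t x => u1 t x - u2 t x in
  \forall t \ae mu, 0 < t < T -> L2 lb (e (dt Om T u t)) /\
    \forall x \ae lb, e (dt Om T u t) x = q v1 t x - q v2 t x.
Proof.
move=> hu1 hu2 hv1 hv2 d1 d2 u; have := dt_lin_slice (-1) hu1 hu2 hv1 hv2 d1 d2.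
rewrite (_ : (fun t x => u1 t x + -1 * u2 t x) = u); last first.
  by apply/funext => t; apply/funext => x; rewrite mulN1r.
apply: aeS => t H tI; have [l1 l2] := H tI; split; first exact: l1.
by apply: aeS l2 => x ->; rewrite mulN1r.
Qed.

Lemma sub_slice u1 u2 : LQ2 Om T u1 -> LQ2 Om T u2 -> \forall t \ae mu, 0 < t < T ->
  L2 lb (e (fun x => u1 t x - u2 t x)) /\
  \forall x \ae lb, e (fun x => u1 t x - u2 t x) x = q u1 t x - q u2 t x.
Proof.
move=> l1 l2; apply: aeS2 (LQ2_slice l1) (LQ2_slice l2) => t k1 k2 tI.
rewrite e_sub -(q_in Om u1 tI) -(q_in Om u2 tI); split; first exact: L2B.
by apply: aeW.
Qed.

Lemma regular_gradients w v z p pt gw gv gp (w0 v0 p0 : E -> R) : regular w v z p pt gw gv gp w0 v0 p0 ->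
  let grad u g := \forall t \ae mu, 0 < t < T ->
    inV Om (u t) /\ forall i, \forall x \ae lb, q (g i) t x = e (wpd Om i (u t)) x in
  [/\ grad w gw, grad v gv & grad p gp].
Proof.
move=> r grad; split; apply: aeS2 (reg_slices r) (reg_grad r) => t s g tI; have [h1 h2 h3 _ _] := s tI.
- by split; [exact: inW_inV h1|move=> i; have [k _ _] := g tI i; exact: k].
- by split; [exact: inW_inV h2|move=> i; have [_ k _] := g tI i; exact: k].
- by split; [exact: inW_inV h3|move=> i; have [_ _ k] := g tI i; exact: k].
Qed.

(** Each of the five norms is at most the square root of a multiple of the sum S of
    the squared norms of the data, and S is at most the square of their sum. *)
Lemma difference_bound (C : R) (w1 v1 z1 p1 pt1 f1 w2 v2 z2 p2 pt2 f2 dw : R -> E -> R)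
    (gw1 gv1 gp1 gw2 gv2 gp2 : 'I_N -> R -> E -> R) (w01 v01 p01 w02 v02 p02 : E -> R) : 0 < C ->
  inV Om w01 -> inV Om w02 -> inV Om v01 -> inV Om v02 -> inV Om p01 -> inV Om p02 ->
  regular w1 v1 z1 p1 pt1 gw1 gv1 gp1 w01 v01 p01 -> regular w2 v2 z2 p2 pt2 gw2 gv2 gp2 w02 v02 p02 ->
  LQ2 Om T f1 -> LQ2 Om T f2 ->
  (\forall t \ae mu, 0 < t < T -> L2 lb (e (dw t)) /\ \forall x \ae lb, e (dw t) x = q v1 t x - q v2 t x) ->
  (let S := nrm2 lb (fun x => e v01 x - e v02 x) + nrm2 lb (fun x => e w01 x - e w02 x)
    + nrm2 lb (fun x => e p01 x - e p02 x) + \sum_i nrm2 lb (fun x => e (wpd Om i w01) x - e (wpd Om i w02) x)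
    + \int[mu]_t nrm2 lb (fun x => q f1 t x - q f2 t x) in
  [/\ \forall t \ae mu, 0 < t < T -> [/\ nrm2 lb (fun x => q v1 t x - q v2 t x) <= C * S,
        nrm2 lb (fun x => q p1 t x - q p2 t x) <= C * S,
        nrm2 lb (fun x => q w1 t x - q w2 t x) <= C * S &
        \sum_i nrm2 lb (fun x => q (gw1 i) t x - q (gw2 i) t x) <= C * S],
      \int[mu]_t (\sum_i nrm2 lb (fun x => q (gv1 i) t x - q (gv2 i) t x)) <= C * S &
      \int[mu]_t (\sum_i nrm2 lb (fun x => q (gp1 i) t x - q (gp2 i) t x)) <= C * S]) ->
  let w t x := w1 t x - w2 t x in let p t x := p1 t x - p2 t x in is_true
  ((normLp T +oo (normH Om) w + normLp T +oo (normH Om) dw)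
   + (normLp T 2%:E (normV Om) w ^+ 2 + normLp T 2%:E (normV Om) dw ^+ 2) `^ (2^-1)
   + (normLp T +oo (normH Om) p + normLp T 2%:E (normV Om) p)
   <= (5 * Num.sqrt ((3 * T + 1) * C))%:E * (normH Om (fun x => v01 x - v02 x)%R
      + normV Om (fun x => w01 x - w02 x)%R + normH Om (fun x => p01 x - p02 x)%R
      + normL2Q Om T (fun t x => f1 t x - f2 t x)%R))%E.
Proof.
move=> C0 Vw1 Vw2 Vv1 Vv2 Vp1 Vp2 r1 r2 lf1 lf2 hdw.
set nv := nrm2 lb (fun x => e v01 x - e v02 x); set nw := nrm2 lb (fun x => e w01 x - e w02 x).
set np := nrm2 lb (fun x => e p01 x - e p02 x); set ng := \sum_i _; set nf := \int[mu]_t _.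
pose S := nv + nw + np + ng + nf; rewrite -/S => -[Hae Hv Hp] w p.
have nv0 : 0 <= nv by exact: nrm2_ge0.
have nw0 : 0 <= nw by exact: nrm2_ge0.
have np0 : 0 <= np by exact: nrm2_ge0.
have ng0 : 0 <= ng by apply: sumr_ge0 => i _; exact: nrm2_ge0.
have nf0 : 0 <= nf by apply: int_ge0 => t; exact: nrm2_ge0.
have lw1 : LQ2 Om T w1 := curve_L2u (reg_w r1). have lw2 : LQ2 Om T w2 := curve_L2u (reg_w r2).
have lv1 : LQ2 Om T v1 := curve_L2u (reg_v r1). have lv2 : LQ2 Om T v2 := curve_L2u (reg_v r2).
have lp1 : LQ2 Om T p1 := curve_L2u (reg_p r1). have lp2 : LQ2 Om T p2 := curve_L2u (reg_p r2).
have lgw1 i : LQ2 Om T (gw1 i) := curve_L2u (reg_g r1 i). have lgw2 i : LQ2 Om T (gw2 i) := curve_L2u (reg_g r2 i).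
have lgv1 i : LQ2 Om T (gv1 i) := curve_L2 (reg_g r1 i). have lgv2 i : LQ2 Om T (gv2 i) := curve_L2 (reg_g r2 i).
pose r := Num.sqrt nv + Num.sqrt (nw + ng) + Num.sqrt np + Num.sqrt nf.
have r0 : 0 <= r by rewrite /r !addr_ge0 ?sqrtr_ge0.
have eV : normH Om (fun x => v01 x - v02 x) = (Num.sqrt nv)%:E by rewrite normH_sub//; exact: inV_L2.
have eP : normH Om (fun x => p01 x - p02 x) = (Num.sqrt np)%:E by rewrite normH_sub//; exact: inV_L2.
have eW : normV Om (fun x => w01 x - w02 x) = (Num.sqrt (nw + ng))%:E.
  apply: (normV_sub Vw1 Vw2 (fun i => (wpdP Om_open i Vw1).1) (fun i => (wpdP Om_open i Vw2).1));
    by move=> i; apply: aeW.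
have lf : LQ2 Om T (fun t x => f1 t x - f2 t x).
  have E z : q (fun t x => f1 t x - f2 t x) z.1 z.2 = q f1 z.1 z.2 - q f2 z.1 z.2 by exact: q_sub.
  by rewrite /LQ2; under eq_fun do rewrite E; exact: L2B lf1 lf2.
have eF : normL2Q Om T (fun t x => f1 t x - f2 t x) = (Num.sqrt nf)%:E.
  rewrite normL2QE//; congr (Num.sqrt _)%:E.
  apply: etrans (@fub1 _ _ (measurableTypeR R) E R mu lb (fun t x => q (fun t x => f1 t x - f2 t x) t x ^+ 2) lf.2) _.
  by apply: eq_Rintegral => t _; apply: eq_Rintegral => x _; rewrite q_sub.
rewrite eV eP eW eF -!EFinD -/r.
have Sr : S <= r ^+ 2.
  have := square_sum_le (sqrtr_ge0 nv) (sqrtr_ge0 (nw + ng)) (sqrtr_ge0 np) (sqrtr_ge0 nf).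
  rewrite !sqr_sqrtr ?addr_ge0// => h; apply: le_trans h.
  by rewrite le_eqVlt; apply/orP; left; apply/eqP; rewrite /S; ring.
have S0 : 0 <= S by rewrite /S !addr_ge0.
have A0 : 0 <= C * S by rewrite mulr_ge0// ltW.
have TA0 : 0 <= T * (C * S) by rewrite mulr_ge0// ltW.
have sV (g1 g2 : 'I_N -> R -> E -> R) : supported_in 0 T (fun t => \sum_i nrm2 lb (fun x => q (g1 i) t x - q (g2 i) t x)).
  by move=> t tI; rewrite big1// => i _; exact: (nrm2_sub_supp (g1 i) (g2 i) tI).
have [W1 V1 P1] := regular_gradients r1; have [W2 V2 P2] := regular_gradients r2.
have iw := time_int_le (nrm2_sub_time lw1 lw2) (nrm2_sub_supp w1 w2) (aeS (fun t H tI => let: And4 _ _ h _ := H tI in h) Hae).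
have iv := time_int_le (nrm2_sub_time lv1 lv2) (nrm2_sub_supp v1 v2) (aeS (fun t H tI => let: And4 h _ _ _ := H tI in h) Hae).
have ip := time_int_le (nrm2_sub_time lp1 lp2) (nrm2_sub_supp p1 p2) (aeS (fun t H tI => let: And4 _ h _ _ := H tI in h) Hae).
have igw := time_int_le (L1_sum _ (fun i => nrm2_sub_time (lgw1 i) (lgw2 i))) (sV gw1 gw2) (aeS (fun t H tI => let: And4 _ _ _ h := H tI in h) Hae).
have n1 : (normLp T +oo (normH Om) w <= (Num.sqrt (C * S))%:E)%E.
  apply: (normLpooH_sub A0 lw1 lw2 (sub_slice lw1 lw2)) => //.
  by apply: aeS Hae => t H tI; have [_ _ h _] := H tI.
have n2 : (normLp T +oo (normH Om) dw <= (Num.sqrt (C * S))%:E)%E.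
  apply: (normLpooH_sub A0 lv1 lv2 hdw) => //.
  by apply: aeS Hae => t H tI; have [h _ _ _] := H tI.
have n3 : (normLp T +oo (normH Om) p <= (Num.sqrt (C * S))%:E)%E.
  apply: (normLpooH_sub A0 lp1 lp2 (sub_slice lp1 lp2)) => //.
  by apply: aeS Hae => t H tI; have [_ h _ _] := H tI.
have m1 : (normLp T 2%:E (normV Om) w <= (Num.sqrt (2 * T * (C * S)))%:E)%E.
  apply: (normLp2V_sub lw1 lw2 lgw1 lgw2 W1 W2 (sub_slice lw1 lw2)).
  by rewrite -mulrA mulr_natl mulr2n; exact: (lerD iw igw).
have m2 : (normLp T 2%:E (normV Om) dw <= (Num.sqrt (T * (C * S) + C * S))%:E)%E.
  by apply: (normLp2V_sub lv1 lv2 lgv1 lgv2 V1 V2 hdw); exact: (lerD iv Hv).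
have m3 : (normLp T 2%:E (normV Om) p <= (Num.sqrt (T * (C * S) + C * S))%:E)%E.
  by apply: (normLp2V_sub lp1 lp2 (reg_gp r1) (reg_gp r2) P1 P2 (sub_slice lp1 lp2)); exact: (lerD ip Hp).
have L0 (u : R -> E -> R) : (0 <= normLp T 2%:E (normV Om) u)%E by exact: Lnorm_ge0.
have TA2 : 0 <= 2 * T * (C * S) by rewrite -mulrA mulr_ge0.
have h1 := H1_norm_le TA2 (addr_ge0 TA0 A0) (L0 w) (L0 dw) m1 m2.
have B0 : 0 <= (3 * T + 1) * C by rewrite mulr_ge0 ?addr_ge0 ?mulr_ge0// ltW.
have CS : C * S <= C * r ^+ 2 by rewrite ler_pM2l.
have [c1 c2 c3] := final_constants T0 A0 CS; rewrite mulrA in c1 c2 c3.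
exact: (sum5_sqrt_le n1 n2 h1 n3 m3 B0 r0).
Qed.

End difference_norms.

(** * Continuous dependence on the data *)

Theorem theorem2p8 (R : realType) (N : nat) (Om : set 'rV[R]_N) (T : R)
  (betahat : R -> \bar R) (pihat : R -> R) (kappa tau gamma l : R)
  (phistar : 'rV[R]_N -> R)
  (hN : (0 < N)%N)
  (Om_open : open Om) (Om_bounded : bounded_set Om)
  (Om_smooth : smooth_boundary Om)
  (hT : 0 < T)
  (betahat_ge0 : forall r, (0 <= betahat r)%E)
  (betahat_convex : ereal_convex betahat)
  (betahat_proper : ereal_proper betahat)
  (betahat_lsc : lower_semicontinuous betahat)
  (betahat_0 : betahat 0 = 0%E)
  (pihat_derivable : forall r, derivable pihat r 1)
  (pi_continuous : continuous (derive1 pihat))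
  (pi_lipschitz : exists k : R, k.-lipschitz (derive1 pihat))
  (hkappa : 0 < kappa) (htau : 0 < tau) (hgamma : 0 < gamma) (hl : 0 < l)
  (phistar_W : inW Om phistar)
  (beta0_phistar : exists2 b, inH Om b &
     ae_Om Om (fun x => min_section (subdiff betahat) (phistar x) (b x))) :
  exists2 C8 : R, 0 < C8 &
  forall (rho : R), 0 < rho ->
  forall (theta01 theta02 w01 w02 phi01 phi02 : 'rV[R]_N -> R)
    (f1 f2 w1 w2 phi1 phi2 xi1 xi2 sigma1 sigma2 : R -> 'rV[R]_N -> R),
  inV Om theta01 -> inV Om theta02 ->
  inW Om w01 -> inW Om w02 ->
  inV Om phi01 -> inV Om phi02 ->
  (leb N).-integrable Om (betahat \o phi01) ->
  (leb N).-integrable Om (betahat \o phi02) ->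
  inL2Q Om T f1 -> inL2Q Om T f2 ->
  solutionB Om T kappa tau gamma l rho betahat pihat phistar
    f1 theta01 w01 phi01 w1 phi1 xi1 sigma1 ->
  solutionB Om T kappa tau gamma l rho betahat pihat phistar
    f2 theta02 w02 phi02 w2 phi2 xi2 sigma2 ->
  let w := fun t x => w1 t x - w2 t x in
  let phi := fun t x => phi1 t x - phi2 t x in
  ((normW1oo Om T (normH Om) w + normH1 Om T (normV Om) w)
   + (normLp T +oo (normH Om) phi + normLp T 2%:E (normV Om) phi)
   <= C8%:E * (normH Om (fun x => theta01 x - theta02 x)%R
               + normV Om (fun x => w01 x - w02 x)%R
               + normH Om (fun x => phi01 x - phi02 x)%R
               + normL2Q Om T (fun t x => f1 t x - f2 t x)%R))%E.
Proof.
have [k0 Lip] := pi_lipschitz.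
have piK a b : `|derive1 pihat a - derive1 pihat b| <= `|k0| * `|a - b|.
  by apply: le_trans (Lip (a, b) _) _ => //=; rewrite ler_wpM2r// ler_norm.
have [C C0 energy] := difference_energy hN Om_open Om_bounded hT Om_smooth hkappa htau hgamma hl (normr_ge0 k0).
exists (5 * Num.sqrt ((3 * T + 1) * C)).
  by rewrite mulr_gt0// sqrtr_gt0 mulr_gt0// addr_gt0// mulr_gt0.
move=> rho rho0 theta01 theta02 w01 w02 phi01 phi02 f1 f2 w1 w2 phi1 phi2 xi1 xi2 sigma1 sigma2.
move=> Vt1 Vt2 Ww1 Ww2 Vp1 Vp2 _ _ hf1 hf2 sol1 sol2.
have lf1 := inL2Q_LQ2 Om_open hf1; have lf2 := inL2Q_LQ2 Om_open hf2.
have [gw1 [gv1 [gp1 r1]]] := solution_regular hN Om_open Om_bounded hT Vt1 Ww1 Vp1 sol1.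
have [gw2 [gv2 [gp2 r2]]] := solution_regular hN Om_open Om_bounded hT Vt2 Ww2 Vp2 sol2.
have [[wH1 dw1 vH1] [_ dv1 zH1]] := w_H2H sol1; have [pH1 dp1 ptH1] := phi_H1H sol1.
have [[wH2 dw2 vH2] [_ dv2 zH2]] := w_H2H sol2; have [pH2 dp2 ptH2] := phi_H1H sol2.
apply: (difference_bound hN Om_open Om_bounded hT C0 (inW_inV Ww1) (inW_inV Ww2) Vt1 Vt2 Vp1 Vp2 r1 r2 lf1 lf2).
  exact: (dt_sub_slice Om_open Om_bounded hT wH1 wH2 vH1 vH2 (dtP dw1) (dtP dw2)).
have y1 := dt_lin_slice Om_open Om_bounded hT l vH1 pH1 zH1 ptH1 (dtP dv1) (dtP dp1).
have y2 := dt_lin_slice Om_open Om_bounded hT l vH2 pH2 zH2 ptH2 (dtP dv2) (dtP dp2).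
exact: (energy _ _ _ _ _ _ _ _ _ _ _ _ _ _ _ _ _ _ _ _ _ _ _ _ _ _ _ _ _ _ _ _ _ _ rho0 betahat_ge0 piK
  (inV_L2 Om_open (inW_inV phistar_W)) r1 r2 lf1 lf2 y1 y2 (eq_w sol1) (eq_w sol2) (eq_phi sol1) (eq_phi sol2)
  (xi_beta sol1) (xi_beta sol2) (sigma_Sign sol1) (sigma_Sign sol2)).
Qed.
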